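(* Let $(M^N,g)$ be a closed Riemannian manifold of dimension $N$ and let $\sigma\in\mathbb R$. If $M$ has heat scalar curvature at least $\sigma$ in dimension $N$, then $\mathrm{Scal}_g\ge\sigma$ on $M$. Conversely, if $\min_M\mathrm{Scal}_g>\sigma$, then $M$ has heat scalar curvature at least $\sigma$ in dimension $N$. Hence $$\min_M\mathrm{Scal}_g=\sup\{\sigma\in\mathbb R: M\text{ has heat scalar curvature at least }\sigma\text{ in dimension }N\}.$$
   Context: Heat objects on a Riemannian manifold $(M,g)$: $P_t=e^{t\Delta}$ is the heat semigroup of the Laplace--Beltrami operator $\Delta$ (associated with the Dirichlet form $\int_M|\nabla f|^2\,d\mathrm{Vol}_g$), $p_t(x,y)$ is the minimal heat kernel, so $P_tf(x)=\int_M p_t(x,y)f(y)\,d\mathrm{Vol}_g(y)$. Pointed Nash entropy with normalization dimension $N>0$: for $x\in M$, $t,s>0$, $$\mathcal N_x^{(N)}(t):=-\int_M p_t(x,y)\log p_t(x,y)\,d\mathrm{Vol}_g(y)-\frac N2\log(4\pi t)-\frac N2,\qquad \mathbf N_x^{(N)}(t,s):=P_s\bigl(\mathcal N_\bullet^{(N)}(t)\bigr)(x).$$ Inverse-time geodesics: curves $\gamma_\theta=(t_\theta,s_\theta)\in(0,\infty)^2$, $\theta\in[0,1]$, such that $t_\theta+s_\theta$ is constant in $\theta$ and $t_\theta^{-1}=(1-\theta)t_0^{-1}+\theta t_1^{-1}$. A function $F(t,s)$ is concave along $\gamma$ if $\theta\mapsto F(\gamma_\theta)$ is concave on $[0,1]$.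 Heat scalar lower bound: $M$ has heat scalar curvature at least $\sigma$ in dimension $N$ if there is $\tau>0$, independent of $x$, such that for every $x\in M$ the function $(t,s)\mapsto\mathbf N_x^{(N)}(t,s)+\frac\sigma2 t$ is concave along every inverse-time geodesic contained in $(0,\tau)^2$. *)

(* Defs.v *)
From HB Require Import structures.
From mathcomp Require Import all_boot all_order all_algebra.
From mathcomp Require Import all_classical all_reals all_analysis.

Set Implicit Arguments.
Unset Strict Implicit.
Unset Printing Implicit Defensive.

Import Order.TTheory GRing.Theory Num.Theory.
Import numFieldNormedType.Exports.

Local Open Scope classical_set_scope.
Local Open Scope ring_scope.

Definition partial (R : realType) (n : nat) (a : 'I_n) (f : 'rV[R]_n -> R)
    (u : 'rV[R]_n) : R :=
  'D_(delta_mx 0 a) f u.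

Definition iter_partial (R : realType) (n : nat) (l : seq 'I_n)
    (f : 'rV[R]_n -> R) : 'rV[R]_n -> R :=
  foldr (@partial R n) f l.

(* C^oo on an open set U: the values of f outside U play no role. *)
Definition smooth_on (R : realType) (n : nat) (U : set 'rV[R]_n)
    (f : 'rV[R]_n -> R) : Prop :=
  forall (l : seq 'I_n) (u : 'rV[R]_n), U u ->
    {for u, continuous (iter_partial l f)} /\
    forall a : 'I_n, derivable (iter_partial l f) u (delta_mx 0 a).

(* The atlas need not be maximal. Outside [chart_dom i] and [chart_cod i] the
   total functions [chart i] and [chart_inv i] are irrelevant. The base type is
   pointed, hence manifolds are nonempty; they need not be connected. *)
Record smoothManifold (R : realType) (N : nat) := SmoothManifold {
  points :> ptopologicalType ;
  points_hausdorff : hausdorff_space points ;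
  points_second_countable : second_countable (T := points) ;
  chart_index : Type ;
  chart_dom : chart_index -> set points ;
  chart_cod : chart_index -> set 'rV[R]_N ;
  chart : chart_index -> points -> 'rV[R]_N ;
  chart_inv : chart_index -> 'rV[R]_N -> points ;
  chart_at : points -> chart_index ;
  chart_dom_open : forall i, open (chart_dom i) ;
  chart_cod_open : forall i, open (chart_cod i) ;
  chart_dom_cod : forall i x, chart_dom i x -> chart_cod i (chart i x) ;
  chart_cod_dom : forall i u, chart_cod i u -> chart_dom i (chart_inv i u) ;
  chartK : forall i x, chart_dom i x -> chart_inv i (chart i x) = x ;
  chart_invK : forall i u, chart_cod i u -> chart i (chart_inv i u) = u ;
  chart_continuous : forall i x, chart_dom i x ->
    {for x, continuous (chart i)} ;
  chart_inv_continuous : forall i u, chart_cod i u ->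
    {for u, continuous (chart_inv i)} ;
  chart_atP : forall x, chart_dom (chart_at x) x ;
  transition_smooth : forall i j (b : 'I_N),
    smooth_on (chart_cod i `&` chart_inv i @^-1` chart_dom j)
      (fun u => chart j (chart_inv i u) 0 b)
}.

(* [metric i u] is the Gram matrix of the coordinate frame of chart i at the
   point of coordinates u. *)
Record riemannianManifold (R : realType) (N : nat) := RiemannianManifold {
  base_manifold :> smoothManifold R N ;
  metric : chart_index base_manifold -> 'rV[R]_N -> 'M[R]_N ;
  metric_smooth : forall i (a b : 'I_N),
    smooth_on (chart_cod i) (fun u => metric i u a b) ;
  metric_symmetric : forall i u, chart_cod i u -> (metric i u)^T = metric i u ;
  metric_pos : forall i u (v : 'rV[R]_N), chart_cod i u -> v != 0 ->
    0 < (v *m metric i u *m v^T) 0 0 ;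
  metric_transition : forall i j u, chart_cod i u ->
    chart_dom j (chart_inv i u) ->
    let J := \matrix_(a, b)
      partial a (fun w => chart j (chart_inv i w) 0 b) u in
    metric i u = J *m metric j (chart j (chart_inv i u)) *m J^T
}.

Section curvature_in_coordinates.
Variables (R : realType) (N : nat) (g : 'rV[R]_N -> 'M[R]_N).

(* Gamma^k_{ab} *)
Definition christoffel (k a b : 'I_N) (u : 'rV[R]_N) : R :=
  2^-1 * \sum_(l < N) invmx (g u) k l *
    (partial a (fun w => g w b l) u + partial b (fun w => g w a l) u
     - partial l (fun w => g w a b) u).

(* Riem^d_{cab}, where R(X, Y)Z = [nabla_X, nabla_Y] Z - nabla_{[X, Y]} Z and
   R(e_a, e_b) e_c = \sum_d Riem^d_{cab} e_d *)
Definition riemann_coord (d c a b : 'I_N) (u : 'rV[R]_N) : R :=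
  partial a (christoffel d b c) u - partial b (christoffel d a c) u
  + \sum_(l < N) (christoffel d a l u * christoffel l b c u
                  - christoffel d b l u * christoffel l a c u).

Definition ricci_coord (c b : 'I_N) (u : 'rV[R]_N) : R :=
  \sum_(a < N) riemann_coord a c a b u.

Definition scalar_coord (u : 'rV[R]_N) : R :=
  \sum_(a < N) \sum_(b < N) invmx (g u) a b * ricci_coord a b u.

Definition laplace_coord (f : 'rV[R]_N -> R) (u : 'rV[R]_N) : R :=
  let rho w := Num.sqrt (\det (g w)) in
  (rho u)^-1 * \sum_(a < N)
    partial a (fun w => rho w *
      \sum_(b < N) invmx (g w) a b * partial b f w) u.

End curvature_in_coordinates.

(* The integral over R^n against Lebesgue measure of a nonnegative Borel
   function, as an iterated integral. *)
Fixpoint lebesgue_rV_integral (R : realType) (n : nat) :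
    ('rV[R]_n -> \bar R) -> \bar R :=
  match n with
  | 0 => fun F => F 0
  | n'.+1 => fun F => (\int[@lebesgue_measure R]_(x in setT)
      lebesgue_rV_integral (fun v : 'rV[R]_n' =>
        F (row_mx (const_mx x : 'rV[R]_1) v)))%E
  end.

Section geometry.
Variables (R : realType) (N : nat) (M : riemannianManifold R N).

Definition scalar_curvature (x : M) : R :=
  scalar_coord (metric (chart_at x)) (chart (chart_at x) x).

Definition laplace_beltrami (f : M -> R) (x : M) : R :=
  laplace_coord (metric (chart_at x)) (f \o chart_inv (chart_at x))
    (chart (chart_at x) x).

Definition smooth_function (f : M -> R) : Prop :=
  forall i : chart_index M, smooth_on (chart_cod i) (f \o chart_inv i).

(* u t x is C^oo in (t, x) on (0, +oo) x M. *)
Definition smooth_space_time (u : R -> M -> R) : Prop :=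
  forall i : chart_index M,
    smooth_on [set w : 'rV[R]_(1 + N) |
                0 < lsubmx w 0 0 /\ chart_cod i (rsubmx w)]
      (fun w => u (lsubmx w 0 0) (chart_inv i (rsubmx w))).

Definition borel : measurableType _ := g_sigma_algebraType (@open M).

(* d Vol = sqrt (det g) du in every chart; this determines the measure, as
   countably many charts cover M. *)
Definition riemannian_volume (vol : {measure set borel -> \bar R}) : Prop :=
  forall (i : chart_index M) (A : set borel),
    measurable A -> A `<=` chart_dom i ->
    vol A = lebesgue_rV_integral (fun u : 'rV[R]_N =>
      (\1_(chart i @` A) u * Num.sqrt (\det (metric i u)))%:E).

Section heat.
Variable vol : {measure set borel -> \bar R}.

Definition fundamental_solution (y : M) (u : R -> M -> R) : Prop :=
  [/\ smooth_space_time u,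
      forall (t : R) (x : M), 0 < t -> 0 <= u t x,
      forall (t : R) (x : M), 0 < t ->
        derive1 (fun r => u r x) t = laplace_beltrami (u t) x
    & forall f : M -> R, smooth_function f ->
        compact (closure [set x | f x != 0]) ->
        (\int[vol]_(x in setT) (u t x * f x)) @[t --> 0^'+] --> f y].

(* p t x y = p_t(x, y); the values for t <= 0 are irrelevant. *)
Definition minimal_heat_kernel (p : R -> M -> M -> R) : Prop :=
  forall y : M, fundamental_solution y (fun t x => p t x y) /\
    forall u, fundamental_solution y u ->
      forall (t : R) (x : M), 0 < t -> p t x y <= u t x.

Variable p : R -> M -> M -> R.

Definition heat_semigroup (t : R) (f : M -> R) (x : M) : R :=
  \int[vol]_(y in setT) (p t x y * f y).

(* D is the normalization dimension; ln 0 = 0, so that 0 log 0 = 0. *)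
Definition pointed_nash_entropy (D : R) (x : M) (t : R) : R :=
  - (\int[vol]_(y in setT) (p t x y * ln (p t x y)))
  - D / 2 * ln (4 * pi * t) - D / 2.

Definition nash_entropy (D : R) (x : M) (t s : R) : R :=
  heat_semigroup s (fun z => pointed_nash_entropy D z t) x.

Definition inverse_time_geodesic (t s : R -> R) : Prop :=
  forall theta : R, 0 <= theta <= 1 ->
    [/\ 0 < t theta, 0 < s theta,
        t theta + s theta = t 0 + s 0
      & (t theta)^-1 = (1 - theta) * (t 0)^-1 + theta * (t 1)^-1].

Definition concave_along (F : R -> R -> R) (t s : R -> R) : Prop :=
  convex_function (E := R^o) [set theta : R^o | 0 <= theta <= 1]
    (fun theta => - F (t theta) (s theta)).

Definition heat_scalar_curvature_ge (D sigma : R) : Prop :=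
  exists2 tau : R, 0 < tau &
    forall (x : M) (t s : R -> R), inverse_time_geodesic t s ->
      (forall theta : R, 0 <= theta <= 1 -> t theta < tau /\ s theta < tau) ->
      concave_along (fun t' s' => nash_entropy D x t' s' + sigma / 2 * t') t s.

End heat.
End geometry.

(* Main.v *)
(* For u = p_t(., y) + e, the derivative in t of the integral of u log u against
   p_(c - t)(x, .) is minus a Fisher information j_y(t), and Bochner's formula
   bounds j_y' by -2 times the integral of u Ric(grad log u, grad log u) plus
   4 l (d_t u - j_y) + 2 N l^2 u, for every l. Integrating over y, the concavity
   of the entropy in 1/t follows (with l = 1/2t) from a lower bound on
   2t int_y u Ric(grad log u, grad log u). This comes from a Cramer-Rao inequality
   in y: testing the score grad_z log p_t(z, y) against coordinate differences
   xi(y) - xi(z) gives 2t int_y u B(score, score) >= tr B - o(1) for B >= 0.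
   Conversely, concavity makes the tilted entropy nonincreasing in t, so the
   Fisher information is at most N/2t - sigma/2; the Cramer-Rao inequality in
   coordinates with vanishing Hessian at z bounds it below by N/2t - Scal/2 - o(1).
   Only expansions of P_t psi for smooth psi and Li-Yau bounds are used, no
   asymptotics of the kernel. *)
Require Import Defs.
From HB Require Import structures.
From mathcomp Require Import all_boot all_order all_algebra.
From mathcomp Require Import all_classical all_reals all_analysis.
From mathcomp Require Import measurable_realfun ring lra.

Set Implicit Arguments.
Unset Strict Implicit.
Unset Printing Implicit Defensive.

Import Order.TTheory GRing.Theory Num.Theory.
Import numFieldNormedType.Exports.

Local Open Scope classical_set_scope.
Local Open Scope ring_scope.

(** * Calculus in R^n *)

(** On a line t + s = c the iterated entropy is a function of t alone and inverse-time geodesics are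
    the segments in w = 1/t, so both directions are one-variable statements in w. The tilted entropy
    is concave on the half-line w > 1/c and bounded below as w grows, because Li-Yau bounds the mean
    Fisher information by N/2t + O(1); such a function cannot decrease in w, which is why concavity
    gives monotonicity in t. That upper bound and the Cramer-Rao lower bound agree to leading order,
    and the curvature sits in the next term. Two parameters shape the estimates. Strict positivity
    of the kernel is not at hand, so the logarithm is taken of p + e; and errors come as sqrt t +
    e/t. Hence e tends to 0 first, at fixed t, and what survives is C sqrt t. In the converse it is
    absorbed by a small tau, at the expense of the strict inequality between sigma and the scalar
    curvature. Entropies at e = 0 are compared with shifted ones by monotonicity in e, since Fisher
    informations are formed only for e > 0. *)

Section one_variable.
Context {R : realType}.

Lemma eq_ler (x y : R) : x = y -> x <= y.
Proof. by move=> ->. Qed.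

Lemma line_is_derive (V : normedModType R) (f : V -> R) (x v : V) (s d : R) :
  is_derive (s *: v + x) v f d -> is_derive s 1 (fun r => f (r *: v + x)) d.
Proof.
have E : (fun h : R => h^-1 *: (((fun r => f (r *: v + x)) \o shift s) (h *: 1)
    - f (s *: v + x))) =
  (fun h => h^-1 *: ((f \o shift (s *: v + x)) (h *: v) - f (s *: v + x))).
  by apply/funext => h /=; rewrite [h%:A]mulr1 scalerDl addrA.
by move=> [df <-]; split; rewrite /derivable /derive ?E.
Qed.

Lemma derive_line (V : normedModType R) (f : V -> R) (x v : V) :
  'D_v f x = 'D_1 (fun h : R => f (h *: v + x)) 0.
Proof.
have E : (fun h : R => h^-1 *: ((f \o shift x) (h *: v) - f x)) =
  (fun h => h^-1 *: (((fun h : R => f (h *: v + x)) \o shift 0) (h *: 1)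
    - f (0 *: v + x))).
  by apply/funext => h /=; rewrite addr0 scale0r add0r [h%:A]mulr1.
by rewrite /derive E.
Qed.

(** The hypothesis is symmetric about 0 so that increments of either sign are covered. *)
Lemma mean_value_ineq (g : R -> R) (c e h : R) :
  (forall s, `|s| <= `|h| -> derivable g s 1 /\ `|'D_1 g s - c| <= e) ->
  `|g h - g 0 - h * c| <= e * `|h|.
Proof.
move=> H.
have [->|h0] := eqVneq h 0; first by rewrite subrr mul0r subr0 normr0 mulr0.
have K a b : a < b -> (forall s, s \in `[a, b] -> `|s| <= `|h|) ->
    exists2 s, `|s| <= `|h| & g b - g a = 'D_1 g s * (b - a).
  move=> ab Hab; have [s|s|] := @MVT R g (fun s => 'D_1 g s) a b ab.
  - by move=> /subset_itv_oo_cc /Hab /H[dg _]; apply: derivableP.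
  - by apply: derivable_within_continuous => r /Hab /H[].
  - by move=> s /subset_itv_oo_cc /Hab ? ?; exists s.
have [hneg|hpos] : h < 0 \/ 0 < h by case: ltgtP h0 => // *; [left|right].
  have [s|s /H[_ Hs] E] := K h 0 hneg.
    rewrite in_itv/= => /andP[hs s0]; rewrite !ler0_norm ?lerN2//; exact: ltW.
  rewrite -[g h - g 0]opprB E sub0r mulrN opprK mulrC -mulrBr normrM mulrC.
  by rewrite ler_wpM2r.
have [s|s /H[_ Hs] E] := K 0 h hpos.
  rewrite in_itv/= => /andP[hs s0]; rewrite !ger0_norm ?lerN2//; exact: ltW.
rewrite E subr0 mulrC -mulrBr normrM mulrC.
by rewrite ler_wpM2r.
Qed.

End one_variable.

Section several_variables.
Context {R : realType} {n : nat}.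
Implicit Types (f g : 'rV[R]_n -> R) (u h : 'rV[R]_n) (U : set 'rV[R]_n).

Let e_ (a : 'I_n) : 'rV[R]_n := delta_mx 0 a.

Definition grad_lin f u h : R := \sum_(a < n) h 0 a * partial a f u.

Lemma grad_lin_is_linear f u : linear (grad_lin f u).
Proof.
move=> k x y; rewrite /grad_lin scaler_sumr -big_split; apply: eq_bigr => a _ /=.
by rewrite !mxE mulrDl -mulrA.
Qed.

HB.instance Definition _ f u :=
  GRing.isLinear.Build R 'rV[R]_n R _ (grad_lin f u) (grad_lin_is_linear f u).

Lemma grad_lin_continuous f u : continuous (grad_lin f u).
Proof.
apply: continuous_big => [|a _ x]; first exact: add_continuous.
apply: (@continuousM _ _ (fun h : 'rV[R]_n => h 0 a) (fun=> _)).
  exact: coord_continuous.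
exact: cst_continuous.
Qed.

(** The norm of a row vector is the maximum of its coordinates, so the balls used throughout are
    cubes. *)
Lemma rV_norm_le u (e : R) : 0 <= e -> (`|u| <= e) <-> (forall a, `|u 0 a| <= e).
Proof.
move=> e0; rewrite /Num.Def.normr/= mx_normrE; split.
  by move=> H a; apply: le_trans H; exact: (le_bigmax _ _ (0, a)).
by move=> H; apply: bigmax_le => // -[i a] _; rewrite ord1 H.
Qed.

Lemma rV_coord_le u a : `|u 0 a| <= `|u|.
Proof. by move: a; apply/(rV_norm_le _ (normr_ge0 _)). Qed.

Lemma littleo_eps (V W : normedModType R) (F dF : V -> W) (c : W) :
  (forall e : R, 0 < e -> \forall h \near 0, `|F h - (c + dF h)| <= e * `|h|) ->
  F = cst c + dF +o_ 0 id.
Proof. by move=> H; apply/eqaddoP. Qed.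

(** The increment from u to u + h is split along a staircase of coordinate segments, each controlled
    by the mean value inequality for a single partial derivative. *)
Lemma C1_taylor f u : (\forall w \near u, forall a, derivable f w (e_ a)) ->
  (forall a, {for u, continuous (partial a f)}) ->
  forall e : R, 0 < e ->
  \forall h \near (0 : 'rV[R]_n), `|f (h + u) - (f u + grad_lin f u h)| <= e * `|h|.
Proof.
move=> df cf e e0.
(* There are n legs of error e' each; the successor avoids a division by zero in dimension 0. *)
pose e' := e / n.+1%:R.
have e'0 : 0 < e' by rewrite divr_gt0.
have H a : \forall w \near u,
    derivable f w (e_ a) /\ `|partial a f w - partial a f u| <= e'.
  apply: filterI; first by apply: filterS df => w; apply.
  have /cvgrPdist_le/(_ _ e'0) := cf a.
  by apply: filterS => w; rewrite distrC.
have {H} := @filter_forall _ _ _ _ (nbhs_filter u) H.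
move=> /nbhs_ballP[d /= d0 Hd].
apply/nbhs_ballP; exists d => // h; rewrite -ball_normE /= sub0r normrN => hd.
(* The k-th corner of the staircase: the first k coordinates of h, then zeros. *)
pose T k : 'rV[R]_n := \row_j if (j < k)%N then h 0 j else 0.
suff H k : (k <= n)%N -> `|f (u + T k) - f u -
    \sum_(a < n | (a < k)%N) h 0 a * partial a f u| <= k%:R * e' * `|h|.
  have := H n (leqnn n).
  have -> : T n = h by apply/rowP => j; rewrite mxE ltn_ord.
  rewrite (eq_bigl xpredT); last by move=> a; rewrite ltn_ord.
  rewrite /= [h + u]addrC opprD addrA => /le_trans; apply.
  rewrite ler_wpM2r// /e' mulrCA ler_piMr// ?(ltW e0)//.
  by rewrite ler_pdivrMr// mul1r ler_nat.
elim: k => [_|k IH kn].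
  have -> : T 0 = 0 by apply/rowP => j; rewrite !mxE.
  by rewrite addr0 subrr big_pred0// subr0 normr0 !mul0r.
pose a := Ordinal kn.
have -> : T k.+1 = h 0 a *: e_ a + T k.
  apply/rowP => j; rewrite !mxE eqxx /= ltnS leq_eqVlt -val_eqE /= eq_sym.
  rewrite [in RHS]eq_sym.
  case: (ltngtP j k) => [jk|jk|jk] /=; rewrite ?mulr0 ?mulr1 ?add0r ?addr0//.
  by congr (h _ _); exact: val_inj.
rewrite (bigD1 a)//= (eq_bigl (fun b : 'I_n => (b < k)%N)); last first.
  move=> b; rewrite ltnS leq_eqVlt -val_eqE/=.
  by case: (ltngtP b k).
have := IH (ltnW kn); set S := \sum_(_ < _ | _) _.
set F0 := f (u + T k) => IH'.
have : `|f (h 0 a *: e_ a + (u + T k)) - F0 - h 0 a * partial a f u|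
    <= e' * `|h 0 a|.
  have := @mean_value_ineq R (fun s => f (s *: e_ a + (u + T k)))
    (partial a f u) e' (h 0 a).
  rewrite scale0r add0r; apply => s hs.
  have [] : derivable f (s *: e_ a + (u + T k)) (e_ a) /\
      `|partial a f (s *: e_ a + (u + T k)) - partial a f u| <= e'.
    apply: Hd; rewrite -ball_normE /=.
    have -> : u - (s *: e_ a + (u + T k)) = - (s *: e_ a + T k).
      by rewrite addrCA [- (u + _)]opprD addrA subrr add0r.
    rewrite normrN; apply: le_lt_trans hd; apply/rV_norm_le => // j.
    rewrite !mxE eqxx /=; case: eqP => [->|_].
      by rewrite ltnn addr0 mulr1 (le_trans hs)// rV_coord_le.
    by rewrite mulr0 add0r; case: ifP => _; rewrite ?normr0 ?rV_coord_le.
  move=> /derivableP/line_is_derive dfs.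
  by rewrite (@derive_val _ _ _ _ _ _ _ dfs); split => //; exact: ex_derive.
rewrite addrCA => /(lerD IH') {}IH'.
have -> : k.+1%:R * e' * `|h| = k%:R * e' * `|h| + e' * `|h|.
  by rewrite -natr1 !mulrDl mul1r.
apply: le_trans (le_trans IH' _); last first.
  by rewrite lerD2l ler_wpM2l ?(ltW e'0)// rV_coord_le.
apply: le_trans (ler_normD _ _); apply: eq_ler; congr (`|_|); ring.
Qed.

Lemma C1_differentiable f u :
  (\forall w \near u, forall a, derivable f w (e_ a)) ->
  (forall a, {for u, continuous (partial a f)}) ->
  differentiable f u.
Proof.
move=> df cf; apply/diff_locallyP.
have Hf := littleo_eps (C1_taylor df cf).
rewrite (diff_unique (@grad_lin_continuous f u) Hf).
by split; [exact: grad_lin_continuous|exact: Hf].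
Qed.

Lemma derive_gradE f u h : differentiable f u ->
  'D_h f u = \sum_(a < n) h 0 a * partial a f u.
Proof.
move=> df; rewrite deriveE//.
have {1}-> : h = \sum_(a < n) h 0 a *: e_ a.
  rewrite [LHS]row_sum_delta; apply: eq_bigr => a _; congr (_ *: _).
rewrite linear_sum; apply: eq_bigr => a _.
by rewrite linearZ /= /partial deriveE.
Qed.

Lemma curve_is_derive f (c : R -> 'rV[R]_n) (t : R) (v : 'rV[R]_n) :
  differentiable f (c t) ->
  (forall a, is_derive t 1 (fun s => c s 0 a) (v 0 a)) ->
  is_derive t 1 (f \o c) (\sum_(a < n) v 0 a * partial a f (c t)).
Proof.
move=> df dc.
have Dc : derivable c t 1.
  by apply/derivable_mxP => i j; rewrite ord1; exact: ex_derive.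
have Dc' : differentiable c t by exact/derivable1_diffP.
apply: DeriveDef.
  by apply/derivable1_diffP; exact: differentiable_comp.
rewrite deriveE; last exact: differentiable_comp.
rewrite diff_comp//= -!deriveE// derive_mx// derive_gradE//.
by apply: eq_bigr => a _; rewrite mxE derive_val.
Qed.

End several_variables.

(** * Functions of class C^k, smooth functions and symmetry of second derivatives *)

Section smooth_classes.
Context {R : realType} {n : nat}.
Implicit Types (f g : 'rV[R]_n -> R) (u h : 'rV[R]_n) (U V : set 'rV[R]_n).

Local Notation e_ a := (delta_mx 0 a : 'rV[R]_n).

(** Class C^k by recursion on the order, innermost derivative first. Stability under products,
    inverses and composition is then an induction on k, since the derivative of the result involves
    f itself only to one order less. *)
Fixpoint Cn (k : nat) U f : Prop :=
  (forall u, U u -> {for u, continuous f}) /\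
  if k is k'.+1 then
    forall a, (forall u, U u -> derivable f u (e_ a)) /\ Cn k' U (partial a f)
  else True.

Lemma Cn_cont k U f : Cn k U f -> forall u, U u -> {for u, continuous f}.
Proof. by case: k => [|k] []. Qed.

Lemma iter_partial_rcons l a f :
  iter_partial (rcons l a) f = iter_partial l (partial a f).
Proof. by rewrite /iter_partial foldr_rcons. Qed.

Lemma smooth_on_partial U f a : smooth_on U f -> smooth_on U (partial a f).
Proof. by move=> sf l u Uu; rewrite -iter_partial_rcons; exact: sf. Qed.

Lemma smooth_onP U f : smooth_on U f <-> forall k, Cn k U f.
Proof.
split=> [sf k|Cf l].
  elim: k f sf => [|k IH] f sf /=; split=> //.
  - by move=> u /(sf [::])[].
  - by move=> u /(sf [::])[].
  - move=> a; split; first by move=> u /(sf [::])[].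
    exact/IH/smooth_on_partial.
elim/last_ind: l f Cf => [|l a IH] f Cf.
  by move=> u Uu; split=> [|a]; [exact: (Cn_cont (Cf 0%N))|have [+ _] := (Cf 1%N).2 a; apply].
by rewrite iter_partial_rcons; apply: IH => k; have [_ /(_ a)[]] := Cf k.+1.
Qed.

Lemma CnS k U f : Cn k.+1 U f -> Cn k U f.
Proof.
elim: k f => [|k IH] f; first by case.
by move=> [cf df]; split=> // a; have [? /IH] := df a.
Qed.

Lemma Cn_1 k U f : Cn k.+1 U f -> Cn 1 U f.
Proof. by elim: k => // k IH /CnS. Qed.

Lemma near_eq_continuous (T : topologicalType) (f g : T -> R) (u : T) :
  {near u, f =1 g} -> {for u, continuous f} -> {for u, continuous g}.
Proof.
move=> fg cf; rewrite /prop_for /continuous_at -(nbhs_singleton fg).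
by apply: cvg_trans cf; exact: near_eq_cvg.
Qed.

Lemma open_near_eq U f g u : open U -> (forall u, U u -> f u = g u) -> U u ->
  {near u, f =1 g}.
Proof. by move=> oU fg Uu; near do apply: fg; exact: open_nbhs_nbhs.
Unshelve. all: by end_near. Qed.

Lemma partial_ext U f g u a : open U -> (forall u, U u -> f u = g u) -> U u ->
  partial a f u = partial a g u.
Proof. by move=> oU fg Uu; apply: near_eq_derive; exact: open_near_eq fg Uu. Qed.

Lemma Cn_ext k U f g : open U -> (forall u, U u -> f u = g u) ->
  Cn k U f -> Cn k U g.
Proof.
move=> oU; elim: k f g => [|k IH] f g fg [cf df]; split=> //.
- by move=> u Uu; apply: near_eq_continuous (cf _ Uu); exact: open_near_eq fg Uu.
- by move=> u Uu; apply: near_eq_continuous (cf _ Uu); exact: open_near_eq fg Uu.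
move=> a; have [da Ca] := df a; split.
  by move=> u Uu; apply: near_eq_derivable (da _ Uu); exact: open_near_eq fg Uu.
by apply: IH Ca => u; exact: partial_ext.
Qed.

Lemma Cn_cst k U (c : R) : Cn k U (fun=> c).
Proof.
elim: k c => [|k IH] c; split=> //; try by move=> u _; exact: cst_continuous.
move=> a; split; first by move=> u _; exact: derivable_cst.
have -> : partial a (fun=> c) = (fun=> 0) by apply/funext => u; exact: derive_cst.
exact: IH.
Qed.

Lemma CnD k U f g : open U -> Cn k U f -> Cn k U g -> Cn k U (fun u => f u + g u).
Proof.
move=> oU; elim: k f g => [|k IH] f g [cf df] [cg dg]; split=> //;
  try by move=> u Uu; apply: continuousD; [exact: cf|exact: cg].
move=> a; have [da Ca] := df a; have [db Cb] := dg a; split.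
  by move=> u Uu; apply: derivableD; [exact: da|exact: db].
apply: Cn_ext (IH _ _ Ca Cb) => // u Uu /=.
by rewrite [RHS]/partial deriveD//; [exact: da|exact: db].
Qed.

Lemma CnM k U f g : open U -> Cn k U f -> Cn k U g -> Cn k U (fun u => f u * g u).
Proof.
move=> oU; elim: k f g => [|k IH] f g Cf Cg.
  by split=> // u Uu; apply: continuousM; [exact: (Cn_cont Cf)|exact: (Cn_cont Cg)].
split; first by move=> u Uu; apply: continuousM;
  [exact: (Cn_cont Cf)|exact: (Cn_cont Cg)].
move=> a; have [da Ca] := Cf.2 a; have [db Cb] := Cg.2 a; split.
  by move=> u Uu; apply: derivableM; [exact: da|exact: db].
apply: Cn_ext (CnD oU (IH _ _ (CnS Cf) Cb) (IH _ _ (CnS Cg) Ca)) => // u Uu.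
by rewrite [RHS]/partial deriveM//; [exact: da|exact: db].
Qed.

Lemma Cn_sum k U I (r : seq I) (P : pred I) (F : I -> 'rV[R]_n -> R) : open U ->
  (forall i, Cn k U (F i)) -> Cn k U (fun u => \sum_(i <- r | P i) F i u).
Proof.
move=> oU CF; elim: r => [|i r IH].
  by apply: (Cn_ext (f := fun=> 0)) => // [u|]; rewrite ?big_nil//; exact: Cn_cst.
apply: (Cn_ext (f := fun u => (if P i then F i u else 0) +
    \sum_(i <- r | P i) F i u)) => // [u|].
  by rewrite big_cons; case: ifP; rewrite ?add0r.
by apply: CnD => //; case: (P i) => //; exact: Cn_cst.
Qed.

Lemma Cn_prod k U I (r : seq I) (P : pred I) (F : I -> 'rV[R]_n -> R) : open U ->
  (forall i, Cn k U (F i)) -> Cn k U (fun u => \prod_(i <- r | P i) F i u).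
Proof.
move=> oU CF; elim: r => [|i r IH].
  by apply: (Cn_ext (f := fun=> 1)) => // [u|]; rewrite ?big_nil//; exact: Cn_cst.
apply: (Cn_ext (f := fun u => (if P i then F i u else 1) *
    \prod_(i <- r | P i) F i u)) => // [u|].
  by rewrite big_cons; case: ifP; rewrite ?mul1r.
by apply: CnM => //; case: (P i) => //; exact: Cn_cst.
Qed.

Lemma is_derive_coord a (u v : 'rV[R]_n) :
  is_derive u v (fun w : 'rV[R]_n => w 0 a) (v 0 a).
Proof.
have E : (fun h : R => h^-1 *: (((fun w : 'rV[R]_n => w 0 a) \o shift u) (h *: v)
    - u 0 a)) = (fun h : R => h^-1 * h * v 0 a).
  by apply/funext => h /=; rewrite !mxE addrK [LHS]mulrA.
have L : (fun h : R => h^-1 * h * v 0 a) @ 0^' --> v 0 a.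
  apply: cvg_near_cst; near=> h; rewrite mulVf ?mul1r//.
  by near: h; exact: nbhs_dnbhs_neq.
split; rewrite /derivable /derive E; first by apply/cvg_ex; eexists; exact: L.
exact: cvg_lim L.
Unshelve. all: by end_near. Qed.

Lemma Cn_coord k U a : Cn k U (fun u => u 0 a).
Proof.
case: k => [|k]; split=> //; try by move=> u _; exact: coord_continuous.
move=> b; split.
  by move=> u _; apply: (@ex_derive _ _ _ _ _ _ _ (is_derive_coord a u _)).
have -> : partial b (fun u => u 0 a) = (fun=> (e_ b) 0 a).
  by apply/funext => u; exact: (@derive_val _ _ _ _ _ _ _ (is_derive_coord a u _)).
exact: Cn_cst.
Qed.

Lemma CnN k U f : open U -> Cn k U f -> Cn k U (fun u => - f u).
Proof.
move=> oU Cf; apply: (Cn_ext (f := fun u => -1 * f u)) => // [u|].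
  by rewrite mulN1r.
exact: CnM (Cn_cst _ _ _) _.
Qed.

Lemma is_derive_comp1 (phi : R -> R) f u v d : derivable f u v ->
  is_derive (f u) 1 phi d -> is_derive u v (phi \o f) (d * 'D_v f u).
Proof.
move=> df dphi.
have /derivable1P df1 := df.
have dphi1 : derivable phi ((fun h : R => f (h *: v + u)) 0) 1.
  by rewrite scale0r add0r; exact: ex_derive.
split.
  apply/derivable1P/derivable1_diffP.
  by apply: (@differentiable_comp _ _ _ _ (fun h : R => f (h *: v + u)) phi);
    exact/derivable1_diffP.
rewrite (derive_line (phi \o f)) (derive_line f) -!derive1E.
rewrite (derive1_comp df1 dphi1) scale0r add0r.
by rewrite [X in X * _]derive1E derive_val.
Qed.

(** One induction treats a whole family phi_j at once, because the derivative of one member may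
    involve the others: x^-k exp(-1/x) needs infinitely many. Inverse, logarithm and square root are
    families with one member. *)
Lemma Cn_comp_family k U f (J : Type) (phi : J -> R -> R) (D : set R)
    (dphi : J -> (R -> R)) : open U ->
  (forall u, U u -> D (f u)) ->
  (forall j x, D x -> is_derive x 1 (phi j) (dphi j x)) ->
  (forall m j, (forall i, Cn m U (phi i \o f)) -> Cn m U f ->
     Cn m U (dphi j \o f)) ->
  Cn k U f -> forall j, Cn k U (phi j \o f).
Proof.
move=> oU UD dp Cd; elim: k => [|k IH] Cf j.
  split=> // u Uu; apply: continuous_comp; first exact: (Cn_cont Cf).
  have [dj _] := dp j _ (UD _ Uu).
  exact/differentiable_continuous/derivable1_diffP.
split.
  move=> u Uu; apply: continuous_comp; first exact: (Cn_cont Cf).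
  have [dj _] := dp j _ (UD _ Uu).
  exact/differentiable_continuous/derivable1_diffP.
move=> a; have [da Ca] := Cf.2 a; split.
  move=> u Uu; have /= H := is_derive_comp1 (da _ Uu) (dp j _ (UD _ Uu)).
  exact: ex_derive.
have IH' := IH (CnS Cf).
apply: Cn_ext (CnM oU (Cd k j IH' (CnS Cf)) Ca) => // u Uu.
have /= H := is_derive_comp1 (da _ Uu) (dp j _ (UD _ Uu)).
by rewrite [RHS]/partial derive_val.
Qed.

Lemma CnV k U f : open U -> (forall u, U u -> f u != 0) -> Cn k U f ->
  Cn k U (fun u => (f u)^-1).
Proof.
move=> oU f0 Cf.
apply: (@Cn_comp_family k U f unit (fun _ x => x^-1) [set x | x != 0]
  (fun _ x => - (x^-1 * x^-1))) => // [_ x /= x0|m _ H _].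
  apply: DeriveDef; first exact: derivableV.
  by rewrite deriveV// derive_id /= expr2 invfM scaleNr [_ *: _]mulr1.
by apply: CnN => //; apply: CnM => //; exact: (H tt).
Qed.

Lemma Cn_ln k U f : open U -> (forall u, U u -> 0 < f u) -> Cn k U f ->
  Cn k U (fun u => ln (f u)).
Proof.
move=> oU f0 Cf.
apply: (@Cn_comp_family k U f unit (fun _ => @ln R) [set x | 0 < x]
  (fun _ x => x^-1)) => //.
by move=> m j _ Cf'; apply: CnV => // u /f0; rewrite lt0r => /andP[].
Qed.

Lemma is_derive_sqrt (x : R) : 0 < x ->
  is_derive x 1 (@Num.sqrt R) (2^-1 * (Num.sqrt x)^-1).
Proof. by move=> x0; have := is_derive1_sqrt x0; rewrite invfM. Qed.

Lemma Cn_sqrt k U f : open U -> (forall u, U u -> 0 < f u) -> Cn k U f ->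
  Cn k U (fun u => Num.sqrt (f u)).
Proof.
move=> oU f0 Cf.
apply: (@Cn_comp_family k U f unit (fun _ => @Num.sqrt R) [set x | 0 < x]
  (fun _ x => 2^-1 * (Num.sqrt x)^-1)) => //.
  by move=> _ x /= x0; exact: is_derive_sqrt.
move=> m j H Cf'; apply: CnM => //; first exact: Cn_cst.
by apply: CnV => //; [move=> u /f0; rewrite -sqrtr_gt0 lt0r => /andP[]|exact: (H tt)].
Qed.

Lemma Cn_differentiable U f u : open U -> Cn 1 U f -> U u -> differentiable f u.
Proof.
move=> oU Cf Uu; apply: C1_differentiable.
  near=> w => a; have [da _] := Cf.2 a; apply: da.
  by near: w; exact: open_nbhs_nbhs.
by move=> a; have [_ [Ca _]] := Cf.2 a; exact: Ca.
Unshelve. all: by end_near. Qed.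

(** The mean value inequality is applied first in direction a, to the increment in direction b, and
    then in direction b to the partial derivative along a. *)
Lemma mixed_difference (d e B : R) f u a b :
  (forall w, ball u d w -> [/\ derivable f w (e_ a),
     derivable (partial a f) w (e_ b) & `|partial b (partial a f) w - B| <= e]) ->
  forall s t, `|s| + `|t| < d ->
  `|f (s *: e_ a + (t *: e_ b + u)) - f (s *: e_ a + u) - f (t *: e_ b + u) + f u
    - s * (t * B)| <= e * `|t| * `|s|.
Proof.
move=> H s t std.
have eN (c : 'I_n) : `|e_ c| <= 1.
  by apply/rV_norm_le => // j; rewrite !mxE; case: (_ && _); rewrite ?normr1 ?normr0.
have K r q : `|r| <= `|s| -> `|q| <= `|t| -> ball u d (r *: e_ a + (q *: e_ b + u)).
  move=> rs qt; rewrite -ball_normE /= addrA opprD [- _ - u]addrC addrA subrr add0r.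
  rewrite normrN; apply: le_lt_trans (ler_normD _ _) _; apply: le_lt_trans std.
  by rewrite lerD// normrZ; [move: rs|move: qt]; apply: le_trans;
    rewrite ler_piMr ?normr_ge0 ?eN.
have := @mean_value_ineq R (fun r => f (r *: e_ a + (t *: e_ b + u)) -
  f (r *: e_ a + u)) (t * B) (e * `|t|) s.
rewrite !scale0r !add0r => H1.
have -> : f (s *: e_ a + (t *: e_ b + u)) - f (s *: e_ a + u) -
    f (t *: e_ b + u) + f u - s * (t * B) =
  f (s *: e_ a + (t *: e_ b + u)) - f (s *: e_ a + u) -
    (f (t *: e_ b + u) - f u) - s * (t * B) by ring.
apply: H1 => r rs.
have [d1 _ _] := H _ (K r t rs (lexx _)).
have d2 : derivable f (r *: e_ a + u) (e_ a).
  have [] := H (r *: e_ a + u) => //.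
  by have := K r 0 rs; rewrite normr0 scale0r add0r; apply.
have /line_is_derive L1 := derivableP d1.
have /line_is_derive L2 := derivableP d2.
have L := is_deriveB L1 L2.
split; first exact: (@ex_derive _ _ _ _ _ _ _ L).
rewrite (@derive_val _ _ _ _ _ _ _ L) -!/(partial _ _ _).
have := @mean_value_ineq R (fun q => partial a f (q *: e_ b + (r *: e_ a + u)))
  B e t.
rewrite scale0r add0r [t *: _ + (r *: _ + _)]addrCA; apply => q qt.
have [_ d3 d3B] := H _ (K r q rs qt).
rewrite addrCA in d3 d3B.
have /line_is_derive L3 := derivableP d3.
split; first exact: (@ex_derive _ _ _ _ _ _ _ L3).
by rewrite (@derive_val _ _ _ _ _ _ _ L3).
Qed.

(** Schwarz's theorem. The second difference over a square of side s is symmetric in a and b and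
    approximates both s^2 A and s^2 B within (e/2) s^2, hence |A - B| <= e. *)
Lemma partialC U f u a b : open U -> Cn 2 U f -> U u ->
  partial a (partial b f) u = partial b (partial a f) u.
Proof.
move=> oU Cf Uu.
have [dfa [_ Ca]] := Cf.2 a; have [dfb [_ Cb]] := Cf.2 b.
have [dab [cab _]] := Ca b; have [dba [cba _]] := Cb a.
set A := LHS; set B := RHS.
apply/eqP; rewrite -subr_eq0 -normr_le0; apply/ler_addgt0Pl => e e0; rewrite addr0.
have e20 : 0 < e / 2 by rewrite divr_gt0.
have nU : \forall w \near u, U w by exact: open_nbhs_nbhs.
have : \forall w \near u, [/\ U w, `|partial b (partial a f) w - B| <= e / 2 &
    `|partial a (partial b f) w - A| <= e / 2].
  have /cvgrPdist_le/(_ _ e20) H1 := cab _ Uu.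
  have /cvgrPdist_le/(_ _ e20) H2 := cba _ Uu.
  by apply: filterS3 nU H1 H2 => w Uw h1 h2; split;
    [exact: Uw|rewrite distrC; exact: h1|rewrite distrC; exact: h2].
move=> /nbhs_ballP[d /= d0 Hd].
pose s := d / 4.
have s0 : 0 < s by rewrite divr_gt0.
have ssd : `|s| + `|s| < d by rewrite gtr0_norm// /s; lra.
have H1 := @mixed_difference d (e / 2) B f u a b _ s s ssd.
have H2 := @mixed_difference d (e / 2) A f u b a _ s s ssd.
have {}H1 := H1 (fun w bw => let: And3 Uw h _ := Hd w bw in
  And3 (dfa _ Uw) (dab _ Uw) h).
have {}H2 := H2 (fun w bw => let: And3 Uw _ h := Hd w bw in
  And3 (dfb _ Uw) (dba _ Uw) h).
rewrite [s *: e_ b + (_ + _)]addrCA in H2.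
set X := f _ in H1 H2; set Y := f (s *: e_ a + u) in H1 H2.
set Z := f (s *: e_ b + u) in H1 H2.
have : `|s * (s * (A - B))| <= e * (s * s).
  have -> : s * (s * (A - B)) = (X - Y - Z + f u - s * (s * B)) -
     (X - Z - Y + f u - s * (s * A)) by ring.
  apply: le_trans (ler_normB _ _) _; apply: le_trans (lerD H1 H2) _.
  by rewrite gtr0_norm//; apply: eq_ler; field.
by rewrite mulrA normrM gtr0_norm ?mulr_gt0// mulrC ler_pM2r ?mulr_gt0.
Qed.

Lemma smooth_onC U f u a b : open U -> smooth_on U f -> U u ->
  partial a (partial b f) u = partial b (partial a f) u.
Proof. by move=> oU /smooth_onP Cf; exact: partialC. Qed.

End smooth_classes.

Section composition.
Context {R : realType} {n m : nat}.
Implicit Types (f : 'rV[R]_m -> R) (Phi : 'rV[R]_n -> 'rV[R]_m).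

Lemma rV_continuous (T : topologicalType) (F : T -> 'rV[R]_m) (t : T) :
  (forall b, {for t, continuous (fun s => F s 0 b)}) -> {for t, continuous F}.
Proof.
move=> cF; apply/cvgrPdist_le => e e0.
have H b : \forall s \near t, `|(F t - F s) 0 b| <= e.
  have /cvgrPdist_le/(_ _ e0) := cF b.
  by apply: filterS => s; rewrite !mxE.
have := @filter_forall _ _ _ _ (nbhs_filter t) H.
by apply: filterS => s Hs; apply/rV_norm_le => //; exact: ltW.
Qed.

Lemma partial_comp U V f Phi u a : open U -> open V -> Cn 1 V f ->
  (forall b, Cn 1 U (fun w => Phi w 0 b)) -> (forall w, U w -> V (Phi w)) -> U u ->
  is_derive u (delta_mx 0 a) (f \o Phi)
    (\sum_(b < m) partial b f (Phi u) * partial a (fun w => Phi w 0 b) u).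
Proof.
move=> oU oV Cf CP UV Uu.
have dP b : derivable (fun w => Phi w 0 b) u (delta_mx 0 a).
  by have [+ _] := (CP b).2 a; apply.
pose c (s : R) := Phi (s *: delta_mx 0 a + u).
have c0 : c 0 = Phi u by rewrite /c scale0r add0r.
pose v : 'rV[R]_m := \row_b partial a (fun w => Phi w 0 b) u.
have H := @curve_is_derive R m f c 0 v.
have {}H : is_derive (0 : R) (1 : R) (f \o c)
    (\sum_(b < m) v 0 b * partial b f (c 0)).
  apply: H; first by rewrite c0; apply: (Cn_differentiable oV Cf); exact: UV.
  move=> b; rewrite mxE; apply: (@line_is_derive _ _ (fun w => Phi w 0 b)).
  by rewrite scale0r add0r; exact: derivableP.
split; first by apply/derivable1P; exact: (@ex_derive _ _ _ _ _ _ _ H).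
rewrite (derive_line (f \o Phi)); transitivity ('D_(1 : R) (f \o c) (0 : R)) => //.
rewrite (@derive_val _ _ _ _ _ _ _ H); apply: eq_bigr => b _.
by rewrite c0 mxE mulrC.
Qed.

Lemma Cn_comp k U V f Phi : open U -> open V -> Cn k V f ->
  (forall b, Cn k U (fun w => Phi w 0 b)) -> (forall w, U w -> V (Phi w)) ->
  Cn k U (f \o Phi).
Proof.
move=> oU oV; elim: k f => [|k IH] f Cf CP UV.
  split=> // u Uu; apply: continuous_comp; last exact/(Cn_cont Cf)/UV.
  by apply: rV_continuous => b; exact: (Cn_cont (CP b)).
have Cf1 : Cn 1 V f by elim: k Cf {IH CP} => // k IH /CnS.
have CP1 b : Cn 1 U (fun w => Phi w 0 b).
  exact: Cn_1 (CP b).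
split.
  move=> u Uu; apply: continuous_comp; last exact/(Cn_cont Cf)/UV.
  by apply: rV_continuous => b; exact: (Cn_cont (CP b)).
move=> a; split.
  move=> u Uu; have /= H := partial_comp a oU oV Cf1 CP1 UV Uu.
  exact: (@ex_derive _ _ _ _ _ _ _ H).
apply: (Cn_ext (f := fun u => \sum_(b < m) (partial b f \o Phi) u *
    partial a (fun w => Phi w 0 b) u)) => //.
  move=> u Uu; have /= H := partial_comp a oU oV Cf1 CP1 UV Uu.
  by rewrite [RHS]/partial (@derive_val _ _ _ _ _ _ _ H).
apply: Cn_sum => // b; apply: CnM => //.
  apply: IH => //; first by have [_ /(_ b)[]] := Cf.
  by move=> b'; exact/CnS/CP.
by have [_ /(_ a)[]] := CP b.
Qed.

End composition.

Section smooth_rules.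
Context {R : realType} {n : nat}.
Implicit Types (f g : 'rV[R]_n -> R) (u : 'rV[R]_n) (U V : set 'rV[R]_n).

Lemma smooth_on_sub U V f : V `<=` U -> smooth_on U f -> smooth_on V f.
Proof. by move=> VU sf l u /VU; exact: sf. Qed.

Lemma smooth_onU U V f : smooth_on U f -> smooth_on V f -> smooth_on (U `|` V) f.
Proof. by move=> sf sg l u [/sf|/sg]; apply. Qed.

Lemma smooth_on_continuous U f u : smooth_on U f -> U u -> {for u, continuous f}.
Proof. by move=> sf Uu; have [] := sf [::] u Uu. Qed.

Lemma smooth_on_derivable U f u a : smooth_on U f -> U u ->
  derivable f u (delta_mx 0 a).
Proof. by move=> sf Uu; have [_] := sf [::] u Uu; apply. Qed.

#[global] Opaque smooth_on.

Lemma smooth_on_ext U f g : open U -> (forall u, U u -> f u = g u) ->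
  smooth_on U f -> smooth_on U g.
Proof.
by move=> oU fg /smooth_onP sf; apply/smooth_onP => k; exact: Cn_ext fg (sf k).
Qed.

Lemma smooth_on_cst U (c : R) : smooth_on U (fun=> c).
Proof. by apply/smooth_onP => k; exact: Cn_cst. Qed.

Lemma smooth_on_coord U a : smooth_on U (fun u => u 0 a).
Proof. by apply/smooth_onP => k; exact: Cn_coord. Qed.

Lemma smooth_onD U f g : open U -> smooth_on U f -> smooth_on U g ->
  smooth_on U (fun u => f u + g u).
Proof.
by move=> oU /smooth_onP sf /smooth_onP sg; apply/smooth_onP => k; exact: CnD.
Qed.

Lemma smooth_onM U f g : open U -> smooth_on U f -> smooth_on U g ->
  smooth_on U (fun u => f u * g u).
Proof.
by move=> oU /smooth_onP sf /smooth_onP sg; apply/smooth_onP => k; exact: CnM.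
Qed.

Lemma smooth_onN U f : open U -> smooth_on U f -> smooth_on U (fun u => - f u).
Proof. by move=> oU /smooth_onP sf; apply/smooth_onP => k; exact: CnN. Qed.

Lemma smooth_onB U f g : open U -> smooth_on U f -> smooth_on U g ->
  smooth_on U (fun u => f u - g u).
Proof. by move=> oU sf sg; exact: smooth_onD oU sf (smooth_onN oU sg). Qed.

Lemma smooth_on_sum U I (r : seq I) (P : pred I) (F : I -> 'rV[R]_n -> R) :
  open U -> (forall i, smooth_on U (F i)) ->
  smooth_on U (fun u => \sum_(i <- r | P i) F i u).
Proof.
move=> oU sF; apply/smooth_onP => k; apply: Cn_sum => // i.
exact: (smooth_onP _ _).1.
Qed.

Lemma smooth_on_prod U I (r : seq I) (P : pred I) (F : I -> 'rV[R]_n -> R) :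
  open U -> (forall i, smooth_on U (F i)) ->
  smooth_on U (fun u => \prod_(i <- r | P i) F i u).
Proof.
move=> oU sF; apply/smooth_onP => k; apply: Cn_prod => // i.
exact: (smooth_onP _ _).1.
Qed.

Lemma smooth_onV U f : open U -> (forall u, U u -> f u != 0) ->
  smooth_on U f -> smooth_on U (fun u => (f u)^-1).
Proof.
by move=> oU f0 /smooth_onP sf; apply/smooth_onP => k; exact: CnV.
Qed.

Lemma smooth_on_ln U f : open U -> (forall u, U u -> 0 < f u) ->
  smooth_on U f -> smooth_on U (fun u => ln (f u)).
Proof.
by move=> oU f0 /smooth_onP sf; apply/smooth_onP => k; exact: Cn_ln.
Qed.

Lemma smooth_on_sqrt U f : open U -> (forall u, U u -> 0 < f u) ->
  smooth_on U f -> smooth_on U (fun u => Num.sqrt (f u)).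
Proof.
by move=> oU f0 /smooth_onP sf; apply/smooth_onP => k; exact: Cn_sqrt.
Qed.

Lemma smooth_on_differentiable U f u : open U -> smooth_on U f -> U u ->
  differentiable f u.
Proof. by move=> oU /smooth_onP sf; exact: Cn_differentiable. Qed.

Lemma partialD U f g u a : smooth_on U f -> smooth_on U g -> U u ->
  partial a (fun w => f w + g w) u = partial a f u + partial a g u.
Proof.
move=> sf sg Uu; rewrite [LHS]/partial deriveD//.
  exact: smooth_on_derivable sf Uu.
exact: smooth_on_derivable sg Uu.
Qed.

Lemma partialM U f g u a : smooth_on U f -> smooth_on U g -> U u ->
  partial a (fun w => f w * g w) u = partial a f u * g u + f u * partial a g u.
Proof.
move=> sf sg Uu; rewrite [LHS]/partial deriveM//.
- by rewrite addrC; congr (_ + _); exact: mulrC.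
- exact: smooth_on_derivable sf Uu.
- exact: smooth_on_derivable sg Uu.
Qed.

Lemma partial_cst (c : R) u a : partial a (fun=> c) u = 0.
Proof. exact: derive_cst. Qed.

Lemma partial_coord u a b : partial a (fun w => w 0 b) u = (a == b)%:R.
Proof.
rewrite [LHS](@derive_val _ _ _ _ _ _ _ (is_derive_coord b u _)) mxE eqxx.
by rewrite eq_sym.
Qed.

Lemma partialN U f u a : smooth_on U f -> U u ->
  partial a (fun w => - f w) u = - partial a f u.
Proof.
by move=> sf Uu; rewrite [LHS]/partial deriveN//; exact: smooth_on_derivable sf Uu.
Qed.

Lemma partialB U f g u a : open U -> smooth_on U f -> smooth_on U g -> U u ->
  partial a (fun w => f w - g w) u = partial a f u - partial a g u.
Proof.
move=> oU sf sg Uu.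
by rewrite (partialD a sf (smooth_onN oU sg) Uu) (partialN a sg Uu).
Qed.

Lemma partial_sum U I (r : seq I) (P : pred I) (F : I -> 'rV[R]_n -> R) u a :
  open U -> (forall i, smooth_on U (F i)) -> U u ->
  partial a (fun w => \sum_(i <- r | P i) F i w) u =
  \sum_(i <- r | P i) partial a (F i) u.
Proof.
move=> oU sF Uu; elim: r => [|i r IH].
  by rewrite big_nil -[RHS](partial_cst 0 u a); congr (partial a _ u);
    apply/funext => w; rewrite big_nil.
rewrite big_cons -IH; case: ifP => Pi.
  rewrite -(@partialD U)//; last exact: smooth_on_sum.
  by congr (partial a _ u); apply/funext => w; rewrite big_cons Pi.
by congr (partial a _ u); apply/funext => w; rewrite big_cons Pi.
Qed.

Lemma partial_prod U (I : eqType) (r : seq I) (F : I -> 'rV[R]_n -> R) u a :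
  open U -> (forall i, smooth_on U (F i)) -> U u -> uniq r ->
  partial a (fun w => \prod_(i <- r) F i w) u =
  \sum_(k <- r) \prod_(i <- r) (if i == k then partial a (F i) u else F i u).
Proof.
move=> oU sF Uu; elim: r => [_|i r IH /= /andP[ir ur]].
  by rewrite big_nil -[RHS](partial_cst 1 u a); congr (partial a _ u);
    apply/funext => w; rewrite big_nil.
rewrite big_cons big_cons eqxx.
have -> : (fun w => \prod_(j <- i :: r) F j w) =
    (fun w => F i w * \prod_(j <- r) F j w).
  by apply/funext => w; rewrite big_cons.
rewrite (@partialM U)//; last exact: smooth_on_prod.
rewrite IH//; congr (_ * _ + _).
  apply: eq_big_seq => j jr; case: eqP => // ji.
  by move: jr ir; rewrite ji => ->.
rewrite big_distrr /=; apply: eq_big_seq => k kr; rewrite big_cons.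
by case: eqP => // ik; move: kr ir; rewrite ik => ->.
Qed.

Lemma partial_comp1 U (phi : R -> R) (d : R) f u a : smooth_on U f -> U u ->
  is_derive (f u) 1 phi d ->
  partial a (fun w => phi (f w)) u = d * partial a f u.
Proof.
move=> sf Uu dphi.
have df : derivable f u (delta_mx 0 a) by exact: smooth_on_derivable sf Uu.
exact: (@derive_val _ _ _ _ _ _ _ (is_derive_comp1 df dphi)).
Qed.

Lemma smooth_on_comp m (U : set 'rV[R]_n) (V : set 'rV[R]_m) (f : 'rV[R]_m -> R)
    (Phi : 'rV[R]_n -> 'rV[R]_m) :
  open U -> open V -> smooth_on V f ->
  (forall b, smooth_on U (fun w => Phi w 0 b)) -> (forall w, U w -> V (Phi w)) ->
  smooth_on U (fun w => f (Phi w)).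
Proof.
move=> oU oV /smooth_onP sf sP UV; apply/smooth_onP => k.
by apply: (Cn_comp oU oV (sf k) _ UV) => b; exact: (smooth_onP _ _).1.
Qed.

Lemma smooth_on_det m U (A : 'rV[R]_n -> 'M[R]_m) : open U ->
  (forall i j, smooth_on U (fun w => A w i j)) -> smooth_on U (fun w => \det (A w)).
Proof.
move=> oU sA; apply: smooth_on_sum => // s; apply: smooth_onM => //.
  exact: smooth_on_cst.
by apply: smooth_on_prod => // i; exact: sA.
Qed.

(** Cramer's rule: the entries are cofactors divided by the determinant. *)
Lemma smooth_on_invmx m U (A : 'rV[R]_n -> 'M[R]_m) : open U ->
  (forall i j, smooth_on U (fun w => A w i j)) ->
  (forall w, U w -> \det (A w) != 0) ->
  forall i j, smooth_on U (fun w => invmx (A w) i j).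
Proof.
move=> oU sA dA i j.
apply: (@smooth_on_ext _ (fun w => (\det (A w))^-1 *
    ((-1) ^+ (j + i) * \det (row' j (col' i (A w)))))) => //.
  move=> w Uw; rewrite /invmx unitmxE unitfE dA//.
  by rewrite !mxE.
apply: smooth_onM => //; first by apply: smooth_onV => //; exact: smooth_on_det.
apply: smooth_onM => //; first exact: smooth_on_cst.
apply: smooth_on_det => // k l.
by apply: (smooth_on_ext oU _ (sA (lift j k) (lift i l))) => w _; rewrite !mxE.
Qed.

(** Jacobi's formula. The determinant is differentiated one row at a time, and the matrix [B k] with
    differentiated row k is expanded along that row, whose cofactors are those of A. *)
Lemma partial_det m U (A : 'rV[R]_n -> 'M[R]_m) u a : open U ->
  (forall i j, smooth_on U (fun w => A w i j)) -> U u ->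
  \det (A u) != 0 ->
  partial a (fun w => \det (A w)) u =
  \det (A u) * \sum_i \sum_j invmx (A u) j i * partial a (fun w => A w i j) u.
Proof.
move=> oU sA Uu dA.
pose B k := \matrix_(i, j)
  if i == k then partial a (fun w => A w i j) u else A u i j.
transitivity (\sum_k \det (B k)).
  rewrite {1}/determinant (@partial_sum U)//; last first.
    move=> s; apply: smooth_onM => //; first exact: smooth_on_cst.
    by apply: smooth_on_prod => // i; exact: sA.
  rewrite /determinant exchange_big; apply: eq_bigr => s _.
  have sP : smooth_on U (fun w => \prod_i A w i (perm.fun_of_perm s i)).
    by apply: smooth_on_prod => // i; exact: sA.
  rewrite (partialM _ (@smooth_on_cst U _) sP Uu).
  rewrite partial_cst mul0r add0r -big_distrr /=; congr (_ * _).
  rewrite (@partial_prod U)//; last exact: index_enum_uniq.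
  by apply: eq_bigr => k _; apply: eq_bigr => i _; rewrite mxE.
rewrite big_distrr /=; apply: eq_bigr => k _.
rewrite (expand_det_row _ k) big_distrr /=; apply: eq_bigr => j _.
rewrite mxE eqxx mulrC mulrA; congr (_ * _).
rewrite /invmx unitmxE unitfE dA !mxE mulrA mulfV// mul1r.
rewrite /cofactor; congr (_ * \det _).
by apply/matrixP => i l; rewrite !mxE eq_sym (negbTE (neq_lift _ _)).
Qed.

End smooth_rules.

#[global] Opaque partial.

Ltac smooth_leaf := fail.

Ltac smooth1 :=
  lazymatch goal with
  | |- open _ => assumption
  | |- smooth_on _ (fun _ => ?c) => apply: smooth_on_cst
  | |- smooth_on _ (fun x => (@?f x + - @?g x)%R) => eapply smooth_onB
  | |- smooth_on _ (fun x => (@?f x + @?g x)%R) => eapply smooth_onD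
  | |- smooth_on _ (fun x => (@?f x * @?g x)%R) => eapply smooth_onM
  | |- smooth_on _ (fun x => (- @?f x)%R) => eapply smooth_onN
  | |- smooth_on _ (fun x => @bigop.body _ _ _ _ (@?F x)) =>
      eapply smooth_on_sum; [|intros ?]
  | |- smooth_on _ (partial _ _) => apply smooth_on_partial
  | |- smooth_on _ (fun x => partial _ _ x) => apply smooth_on_partial
  | |- smooth_on _ (fun x => fun_of_matrix x _ _) => apply: smooth_on_coord
  | H : smooth_on ?U ?f |- smooth_on ?U ?f => exact H
  | H : smooth_on ?U ?f |- smooth_on ?U (fun x => ?f x) => exact H
  | H : forall a b, smooth_on ?U (fun u => fun_of_matrix (?g u) a b) |-
      smooth_on ?U (fun u => fun_of_matrix (?g u) _ _) => exact (H _ _)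
  | H : forall a, smooth_on ?U (?F a) |- smooth_on ?U (?F _) => exact (H _)
  | H : forall a, smooth_on ?U (?F a) |- smooth_on ?U (fun x => ?F _ x) => exact (H _)
  | |- _ => smooth_leaf
  end.
Ltac smooth := repeat smooth1.

(** * Metrics in a chart *)

Section spd.
Context {R : rcfType}.

(** Induction by block elimination: the Schur complement D - b^T b / a0 is again positive definite.
    The factorisation takes the place of diagonalisation for the positivity of determinants and
    traces. *)
Lemma spd_cholesky n (g : 'M[R]_n) : g^T = g ->
  (forall v : 'rV[R]_n, v != 0 -> 0 < (v *m g *m v^T) 0 0) ->
  exists2 L : 'M[R]_n, g = L *m L^T & \det L != 0.
Proof.
elim: n g => [|n IH] g gT gpos.
  exists 1%:M; last by rewrite det1 oner_neq0.
  by apply/matrixP => -[].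
pose g' : 'M[R]_(1 + n) := g.
have g'T : g'^T = g' by [].
have g'pos (v : 'rV[R]_(1 + n)) : v != 0 -> 0 < (v *m g' *m v^T) 0 0 by exact: gpos.
rewrite -[g]/g'; move: g' g'T g'pos => {g gT gpos} g gT gpos.
pose a := ulsubmx g; pose b := ursubmx g; pose D := drsubmx g.
have gE : g = block_mx a b b^T D.
  rewrite -{1}(submxK g); congr block_mx.
  by rewrite /b trmx_ursub gT.
have DT : D^T = D by rewrite /D trmx_drsub gT.
pose a0 := a 0 0.
have aE : a = a0%:M by rewrite [a]mx11_scalar.
have a0_gt0 : 0 < a0.
  have := gpos (row_mx 1%:M 0).
  rewrite gE mul_row_block tr_row_mx mul_row_col !mul0mx !mul1mx !addr0 trmx1.
  rewrite trmx0 mulmx0 addr0 mulmx1; apply.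
  apply/eqP => /rowP/(_ (lshift _ 0)); rewrite row_mxEl !mxE eqxx => /eqP.
  by rewrite oner_eq0.
pose D' := D - a0^-1 *: (b^T *m b).
have [||L' D'E dL'] := IH D'.
- by rewrite /D' linearB /= linearZ /= trmx_mul trmxK DT.
(* This x minimises the form of g at (x, w) for fixed w, and the minimum is the form of D' at w. *)
- move=> w w0; pose x : 'rV[R]_1 := - a0^-1 *: (w *m b^T).
  have := gpos (row_mx x w).
  have -> : row_mx x w *m g *m (row_mx x w)^T = w *m D' *m w^T.
    rewrite gE mul_row_block tr_row_mx mul_row_col.
    have -> : x *m a + w *m b^T = 0.
      by rewrite aE mul_mx_scalar /x scalerA mulrN mulfV ?gt_eqF// scaleN1r addNr.
    rewrite mul0mx add0r /D' /x mulmxBr; congr (_ *m _).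
    by rewrite addrC -scalemxAr mulmxA -scalemxAl scaleNr.
  apply; apply: contraNneq w0 => /(congr1 rsubmx).
  by rewrite row_mxKr linear0 => ->.
pose Lb : 'M[R]_(1 + n) :=
  block_mx (Num.sqrt a0)%:M 0 ((Num.sqrt a0)^-1 *: b^T) L'.
have s0 : Num.sqrt a0 != 0 by rewrite gt_eqF// sqrtr_gt0.
exists Lb; last first.
  by rewrite (@det_lblock _ 1 n) mulf_neq0// det_scalar1.
suff gL : g = Lb *m Lb^T by [].
rewrite tr_block_mx mulmx_block !trmx0 !mulmx0 !mul0mx !addr0 tr_scalar_mx.
rewrite linearZ /= trmxK -D'E -scalar_mxM -expr2 sqr_sqrtr ?ltW// -aE.
rewrite -scalemxAr mul_scalar_mx scalerA mulVf// scale1r.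
rewrite -scalemxAl mul_mx_scalar scalerA mulVf// scale1r.
rewrite -scalemxAl -scalemxAr scalerA -invfM -expr2 sqr_sqrtr ?ltW//.
by rewrite /D' addrC subrK gE.
Qed.

Lemma spd_det_gt0 n (g : 'M[R]_n) : g^T = g ->
  (forall v : 'rV[R]_n, v != 0 -> 0 < (v *m g *m v^T) 0 0) -> 0 < \det g.
Proof.
move=> gT /(spd_cholesky gT)[L -> dL].
by rewrite det_mulmx det_tr -expr2 exprn_even_gt0.
Qed.

Lemma trace_mulmx_tr n (X : 'M[R]_n) : 0 <= \tr (X *m X^T).
Proof.
rewrite /mxtrace; apply: sumr_ge0 => i _; rewrite mxE; apply: sumr_ge0 => j _.
by rewrite mxE -expr2 sqr_ge0.
Qed.

(** With h = L L^T the trace is the squared Hilbert-Schmidt norm of L^T H L. In [gamma2_ge] it is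
    the squared norm of a shifted Hessian. *)
Lemma trace_spd_sym_ge0 n (h H : 'M[R]_n) : h^T = h -> H^T = H ->
  (forall v : 'rV[R]_n, v != 0 -> 0 < (v *m h *m v^T) 0 0) ->
  0 <= \tr (h *m H *m (h *m H)).
Proof.
move=> hT HT /(spd_cholesky hT)[L -> _].
have -> : \tr (L *m L^T *m H *m (L *m L^T *m H)) =
    \tr ((L^T *m H *m L) *m (L^T *m H *m L)^T).
  rewrite !trmx_mul trmxK HT -!mulmxA mxtrace_mulC.
  by rewrite -!mulmxA.
exact: trace_mulmx_tr.
Qed.

Lemma spd_inv n (g : 'M[R]_n) : g^T = g -> \det g != 0 ->
  (forall v : 'rV[R]_n, v != 0 -> 0 < (v *m g *m v^T) 0 0) ->
  (invmx g)^T = invmx g /\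
  forall v : 'rV[R]_n, v != 0 -> 0 < (v *m invmx g *m v^T) 0 0.
Proof.
move=> gT dg gpos.
have ug : g \in unitmx by rewrite unitmxE unitfE.
have hT : (invmx g)^T = invmx g by rewrite trmx_inv gT.
split=> // v v0; have := gpos (v *m invmx g).
rewrite trmx_mul hT mulmxKV// !mulmxA; apply.
by apply: contraNneq v0 => /(congr1 (mulmx^~ g)); rewrite mulmxKV// mul0mx => ->.
Qed.

End spd.

(** * Index algebra of Bochner's formula *)

Section bochner_algebra.
Context {R : comRingType} {n : nat}.
Variables (S K dv dw : 'I_n -> 'I_n -> R) (G P : 'I_n -> 'I_n -> 'I_n -> R).
Variables (DG : 'I_n -> 'I_n -> 'I_n -> 'I_n -> R) (v w : 'I_n -> R).
Hypothesis GC : forall b c d, G b c d = G b d c.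
Hypothesis PC : forall a b c, P a b c = P c b a.
Hypothesis SE : forall b c, S b c = dv c b + \sum_d G b c d * v d.
Hypothesis KE : forall c a, K c a = dw a c + \sum_d G c a d * w d.

Let T a b c := P a b c + \sum_d (DG a b c d * v d + G b c d * dv a d).

(** The commutation of covariant derivatives, stripped of geometry: v and w stand for the gradients
    of f and k, dv and dw for their derivatives, P for second derivatives, G and DG for the
    Christoffel symbols and their derivatives, S and K for the covariant derivatives of the
    gradients. The last sum contracts the coordinate expression of Ric with v and w. *)
Lemma bochner_algebra :
  \sum_a \sum_c (T a a c * w c + S a c * dw a c)
    + \sum_a \sum_e G a a e * \sum_c S e c * w c =
  \sum_a \sum_c S a c * K c a + \sum_c w c * \sum_a T c a a
    + \sum_e \sum_c (\sum_a (DG a a c e - DG c a a e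
        + \sum_l (G a a l * G l c e - G a c l * G l a e))) * v e * w c.
Proof.
(* X is the defect in exchanging the divergence of S with the gradient of its trace. E2 expands it
   through S, and the curvature is the part X1 + X4 free of S. *)
pose X := \sum_a \sum_c \sum_d w c * ((DG a a c d - DG c a a d) * v d
  + G a c d * dv a d - G a a d * dv c d).
have E1 : \sum_a \sum_c T a a c * w c = \sum_c w c * (\sum_a T c a a) + X.
  under [in RHS]eq_bigr do rewrite big_distrr /=.
  rewrite [in RHS]exchange_big /= -big_split; apply: eq_bigr => a _ /=.
  rewrite -big_split; apply: eq_bigr => c _ /=.
  rewrite /T [P a a c]PC !mulrDl !mulrDr -!addrA mulrC; congr (_ + _).
  rewrite big_distrl big_distrr -big_split /=; apply: eq_bigr => d _; ring.
pose X1 := \sum_a \sum_c \sum_d w c * (DG a a c d - DG c a a d) * v d.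
pose X2 := \sum_a \sum_c \sum_d w c * G a c d * S d a.
pose X3 := \sum_a \sum_c \sum_d w c * G a a d * S d c.
pose X4 := \sum_a \sum_c \sum_d \sum_e
  w c * (G a a d * G d c e - G a c d * G d a e) * v e.
have E2 : X = X1 + X2 - X3 + X4.
  rewrite /X1 /X2 /X3 /X4 -sumrN -!big_split; apply: eq_bigr => a _ /=.
  rewrite -sumrN -!big_split; apply: eq_bigr => c _ /=.
  rewrite -sumrN -!big_split; apply: eq_bigr => d _ /=.
  have -> : \sum_e w c * (G a a d * G d c e - G a c d * G d a e) * v e =
      w c * G a a d * (\sum_e G d c e * v e)
      - w c * G a c d * (\sum_e G d a e * v e).
    by rewrite !big_distrr -sumrB /=; apply: eq_bigr => e _; ring.
  rewrite !SE; ring.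
have E3 : \sum_a \sum_e G a a e * (\sum_c S e c * w c) = X3.
  apply: eq_bigr => a _; rewrite exchange_big /=; apply: eq_bigr => e _.
  by rewrite big_distrr /=; apply: eq_bigr => c _; ring.
have E4 : \sum_a \sum_c S a c * K c a = \sum_a \sum_c S a c * dw a c + X2.
  transitivity (\sum_a \sum_c S a c * dw a c +
      \sum_a \sum_c \sum_d S a c * G c a d * w d).
    rewrite -big_split; apply: eq_bigr => a _ /=.
    rewrite -big_split; apply: eq_bigr => c _ /=.
    rewrite KE mulrDr big_distrr /=; congr (_ + _).
    by apply: eq_bigr => d _; ring.
  congr (_ + _); rewrite /X2 [LHS]exchange_big /=; apply: eq_bigr => a _.
  rewrite [LHS]exchange_big /=; apply: eq_bigr => c _; apply: eq_bigr => d _.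
  by rewrite [G a d c]GC; ring.
have E5 : \sum_e \sum_c (\sum_a (DG a a c e - DG c a a e
        + \sum_l (G a a l * G l c e - G a c l * G l a e))) * v e * w c = X1 + X4.
  have -> : X4 = \sum_a \sum_c \sum_e \sum_d
      w c * (G a a d * G d c e - G a c d * G d a e) * v e.
    by apply: eq_bigr => a _; apply: eq_bigr => c _; rewrite exchange_big.
  rewrite /X1 -big_split exchange_big /=.
  under [in RHS]eq_bigr do rewrite -big_split /=.
  rewrite [in RHS]exchange_big /=; apply: eq_bigr => c _.
  under [in RHS]eq_bigr do rewrite -big_split /=.
  rewrite [in RHS]exchange_big /=; apply: eq_bigr => e _.
  rewrite !big_distrl /=; apply: eq_bigr => a _.
  rewrite !mulrDl !big_distrl /=; congr (_ + _); first by ring.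
  by apply: eq_bigr => d _; ring.
under eq_bigr do rewrite big_split /=.
rewrite big_split /= E1 E2 E3 E4 E5; ring.
Qed.

End bochner_algebra.

Section kronecker.
Context {R : realType} {n : nat}.

Lemma sum_kron (X : 'I_n -> R) e : \sum_l (e == l)%:R * X l = X e.
Proof.
rewrite (bigD1 e)//= eqxx mul1r big1 ?addr0// => l le.
by rewrite eq_sym (negbTE le) mul0r.
Qed.

End kronecker.

(** * Connection, Hessian, Laplacian and Bochner's formula in a chart *)

Section chart_geometry.
Context {R : realType} {N : nat}.
Variables (g : 'rV[R]_N -> 'M[R]_N) (U : set 'rV[R]_N).
Hypothesis oU : open U.
Hypothesis sg : forall a b, smooth_on U (fun u => g u a b).
Hypothesis gT : forall u, U u -> (g u)^T = g u.
Hypothesis gpos : forall u (v : 'rV[R]_N), U u -> v != 0 ->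
  0 < (v *m g u *m v^T) 0 0.

Implicit Types (f k : 'rV[R]_N -> R) (u : 'rV[R]_N).

Let h u := invmx (g u).
Let rho u := Num.sqrt (\det (g u)).
Local Notation Gam := (christoffel g).

Definition grad_coord f (d : 'I_N) u : R := \sum_b invmx (g u) d b * partial b f u.

Definition gamma_coord f k u : R :=
  \sum_a \sum_b invmx (g u) a b * partial a f u * partial b k u.

(* covariant derivative of the gradient, with one index raised *)
Definition hess_coord f (d a : 'I_N) u : R :=
  partial a (grad_coord f d) u + \sum_c Gam d a c u * grad_coord f c u.

Lemma det_metric_gt0 u : U u -> 0 < \det (g u).
Proof. by move=> Uu; apply: spd_det_gt0 => [|v]; [exact: gT|exact: gpos]. Qed.

Lemma smooth_inv_metric a b : smooth_on U (fun u => invmx (g u) a b).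
Proof.
by apply: smooth_on_invmx => // u /det_metric_gt0; rewrite lt0r => /andP[].
Qed.

Lemma smooth_density : smooth_on U (fun u => Num.sqrt (\det (g u))).
Proof.
by apply: smooth_on_sqrt => //; [exact: det_metric_gt0|exact: smooth_on_det].
Qed.

Lemma density_gt0 u : U u -> 0 < rho u.
Proof. by move=> Uu; rewrite sqrtr_gt0 det_metric_gt0. Qed.

Ltac smooth_leaf ::= apply smooth_inv_metric.

Lemma smooth_christoffel d a b : smooth_on U (Gam d a b).
Proof.
by rewrite /christoffel; smooth.
Qed.

Lemma smooth_grad f d : smooth_on U f -> smooth_on U (grad_coord f d).
Proof. by move=> sf; rewrite /grad_coord; smooth. Qed.

Lemma smooth_gamma f k : smooth_on U f -> smooth_on U k ->
  smooth_on U (gamma_coord f k).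
Proof. by move=> sf sk; rewrite /gamma_coord; smooth. Qed.

Ltac smooth_leaf ::=
  first [apply smooth_inv_metric | apply smooth_christoffel | apply smooth_grad].

Lemma smooth_hess f d a : smooth_on U f -> smooth_on U (hess_coord f d a).
Proof.
by move=> sf; rewrite /hess_coord; smooth.
Qed.

Ltac smooth_leaf ::=
  lazymatch goal with
  | |- smooth_on _ (grad_coord _ _) => apply smooth_grad
  | |- smooth_on _ (fun x => grad_coord _ _ x) => apply smooth_grad
  | |- smooth_on _ (gamma_coord _ _) => apply smooth_gamma
  | |- smooth_on _ (fun x => gamma_coord _ _ x) => apply smooth_gamma
  | |- smooth_on _ (hess_coord _ _ _) => apply smooth_hess
  | |- smooth_on _ (fun x => hess_coord _ _ _ x) => apply smooth_hess
  | |- smooth_on _ (christoffel _ _ _ _) => apply smooth_christoffel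
  | |- smooth_on _ (fun x => christoffel _ _ _ _ x) => apply smooth_christoffel
  | |- smooth_on _ (fun x => Num.sqrt _) => apply smooth_density
  | |- smooth_on _ (fun x => fun_of_matrix (invmx _) _ _) => apply smooth_inv_metric
  end.

Lemma metricC u a b : U u -> g u a b = g u b a.
Proof. by move=> /gT {1}<-; rewrite mxE. Qed.

Lemma inv_metricC u a b : U u -> h u a b = h u b a.
Proof. by move=> /gT gTu; rewrite /h -{1}gTu -trmx_inv mxE. Qed.

Lemma partial_metricC u a b l : U u ->
  partial l (fun w => g w a b) u = partial l (fun w => g w b a) u.
Proof. by move=> Uu; apply: partial_ext oU _ Uu => w; exact: metricC. Qed.

Lemma metric_unit u : U u -> g u \in unitmx.
Proof. by move=> /det_metric_gt0; rewrite unitmxE unitfE lt0r => /andP[]. Qed.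

Lemma metric_invE u e b : U u -> \sum_d g u e d * h u d b = (e == b)%:R.
Proof. by move=> /metric_unit/mulmxV/matrixP/(_ e b); rewrite !mxE. Qed.

Lemma inv_metricE u e b : U u -> \sum_d h u e d * g u d b = (e == b)%:R.
Proof. by move=> /metric_unit/mulVmx/matrixP/(_ e b); rewrite !mxE. Qed.

Lemma lower_raise u (X : 'I_N -> R) e : U u ->
  \sum_d g u e d * \sum_l h u d l * X l = X e.
Proof.
move=> Uu; under eq_bigr do rewrite big_distrr /=.
rewrite exchange_big /= -[RHS]sum_kron; apply: eq_bigr => l _.
by rewrite -(metric_invE _ _ Uu) big_distrl /=; apply: eq_bigr => d _; rewrite mulrA.
Qed.

Lemma raise_lower u (X : 'I_N -> R) e : U u ->
  \sum_d h u e d * \sum_l g u d l * X l = X e.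
Proof.
move=> Uu; under eq_bigr do rewrite big_distrr /=.
rewrite exchange_big /= -[RHS]sum_kron; apply: eq_bigr => l _.
by rewrite -(inv_metricE _ _ Uu) big_distrl /=; apply: eq_bigr => d _; rewrite mulrA.
Qed.

Lemma christoffelC u d a b : U u -> Gam d a b u = Gam d b a u.
Proof.
move=> Uu; rewrite /christoffel; congr (_ * _); apply: eq_bigr => l _.
congr (_ * _); rewrite [partial l _ u](partial_metricC _ _ _ Uu); ring.
Qed.

Lemma lower_christoffel u e a c : U u ->
  \sum_d g u e d * Gam d a c u =
  2^-1 * (partial a (fun w => g w c e) u + partial c (fun w => g w a e) u
          - partial e (fun w => g w a c) u).
Proof.
move=> Uu; pose X l := partial a (fun w => g w c l) u
  + partial c (fun w => g w a l) u - partial l (fun w => g w a c) u.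
rewrite -[_ - _]/(X e) -(lower_raise X e Uu) big_distrr /=.
by apply: eq_bigr => d _; rewrite /christoffel; ring.
Qed.

Lemma lower_grad f u e : U u ->
  \sum_d g u e d * grad_coord f d u = partial e f u.
Proof. by move=> Uu; rewrite (lower_raise (fun b => partial b f u)). Qed.

Lemma lower_partial_grad f u e a : smooth_on U f -> U u ->
  \sum_d g u e d * partial a (grad_coord f d) u =
  partial a (partial e f) u
  - \sum_d partial a (fun w => g w e d) u * grad_coord f d u.
Proof.
move=> sf Uu.
have /(partial_ext a oU) : forall w, U w -> \sum_d g w e d * grad_coord f d w =
  partial e f w by move=> w; exact: lower_grad.
move=> /(_ u Uu) <-.
have sF d : smooth_on U (fun w => g w e d * grad_coord f d w) by smooth.
rewrite (partial_sum _ _ _ oU sF Uu) -sumrB; apply: eq_bigr => d _.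
rewrite (partialM _ (sg e d) (smooth_grad d sf) Uu); ring.
Qed.

(** The Hessian with both indices down. The Christoffel symbols of the first kind are expanded, so
    that symmetry in e and a reduces to that of second derivatives. *)
Definition hess_low f (e a : 'I_N) u : R :=
  partial a (partial e f) u - \sum_c 2^-1 *
    (partial a (fun w => g w e c) u + partial e (fun w => g w a c) u
     - partial c (fun w => g w a e) u) * grad_coord f c u.

Lemma lower_hess f u e a : smooth_on U f -> U u ->
  \sum_d g u e d * hess_coord f d a u = hess_low f e a u.
Proof.
move=> sf Uu; rewrite /hess_coord.
under eq_bigr do rewrite mulrDr big_distrr /=.
rewrite big_split /= lower_partial_grad// /hess_low -addrA; congr (_ + _).
rewrite exchange_big /= -sumrN -big_split -sumrN; apply: eq_bigr => c _ /=.
under eq_bigr do rewrite mulrA.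
rewrite -big_distrl /= lower_christoffel// [partial a (fun w => g w c e) u]partial_metricC//.
by field.
Qed.

Lemma hess_lowC f u e a : smooth_on U f -> U u ->
  hess_low f e a u = hess_low f a e u.
Proof.
move=> sf Uu; rewrite /hess_low (smooth_onC _ _ oU sf Uu); congr (_ - _).
apply: eq_bigr => c _; rewrite [partial c (fun w => g w e a) u]partial_metricC//.
ring.
Qed.

Lemma hess_coordE f u d a : smooth_on U f -> U u ->
  hess_coord f d a u = \sum_e h u d e * hess_low f e a u.
Proof.
move=> sf Uu; rewrite -(raise_lower (fun d => hess_coord f d a u) d Uu).
by apply: eq_bigr => e _; rewrite lower_hess.
Qed.

Lemma gamma_gradl f k u : gamma_coord f k u = \sum_a partial a f u * grad_coord k a u.
Proof.
apply: eq_bigr => a _; rewrite /grad_coord big_distrr /=; apply: eq_bigr => b _.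
ring.
Qed.

Lemma gamma_coordC f k u : U u -> gamma_coord f k u = gamma_coord k f u.
Proof.
move=> Uu; rewrite /gamma_coord exchange_big; apply: eq_bigr => a _.
apply: eq_bigr => b _; rewrite -/(h u) inv_metricC//; ring.
Qed.

(** Compatibility of the connection with the metric. Lowering an index turns the derivative of a
    gradient into a second derivative minus a derivative of the metric, and the metric derivatives
    recombine into the two Hessians. *)
Lemma partial_gamma f k u a : smooth_on U f -> smooth_on U k -> U u ->
  partial a (gamma_coord f k) u =
  \sum_c (hess_low f c a u * grad_coord k c u + hess_low k c a u * grad_coord f c u).
Proof.
move=> sf sk Uu.
have -> : gamma_coord f k = fun w => \sum_c partial c f w * grad_coord k c w.
  by apply/funext => w; exact: gamma_gradl.
have sF c : smooth_on U (fun w => partial c f w * grad_coord k c w) by smooth.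
rewrite (partial_sum _ _ _ oU sF Uu).
under eq_bigr => c _ do rewrite (partialM _ (smooth_on_partial c sf)
  (smooth_grad c sk) Uu) -(lower_grad f c Uu).
rewrite !big_split /=.
have -> : \sum_c (\sum_d g u c d * grad_coord f d u) * partial a (grad_coord k c) u
  = \sum_d (partial a (partial d k) u
     - \sum_c partial a (fun w => g w d c) u * grad_coord k c u) * grad_coord f d u.
  under eq_bigr do rewrite big_distrl /=.
  rewrite exchange_big /=; apply: eq_bigr => d _.
  rewrite -lower_partial_grad// big_distrl /=; apply: eq_bigr => c _.
  rewrite [g u c d]metricC//; ring.
rewrite /hess_low.
under [in RHS]eq_bigr do rewrite mulrBl big_distrl /=.
under [X in _ = _ + X]eq_bigr do rewrite mulrBl big_distrl /=.
under [X in _ + X = _]eq_bigr do rewrite mulrBl big_distrl /=.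
rewrite !sumrB.
set A := \sum_(i < N) partial a (partial i f) u * _.
set B := \sum_(i < N) partial a (partial i k) u * _.
rewrite [X in _ = _ + (_ - X)]exchange_big /=.
have -> : \sum_(i < N) \sum_(j < N) partial a (fun w => g w i j) u *
    grad_coord k j u * grad_coord f i u =
  \sum_(i < N) \sum_(i0 < N)
     2^-1 * (partial a (fun w => g w i i0) u +
             partial i (fun w => g w a i0) u -
             partial i0 (fun w => g w a i) u) * grad_coord f i0 u * grad_coord k i u
  + \sum_(j < N) \sum_(i < N) 2^-1 *
       (partial a (fun w => g w i j) u +
        partial i (fun w => g w a j) u -
        partial j (fun w => g w a i) u) * grad_coord k j u * grad_coord f i u.
  rewrite [LHS]exchange_big -big_split; apply: eq_bigr => i _ /=.
  rewrite -big_split; apply: eq_bigr => j _ /=.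
  rewrite [partial a (fun w => g w j i) u]partial_metricC//.
  by field.
ring.
Qed.

Lemma grad_gamma f k u b : smooth_on U f -> smooth_on U k -> U u ->
  grad_coord (gamma_coord f k) b u =
  \sum_c (hess_coord f b c u * grad_coord k c u
          + hess_coord k b c u * grad_coord f c u).
Proof.
move=> sf sk Uu; rewrite /grad_coord.
under eq_bigr => a _ do rewrite partial_gamma// big_distrr /=.
rewrite exchange_big /=; apply: eq_bigr => c _.
rewrite !hess_coordE// !big_distrl -big_split /=; apply: eq_bigr => a _.
rewrite [hess_low f a c u]hess_lowC// [hess_low k a c u]hess_lowC// /h.
by rewrite -!/(grad_coord _ _ _); ring.
Qed.

(** Jacobi's formula for the logarithm of sqrt(det g). It turns the divergence form of the
    Laplacian, in which the density is differentiated, into the trace of the Hessian. *)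
Lemma trace_christoffel u c : U u ->
  partial c rho u = rho u * \sum_a Gam a a c u.
Proof.
move=> Uu; have d0 := det_metric_gt0 Uu.
rewrite (partial_comp1 c (smooth_on_det oU sg) Uu (is_derive_sqrt d0)).
rewrite (partial_det c oU sg Uu) ?gt_eqF//.
have -> : \sum_a Gam a a c u =
    2^-1 * \sum_i \sum_j h u j i * partial c (fun w => g w i j) u.
  rewrite /christoffel -big_distrr /=; congr (_ * _).
  under eq_bigr do under eq_bigr do rewrite -addrA mulrDr [X in _ + X]mulrDr.
  under eq_bigr do rewrite !big_split /=.
  rewrite !big_split /=.
  rewrite addrCA [X in _ + (X + _)](_ : _ =
    - \sum_(a < N) \sum_(l < N) invmx (g u) a l * - partial l (fun w => g w a c) u).
    rewrite addNr addr0; apply: eq_bigr => a _; apply: eq_bigr => l _.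
    by rewrite -!/(h u) inv_metricC.
  rewrite exchange_big -sumrN; apply: eq_bigr => l _ /=.
  rewrite -sumrN; apply: eq_bigr => a _; rewrite -!/(h u) inv_metricC//.
  by rewrite [partial a _ u]partial_metricC//; ring.
rewrite /rho -{2}(sqr_sqrtr (ltW d0)).
have s0 : Num.sqrt (\det (g u)) != 0 by rewrite gt_eqF// sqrtr_gt0.
rewrite /h; set W := \sum_i _; field.
exact: s0.
Qed.

Lemma div_density (X : 'I_N -> 'rV[R]_N -> R) u : U u ->
  (forall a, smooth_on U (X a)) ->
  (rho u)^-1 * \sum_a partial a (fun w => rho w * X a w) u =
  \sum_a partial a (X a) u + \sum_a \sum_c Gam a a c u * X c u.
Proof.
move=> Uu sX.
have r0 : rho u != 0 by rewrite gt_eqF// density_gt0.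
rewrite [X in _ = _ + X]exchange_big /= -big_split big_distrr /=.
apply: eq_bigr => a _; rewrite (partialM _ smooth_density (sX a) Uu).
rewrite trace_christoffel// -big_distrl /= -/(rho u).
set W := \sum_a _; field; exact: r0.
Qed.

Lemma laplace_div f u : smooth_on U f -> U u ->
  laplace_coord g f u = \sum_a partial a (grad_coord f a) u
    + \sum_a \sum_c Gam a a c u * grad_coord f c u.
Proof. by move=> sf Uu; exact: (div_density Uu (fun a => smooth_grad a sf)). Qed.

Lemma laplace_trace f u : smooth_on U f -> U u ->
  laplace_coord g f u = \sum_a hess_coord f a a u.
Proof. by move=> sf Uu; rewrite laplace_div// -big_split. Qed.

Definition ricci_form (v w : 'I_N -> R) u : R :=
  \sum_e \sum_c ricci_coord g e c u * v e * w c.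

Lemma div_hess f k u : smooth_on U f -> smooth_on U k -> U u ->
  \sum_a partial a (fun x => \sum_c hess_coord f a c x * grad_coord k c x) u
  + \sum_a \sum_e Gam a a e u * (\sum_c hess_coord f e c u * grad_coord k c u) =
  \sum_a \sum_c hess_coord f a c u * hess_coord k c a u
  + gamma_coord k (laplace_coord g f) u
  + ricci_form (fun e => grad_coord f e u) (fun c => grad_coord k c u) u.
Proof.
move=> sf sk Uu.
have Hd a b c : partial a (hess_coord f b c) u =
    partial a (partial c (grad_coord f b)) u +
    \sum_d (partial a (Gam b c d) u * grad_coord f d u
            + Gam b c d u * partial a (grad_coord f d) u).
  have s1 : smooth_on U (partial c (grad_coord f b)).
    by smooth.
  have s3 d : smooth_on U (fun x => Gam b c d x * grad_coord f d x).
    by smooth.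
  have s2 : smooth_on U (fun x => \sum_d Gam b c d x * grad_coord f d x).
    by smooth.
  rewrite (partialD a s1 s2 Uu) (partial_sum _ _ _ oU s3 Uu); congr (_ + _).
  by apply: eq_bigr => d _; rewrite (partialM a (smooth_christoffel _ _ _)
    (smooth_grad _ sf) Uu).
have E := @bochner_algebra R N (fun b c => hess_coord f b c u)
  (fun b c => hess_coord k b c u) (fun a d => partial a (grad_coord f d) u)
  (fun a d => partial a (grad_coord k d) u) (fun b c d => Gam b c d u)
  (fun a b c => partial a (partial c (grad_coord f b)) u)
  (fun a b c d => partial a (Gam b c d) u)
  (fun d => grad_coord f d u) (fun d => grad_coord k d u).
have -> : gamma_coord k (laplace_coord g f) u =
    \sum_c grad_coord k c u * \sum_a partial c (hess_coord f a a) u.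
  rewrite gamma_coordC// gamma_gradl; apply: eq_bigr => c _; rewrite mulrC.
  have sF a : smooth_on U (hess_coord f a a) by smooth.
  congr (_ * _); rewrite -(partial_sum _ _ _ oU sF Uu).
  by apply: partial_ext oU _ Uu => w Uw; rewrite laplace_trace.
transitivity (\sum_a \sum_c (partial a (hess_coord f a c) u * grad_coord k c u
     + hess_coord f a c u * partial a (grad_coord k c) u)
  + \sum_a \sum_e Gam a a e u * (\sum_c hess_coord f e c u * grad_coord k c u)).
  congr (_ + _); apply: eq_bigr => a _.
  have sF c : smooth_on U (fun x => hess_coord f a c x * grad_coord k c x).
    by smooth.
  rewrite (partial_sum _ _ _ oU sF Uu).
  by apply: eq_bigr => c _; rewrite (partialM a (smooth_hess _ _ sf)
    (smooth_grad _ sk) Uu).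
under eq_bigr do under eq_bigr do rewrite Hd.
rewrite E; last 4 first.
- by move=> b c d; exact: christoffelC.
- by move=> a b c; rewrite (smooth_onC _ _ oU (smooth_grad b sf) Uu).
- by [].
- by [].
congr (_ + _ + _).
by apply: eq_bigr => c _; under [in RHS]eq_bigr do rewrite Hd.
Qed.

(** By [grad_gamma] this is the sum of two instances of [div_hess]. The polarised form serves for
    products of distinct coordinate functions in [lap_gam_xi], the diagonal case in [gamma2_ge]. *)
Lemma bochner f k u : smooth_on U f -> smooth_on U k -> U u ->
  laplace_coord g (gamma_coord f k) u =
  2 * (\sum_a \sum_c hess_coord f a c u * hess_coord k c a u)
  + gamma_coord k (laplace_coord g f) u + gamma_coord f (laplace_coord g k) u
  + ricci_form (fun e => grad_coord f e u) (fun c => grad_coord k c u) u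
  + ricci_form (fun e => grad_coord k e u) (fun c => grad_coord f c u) u.
Proof.
move=> sf sk Uu.
pose A f k b x := \sum_c hess_coord f b c x * grad_coord k c x.
have sA f' k' b : smooth_on U f' -> smooth_on U k' -> smooth_on U (A f' k' b).
  by move=> ? ?; rewrite /A; smooth.
have E b w : U w -> grad_coord (gamma_coord f k) b w = A f k b w + A k f b w.
  by move=> Uw; rewrite grad_gamma// big_split.
rewrite (laplace_div (smooth_gamma sf sk) Uu).
under eq_bigr => a _ do rewrite (partial_ext a oU (E a) Uu)
  (partialD a (sA _ _ a sf sk) (sA _ _ a sk sf) Uu).
under [X in _ + X]eq_bigr do under eq_bigr do rewrite E// mulrDr.
under [X in _ + X]eq_bigr do rewrite big_split /=.
have D1 : \sum_a partial a (A f k a) u + \sum_a \sum_e Gam a a e u * A f k e u = _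
  := div_hess sf sk Uu.
have D2 : \sum_a partial a (A k f a) u + \sum_a \sum_e Gam a a e u * A k f e u = _
  := div_hess sk sf Uu.
apply: etrans (congr2 +%R (big_split _ _ _ _ _) (big_split _ _ _ _ _)) _.
apply: etrans (addrACA _ _ _ _) _.
apply: etrans (congr2 +%R D1 D2) _.
have -> : \sum_a \sum_c hess_coord k a c u * hess_coord f c a u =
    \sum_a \sum_c hess_coord f a c u * hess_coord k c a u.
  rewrite exchange_big; apply: eq_bigr => a _; apply: eq_bigr => c _.
  exact: mulrC.
have gen (x p q r s : R) : x + p + q + (x + r + s) = 2 * x + p + r + q + s by ring.
exact: gen.
Qed.

End chart_geometry.

Ltac smooth_leaf ::=
  lazymatch goal with
  | |- smooth_on _ (grad_coord _ _ _) => apply smooth_grad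
  | |- smooth_on _ (fun x => grad_coord _ _ _ x) => apply smooth_grad
  | |- smooth_on _ (gamma_coord _ _ _) => apply smooth_gamma
  | |- smooth_on _ (fun x => gamma_coord _ _ _ x) => apply smooth_gamma
  | |- smooth_on _ (hess_coord _ _ _ _) => apply smooth_hess
  | |- smooth_on _ (fun x => hess_coord _ _ _ _ x) => apply smooth_hess
  | |- smooth_on _ (christoffel _ _ _ _) => apply smooth_christoffel
  | |- smooth_on _ (fun x => christoffel _ _ _ _ x) => apply smooth_christoffel
  | |- smooth_on _ (fun x => Num.sqrt _) => apply smooth_density
  | |- smooth_on _ (fun x => fun_of_matrix (invmx _) _ _) => apply smooth_inv_metric
  end.

(** * Lebesgue measure on R^n *)

Section borel_rV.
Context {R : realType}.
Implicit Types n : nat.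

Definition borel_rV n : measurableType _ := g_sigma_algebraType (@open 'rV[R]_n).

Lemma open_measurable_rV n (A : set 'rV[R]_n) : open A ->
  measurable (A : set (borel_rV n)).
Proof. by move=> oA; exact: sub_sigma_algebra. Qed.

Lemma closed_measurable_rV n (A : set 'rV[R]_n) : closed A ->
  measurable (A : set (borel_rV n)).
Proof.
move=> cA; rewrite -[A]setCK; apply: measurableC; apply: open_measurable_rV.
exact: closed_openC.
Qed.

Lemma countable_bigcup_measurable d (T : measurableType d) (I : countType)
    (F : I -> set T) : (forall i, measurable (F i)) -> measurable (\bigcup_i F i).
Proof.
move=> mF.
pose G k := if unpickle k is Some i then F i else set0.
have -> : \bigcup_i F i = \bigcup_k G k.
  apply/seteqP; split=> x.
    by move=> [i _ Fi]; exists (pickle i) => //; rewrite /G pickleK.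
  by move=> [k _]; rewrite /G; case: unpickle => // i Fi; exists i.
by apply: bigcup_measurable => k _; rewrite /G; case: unpickle.
Qed.

Lemma rat_approx_rV n (v : 'rV[R]_n) (e : R) : 0 < e ->
  exists q : 'rV[rat]_n, `|map_mx ratr q - v| < e.
Proof.
move=> e0.
have H j : exists q : rat, `|ratr q - v 0 j| <= e / 2.
  have [|q] := @rat_in_itvoo R (v 0 j) (v 0 j + e / 2).
    by rewrite ltrDl divr_gt0.
  rewrite in_itv /= => /andP[q1 q2]; exists q.
  rewrite ger0_norm; first by rewrite lerBlDl; exact: ltW.
  by rewrite subr_ge0; exact: ltW.
have {H} [q Hq] := choice H.
exists (\row_j q j); apply: (@le_lt_trans _ _ (e / 2)).
  by apply/rV_norm_le => [|j]; [rewrite divr_ge0// ltW|rewrite !mxE].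
by rewrite ltr_pdivrMr// ltr_pMr// ltr1n.
Qed.

Definition cons_rV n (z : R * 'rV[R]_n) : 'rV[R]_n.+1 :=
  row_mx (const_mx z.1 : 'rV[R]_1) z.2.

Lemma cons_rV_norm n (z : R * 'rV[R]_n) (e : R) : 0 <= e ->
  (`|cons_rV z| <= e) <-> (`|z.1| <= e /\ `|z.2| <= e).
Proof.
move=> e0; split.
  move=> /(rV_norm_le _ e0) H; split.
    by have := H (@lshift 1 n 0); rewrite /cons_rV (@row_mxEl _ 1 1 n) mxE.
  apply/(rV_norm_le _ e0) => j.
  by have := H (@rshift 1 n j); rewrite /cons_rV (@row_mxEr _ 1 1 n).
move=> [H1 /(rV_norm_le _ e0) H2]; apply/(rV_norm_le _ e0) => j.
rewrite /cons_rV; have [i ->|i ->] := @split_ordP 1 n j.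
  by rewrite (@row_mxEl _ 1 1 n) mxE.
by rewrite (@row_mxEr _ 1 1 n).
Qed.

Lemma cons_rVB n (x y : R) (v w : 'rV[R]_n) :
  cons_rV (x, v) - cons_rV (y, w) = cons_rV (x - y, v - w).
Proof.
rewrite /cons_rV /=; apply/rowP => j; rewrite [LHS]mxE [X in _ + X]mxE.
have [i ->|i ->] := @split_ordP 1 n j.
  by rewrite !(@row_mxEl _ 1 1 n) !mxE.
by rewrite !(@row_mxEr _ 1 1 n) !mxE.
Qed.

(** An open set is a countable union of products of balls with rational centres, so Borel sets of
    R^(n+1) are measurable for the product sigma-algebra. *)
Lemma measurable_cons_rV n :
  measurable_fun setT (@cons_rV n : measurableTypeR R * borel_rV n -> borel_rV n.+1).
Proof.
apply: (@measurability _ _ _ (borel_rV n.+1) _ _ (@open 'rV[R]_n.+1)) => //.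
move=> B [W oW <-].
rewrite setTI.
pose I := (rat * 'rV[rat]_n * nat)%type.
pose c (i : I) : R * 'rV[R]_n := (ratr i.1.1, map_mx ratr i.1.2).
pose r (i : I) : R := i.2.+1%:R^-1.
pose F (i : I) : set (measurableTypeR R * borel_rV n) :=
  if `[< ball (cons_rV (c i)) (r i) `<=` W >] then
    (ball (c i).1 (r i) `*` ball (c i).2 (r i)) else set0.
have -> : @cons_rV n @^-1` W = \bigcup_i F i.
  apply/seteqP; split=> [[x v] Oz|[x v] [i _]]; last first.
    rewrite /F; case: asboolP => // HO [/= b1 b2]; apply: HO.
    rewrite -ball_normE /= /c cons_rVB.
    have r0 : 0 < r i by rewrite invr_gt0.
    move: b1 b2; rewrite -!ball_normE /= => b1 b2.
    have m0 : 0 <= Num.max `|(c i).1 - x| `|(c i).2 - v| by rewrite le_max normr_ge0.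
    apply: (@le_lt_trans _ _ (Num.max `|(c i).1 - x| `|(c i).2 - v|)).
      by apply/(cons_rV_norm _ m0); rewrite /= !le_max !lexx orbT.
    by rewrite gt_max b1 b2.
  have /nbhs_ballP[e /= e0 He] : nbhs (cons_rV (x, v)) W by exact: open_nbhs_nbhs.
  have [k _ Hk] := near_infty_natSinv_lt (PosNum (divr_gt0 e0 (ltr0n R 2 : 0 < 2))).
  have {}Hk := Hk k (leqnn k); rewrite /= in Hk.
  have k0 : 0 < k.+1%:R^-1 :> R by rewrite invr_gt0.
  have [q Hq] := rat_approx_rV v k0.
  have [q1 Hq1] : exists q1 : rat, `|ratr q1 - x| < k.+1%:R^-1.
    have [|q1] := @rat_in_itvoo R x (x + k.+1%:R^-1); first by rewrite ltrDl.
    rewrite in_itv /= => /andP[h1 h2]; exists q1.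
    by rewrite ger0_norm ?subr_ge0 ?ltW// ltrBlDl.
  exists (q1, q, k) => //; rewrite /F; case: asboolP => [_|[]].
    by split; rewrite /= -ball_normE.
  move=> w; rewrite -ball_normE /= => Hw; apply: He; rewrite -ball_normE /=.
  rewrite -(subrKA (cons_rV (c (q1, q, k)))).
  apply: le_lt_trans (ler_normD _ _) _.
  rewrite (splitr e); apply: ltrD; last exact: lt_trans Hw Hk.
  apply: le_lt_trans Hk; rewrite distrC cons_rVB.
  by apply/(cons_rV_norm _ (ltW k0)); rewrite /= !ltW.
apply: countable_bigcup_measurable => i; rewrite /F; case: asboolP => // _.
apply: measurableX; first exact: measurable_ball.
by apply: open_measurable_rV; apply: ball_open; rewrite invr_gt0.
Qed.

Lemma norm_ball_measurable n (r : R) : measurable ([set u | `|u| <= r] : set (borel_rV n)).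
Proof.
apply: closed_measurable_rV.
rewrite (_ : [set v : 'rV[R]_n | `|v| <= r] = (fun v : 'rV[R]_n => `|v|) @^-1` [set x | x <= r])//.
by apply: closed_comp; [move=> x _; exact: norm_continuous|exact: closed_le].
Qed.

Lemma rV_ball_bigcup n : [set: 'rV[R]_n] = \bigcup_k [set u | `|u| <= k%:R].
Proof.
apply/seteqP; split=> // u _; exists (Num.bound `|u|) => //=.
by rewrite ltW// archi_boundP.
Qed.

(** [lebesgue_rV_integral] is a mere iterated integral. A measure with the same integrals comes from
    pushing forward products with Lebesgue measure, which opens the way to convergence theorems;
    finiteness on cubes gives the sigma-finiteness that the next dimension needs. *)
Lemma lebesgue_rV_measure n :
  exists mu : {sigma_finite_measure set (borel_rV n) -> \bar R},
  (forall k : nat, (mu [set u : 'rV[R]_n | (`|u| <= k%:R)%R] < +oo)%E) /\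
  forall F : borel_rV n -> \bar R,
    measurable_fun setT F -> (forall u, (0 <= F u)%E) ->
    (\int[mu]_u F u)%E = lebesgue_rV_integral F.
Proof.
elim: n => [|n [mu [muB muI]]].
  exists (@dirac _ (borel_rV 0) (0 : 'rV[R]_0) R).
  split; first by move=> k; rewrite /= diracE ltry.
  move=> F mF F0; rewrite integral_dirac//.
  by rewrite /= diracE mem_set// mul1e.
pose phi : measurableTypeR R * borel_rV n -> borel_rV n.+1 := @cons_rV n.
have mphi : measurable_fun setT phi by exact: measurable_cons_rV.
pose m12 := (@lebesgue_measure R \x mu)%E.
pose nuF : {measure set (borel_rV n.+1) -> \bar R} := pushforward m12 phi.
pose nu := nuF mphi.
have nuB (k : nat) : (nu [set u : 'rV[R]_n.+1 | (`|u| <= k%:R)%R] < +oo)%E.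
  rewrite /= /pushforward.
  have -> : phi @^-1` [set u | `|u| <= k%:R] =
      [set x : R | `|x| <= k%:R] `*` [set v : 'rV[R]_n | `|v| <= k%:R].
    apply/seteqP; split=> z /=.
      by move/(cons_rV_norm _ (ler0n R k)).
    by move=> H; apply/(cons_rV_norm _ (ler0n R k)).
  have kI : [set x : R | `|x| <= k%:R] = `[- k%:R, k%:R]%classic.
    by apply/seteqP; split=> x /=; rewrite in_itv /= ler_norml.
  have kL : (@lebesgue_measure R [set x : R | (`|x| <= k%:R)%R] < +oo)%E.
    by rewrite kI lebesgue_measure_itv; case: ifP => _; rewrite ?ltry.
  rewrite /m12 product_measure1E//; last 2 first.
  - by rewrite kI; exact: measurable_itv.
  - exact: norm_ball_measurable.
  apply: lte_mul_pinfty => //.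
    by rewrite ge0_fin_numE//; exact: kL.
have nuS : sigma_finite [set: borel_rV n.+1] nu.
  exists (fun k => [set u : 'rV[R]_n.+1 | `|u| <= k%:R]); first exact: rV_ball_bigcup.
  by move=> k; split; [exact: norm_ball_measurable|exact: nuB].
pose nuSM := Measure_isSigmaFinite.Build _ _ _ nu nuS.
pose nu' : {sigma_finite_measure set (borel_rV n.+1) -> \bar R} :=
  HB.pack (Measure.sort nu) nuSM.
exists nu'; split; first exact: nuB.
move=> F mF F0.
have mFphi : measurable_fun setT (F \o phi).
  exact: measurableT_comp.
transitivity (\int[nu]_u F u)%E; first by [].
rewrite ge0_integral_pushforward// preimage_setT.
rewrite /m12 fubini_tonelli1//; last by move=> z /=.
rewrite /=; apply: eq_integral => x _.
rewrite /fubini_F muI//; last by move=> u; exact: F0.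
apply: (measurableT_comp mFphi (g := fun v => (x, v))).
exact: pair1_measurable.
Qed.
End borel_rV.

Section transport.
Local Open Scope ereal_scope.
Context {R : realType} d1 d2 (T1 : measurableType d1) (T2 : measurableType d2).
Variables (nu : {measure set T1 -> \bar R}) (mu : {measure set T2 -> \bar R}).
Variables (D : set T1) (V : set T2) (phi : T2 -> T1) (r : T2 -> R).
Hypotheses (mD : measurable D) (mV : measurable V).
Hypotheses (mphi : measurable_fun V phi) (mr : measurable_fun V r).
Hypothesis r0 : forall u, V u -> (0 <= r u)%R.
Hypothesis nuE : forall A, measurable A ->
  nu (A `&` D) = \int[mu]_(u in V) (\1_A (phi u) * r u)%:E.

Import HBNNSimple.

(** A change of variables known for sets extends to nonnegative functions through simple functions
    and monotone convergence. *)
Lemma transport_integral (f : T1 -> \bar R) : measurable_fun setT f ->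
  (forall x, 0 <= f x) ->
  \int[nu]_(x in D) f x = \int[mu]_(u in V) (f (phi u) * (r u)%:E).
Proof.
move=> mf f0.
pose f_ := nnsfun_approx measurableT mf.
have mfD n : measurable_fun D (fun x => (f_ n x)%:E).
  apply/measurable_EFinP; exact: (measurable_funS measurableT).
have mfV n : measurable_fun V (fun u => (f_ n (phi u))).
  by apply: measurableT_comp mphi.
have cvf x : (f_ n x)%:E @[n --> \oo] --> f x by apply: cvg_nnsfun_approx.
have rE u : V u -> 0 <= (r u)%:E by move=> Vu; rewrite lee_fin r0.
transitivity (limn (fun n => \int[nu]_(x in D) (f_ n x)%:E)).
  rewrite -monotone_convergence//.
  - by apply: eq_integral => y _; apply/esym/cvg_lim.
  - by move=> n y _; rewrite lee_fin.
  - by move=> y _ m n mn; rewrite lee_fin; exact/lefP/nd_nnsfun_approx.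
transitivity (limn (fun n => \int[mu]_(u in V) ((f_ n (phi u))%:E * (r u)%:E))); last first.
  rewrite -monotone_convergence//.
  - apply: eq_integral => u _; apply/cvg_lim => //.
    by apply: cvgeZr => //; exact: cvf.
  - by move=> n; apply: emeasurable_funM; apply/measurable_EFinP.
  - by move=> n u Vu; rewrite mule_ge0 ?rE// lee_fin.
  - move=> u Vu m n mn; apply: lee_wpmul2r; first exact: rE.
    by rewrite lee_fin; exact/lefP/nd_nnsfun_approx.
congr (limn _); apply/funext => n.
have mk k : measurable (f_ n @^-1` [set k]) by exact: measurable_sfunP.
transitivity (\sum_(k \in range (f_ n)) (k%:E * nu (f_ n @^-1` [set k] `&` D))).
  under eq_integral do rewrite fimfunE -fsumEFin//.
  rewrite ge0_integral_fsum//; last 2 first.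
  - by move=> y; apply/measurable_EFinP/measurable_funM => //; apply: measurable_funS (measurable_indic _ _).
  - by move=> y x _; rewrite nnfun_muleindic_ge0.
  apply: eq_fsbigr => k _.
  by rewrite integralZl_indic_nnsfun// integral_indic.
transitivity (\sum_(k \in range (f_ n))
    \int[mu]_(u in V) (k%:E * (\1_(f_ n @^-1` [set k]) (phi u) * r u)%:E)).
  apply: eq_fsbigr => k; rewrite inE => -[x _ <-]; rewrite nuE// ge0_integralZl//.
  - apply/measurable_EFinP; apply: measurable_funM => //.
    by apply: measurableT_comp mphi; exact: measurable_indic.
  - by move=> u Vu; rewrite lee_fin mulr_ge0// r0.
  - by rewrite lee_fin.
rewrite -ge0_integral_fsum//.
- apply: eq_integral => u _; rewrite -EFinM [in RHS]fimfunE.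
  rewrite fsumEFin//; congr EFin; rewrite mulr_fsuml//.
  by apply: eq_fsbigr => k _; rewrite mulrA.
- move=> k; apply/measurable_EFinP; apply: measurable_funM => //.
  apply: measurable_funM => //.
  by apply: measurableT_comp mphi; exact: measurable_indic.
- move=> k u Vu; rewrite lee_fin mulrA mulr_ge0 ?r0//.
  by rewrite -lee_fin EFinM nnfun_muleindic_ge0.
Qed.

End transport.

Section translation.
Context {R : realType}.
Local Open Scope ereal_scope.

Lemma lebesgue_measure_shift (h : R) (A : set R) : measurable A ->
  pushforward (@lebesgue_measure R) (fun x : measurableTypeR R => (x + h)%R : measurableTypeR R) A
  = lebesgue_measure A.
Proof.
move=> mA.
have mh : measurable_fun setT (fun x : measurableTypeR R => (x + h)%R : measurableTypeR R).
  by apply: measurable_funD.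
apply/esym/lebesgue_measure_unique => //= _ [[a b]] _ <-.
rewrite /pushforward.
have -> : (fun x : R => (x + h)%R) @^-1` `]a, b] = `](a - h)%R, (b - h)%R]%classic.
  by apply/seteqP; split=> x /=; rewrite !in_itv /= ltrBlDr lerBrDr.
by rewrite !lebesgue_measure_itv/= !lte_fin ltrD2r !EFinB; case: ifP => // _;
  rewrite -!EFinB opprB addrA subrK.
Qed.

Lemma integral_shift (h : R) (f : R -> \bar R) : measurable_fun setT f ->
  (forall x, 0 <= f x) ->
  \int[lebesgue_measure]_x f (x + h)%R = \int[lebesgue_measure]_x f x.
Proof.
move=> mf f0.
have mh : measurable_fun setT (fun x : measurableTypeR R => (x + h)%R : measurableTypeR R).
  by apply: measurable_funD.
transitivity (\int[pushforward (@lebesgue_measure R)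
   (fun x : measurableTypeR R => (x + h)%R : measurableTypeR R)]_x f x).
  by rewrite ge0_integral_pushforward// preimage_setT.
by apply: eq_measure_integral => A mA _; exact: lebesgue_measure_shift.
Qed.

Lemma measurable_cons_section n (F : borel_rV n.+1 -> \bar R) (x : R) :
  measurable_fun setT F ->
  measurable_fun setT (fun v : borel_rV n => F (row_mx (const_mx x : 'rV[R]_1) v)).
Proof.
move=> mF; have mFc := measurableT_comp mF (measurable_cons_rV (n := n)).
apply: (measurableT_comp mFc (g := fun v : borel_rV n => (x : measurableTypeR R, v))).
exact: pair1_measurable.
Qed.

Lemma measurable_lebesgue_rV_integral n (F : borel_rV n.+1 -> \bar R) :
  measurable_fun setT F -> (forall u, 0 <= F u) ->
  measurable_fun setT (fun x : measurableTypeR R => lebesgue_rV_integral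
    (fun v : 'rV[R]_n => F (row_mx (const_mx x : 'rV[R]_1) v))).
Proof.
move=> mF F0; have [mu [_ muI]] := lebesgue_rV_measure (R := R) n.
have mFc := measurableT_comp mF (measurable_cons_rV (n := n)).
have := @measurable_fun_fubini_tonelli_F _ _ (measurableTypeR R) (borel_rV n) R mu
  (F \o (@cons_rV R n)) mFc (fun z => F0 _).
apply: eq_measurable_fun => x _.
by rewrite -muI//; exact: measurable_cons_section.
Qed.

Lemma lebesgue_rV_integral_shift n (F : borel_rV n -> \bar R) (h : R) (a : 'I_n) :
  measurable_fun setT F -> (forall u, 0 <= F u) ->
  lebesgue_rV_integral (fun u : 'rV[R]_n => F (u + h *: delta_mx 0 a)%R) =
  lebesgue_rV_integral F.
Proof.
elim: n F a => [F []//|n IH F a mF F0].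
have [i ->|i ->] := @split_ordP 1 n a.
  rewrite /= -[RHS](integral_shift h); last 2 first.
  - exact: measurable_lebesgue_rV_integral.
  - move=> x; have [mu [_ muI]] := lebesgue_rV_measure (R := R) n.
    rewrite -muI//; first by apply: integral_ge0 => u _; exact: F0.
    exact: measurable_cons_section.
  apply: eq_integral => x _; congr lebesgue_rV_integral; apply/funext => v.
  congr F; apply/rowP => j; rewrite [LHS]mxE.
  have [k ->|k ->] := @split_ordP 1 n j.
    by rewrite !(@row_mxEl _ 1 1 n) !mxE (ord1 k) (ord1 i) !eqxx mulr1.
  rewrite !(@row_mxEr _ 1 1 n) !mxE eqxx /= -val_eqE /= (ord1 i) /=.
  by rewrite mulr0 addr0.
rewrite /=; apply: eq_integral => x _.
rewrite -[RHS](IH _ i)//; last exact: measurable_cons_section.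
congr lebesgue_rV_integral; apply/funext => v.
congr F; apply/rowP => j; rewrite [LHS]mxE.
have [k ->|k ->] := @split_ordP 1 n j.
  by rewrite !(@row_mxEl _ 1 1 n) !mxE eqxx -val_eqE /= (ord1 k) /= mulr0 addr0.
rewrite !(@row_mxEr _ 1 1 n) !mxE !eqxx -!val_eqE /= eqn_add2l; congr (_ + _ * _)%R.
Qed.

Definition lebesgue_rV n : {sigma_finite_measure set (borel_rV (R := R) n) -> \bar R} :=
  sval (cid (lebesgue_rV_measure n)).

Lemma lebesgue_rV_ball n (k : nat) :
  lebesgue_rV n [set u : 'rV[R]_n | (`|u| <= k%:R)%R] < +oo.
Proof. by rewrite /lebesgue_rV; case: cid => mu /= []. Qed.

Lemma lebesgue_rVE n (F : borel_rV n -> \bar R) : measurable_fun setT F ->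
  (forall u, 0 <= F u) -> \int[lebesgue_rV n]_u F u = lebesgue_rV_integral F.
Proof. by rewrite /lebesgue_rV; case: cid => mu /= [_]; apply. Qed.

Lemma measurable_shift_rV n (w : 'rV[R]_n) :
  measurable_fun setT (fun u : borel_rV n => (u + w)%R : borel_rV n).
Proof.
apply: (@measurability _ _ _ (borel_rV n) _ _ (@open 'rV[R]_n)) => //.
move=> _ [B oB <-]; rewrite setTI; apply: open_measurable_rV.
have cw : continuous (fun u : 'rV[R]_n => (u + w)%R).
  move=> u; apply: (@rV_continuous R n _ (fun v : 'rV[R]_n => (v + w)%R)) => b.
  have -> : (fun s : 'rV[R]_n => (s + w)%R 0%R b) = (fun s => s 0 b + w 0 b)%R.
    by apply/funext => s; rewrite mxE.
  apply: (@continuousD _ _ _ (fun s : 'rV[R]_n => s 0%R b) (fun=> w 0%R b)).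
    exact: coord_continuous.
  exact: cst_continuous.
exact: (open_comp (fun u _ => cw u) oB).
Qed.

(** This invariance is the source of integration by parts, in [integral_partial0]. *)
Lemma integral_rV_shift n (F : borel_rV n -> \bar R) (h : R) (a : 'I_n) :
  measurable_fun setT F ->
  \int[lebesgue_rV n]_u F (u + h *: delta_mx 0 a)%R = \int[lebesgue_rV n]_u F u.
Proof.
move=> mF.
have H (G : borel_rV n -> \bar R) : measurable_fun setT G -> (forall u, 0 <= G u) ->
    \int[lebesgue_rV n]_u G (u + h *: delta_mx 0 a)%R = \int[lebesgue_rV n]_u G u.
  move=> mG G0; rewrite !lebesgue_rVE//; first exact: lebesgue_rV_integral_shift.
  by apply: (measurableT_comp mG); exact: measurable_shift_rV.
have Hp := H _ (measurable_funepos mF) (funepos_ge0 F).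
have Hn := H _ (measurable_funeneg mF) (funeneg_ge0 F).
rewrite [LHS]integralE [RHS]integralE; congr (_ - _).
  rewrite -Hp.
  by apply: eq_integral => u _; rewrite !funeposE.
by rewrite -Hn; apply: eq_integral => u _; rewrite !funenegE.
Qed.

End translation.

(** * Manifolds and the Laplacian *)

Section flat.
Context {R : realType}.

(* x^-k e^{-1/x}, extended by 0; this family is closed under differentiation *)
Definition flat_pow (k : nat) (x : R) : R :=
  if 0 < x then x ^- k * expR (- x^-1) else 0.

Lemma flat_pow_ge0 k x : 0 <= flat_pow k x.
Proof. by rewrite /flat_pow; case: ifP => // x0; rewrite mulr_ge0 ?expR_ge0// invr_ge0 exprn_ge0// ltW. Qed.

Lemma flat_pow_le k (x : R) : `|flat_pow k x| <= k.+2%:R ^+ k.+2 * x ^+ 2.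
Proof.
rewrite ger0_norm ?flat_pow_ge0// /flat_pow; case: ifP => x0; last first.
  by rewrite mulr_ge0 ?sqr_ge0// exprn_ge0.
have m0 : 0 < k.+2%:R :> R by [].
have H : expR (- x^-1) <= (k.+2%:R * x) ^+ k.+2.
  rewrite expRN -[X in _ <= X]invrK lef_pV2 ?posrE ?expR_gt0 ?invr_gt0 ?exprn_gt0 ?mulr_gt0//.
  rewrite -exprVn invfM.
  have -> : x^-1 = k.+2%:R * (k.+2%:R^-1 * x^-1) by rewrite mulrA mulfV ?mul1r// gt_eqF.
  rewrite expRM_natl mulKf ?gt_eqF//.
  apply: lerXn2r; rewrite ?nnegrE ?expR_ge0 ?mulr_ge0 ?invr_ge0 ?ltW//.
  by apply: le_lt_trans (expR_gt1Dx _); rewrite ?lerDr// gt_eqF// mulr_gt0 ?invr_gt0.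
apply: le_trans (ler_wpM2l _ H) _; first by rewrite invr_ge0 exprn_ge0// ltW.
rewrite exprMn mulrCA ler_wpM2l ?exprn_ge0//.
by rewrite -[k.+2]addn2 exprD mulrA mulVf ?mul1r// expf_neq0// gt_eqF.
Qed.

Lemma is_derive_flat_pow k (x : R) :
  is_derive x 1 (flat_pow k) (- k%:R * flat_pow k.+1 x + flat_pow k.+2 x).
Proof.
have [x0|x0|->] := ltgtP x 0.
- have nx : \forall y \near x, flat_pow k y = 0.
    near=> y; rewrite /flat_pow ltNge ltW//.
    by near: y; apply: open_nbhs_nbhs; split; [exact: open_lt|].
  apply: (near_eq_is_derive (f := cst 0)); last first.
    rewrite /flat_pow ltNge ltW//= mulr0 addr0; exact: is_derive_cst.
  by apply: filterS nx => y ->.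
- pose F (y : R) := y^-1 ^+ k * expR (- y^-1).
  have xn0 : x != 0 by rewrite gt_eqF.
  apply: (near_eq_is_derive (f := F)).
    near=> y; rewrite /flat_pow /F exprVn.
    suff -> : 0 < y by [].
    by near: y; apply: open_nbhs_nbhs; split; [exact: open_gt|].
  have dV : is_derive x 1 (fun y : R => y^-1) (- (x^-1 * x^-1)).
    apply: DeriveDef; first exact: derivableV.
    by rewrite deriveV// derive_id /= expr2 invfM scaleNr [_ *: _]mulr1.
  have dN := is_deriveN dV.
  have de : is_derive x 1 (fun y : R => expR (- y^-1)) (expR (- x^-1) * - - (x^-1 * x^-1)).
    by apply: (is_derive1_comp (is_derive_expR _)).
  have dX := is_deriveX k dV.
  have EF : F = ([eta GRing.inv] ^+ k * (fun y : R => expR (- y^-1)) : R -> R).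
    by apply/funext => y; rewrite /F !fctE.
  rewrite EF; apply: (is_derive_eq (is_deriveM dX de)).
  rewrite !fctE /flat_pow x0 opprK /GRing.scale /=.
  case: k {F EF dX} => [|k]; first by rewrite expr0; field.
  by have -> : k.+1.-1 = k by []; rewrite -!exprVn !exprS; ring.
have C0 : 0 < k.+2%:R ^+ k.+2 :> R by rewrite exprn_gt0.
have f0 : flat_pow k 0 = 0 by rewrite /flat_pow ltxx.
have L : (fun h : R => h^-1 *: ((flat_pow k \o shift 0) (h *: 1) - flat_pow k 0)) @ 0^' --> (0 : R).
  apply/cvgrPdist_le => e e0; near=> h.
  rewrite /= addr0 [h%:A]mulr1 f0 subr0 sub0r normrN normrM normfV.
  have h0 : h != 0 by near: h; exact: nbhs_dnbhs_neq.
  rewrite ler_pdivrMl ?normr_gt0//; apply: le_trans (flat_pow_le _ _) _.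
  rewrite -real_normK ?num_real// expr2 mulrCA ler_wpM2l//.
  rewrite mulrC -ler_pdivlMr// ltW//.
  by near: h; apply: dnbhs0_lt; rewrite divr_gt0.
rewrite /flat_pow ltxx mulr0 addr0.
split; first by apply/cvg_ex; exists 0.
exact: cvg_lim L.
Unshelve. all: by end_near. Qed.

Lemma smooth_on_flat n (U : set 'rV[R]_n) f : open U -> smooth_on U f ->
  smooth_on U (fun u => flat_pow 0 (f u)).
Proof.
move=> oU /smooth_onP sf; apply/smooth_onP => m.
apply: (@Cn_comp_family R n m U f nat flat_pow setT
  (fun j x => - j%:R * flat_pow j.+1 x + flat_pow j.+2 x)) => //.
  by move=> j x _; exact: is_derive_flat_pow.
move=> m' j H Cf; apply: CnD => //; last exact: H.
by apply: CnM => //; [exact: Cn_cst|exact: H].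
Qed.

Definition smooth_step (x : R) := flat_pow 0 x / (flat_pow 0 x + flat_pow 0 (1 - x)).

Lemma flat_gt0 (x : R) : 0 < x -> 0 < flat_pow 0 x.
Proof. by move=> x0; rewrite /flat_pow x0 expr0 invr1 mul1r expR_gt0. Qed.

(** The numbers x and 1 - x are never both nonpositive. *)
Lemma smooth_step_den (x : R) : 0 < flat_pow 0 x + flat_pow 0 (1 - x).
Proof.
have [x0|x0] := ltP 0 x; first by rewrite ltr_pwDl ?flat_gt0 ?flat_pow_ge0.
by rewrite ltr_wpDl ?flat_pow_ge0// flat_gt0// subr_gt0 (le_lt_trans x0).
Qed.

Lemma smooth_step_ge0 x : 0 <= smooth_step x.
Proof. by rewrite divr_ge0 ?flat_pow_ge0// ltW// smooth_step_den. Qed.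

Lemma smooth_step1 x : 1 <= x -> smooth_step x = 1.
Proof.
move=> x1; rewrite /smooth_step [flat_pow 0 (1 - x)]/flat_pow ltNge subr_le0 x1 /=.
by rewrite addr0 divff// gt_eqF// flat_gt0// (lt_le_trans ltr01).
Qed.

Lemma smooth_step0 x : x <= 0 -> smooth_step x = 0.
Proof. by move=> x0; rewrite /smooth_step /flat_pow ltNge x0 /= mul0r. Qed.

Lemma smooth_on_step n (U : set 'rV[R]_n) f : open U -> smooth_on U f ->
  smooth_on U (fun u => smooth_step (f u)).
Proof.
move=> oU sf; have s1 := smooth_on_flat oU sf.
have s2 : smooth_on U (fun u => 1 - f u) by smooth.
have s3 := smooth_on_flat oU s2.
apply: (smooth_onM oU s1); apply: (smooth_onV oU); last by smooth.
by move=> u _; rewrite gt_eqF// smooth_step_den.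
Qed.

(** With x the rescaled coordinate, 2 - x^2 is at least 1 for |x| <= 1 and at most 0 for |x| >= 2:
    the bump is 1 on the cube of radius r and 0 outside that of radius 2r. Squaring instead of
    taking |x| keeps the argument smooth. *)
Definition bump_rV n (c : 'rV[R]_n) (r : R) (u : 'rV[R]_n) : R :=
  \prod_(a < n) smooth_step (2 - ((u 0 a - c 0 a) * r^-1) ^+ 2).

Lemma smooth_bump_rV n (c : 'rV[R]_n) (r : R) U : open U ->
  smooth_on U (bump_rV c r).
Proof.
move=> oU; apply: smooth_on_prod => // a; apply: (smooth_on_step oU).
have sc : smooth_on U (fun u : 'rV[R]_n => (u 0 a - c 0 a) * r^-1) by smooth.
have sc2 := smooth_onM oU sc sc.
by apply: (smooth_onB oU) sc2; smooth.
Qed.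

Lemma bump_rV_ge0 n (c : 'rV[R]_n) (r : R) u : 0 <= bump_rV c r u.
Proof. by apply: prodr_ge0 => a _; exact: smooth_step_ge0. Qed.

Lemma bump_rV1 n (c : 'rV[R]_n) (r : R) u : 0 < r -> `|u - c| <= r ->
  bump_rV c r u = 1.
Proof.
move=> r0 /(rV_norm_le _ (ltW r0)) H; apply: big1 => a _; apply: smooth_step1.
rewrite lerBrDr -lerBrDl -real_normK ?num_real// normrM normfV (gtr0_norm r0).
have -> : 2 - 1 = 1 :> R by lra.
rewrite expr_le1// ?divr_ge0// ?(ltW r0)// ler_pdivrMr// mul1r.
by have := H a; rewrite !mxE.
Qed.

Lemma bump_rV0 n (c : 'rV[R]_n) (r : R) u : 0 < r -> 2 * r < `|u - c| ->
  bump_rV c r u = 0.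
Proof.
move=> r0 H.
have [/existsP[a Ha]|] := boolP [exists a, 2 * r < `|u 0 a - c 0 a|].
  apply/eqP; rewrite /bump_rV (bigD1 a)//= smooth_step0 ?mul0r//.
  rewrite subr_le0 -real_normK ?num_real// normrM normfV (gtr0_norm r0).
  apply: (@le_trans _ _ (2 ^+ 2)); first by rewrite expr2; lra.
  by rewrite lerXn2r ?nnegrE ?divr_ge0 ?(ltW r0)// ler_pdivlMr// ltW.
rewrite negb_exists => /forallP Hn.
have : `|u - c| <= 2 * r.
  apply/rV_norm_le; first by rewrite mulr_ge0// ltW.
  by move=> a; rewrite !mxE leNgt; exact: Hn.
by rewrite leNgt H.
Qed.

End flat.

Section topology_lemmas.
Context {R : realType}.

Lemma preimage_open_on (S T : topologicalType) (V : set S) (W : set T) (f : S -> T) :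
  open V -> open W -> (forall x, V x -> {for x, continuous f}) ->
  open (V `&` f @^-1` W).
Proof.
move=> oV oW cf; rewrite openE => x [Vx Wfx].
apply: filterI; first exact: open_nbhs_nbhs.
by apply: (cf _ Vx); exact: open_nbhs_nbhs.
Qed.

Lemma continuous_on_measurable (T : ptopologicalType) (V : set T) (f : T -> R) :
  open V -> (forall x, V x -> {for x, continuous f}) ->
  measurable_fun (V : set (g_sigma_algebraType (@open T))) f.
Proof.
move=> oV cf; apply: (measurability _ (RGenOpens.measurableE R)).
move=> _ [_ [a [b ->]] <-]; apply: sub_sigma_algebra.
by apply: preimage_open_on => //; exact: interval_open.
Qed.

Lemma continuous_on_measurable_top (S T : ptopologicalType) (V : set S) (f : S -> T) :
  open V -> (forall x, V x -> {for x, continuous f}) ->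
  measurable_fun (V : set (g_sigma_algebraType (@open S)))
    (f : g_sigma_algebraType (@open S) -> g_sigma_algebraType (@open T)).
Proof.
move=> oV cf.
apply: (@measurability _ _ _ (g_sigma_algebraType (@open T)) _ _ (@open T)) => //.
move=> _ [B oB <-]; apply: sub_sigma_algebra.
exact: preimage_open_on.
Qed.

Lemma closed_ball_rV_compact n (c : 'rV[R]_n) (r : R) :
  compact [set u : 'rV[R]_n | `|u - c| <= r].
Proof.
apply: bounded_closed_compact.
  exists (r + `|c|); split; first exact: num_real.
  move=> x xr u /= ur; apply: le_trans (ltW xr).
  by rewrite -lerBlDr; apply: le_trans ur; exact: lerB_dist.
rewrite (_ : mkset _ = (fun u : 'rV[R]_n => `|u - c|) @^-1` [set x | x <= r])//.
apply: closed_comp; last exact: closed_le.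
move=> u _; apply: continuous_comp; last exact: norm_continuous.
apply: (@rV_continuous R n _ (fun v : 'rV[R]_n => v - c)) => b.
have -> : (fun s : 'rV[R]_n => (s - c) 0 b) = (fun s => s 0 b - c 0 b).
  by apply/funext => s; rewrite !mxE.
apply: (@continuousB _ _ _ (fun s : 'rV[R]_n => s 0 b) (fun=> c 0 b)).
  exact: coord_continuous.
exact: cst_continuous.
Qed.

Lemma compact_finite_cover (T : ptopologicalType) (A : set T) (V : T -> set T) :
  compact A -> (forall x, A x -> open (V x) /\ V x x) ->
  exists s : seq T, forall x, A x -> exists2 y, (y \in s) /\ A y & V y x.
Proof.
move=> cA HV; rewrite compact_cover in cA.
have [|s sA cov] := cA T A V (fun x Ax => (HV x Ax).1).
  by move=> x Ax; exists x => //; exact: (HV x Ax).2.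
exists (finmap.enum_fset s) => x /cov[y /= ys Vyx]; exists y => //; split => //.
by have := sA y ys; rewrite inE.
Qed.

End topology_lemmas.

(** * Charts, bumps and partitions of unity *)

Section manifold_charts.
Context {R : realType} {N : nat} (M : riemannianManifold R N).
Implicit Types (i j : chart_index M) (f : M -> R) (F : 'rV[R]_N -> R).

Lemma cod_open i : open (chart_cod i).
Proof. exact: chart_cod_open. Qed.
Arguments cod_open : clear implicits.

Lemma chart_inv_preimage_open i (W : set M) : open W ->
  open (chart_cod i `&` chart_inv i @^-1` W).
Proof.
move=> oW; apply: preimage_open_on => //; first exact: chart_cod_open.
by move=> u; exact: chart_inv_continuous.
Qed.

Lemma chart_preimage_open i (W : set 'rV[R]_N) : open W ->
  open (chart_dom i `&` chart i @^-1` W).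
Proof.
move=> oW; apply: preimage_open_on => //; first exact: chart_dom_open.
by move=> u; exact: chart_continuous.
Qed.

Definition chart_ext i F (x : M) : R :=
  if `[< chart_dom i x >] then F (chart i x) else 0.

Lemma chart_extE i F u : chart_cod i u -> chart_ext i F (chart_inv i u) = F u.
Proof.
move=> Uu; rewrite /chart_ext asboolT; last exact: chart_cod_dom.
by rewrite chart_invK.
Qed.

Definition in_ball (c : 'rV[R]_N) (r : R) : set 'rV[R]_N := [set u | `|u - c| <= r].

Lemma chart_ball_compact i c r : in_ball c r `<=` chart_cod i ->
  compact (chart_inv i @` in_ball c r).
Proof.
move=> sB; apply: continuous_compact; last exact: closed_ball_rV_compact.
apply: continuous_in_subspaceT => u; rewrite inE => /sB.
exact: chart_inv_continuous.
Qed.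

Lemma chart_ball_closed i c r : in_ball c r `<=` chart_cod i ->
  closed (chart_inv i @` in_ball c r).
Proof.
move=> sB; apply: compact_closed; last exact: chart_ball_compact.
exact: points_hausdorff.
Qed.

Lemma chart_ext0 i c r F x : (forall u, ~ in_ball c r u -> F u = 0) ->
  ~ (chart_inv i @` in_ball c r) x -> chart_ext i F x = 0.
Proof.
move=> F0 nx; rewrite /chart_ext; case: asboolP => // dx.
by apply: F0 => ux; apply: nx; exists (chart i x) => //; exact: chartK.
Qed.

(** Read in another chart j, the function is a composition with a transition map where chart i is
    defined, and zero off the compact set that carries F. Both regions are open, the second because
    compact sets of a Hausdorff space are closed. *)
Lemma chart_ext_smooth i c r F : in_ball c r `<=` chart_cod i ->
  smooth_on (chart_cod i) F -> (forall u, ~ in_ball c r u -> F u = 0) ->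
  smooth_function (chart_ext i F).
Proof.
move=> sB sF F0 j.
pose K := chart_inv i @` in_ball c r.
pose U1 := chart_cod j `&` chart_inv j @^-1` chart_dom i.
pose U2 := chart_cod j `&` chart_inv j @^-1` (~` K).
have oU1 : open U1 by apply: chart_inv_preimage_open; exact: chart_dom_open.
have oU2 : open U2.
  by apply: chart_inv_preimage_open; apply: closed_openC; exact: chart_ball_closed.
apply: (@smooth_on_sub _ _ (U1 `|` U2)).
  move=> u Uu; have [dx|ndx] := pselect (chart_dom i (chart_inv j u)); first by left.
  right; split => //= -[v vB vE]; apply: ndx; rewrite -vE.
  exact/chart_cod_dom/sB.
apply: smooth_onU.
  apply: (@smooth_on_ext _ _ _ (fun u => F (chart i (chart_inv j u))) _ oU1).
    by move=> u [Uu dx] /=; rewrite /chart_ext asboolT.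
  apply: (smooth_on_comp oU1 (cod_open i) sF).
    by move=> b; exact: transition_smooth.
  by move=> u [_ dx]; exact: chart_dom_cod.
apply: (@smooth_on_ext _ _ _ (fun=> 0) _ oU2); last exact: smooth_on_cst.
by move=> u [Uu nK] /=; rewrite (chart_ext0 F0).
Qed.

Definition chart_point (x : M) : 'rV[R]_N := chart (chart_at x) x.

Definition bump_radius (x : M) (r : R) : Prop :=
  0 < r /\ in_ball (chart_point x) (2 * r) `<=` chart_cod (chart_at x).

Lemma bump_radius_exists (x : M) (W : set 'rV[R]_N) : open W -> W (chart_point x) ->
  exists2 r, bump_radius x r & in_ball (chart_point x) (2 * r) `<=` W.
Proof.
move=> oW Wx; have Cx : chart_cod (chart_at x) (chart_point x).
  by apply: chart_dom_cod; exact: chart_atP.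
have oWC : open (W `&` chart_cod (chart_at x)) by apply: openI => //; exact: chart_cod_open.
have : nbhs (chart_point x) (W `&` chart_cod (chart_at x)) by exact: open_nbhs_nbhs.
move=> /nbhs_ballP[e /= e0 He]; have H u : in_ball (chart_point x) (2 * (e / 4)) u ->
    W u /\ chart_cod (chart_at x) u.
  move=> ux; apply: He; rewrite -ball_normE /= distrC; apply: le_lt_trans ux _.
  by have : 0 < e by []; lra.
exists (e / 4); last by move=> u /H[].
by split; [rewrite divr_gt0|move=> u /H[]].
Qed.

Definition chart_bump (x : M) (r : R) : M -> R :=
  chart_ext (chart_at x) (bump_rV (chart_point x) r).

Lemma bump_rV_out c r (u : 'rV[R]_N) : 0 < r -> ~ in_ball c (2 * r) u ->
  bump_rV c r u = 0.
Proof. by move=> r0 /negP; rewrite -ltNge; exact: bump_rV0. Qed.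

Lemma smooth_chart_bump x r : bump_radius x r -> smooth_function (chart_bump x r).
Proof.
move=> [r0 sB]; apply: (chart_ext_smooth sB); last by move=> u; exact: bump_rV_out.
by apply: smooth_bump_rV; exact: chart_cod_open.
Qed.

Lemma chart_bump_ge0 x r y : 0 <= chart_bump x r y.
Proof. by rewrite /chart_bump /chart_ext; case: asboolP => // _; exact: bump_rV_ge0. Qed.

Lemma chart_bump0 x r y : bump_radius x r ->
  ~ (chart_inv (chart_at x) @` in_ball (chart_point x) (2 * r)) y -> chart_bump x r y = 0.
Proof. by move=> [r0 _]; apply: chart_ext0 => u; exact: bump_rV_out. Qed.

Lemma chart_bump1 x r u : bump_radius x r -> in_ball (chart_point x) r u ->
  chart_bump x r (chart_inv (chart_at x) u) = 1.
Proof.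
move=> [r0 sB] ur; rewrite /chart_bump chart_extE ?bump_rV1//.
by apply: sB; apply: (le_trans ur); rewrite ler_peMl ?ltW// ltr1n.
Qed.

Definition chart_ball (x : M) (r : R) : set M :=
  chart_inv (chart_at x) @` in_ball (chart_point x) r.

Lemma chart_ball_nbhs x r : bump_radius x r ->
  exists2 V : set M, open V /\ V x & V `<=` chart_ball x r.
Proof.
move=> [r0 sB].
exists (chart_dom (chart_at x) `&` chart (chart_at x) @^-1` ball (chart_point x) r).
  split; first by apply: chart_preimage_open; exact: ball_open.
  by split; [exact: chart_atP|exact: ballxx].
move=> y [dy]; rewrite /= -ball_normE /= => yr.
exists (chart (chart_at x) y); last exact: chartK.
by rewrite /in_ball /= distrC ltW.
Qed.

Hypothesis M_closed : compact [set: M].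

Lemma chart_ball_cover (r : M -> R) : (forall x, bump_radius x (r x)) ->
  exists n (c : 'I_n -> M), forall x, exists k, chart_ball (c k) (r (c k)) x.
Proof.
move=> Hr; have [V HV] := choice (fun x => (exists2P _ _).1 (chart_ball_nbhs (Hr x))).
have [|s Hs] := compact_finite_cover (T := M) (V := V) M_closed.
  by move=> x _; have [] := HV x.
exists (size s), (fun k => nth point s k) => x.
have [y [ys _] Vyx] := Hs x I.
have ix : (index y s < size s)%N by rewrite index_mem.
by exists (Ordinal ix) => /=; rewrite nth_index//; apply: (HV y).2.
Qed.

Lemma smooth_functionV f : smooth_function f -> (forall x, f x != 0) ->
  smooth_function (fun x => (f x)^-1).
Proof.
by move=> sf f0 i; apply: (smooth_onV (cod_open i)) (sf i) => u _; exact: f0.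
Qed.

Lemma smooth_functionD f k : smooth_function f -> smooth_function k ->
  smooth_function (fun x => f x + k x).
Proof. by move=> sf sk i; exact: (smooth_onD (cod_open i) (sf i) (sk i)). Qed.

Lemma smooth_functionM f k : smooth_function f -> smooth_function k ->
  smooth_function (fun x => f x * k x).
Proof. by move=> sf sk i; exact: (smooth_onM (cod_open i) (sf i) (sk i)). Qed.

Lemma smooth_functionN f : smooth_function f -> smooth_function (fun x => - f x).
Proof. by move=> sf i; exact: (smooth_onN (cod_open i) (sf i)). Qed.

Lemma smooth_functionB f k : smooth_function f -> smooth_function k ->
  smooth_function (fun x => f x - k x).
Proof. by move=> sf sk i; exact: (smooth_onB (cod_open i) (sf i) (sk i)). Qed.

Lemma smooth_function_cst (a : R) : smooth_function (fun=> a : R) (M := M).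
Proof. by move=> i; exact: smooth_on_cst. Qed.

Lemma smooth_function_sum I (s : seq I) (F : I -> M -> R) :
  (forall k, smooth_function (F k)) -> smooth_function (fun x => \sum_(k <- s) F k x).
Proof.
move=> sF i.
exact: (@smooth_on_sum R N _ I s xpredT (fun k => F k \o chart_inv i) (cod_open i)
  (fun k => sF k i)).
Qed.

(** Bumps divided by their sum, which is positive because the smaller balls, where the bumps equal
    1, already cover. *)
Lemma partition_of_unity (r : M -> R) : (forall x, bump_radius x (r x)) ->
  exists n (c : 'I_n -> M) (chi : 'I_n -> M -> R),
  [/\ forall k, smooth_function (chi k), forall k x, 0 <= chi k x,
      forall k x, ~ chart_ball (c k) (2 * r (c k)) x -> chi k x = 0 &
      forall x, \sum_k chi k x = 1].
Proof.
move=> Hr; have [n [c Hc]] := chart_ball_cover Hr.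
pose b k := chart_bump (c k) (r (c k)).
pose S x := \sum_k b k x.
have S0 x : 0 < S x.
  have [k [u ur ux]] := Hc x; rewrite /S (bigD1 k)//= ltr_pwDl//.
    by rewrite /b -ux chart_bump1.
  by apply: sumr_ge0 => l _; exact: chart_bump_ge0.
have sb k : smooth_function (b k) by exact: smooth_chart_bump.
exists n, c, (fun k x => b k x * (S x)^-1); split.
- move=> k; apply: smooth_functionM; first exact: sb.
  apply: smooth_functionV; last by move=> x; rewrite gt_eqF.
  by apply: smooth_function_sum; exact: sb.
- by move=> k x; rewrite mulr_ge0 ?chart_bump_ge0// invr_ge0 ltW.
- by move=> k x nx; rewrite /b chart_bump0 ?mul0r.
- by move=> x; rewrite -mulr_suml -/(S x) divff// gt_eqF.
Qed.

End manifold_charts.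

Arguments cod_open {R N M} i.

(** * Invariance of the Laplacian under changes of chart *)

Section hessian_from_gamma.
Context {R : realType} {N : nat}.
Variables (g : 'rV[R]_N -> 'M[R]_N) (U : set 'rV[R]_N).
Hypothesis oU : open U.
Hypothesis sg : forall a b, smooth_on U (fun u => g u a b).
Hypothesis gT : forall u, U u -> (g u)^T = g u.
Hypothesis gpos : forall u (v : 'rV[R]_N), U u -> v != 0 ->
  0 < (v *m g u *m v^T) 0 0.

Lemma gamma_ext f f' k k' u : U u -> (forall w, U w -> f w = f' w) ->
  (forall w, U w -> k w = k' w) -> gamma_coord g f k u = gamma_coord g f' k' u.
Proof.
move=> Uu ef ek; apply: eq_bigr => a _; apply: eq_bigr => b _.
by rewrite (partial_ext a oU ef Uu) (partial_ext b oU ek Uu).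
Qed.

Lemma laplace_ext f f' u : U u -> (forall w, U w -> f w = f' w) ->
  laplace_coord g f u = laplace_coord g f' u.
Proof.
move=> Uu ef.
have H a : partial a (fun w => Num.sqrt (\det (g w)) *
      \sum_(b < N) invmx (g w) a b * partial b f w) u =
    partial a (fun w => Num.sqrt (\det (g w)) *
      \sum_(b < N) invmx (g w) a b * partial b f' w) u.
  apply: (partial_ext a oU _ Uu) => w Uw.
  by under eq_bigr => b _ do rewrite (partial_ext b oU ef Uw).
exact: (congr1 (fun z => (Num.sqrt (\det (g u)))^-1 * z) (eq_bigr _ (fun a _ => H a))).
Qed.

(* The Hessian is determined by the carre du champ alone, which is why it
   transforms correctly under a change of chart. *)
Lemma hess_gamma f k l u : smooth_on U f -> smooth_on U k -> smooth_on U l -> U u ->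
  gamma_coord g k (gamma_coord g f l) u + gamma_coord g l (gamma_coord g f k) u
  - gamma_coord g f (gamma_coord g k l) u =
  2 * \sum_a \sum_b grad_coord g k a u * grad_coord g l b u * hess_low g f a b u.
Proof.
move=> sf sk sl Uu.
pose T p r q := \sum_a \sum_b grad_coord g p a u * grad_coord g r b u * hess_low g q a b u.
have TC p r q : smooth_on U q -> T p r q = T r p q.
  move=> sq; rewrite /T exchange_big; apply: eq_bigr => a _; apply: eq_bigr => b _.
  by rewrite (hess_lowC oU gT b a sq Uu); ring.
have E p q r : smooth_on U p -> smooth_on U q -> smooth_on U r ->
    gamma_coord g p (gamma_coord g q r) u = T p r q + T p q r.
  move=> sp sq sr; rewrite (gamma_coordC gT _ _ Uu) gamma_gradl /T -big_split /=.
  apply: eq_bigr => a _.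
  rewrite (partial_gamma oU sg gT gpos a sq sr Uu) big_distrl -big_split /=.
  apply: eq_bigr => b _.
  by rewrite (hess_lowC oU gT b a sq Uu) (hess_lowC oU gT b a sr Uu); ring.
rewrite (E k f l) // (E l f k) // (E f k l) // -/(T k l f).
by rewrite (TC l k f sf) (TC l f k sk) (TC k f l sl); ring.
Qed.

Lemma laplace_hess_low f u : smooth_on U f -> U u ->
  laplace_coord g f u = \sum_a \sum_e invmx (g u) a e * hess_low g f a e u.
Proof.
move=> sf Uu; rewrite (laplace_trace oU sg gT gpos sf Uu); apply: eq_bigr => a _.
rewrite (hess_coordE oU sg gT gpos a a sf Uu); apply: eq_bigr => e _.
by rewrite (hess_lowC oU gT e a sf Uu).
Qed.

End hessian_from_gamma.

Section contractions.
Context {R : comPzRingType} {n : nat}.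

Lemma bilinear_mx (A : 'M[R]_n) (p q : 'I_n -> R) :
  \sum_a \sum_b A a b * p a * q b = ((\row_a p a) *m A *m (\row_a q a)^T) 0 0.
Proof.
rewrite mxE exchange_big; apply: eq_bigr => b _ /=.
rewrite !mxE big_distrl /=; apply: eq_bigr => a _; rewrite !mxE; ring.
Qed.

(** A bilinear form is evaluated on a frame X and contracted with G. In [laplace_pull] the frame
    consists of gradients of coordinates, so that Y is the inverse metric and the result is the
    Laplacian. *)
Lemma contract_mx (G : 'M[R]_n) (H X : 'I_n -> 'I_n -> R) (Y : 'M[R]_n) :
  (\matrix_(a, c) X c a) *m G *m (\matrix_(a, c) X c a)^T = Y ->
  \sum_c \sum_d G c d * (\sum_a \sum_b X c a * X d b * H a b) =
  \sum_a \sum_b Y a b * H a b.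
Proof.
move=> <-.
transitivity (\sum_c \sum_d \sum_a \sum_b X c a * G c d * X d b * H a b).
  apply: eq_bigr => c _; apply: eq_bigr => d _; rewrite mulr_sumr.
  apply: eq_bigr => a _; rewrite mulr_sumr; apply: eq_bigr => b _; ring.
rewrite exchange_big /=; under eq_bigr do rewrite exchange_big /=.
rewrite exchange_big /=; apply: eq_bigr => a _.
under eq_bigr do rewrite exchange_big /=.
rewrite exchange_big /=; apply: eq_bigr => b _.
rewrite mxE big_distrl /=; apply: eq_bigr => d _.
rewrite !mxE !big_distrl /=; apply: eq_bigr => c _; rewrite !mxE; ring.
Qed.

End contractions.

#[local] Transparent partial.
Lemma partialE (R : realType) n (a : 'I_n) (f : 'rV[R]_n -> R) u :
  partial a f u = 'D_(delta_mx 0 a) f u.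
Proof. by []. Qed.
#[local] Opaque partial.

Section isometry.
Context {R : realType} {N : nat}.
Variables (g1 g2 : 'rV[R]_N -> 'M[R]_N) (U V : set 'rV[R]_N).
Variables (Phi Psi : 'rV[R]_N -> 'rV[R]_N).
Hypotheses (oU : open U) (oV : open V).
Hypothesis sg1 : forall a b, smooth_on U (fun u => g1 u a b).
Hypothesis g1T : forall u, U u -> (g1 u)^T = g1 u.
Hypothesis g1pos : forall u (v : 'rV[R]_N), U u -> v != 0 ->
  0 < (v *m g1 u *m v^T) 0 0.
Hypothesis sg2 : forall a b, smooth_on V (fun u => g2 u a b).
Hypothesis g2T : forall u, V u -> (g2 u)^T = g2 u.
Hypothesis g2pos : forall u (v : 'rV[R]_N), V u -> v != 0 ->
  0 < (v *m g2 u *m v^T) 0 0.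
Hypothesis sPhi : forall b, smooth_on U (fun u => Phi u 0 b).
Hypothesis sPsi : forall b, smooth_on V (fun u => Psi u 0 b).
Hypothesis PhiV : forall u, U u -> V (Phi u).
Hypothesis PsiPhi : forall u, U u -> Psi (Phi u) = u.

Definition jacobian (F : 'rV[R]_N -> 'rV[R]_N) (u : 'rV[R]_N) : 'M[R]_N :=
  \matrix_(a, b) partial a (fun w => F w 0 b) u.

Hypothesis g1E : forall u, U u ->
  g1 u = jacobian Phi u *m g2 (Phi u) *m (jacobian Phi u)^T.
Hypothesis g2E : forall u, U u ->
  g2 (Phi u) = jacobian Psi (Phi u) *m g1 u *m (jacobian Psi (Phi u))^T.

Lemma partial_jacobian F a u : smooth_on V F -> U u ->
  partial a (F \o Phi) u = \sum_b jacobian Phi u a b * partial b F (Phi u).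
Proof.
move=> sF Uu.
have H := partial_comp a oU oV ((smooth_onP _ _).1 sF 1) (fun b => (smooth_onP _ _).1 (sPhi b) 1) PhiV Uu.
rewrite [LHS]partialE (@derive_val _ _ _ _ _ _ _ H); apply: eq_bigr => b _.
by rewrite mxE mulrC.
Qed.

Lemma smooth_pull F : smooth_on V F -> smooth_on U (F \o Phi).
Proof. by move=> sF; exact: smooth_on_comp oU oV sF sPhi PhiV. Qed.

Lemma inv_metric_pull u : U u ->
  invmx (g2 (Phi u)) = (jacobian Phi u)^T *m invmx (g1 u) *m jacobian Phi u.
Proof.
move=> Uu; set J := jacobian Phi u.
have u1 : g1 u \in unitmx := metric_unit g1T g1pos Uu.
have u2 : g2 (Phi u) \in unitmx := metric_unit g2T g2pos (PhiV Uu).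
have /andP[/andP[Ju _] _] : (J \in unitmx) && (g2 (Phi u) \in unitmx) && (J^T \in unitmx).
  by rewrite -!unitmx_mul -g1E.
have JTu : J^T \in unitmx by rewrite unitmx_tr.
rewrite -[RHS](mulmxK u2) -[LHS]mul1mx; congr (_ *m _).
rewrite -!mulmxA -[J *m _](mulmxK JTu) -g1E// !mulmxA mulmxKV//.
by rewrite mulmxV.
Qed.

Lemma gamma_pull F K u : smooth_on V F -> smooth_on V K -> U u ->
  gamma_coord g1 (F \o Phi) (K \o Phi) u = gamma_coord g2 F K (Phi u).
Proof.
move=> sF sK Uu; rewrite /gamma_coord !bilinear_mx (inv_metric_pull Uu).
have E H : smooth_on V H -> \row_a partial a (H \o Phi) u =
    (\row_b partial b H (Phi u)) *m (jacobian Phi u)^T.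
  move=> sH; apply/rowP => a; rewrite !mxE partial_jacobian//.
  by apply: eq_bigr => b _; rewrite !mxE mulrC.
by rewrite (E F sF) (E K sK) trmx_mul trmxK !mulmxA.
Qed.

(** The Laplacian is recovered from the numbers Hess f (grad x^c, grad x^d), and [hess_gamma]
    expresses these through the carre du champ, which transforms by the first-order chain rule.
    Second derivatives of the transition map never appear. *)
Lemma laplace_pull F u : smooth_on V F -> U u ->
  laplace_coord g1 (F \o Phi) u = laplace_coord g2 F (Phi u).
Proof.
move=> sF Uu.
(* The same functions on both sides: the coordinates of the first chart, read as the components of
   Psi in the second. *)
pose x c (w : 'rV[R]_N) := w 0 c.
pose y c w := Psi w 0 c.
have sx c : smooth_on U (x c) by exact: smooth_on_coord.
have sy c : smooth_on V (y c) by exact: sPsi.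
have sFP := smooth_pull sF.
have xy c w : U w -> x c w = (y c \o Phi) w by move=> Uw; rewrite /= /y PsiPhi.
have sG F' K' : smooth_on V F' -> smooth_on V K' -> smooth_on V (gamma_coord g2 F' K').
  by move=> s1 s2; exact: (smooth_gamma oV sg2 g2T g2pos s1 s2).
have E c d : 2 * (\sum_a \sum_b grad_coord g1 (x c) a u * grad_coord g1 (x d) b u
       * hess_low g1 (F \o Phi) a b u) =
    2 * (\sum_a \sum_b grad_coord g2 (y c) a (Phi u) * grad_coord g2 (y d) b (Phi u)
       * hess_low g2 F a b (Phi u)).
  rewrite -(hess_gamma oU sg1 g1T g1pos sFP (sx c) (sx d) Uu).
  rewrite -(hess_gamma oV sg2 g2T g2pos sF (sy c) (sy d) (PhiV Uu)).
  have P3 (K L : 'rV[R]_N -> R) c' c'' : smooth_on U K -> smooth_on V L ->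
      (forall w, U w -> K w = (L \o Phi) w) ->
      gamma_coord g1 K (gamma_coord g1 (x c') (x c'')) u = gamma_coord g2 L (gamma_coord g2 (y c') (y c'')) (Phi u).
    move=> _ sL KL; rewrite -(gamma_pull sL (sG _ _ (sy c') (sy c'')) Uu).
    apply: (gamma_ext g1 oU Uu KL) => w Uw; rewrite /= -(gamma_pull (sy c') (sy c'') Uw).
    by apply: (gamma_ext g1 oU Uw) => v; exact: xy.
  have P2 c' c'' :
      gamma_coord g1 (x c') (gamma_coord g1 (F \o Phi) (x c'')) u = gamma_coord g2 (y c') (gamma_coord g2 F (y c'')) (Phi u).
    rewrite -(gamma_pull (sy c') (sG _ _ sF (sy c'')) Uu).
    apply: (gamma_ext g1 oU Uu) => w Uw; first exact: xy.
    rewrite /= -(gamma_pull sF (sy c'') Uw).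
    by apply: (gamma_ext g1 oU Uw) => v Uv //; exact: xy.
  by rewrite !P2 (P3 (F \o Phi) F c d).
have two0 : 2 != 0 :> R by rewrite pnatr_eq0.
have {}E c d := mulfI two0 (E c d).
rewrite (laplace_hess_low oU sg1 g1T g1pos sFP Uu).
rewrite (laplace_hess_low oV sg2 g2T g2pos sF (PhiV Uu)).
have gx c a : grad_coord g1 (x c) a u = invmx (g1 u) a c.
  rewrite /grad_coord; under eq_bigr do rewrite partial_coord.
  rewrite (bigD1 c)//= eqxx mulr1 big1 ?addr0// => b /negbTE bc.
  by rewrite bc mulr0.
have u1 := metric_unit g1T g1pos Uu.
have u2 := metric_unit g2T g2pos (PhiV Uu).
have h1T : (invmx (g1 u))^T = invmx (g1 u) by rewrite trmx_inv g1T.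
have h2T : (invmx (g2 (Phi u)))^T = invmx (g2 (Phi u)) by rewrite trmx_inv g2T//; exact: PhiV.
rewrite -(@contract_mx _ _ (g1 u) (fun a b => hess_low g1 (F \o Phi) a b u)
   (fun c a => grad_coord g1 (x c) a u) (invmx (g1 u))); last first.
  have -> : \matrix_(a, c) grad_coord g1 (x c) a u = invmx (g1 u).
    by apply/matrixP => a c; rewrite mxE gx.
  by rewrite mulVmx// mul1mx.
rewrite -(@contract_mx _ _ (g1 u) (fun a b => hess_low g2 F a b (Phi u))
   (fun c a => grad_coord g2 (y c) a (Phi u)) (invmx (g2 (Phi u)))); last first.
  have -> : \matrix_(a, c) grad_coord g2 (y c) a (Phi u) =
      invmx (g2 (Phi u)) *m jacobian Psi (Phi u).
    by apply/matrixP => a c; rewrite !mxE; apply: eq_bigr => e _; rewrite mxE.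
  rewrite trmx_mul h2T -!mulmxA.
  have -> A : jacobian Psi (Phi u) *m (g1 u *m ((jacobian Psi (Phi u))^T *m A)) =
      g2 (Phi u) *m A by rewrite (g2E Uu) !mulmxA.
  by rewrite mulmxV ?mulmx1.
apply: eq_bigr => c _; apply: eq_bigr => d _; congr (_ * _).
exact: E.
Qed.

End isometry.

HB.lock Definition laplacian (R : realType) (N : nat) (M : riemannianManifold R N)
  (f : M -> R) (x : M) : R := laplace_beltrami f x.

(** The carre du champ, defined from the Laplacian so that it is free of charts and smooth by
    construction; [gamE] identifies it with the inner product of gradients. *)
HB.lock Definition gam (R : realType) (N : nat) (M : riemannianManifold R N)
    (f k : M -> R) (x : M) : R :=
  2^-1 * (laplacian (fun y => f y * k y) x - f x * laplacian k x - k x * laplacian f x).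

Section laplace_beltrami.
Context {R : realType} {N : nat} (M : riemannianManifold R N).
Implicit Types (i j : chart_index M) (f k : M -> R) (x : M).

Lemma chart_metric_smooth i a b : smooth_on (chart_cod i) (fun u => metric i u a b).
Proof. exact: metric_smooth. Qed.

Lemma chart_metricT i u : chart_cod i u -> (metric i u)^T = metric i u.
Proof. exact: metric_symmetric. Qed.

Lemma chart_metric_gt0 i u (v : 'rV[R]_N) : chart_cod i u -> v != 0 ->
  0 < (v *m metric i u *m v^T) 0 0.
Proof. exact: metric_pos. Qed.

Lemma laplace_chart i j f u : smooth_function f -> chart_cod i u ->
  chart_dom j (chart_inv i u) ->
  laplace_coord (metric i) (f \o chart_inv i) u =
  laplace_coord (metric j) (f \o chart_inv j) (chart j (chart_inv i u)).
Proof.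
move=> sf Uu du.
pose U := chart_cod i `&` chart_inv i @^-1` chart_dom j.
pose V := chart_cod j `&` chart_inv j @^-1` chart_dom i.
have oU : open U by apply: chart_inv_preimage_open; exact: chart_dom_open.
have oV : open V by apply: chart_inv_preimage_open; exact: chart_dom_open.
pose Phi w := chart j (chart_inv i w); pose Psi w := chart i (chart_inv j w).
have PhiV w : U w -> V (Phi w).
  move=> [Uw dw]; split; first exact: chart_dom_cod.
  by rewrite /= /Phi chartK//; exact: chart_cod_dom.
have PsiPhi w : U w -> Psi (Phi w) = w.
  by move=> [Uw dw]; rewrite /Psi /Phi chartK// chart_invK.
have invPhi w : U w -> chart_inv j (Phi w) = chart_inv i w.
  by move=> [Uw dw]; rewrite /Phi chartK.
have UU : U `<=` chart_cod i by move=> w [].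
have VV : V `<=` chart_cod j by move=> w [].
have E : laplace_coord (metric i) ((f \o chart_inv j) \o Phi) u =
    laplace_coord (metric j) (f \o chart_inv j) (Phi u).
  apply: (@laplace_pull R N (metric i) (metric j) U V Phi Psi oU oV) => //.
  - by move=> a b; apply: (smooth_on_sub UU); exact: chart_metric_smooth.
  - by move=> w [Uw _]; exact: chart_metricT.
  - by move=> w v [Uw _]; exact: chart_metric_gt0.
  - by move=> a b; apply: (smooth_on_sub VV); exact: chart_metric_smooth.
  - by move=> w [Uw _]; exact: chart_metricT.
  - by move=> w v [Uw _]; exact: chart_metric_gt0.
  - by move=> b; exact: transition_smooth.
  - by move=> b; exact: transition_smooth.
  - by move=> w [Uw dw]; exact: metric_transition.
  - move=> w Uw; have [Vw dw] := PhiV _ Uw.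
    by rewrite (metric_transition Vw dw) -/(Psi _) PsiPhi.
  - exact: smooth_on_sub VV (sf j).
apply: etrans E; apply: (laplace_ext (metric i) oU (conj Uu du)) => w Uw.
by rewrite /= invPhi.
Qed.

Local Notation lap := laplacian.

Lemma lapE i f u : smooth_function f -> chart_cod i u ->
  lap f (chart_inv i u) = laplace_coord (metric i) (f \o chart_inv i) u.
Proof.
move=> sf Uu; rewrite laplacian.unlock /laplace_beltrami -(laplace_chart sf Uu)//.
exact: chart_atP.
Qed.

Lemma smooth_laplace_coord i F : smooth_on (chart_cod i) F ->
  smooth_on (chart_cod i) (laplace_coord (metric i) F).
Proof.
move=> sF; have oU := cod_open i.
have sr := smooth_density oU (@chart_metric_smooth i) (@chart_metricT i) (@chart_metric_gt0 i).
have rp := density_gt0 (@chart_metricT i) (@chart_metric_gt0 i).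
have sh := smooth_inv_metric oU (@chart_metric_smooth i) (@chart_metricT i) (@chart_metric_gt0 i).
rewrite /laplace_coord; apply: (smooth_onM oU).
  by apply: (smooth_onV oU) sr => u Uu; rewrite gt_eqF// rp.
eapply smooth_on_sum; [exact oU|intros a]; apply: smooth_on_partial; apply: (smooth_onM oU sr).
eapply smooth_on_sum; [exact oU|intros b]; apply: (smooth_onM oU (sh a b)).
exact: smooth_on_partial.
Qed.

Lemma smooth_lap f : smooth_function f -> smooth_function (lap f).
Proof.
move=> sf i; apply: (@smooth_on_ext _ _ _ (laplace_coord (metric i) (f \o chart_inv i)) _ (cod_open i)).
  by move=> u Uu; rewrite /= (lapE sf Uu).
exact: smooth_laplace_coord.
Qed.

End laplace_beltrami.

Local Notation lap := laplacian.

(** * Product and chain rules, and the curvature-dimension inequality *)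

Section chart_calculus.
Context {R : realType} {N : nat}.
Variables (g : 'rV[R]_N -> 'M[R]_N) (U : set 'rV[R]_N).
Hypothesis oU : open U.
Hypothesis sg : forall a b, smooth_on U (fun u => g u a b).
Hypothesis gT : forall u, U u -> (g u)^T = g u.
Hypothesis gpos : forall u (v : 'rV[R]_N), U u -> v != 0 ->
  0 < (v *m g u *m v^T) 0 0.

Let sgrad := smooth_grad oU sg gT gpos.

Let sum_leibniz (x y : R) (A B P C D : 'I_N -> R) :
  \sum_i (x * A i + y * B i + P i) + \sum_i (x * C i + y * D i) =
  x * (\sum_i A i + \sum_i C i) + y * (\sum_i B i + \sum_i D i) + \sum_i P i.
Proof.
rewrite !big_split /= -!mulr_sumr.
by move: (\sum_i A i) (\sum_i B i) (\sum_i P i) (\sum_i C i) (\sum_i D i) => *; ring.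
Qed.

Lemma gamma_coordM f k l u : smooth_on U f -> smooth_on U k -> U u ->
  gamma_coord g (fun w => f w * k w) l u =
  f u * gamma_coord g k l u + k u * gamma_coord g f l u.
Proof.
move=> sf sk Uu; rewrite !gamma_gradl !big_distrr -big_split /=.
by apply: eq_bigr => a _; rewrite (partialM a sf sk Uu); ring.
Qed.

Lemma grad_coordM f k b w : smooth_on U f -> smooth_on U k -> U w ->
  grad_coord g (fun w => f w * k w) b w = f w * grad_coord g k b w + k w * grad_coord g f b w.
Proof.
move=> sf sk Uw; rewrite /grad_coord !big_distrr -big_split /=; apply: eq_bigr => c _.
by rewrite (partialM c sf sk Uw); ring.
Qed.

Lemma grad_coordD f k b w : smooth_on U f -> smooth_on U k -> U w ->
  grad_coord g (fun w => f w + k w) b w = grad_coord g f b w + grad_coord g k b w.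
Proof.
move=> sf sk Uw; rewrite /grad_coord -big_split /=; apply: eq_bigr => c _.
by rewrite (partialD c sf sk Uw); ring.
Qed.

Lemma grad_coord_cst (c : R) b : grad_coord g (fun=> c) b = fun=> 0.
Proof. by apply/funext => w; rewrite /grad_coord big1// => d _; rewrite partial_cst mulr0. Qed.

#[local] Opaque grad_coord gamma_coord christoffel laplace_coord.

Lemma laplace_coordM f k u : smooth_on U f -> smooth_on U k -> U u ->
  laplace_coord g (fun w => f w * k w) u =
  f u * laplace_coord g k u + k u * laplace_coord g f u + 2 * gamma_coord g f k u.
Proof.
move=> sf sk Uu; have sfk := smooth_onM oU sf sk.
rewrite (laplace_div oU sg gT gpos sf Uu) (laplace_div oU sg gT gpos sk Uu).
apply: etrans (laplace_div oU sg gT gpos sfk Uu) _.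
have D a : partial a (grad_coord g (fun w => f w * k w) a) u =
    f u * partial a (grad_coord g k a) u + k u * partial a (grad_coord g f a) u
    + (partial a f u * grad_coord g k a u + partial a k u * grad_coord g f a u).
  apply: etrans (partial_ext a oU (fun w => grad_coordM a sf sk (w := w)) Uu) _.
  apply: etrans (partialD a (smooth_onM oU sf (sgrad a sk)) (smooth_onM oU sk (sgrad a sf)) Uu) _.
  apply: etrans (congr2 +%R (partialM a sf (sgrad a sk) Uu) (partialM a sk (sgrad a sf) Uu)) _.
  move: (partial a f u) (partial a k u) (partial a _ u) (partial a _ u) => *; ring.
have C a c : christoffel g a a c u * grad_coord g (fun w => f w * k w) c u =
    f u * (christoffel g a a c u * grad_coord g k c u) +
    k u * (christoffel g a a c u * grad_coord g f c u).
  by rewrite (grad_coordM c sf sk Uu); ring.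
apply: etrans (congr2 +%R (eq_bigr _ (fun a _ => D a))
  (eq_bigr _ (fun a _ => eq_bigr _ (fun c _ => C a c)))) _.
under [X in _ + X]eq_bigr do rewrite big_split /= -!big_distrr /=.
apply: etrans (sum_leibniz _ _ _ _ _ _ _) _; congr (_ + _).
apply: etrans (big_split _ _ _ _ _) _.
apply: etrans (congr2 +%R (esym (gamma_gradl g f k u)) (esym (gamma_gradl g k f u))) _.
by rewrite (gamma_coordC gT k f Uu) mulrDl mul1r.
Qed.

Lemma laplace_coordD f k u : smooth_on U f -> smooth_on U k -> U u ->
  laplace_coord g (fun w => f w + k w) u = laplace_coord g f u + laplace_coord g k u.
Proof.
move=> sf sk Uu; have sfk := smooth_onD oU sf sk.
rewrite (laplace_div oU sg gT gpos sf Uu) (laplace_div oU sg gT gpos sk Uu).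
apply: etrans (laplace_div oU sg gT gpos sfk Uu) _.
have D a : partial a (grad_coord g (fun w => f w + k w) a) u =
    partial a (grad_coord g f a) u + partial a (grad_coord g k a) u.
  apply: etrans (partial_ext a oU (fun w => grad_coordD a sf sk (w := w)) Uu) _.
  exact: (partialD a (sgrad a sf) (sgrad a sk) Uu).
have D2 a c : christoffel g a a c u * grad_coord g (fun w => f w + k w) c u =
    christoffel g a a c u * grad_coord g f c u + christoffel g a a c u * grad_coord g k c u.
  by rewrite (grad_coordD c sf sk Uu) mulrDr.
apply: etrans (congr2 +%R (eq_bigr _ (fun a _ => D a))
  (eq_bigr _ (fun a _ => eq_bigr _ (fun c _ => D2 a c)))) _.
under [X in _ + X]eq_bigr do rewrite big_split /=.
by rewrite !big_split; exact: addrACA.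
Qed.

(** The case of use is h = ln f with k = 1/f, in [lap_ln]. *)
Lemma laplace_coord_scaled h f k u : smooth_on U h -> smooth_on U f -> smooth_on U k ->
  (forall a w, U w -> grad_coord g h a w = k w * grad_coord g f a w) -> U u ->
  laplace_coord g h u = k u * laplace_coord g f u + gamma_coord g k f u.
Proof.
move=> sh sf sk G Uu; rewrite (laplace_div oU sg gT gpos sf Uu).
apply: etrans (laplace_div oU sg gT gpos sh Uu) _.
have D a : partial a (grad_coord g h a) u =
    k u * partial a (grad_coord g f a) u + 0 * 0 + partial a k u * grad_coord g f a u.
  apply: etrans (partial_ext a oU (G a) Uu) _.
  apply: etrans (partialM a sk (sgrad a sf) Uu) _.
  by rewrite mul0r addr0 addrC.
have C a : \sum_c christoffel g a a c u * grad_coord g h c u =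
    k u * (\sum_c christoffel g a a c u * grad_coord g f c u) + 0 * 0.
  rewrite mul0r addr0 mulr_sumr; apply: eq_bigr => c _; rewrite (G c u Uu).
  exact: mulrCA.
apply: etrans (congr2 +%R (eq_bigr _ (fun a _ => D a)) (eq_bigr _ (fun a _ => C a))) _.
apply: etrans (sum_leibniz _ _ _ _ _ _ _) _.
by rewrite mul0r addr0; congr (_ + _); exact: (esym (gamma_gradl g k f u)).
Qed.

Lemma laplace_coord_cst (c : R) u : U u -> laplace_coord g (fun=> c) u = 0.
Proof.
move=> Uu; rewrite (laplace_div oU sg gT gpos (smooth_on_cst c) Uu).
rewrite big1 ?add0r; last by move=> a _; rewrite grad_coord_cst partial_cst.
by rewrite big1// => a _; rewrite big1// => d _; rewrite grad_coord_cst mulr0.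
Qed.

(** The squared norm of Hess f + lambda g is nonnegative and expands with the terms 2 lambda Lap f +
    N lambda^2. With lambda left free the bound is affine in Lap f, so it can be integrated before
    lambda is chosen. *)
Lemma gamma2_ge (lambda : R) f u : smooth_on U f -> U u ->
  ricci_form g (fun e => grad_coord g f e u) (fun e => grad_coord g f e u) u <=
  2^-1 * laplace_coord g (gamma_coord g f f) u - gamma_coord g f (laplace_coord g f) u
  + 2 * lambda * laplace_coord g f u + N%:R * lambda ^+ 2.
Proof.
move=> sf Uu; rewrite (bochner oU sg gT gpos sf sf Uu).
rewrite (laplace_trace oU sg gT gpos sf Uu).
pose S := \sum_a \sum_c hess_coord g f a c u * hess_coord g f c a u.
rewrite -/S; set T := \sum_a _; set Q := ricci_form _ _ _ _; set G := gamma_coord _ _ _ _.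
suff : 0 <= S + 2 * lambda * T + N%:R * lambda ^+ 2 by lra.
pose H := (\matrix_(a, b) hess_low g f a b u) + lambda *: g u.
have HT : H^T = H.
  apply/matrixP => a b; rewrite !mxE (metricC gT b a Uu).
  by rewrite (hess_lowC oU gT b a sf Uu).
have gd : \det (g u) != 0 by rewrite gt_eqF// (det_metric_gt0 gT gpos Uu).
have [h1T h1pos] := spd_inv (gT Uu) gd (fun v => gpos Uu (v := v)).
apply: le_trans (trace_spd_sym_ge0 h1T HT h1pos) _; apply: eq_ler.
have -> : invmx (g u) *m H = (\matrix_(a, b) hess_coord g f a b u) + lambda%:M.
  rewrite mulmxDr -scalemxAr mulVmx ?(metric_unit gT gpos Uu)// scalemx1; congr (_ + _).
  apply/matrixP => a b; rewrite !mxE (hess_coordE oU sg gT gpos a b sf Uu).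
  by apply: eq_bigr => c _; rewrite mxE.
set X := \matrix_(a, b) _.
rewrite mulmxDl !mulmxDr !mxtraceD.
rewrite !mul_mx_scalar !mul_scalar_mx !mxtraceZ mxtrace_scalar.
have -> : \tr (X *m X) = S.
  by apply: eq_bigr => a _; rewrite mxE; apply: eq_bigr => c _; rewrite !mxE.
have -> : \tr X = T by apply: eq_bigr => a _; rewrite mxE.
rewrite -mulr_natl; ring.
Qed.

End chart_calculus.

(** * Quadratic forms on covectors *)

Section covectors.
Context {R : realType} {N : nat}.
Variables (g : 'rV[R]_N -> 'M[R]_N) (U : set 'rV[R]_N).
Hypothesis oU : open U.
Hypothesis sg : forall a b, smooth_on U (fun u => g u a b).
Hypothesis gT : forall u, U u -> (g u)^T = g u.
Hypothesis gpos : forall u (v : 'rV[R]_N), U u -> v != 0 ->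
  0 < (v *m g u *m v^T) 0 0.
Implicit Types (p q : 'I_N -> R).

Definition cometric (u : 'rV[R]_N) p q : R := \sum_a \sum_b invmx (g u) a b * p a * q b.

(** The Ricci tensor with both indices raised, to be paired with differentials of functions. *)
Definition ricci_up (a b : 'I_N) (u : 'rV[R]_N) : R :=
  \sum_c \sum_d invmx (g u) a c * ricci_coord g c d u * invmx (g u) d b.

Lemma ricci_formE p q u : U u ->
  ricci_form g (fun e => \sum_b invmx (g u) e b * p b) (fun e => \sum_b invmx (g u) e b * q b) u =
  \sum_a \sum_b ricci_up a b u * p a * q b.
Proof.
move=> Uu; rewrite /ricci_form /ricci_up.
transitivity (\sum_e \sum_c \sum_a \sum_b invmx (g u) a e * ricci_coord g e c u * invmx (g u) c b * p a * q b).
  apply: eq_bigr => e _; apply: eq_bigr => c _.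
  rewrite -mulrA big_distrlr /= mulr_sumr; apply: eq_bigr => a _.
  rewrite mulr_sumr; apply: eq_bigr => b _.
  by rewrite (inv_metricC gT e a Uu); ring.
under eq_bigr do rewrite exchange_big /=.
rewrite exchange_big /=; apply: eq_bigr => a _.
under eq_bigr do rewrite exchange_big /=.
rewrite exchange_big /=; apply: eq_bigr => b _.
rewrite !mulr_suml; apply: eq_bigr => e _; rewrite !mulr_suml; apply: eq_bigr => c _.
by [].
Qed.

Lemma ricci_up_trace u : U u -> \sum_a \sum_b ricci_up a b u * g u a b = scalar_coord g u.
Proof.
move=> Uu; rewrite /ricci_up /scalar_coord.
transitivity (\sum_a \sum_b \sum_c \sum_d
    (ricci_coord g c d u * invmx (g u) a c) * (invmx (g u) d b * g u b a)).
  apply: eq_bigr => a _; apply: eq_bigr => b _; rewrite mulr_suml.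
  apply: eq_bigr => c _; rewrite mulr_suml; apply: eq_bigr => d _.
  by rewrite (metricC gT b a Uu); ring.
under eq_bigr do rewrite exchange_big /=.
rewrite exchange_big /=; apply: eq_bigr => c _.
under eq_bigr do rewrite exchange_big /=.
rewrite exchange_big /=; apply: eq_bigr => d _.
under eq_bigr do rewrite -mulr_sumr (inv_metricE gT gpos _ _ Uu).
rewrite -[RHS](sum_kron (fun a => invmx (g u) c d * ricci_coord g c d u) d).
apply: eq_bigr => a _; have [->|] := eqVneq d a; last by rewrite mulr0 mul0r.
by rewrite (inv_metricC gT a c Uu); ring.
Qed.

Lemma cometric_ge0 p u : U u -> 0 <= cometric u p p.
Proof.
move=> Uu; rewrite /cometric bilinear_mx.
have gd : \det (g u) != 0 by rewrite gt_eqF// (det_metric_gt0 gT gpos Uu).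
have [h1T h1pos] := spd_inv (gT Uu) gd (fun v => gpos Uu (v := v)).
have [->|v0] := eqVneq (\row_a p a) 0; first by rewrite !mul0mx mxE.
exact/ltW/h1pos.
Qed.

(** The nonnegative norm of p - kappa w is expanded, where w is the covector dual to v. In the
    Harnack inequality this trades a directional derivative for a squared gradient. *)
Lemma cometric_young p (v : 'rV[R]_N) (kappa : R) u : U u -> 0 < kappa ->
  2 * \sum_a v 0 a * p a <= kappa^-1 * cometric u p p + kappa * (v *m g u *m v^T) 0 0.
Proof.
move=> Uu k0.
pose w e := \sum_d g u e d * v 0 d.
have := cometric_ge0 (fun e => p e - kappa * w e) Uu.
have B p' q' : cometric u p' q' = \sum_a p' a * \sum_b invmx (g u) a b * q' b.
  apply: eq_bigr => a _; rewrite mulr_sumr; apply: eq_bigr => b _; ring.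
have W a : \sum_b invmx (g u) a b * w b = v 0 a by rewrite (raise_lower gT gpos).
have E : cometric u (fun e => p e - kappa * w e) (fun e => p e - kappa * w e) =
    cometric u p p - 2 * kappa * (\sum_a v 0 a * p a) + kappa ^+ 2 * (v *m g u *m v^T) 0 0.
  have C q : cometric u p q = cometric u q p.
    rewrite /cometric exchange_big; apply: eq_bigr => a _; apply: eq_bigr => b _.
    by rewrite (inv_metricC gT b a Uu); ring.
  have -> : (v *m g u *m v^T) 0 0 = cometric u w w.
    rewrite B; under eq_bigr do rewrite W.
    rewrite mxE; apply: eq_bigr => a _; rewrite !mxE /w; congr (_ * _).
    by apply: eq_bigr => b _; rewrite (metricC gT b a Uu) mulrC.
  have -> : \sum_a v 0 a * p a = cometric u p w.
    by rewrite B; apply: eq_bigr => a _; rewrite W mulrC.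
  transitivity (cometric u p p - kappa * cometric u p w - kappa * cometric u w p + kappa ^+ 2 * cometric u w w).
    clearbody w; rewrite /cometric !mulr_sumr -!sumrB -big_split; apply: eq_bigr => a _ /=.
    rewrite !mulr_sumr -!sumrB -big_split; apply: eq_bigr => b _ /=.
    by ring.
  by rewrite (C w); ring.
rewrite E => H; rewrite -(ler_pM2l k0) mulrDr [kappa * (kappa^-1 * _)]mulrA mulfV ?gt_eqF// mul1r.
by move: H; set X := cometric _ _ _; set Y := \sum_a _; set Z := _ 0 0; lra.
Qed.

(** Young's inequality along the basis vector e_a, with the optimal parameter p_a / g_aa once p_a
    may be taken nonnegative. *)
Lemma coord_cometric_le p a u : U u -> p a ^+ 2 <= g u a a * cometric u p p.
Proof.
move=> Uu.
have ga : 0 < g u a a.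
  have := gpos Uu (v := delta_mx 0 a); rewrite -rowE !mxE (bigD1 a)//= big1; last first.
    by move=> b ba; rewrite !mxE eqxx (negbTE ba) mulr0.
  rewrite !mxE !eqxx mulr1 addr0; apply; apply/eqP => /matrixP/(_ 0 a).
  by rewrite !mxE !eqxx => /eqP; rewrite oner_eq0.
have H' q k : 0 < k -> 2 * q a * k <= cometric u q q + k ^+ 2 * g u a a.
  move=> k0; have := cometric_young q (delta_mx 0 a) Uu k0.
  have -> : \sum_b (delta_mx 0 a : 'rV[R]_N) 0 b * q b = q a.
    rewrite (bigD1 a)//= big1 ?addr0; first by rewrite mxE !eqxx mul1r.
    by move=> b ba; rewrite mxE (negbTE ba) andbF mul0r.
  rewrite -rowE [_ 0 0]mxE (bigD1 a)//= big1 ?addr0; last first.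
    by move=> b ba; rewrite !mxE (negbTE ba) andbF mulr0.
  rewrite !mxE !eqxx mulr1 => {}H.
  have := ler_wpM2l (ltW k0) H; rewrite mulrDr [k * (k^-1 * _)]mulrA mulfV ?gt_eqF// mul1r.
  by move=> H''; apply: le_trans (le_trans H'' _); apply: eq_ler; ring.
have c0 := cometric_ge0 p Uu; have H := H' p.
wlog : p H c0 / 0 <= p a.
  move=> W; have [/W|/ltW pa] := leP 0 (p a); first exact.
  have E : cometric u (fun b => - p b) (fun b => - p b) = cometric u p p.
    by apply: eq_bigr => b _; apply: eq_bigr => d _; ring.
  have := W (fun b => - p b); rewrite E sqrrN; apply => //; last by rewrite oppr_ge0.
  by move=> kk; rewrite -E; exact: H'.
rewrite le_eqVlt => /predU1P[<-|pa]; first by rewrite expr0n mulr_ge0// ltW.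
have := H _ (divr_gt0 pa ga).
have -> : 2 * p a * (p a / g u a a) = 2 * (p a ^+ 2 / g u a a) by ring.
have -> : (p a / g u a a) ^+ 2 * g u a a = p a ^+ 2 / g u a a.
  by field; rewrite gt_eqF.
move=> {}H; rewrite mulrC -ler_pdivrMr//; lra.
Qed.

End covectors.

#[local] Transparent grad_coord gamma_coord christoffel laplace_coord.

#[local] Opaque gamma_coord christoffel laplace_coord ricci_form.

(** * Diffusion calculus on the manifold *)

Section diffusion.
Context {R : realType} {N : nat} (M : riemannianManifold R N).
Implicit Types (i j : chart_index M) (f k l : M -> R) (x : M).

Lemma chart_pointP x : exists i u, chart_cod i u /\ chart_inv i u = x.
Proof.
exists (chart_at x), (chart_point x); have dx := chart_atP x; split.
  exact: chart_dom_cod.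
exact: chartK.
Qed.

Let sg i a b := @chart_metric_smooth R N M i a b.
Let gT i u := @chart_metricT R N M i u.
Let gp i u := @chart_metric_gt0 R N M i u.

Lemma gamE i f k u : smooth_function f -> smooth_function k -> chart_cod i u ->
  gam f k (chart_inv i u) = gamma_coord (metric i) (f \o chart_inv i) (k \o chart_inv i) u.
Proof.
move=> sf sk Uu; rewrite gam.unlock (lapE (smooth_functionM sf sk) Uu) (lapE sf Uu) (lapE sk Uu).
have -> : laplace_coord (metric i) ((fun y => f y * k y) \o chart_inv i) u = _ :=
  laplace_coordM (cod_open i) (@sg i) (@gT i) (@gp i) (sf i) (sk i) Uu.
rewrite /=; move: (laplace_coord _ _ _) (laplace_coord _ _ _) (gamma_coord _ _ _ _) => *.
by field.
Qed.

Lemma smooth_gam f k : smooth_function f -> smooth_function k -> smooth_function (gam f k).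
Proof.
move=> sf sk; rewrite gam.unlock; apply: smooth_functionM; first exact: smooth_function_cst.
exact: smooth_functionB (smooth_functionB (smooth_lap (smooth_functionM sf sk))
  (smooth_functionM sf (smooth_lap sk))) (smooth_functionM sk (smooth_lap sf)).
Qed.

Lemma gamC f k x : gam f k x = gam k f x.
Proof.
rewrite gam.unlock (_ : (fun y => f y * k y) = fun y => k y * f y); first by ring.
by apply/funext => y; rewrite mulrC.
Qed.

Lemma lapM f k x : smooth_function f -> smooth_function k ->
  lap (fun y => f y * k y) x = f x * lap k x + k x * lap f x + 2 * gam f k x.
Proof. by move=> _ _; rewrite gam.unlock; field. Qed.

Lemma lapD f k x : smooth_function f -> smooth_function k ->
  lap (fun y => f y + k y) x = lap f x + lap k x.
Proof.
move=> sf sk; have [i [u [Uu <-]]] := chart_pointP x.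
rewrite (lapE (smooth_functionD sf sk) Uu) (lapE sf Uu) (lapE sk Uu).
exact: (laplace_coordD (cod_open i) (@sg i) (@gT i) (@gp i) (sf i) (sk i) Uu).
Qed.

Lemma lap_cst (a : R) x : lap (fun=> a) x = 0.
Proof.
have [i [u [Uu <-]]] := chart_pointP x; rewrite (lapE (smooth_function_cst a) Uu).
exact: (laplace_coord_cst (cod_open i) (@sg i) (@gT i) (@gp i) _ Uu).
Qed.

Lemma gamM f k l x : smooth_function f -> smooth_function k -> smooth_function l ->
  gam (fun y => f y * k y) l x = f x * gam k l x + k x * gam f l x.
Proof.
move=> sf sk sl; have [i [u [Uu <-]]] := chart_pointP x.
rewrite (gamE (smooth_functionM sf sk) sl Uu) (gamE sf sl Uu) (gamE sk sl Uu).
exact: (gamma_coordM (metric i) (l \o chart_inv i) (sf i) (sk i) Uu).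
Qed.

Lemma gam_cst (a : R) f x : smooth_function f -> gam (fun=> a) f x = 0.
Proof.
move=> sf; have [i [u [Uu <-]]] := chart_pointP x.
rewrite (gamE (smooth_function_cst a) sf Uu).
rewrite gamma_gradl big1// => b _.
by rewrite (_ : _ \o _ = fun=> a)// partial_cst mul0r.
Qed.

Lemma gamD f k l x : smooth_function f -> smooth_function k -> smooth_function l ->
  gam (fun y => f y + k y) l x = gam f l x + gam k l x.
Proof.
move=> sf sk sl; rewrite gam.unlock.
rewrite (_ : (fun y => (f y + k y) * l y) = fun y => f y * l y + k y * l y); last first.
  by apply/funext => y; rewrite mulrDl.
rewrite (lapD x sf sk) (lapD x (smooth_functionM sf sl) (smooth_functionM sk sl)); ring.
Qed.

Lemma gam_ge0 f x : smooth_function f -> 0 <= gam f f x.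
Proof.
move=> sf; have [i [u [Uu <-]]] := chart_pointP x; rewrite (gamE sf sf Uu).
exact: (cometric_ge0 (@gT i) (@gp i) (fun a => partial a (f \o chart_inv i) u) Uu).
Qed.

Lemma smooth_function_ln f : smooth_function f -> (forall x, 0 < f x) ->
  smooth_function (fun x => ln (f x)).
Proof. by move=> sf f0 i; apply: (smooth_on_ln (cod_open i)) (sf i) => u _; exact: f0. Qed.

Lemma gam_ln f k x : smooth_function f -> smooth_function k -> (forall y, 0 < f y) ->
  gam (fun y => ln (f y)) k x = gam f k x / f x.
Proof.
move=> sf sk f0; have [i [u [Uu <-]]] := chart_pointP x.
rewrite (gamE (smooth_function_ln sf f0) sk Uu) (gamE sf sk Uu) !gamma_gradl mulr_suml.
apply: eq_bigr => a _.
rewrite (partial_comp1 (phi := @ln R) a (sf i) Uu (is_derive1_ln (f0 _))) /=; ring.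
Qed.

Lemma gam_inv f x : smooth_function f -> (forall y, 0 < f y) ->
  gam (fun y => (f y)^-1) f x = - gam f f x / f x ^+ 2.
Proof.
move=> sf f0; have fn0 y : f y != 0 by rewrite gt_eqF.
have sV := smooth_functionV sf fn0.
have := gamM x sf sV sf.
rewrite (_ : (fun y => f y * (f y)^-1) = fun=> 1); last by apply/funext => y; rewrite mulfV.
rewrite (gam_cst _ _ sf) => /esym/eqP; rewrite addr_eq0 => /eqP H.
apply: (mulfI (fn0 x)); rewrite H; field; exact: fn0.
Qed.

Lemma lap_ln f x : smooth_function f -> (forall y, 0 < f y) ->
  lap (fun y => ln (f y)) x = lap f x / f x - gam f f x / f x ^+ 2.
Proof.
move=> sf f0; have fn0 y : f y != 0 by rewrite gt_eqF.
have sV := smooth_functionV sf fn0; have sl := smooth_function_ln sf f0.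
rewrite -mulNr -(gam_inv x sf f0).
have [i [u [Uu <-]]] := chart_pointP x.
rewrite (lapE sl Uu) (lapE sf Uu) (gamE sV sf Uu) mulrC.
apply: (laplace_coord_scaled (cod_open i) (@sg i) (@gT i) (@gp i) (sl i) (sf i) (sV i) _ Uu).
move=> a w Uw; rewrite /grad_coord mulr_sumr; apply: eq_bigr => b _.
rewrite (partial_comp1 (phi := @ln R) b (sf i) Uw (is_derive1_ln (f0 _))) /=; ring.
Qed.

Lemma curvature_dimension i f u (lambda : R) : smooth_function f -> chart_cod i u ->
  \sum_a \sum_b ricci_up (metric i) a b u * partial a (f \o chart_inv i) u
     * partial b (f \o chart_inv i) u <=
  2^-1 * lap (gam f f) (chart_inv i u) - gam f (lap f) (chart_inv i u)
  + 2 * lambda * lap f (chart_inv i u) + N%:R * lambda ^+ 2.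
Proof.
move=> sf Uu; have sG := smooth_gam sf sf; have sL := smooth_lap sf.
rewrite (lapE sf Uu) (lapE sG Uu) (gamE sf sL Uu).
rewrite -(ricci_formE (@gT i) _ _ Uu).
have := gamma2_ge (cod_open i) (@sg i) (@gT i) (@gp i) lambda (sf i) Uu.
rewrite /grad_coord => /le_trans; apply; apply: eq_ler.
have E1 : laplace_coord (metric i) (gamma_coord (metric i) (f \o chart_inv i) (f \o chart_inv i)) u =
    laplace_coord (metric i) (gam f f \o chart_inv i) u.
  by apply: (laplace_ext (metric i) (cod_open i) Uu) => w Uw /=; rewrite (gamE sf sf Uw).
have E2 : gamma_coord (metric i) (f \o chart_inv i) (laplace_coord (metric i) (f \o chart_inv i)) u =
    gamma_coord (metric i) (f \o chart_inv i) (lap f \o chart_inv i) u.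
  exact: (gamma_ext (metric i) (cod_open i) Uu (fun w _ => erefl)
    (fun w Uw => esym (lapE sf Uw))).
by rewrite E1 E2.
Qed.

End diffusion.

#[local] Transparent gamma_coord christoffel laplace_coord ricci_form.

(** * Integration and Green's formula *)

Section bounded_measurable.
Context {R : realType} d (T : measurableType d) (mu : {measure set T -> \bar R}).
Hypothesis mu_fin : (mu setT < +oo)%E.
Implicit Types (f g : T -> R).

(** Over a finite measure these functions are integrable and stable under sums and products. The
    class suits integrands on a closed manifold and keeps integrability out of the arguments. *)
Definition bounded_measurable f : Prop :=
  measurable_fun setT f /\ exists C : R, forall x, `|f x| <= C.

Local Notation bm := bounded_measurable.
Local Notation Int f := (\int[mu]_(x in setT) f x).

Lemma bm_integrable f : bm f -> mu.-integrable setT (EFin \o f).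
Proof.
move=> [mf [C HC]]; apply: measurable_bounded_integrable => //.
by exists C; split; [exact: num_real|move=> y Cy x _ /=; exact: le_trans (ltW Cy)].
Qed.

Lemma bm_cst (c : R) : bm (fun=> c).
Proof. by split; [exact: measurable_cst|exists `|c|]. Qed.

Lemma bmD f g : bm f -> bm g -> bm (fun x => f x + g x).
Proof.
move=> [mf [C HC]] [mg [D HD]]; split; first exact: measurable_funD.
by exists (C + D) => x; apply: le_trans (ler_normD _ _) (lerD _ _).
Qed.

Lemma bmN f : bm f -> bm (fun x => - f x).
Proof.
move=> [mf [C HC]]; split; last by exists C => x; rewrite normrN.
by apply: measurableT_comp mf; exact: oppr_measurable.
Qed.

Lemma bmB f g : bm f -> bm g -> bm (fun x => f x - g x).
Proof. by move=> bf /bmN bg; exact: bmD. Qed.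

Lemma bmM f g : bm f -> bm g -> bm (fun x => f x * g x).
Proof.
move=> [mf [C HC]] [mg [D HD]]; split; first exact: measurable_funM.
by exists (C * D) => x; rewrite normrM ler_pM.
Qed.

Lemma bmZ (a : R) f : bm f -> bm (fun x => a * f x).
Proof. by move=> bf; apply: bmM bf; exact: bm_cst. Qed.

Lemma bm_sum I (s : seq I) (F : I -> T -> R) : (forall k, bm (F k)) ->
  bm (fun x => \sum_(k <- s) F k x).
Proof.
move=> bF; elim: s => [|k s IH].
  rewrite (_ : (fun x => _) = fun=> 0); first exact: bm_cst.
  by apply/funext => x; rewrite big_nil.
rewrite (_ : (fun x => _) = fun x => F k x + \sum_(k <- s) F k x); first exact: bmD.
by apply/funext => x; rewrite big_cons.
Qed.

Lemma IntD f g : bm f -> bm g -> Int (fun x => f x + g x) = Int f + Int g.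
Proof. by move=> bf bg; rewrite RintegralD//; exact: bm_integrable. Qed.

Lemma IntB f g : bm f -> bm g -> Int (fun x => f x - g x) = Int f - Int g.
Proof. by move=> bf bg; rewrite RintegralB//; exact: bm_integrable. Qed.

Lemma IntZ (a : R) f : bm f -> Int (fun x => a * f x) = a * Int f.
Proof. by move=> bf; rewrite RintegralZl//; exact: bm_integrable. Qed.

Lemma IntN f : bm f -> Int (fun x => - f x) = - Int f.
Proof.
by move=> bf; rewrite -[RHS]mulN1r -IntZ//; apply: eq_Rintegral => x _; rewrite mulN1r.
Qed.

Lemma Int0 : Int (fun=> 0) = 0 :> R.
Proof. by rewrite Rintegral_cst// mul0r. Qed.

Lemma Int_sum I (s : seq I) (F : I -> T -> R) : (forall k, bm (F k)) ->
  Int (fun x => \sum_(k <- s) F k x) = \sum_(k <- s) Int (F k).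
Proof.
move=> bF; elim: s => [|k s IH].
  by rewrite big_nil; under eq_Rintegral do rewrite big_nil; exact: Int0.
by rewrite big_cons -IH -IntD//; [apply: eq_Rintegral => x _; rewrite big_cons|exact: bm_sum].
Qed.

Lemma le_Int f g : bm f -> bm g -> (forall x, f x <= g x) -> Int f <= Int g.
Proof. by move=> bf bg fg; apply: le_Rintegral => //; exact: bm_integrable. Qed.

Lemma Int_ge0 f : (forall x, 0 <= f x) -> 0 <= Int f.
Proof. by move=> f0; apply: Rintegral_ge0. Qed.

Lemma Int_norm_le f g : bm f -> bm g -> (forall x, `|f x| <= g x) -> `|Int f| <= Int g.
Proof.
move=> bf bg fg; apply: le_trans (le_normr_Rintegral measurableT (bm_integrable bf)) _.
apply: le_Int => //; split; last by have [_ [C HC]] := bf; exists C => x; rewrite normr_id.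
by apply: measurableT_comp bf.1; exact: normr_measurable.
Qed.

Lemma Int_cst (c : R) : Int (fun=> c) = c * fine (mu setT).
Proof. exact: Rintegral_cst. Qed.

Lemma bounded_cvg (F : nat -> T -> R) f (C : R) : (forall n, measurable_fun setT (F n)) ->
  (forall n x, `|F n x| <= C) -> (forall x, F n x @[n --> \oo] --> f x) ->
  bm f /\ Int (F n) @[n --> \oo] --> Int f.
Proof.
move=> mF FC Ff.
have mf : measurable_fun setT f by apply: (measurable_fun_cvg mF) => x _; exact: Ff.
have fC x : `|f x| <= C.
  have cn : `|F n x| @[n --> \oo] --> `|f x|.
    exact: (cvg_norm (Ff x)).
  rewrite -(cvg_lim (@Rhausdorff R) cn); apply: limr_le; first by apply/cvg_ex; exists `|f x|.
  by apply: nearW => n; exact: FC.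
have bf : bm f by split=> //; exists C.
split => //.
have bF n : bm (F n) by split=> //; exists C.
have [|||||_ _ H] := @dominated_convergence _ _ _ mu setT measurableT
  (fun n => EFin \o F n) (EFin \o f) (EFin \o cst C).
- by move=> n; exact/measurable_EFinP.
- exact/measurable_EFinP.
- by apply: aeW => x _; apply: cvg_EFin; [exact: nearW|exact: Ff].
- by apply: bm_integrable; exact: bm_cst.
- by apply: aeW => x n _ /=; rewrite lee_fin.
have E : (\int[mu]_(x in setT) (EFin \o f) x)%E = (Int f)%:E.
  by rewrite /Rintegral fineK//; exact: (integrable_fin_num measurableT (bm_integrable bf)).
by move: H; rewrite E => /fine_cvg.
Qed.

(** A form of Fatou's lemma in which a bounded minorant g is integrated in place of the limit f.
    Truncating F n at g gives a sequence bounded on both sides that converges to g. *)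
Lemma lower_fatou (F : nat -> T -> R) f g (C : R) (u : nat -> R) (a : R) :
  (forall n, bm (F n)) -> bm g -> (forall n x, - C <= F n x) ->
  (forall x, F n x @[n --> \oo] --> f x) -> (forall x, g x <= f x) ->
  (forall n, Int (F n) <= u n) -> u n @[n --> \oo] --> a -> Int g <= a.
Proof.
move=> bF [mg [D HD]] FC Ff gf Fu ua.
pose G n x := Num.min (F n x) (g x).
have mG n : measurable_fun setT (G n) by have [mF _] := bF n; exact: measurable_minr.
have GB n x : `|G n x| <= `|C| + D.
  have D0 : 0 <= D by exact: le_trans (HD x).
  have CD : `|C| <= `|C| + D by rewrite lerDl.
  have gD : `|g x| <= `|C| + D by apply: le_trans (HD x) _; rewrite lerDr.
  rewrite ler_norml le_min ge_min -andbA; apply/and3P; split.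
  - by apply: le_trans (FC n x); rewrite lerN2 (le_trans (ler_norm _)).
  - by rewrite lerNl (le_trans _ gD)// -normrN ler_norm.
  - by rewrite (le_trans (ler_norm _) gD) orbT.
have [x|_ GI] := @bounded_cvg G g (`|C| + D) mG GB.
  apply/cvgrPdist_le => e e0; move/cvgrPdist_le: (Ff x) => /(_ e e0).
  apply: filterS => n; apply: le_trans; rewrite /G.
  case: (leP (F n x) (g x)) => [Fg|_]; last by rewrite subrr normr0.
  rewrite !ger0_norm ?subr_ge0 ?(le_trans Fg)//; exact: lerB.
have bG n : bm (G n) by split; [exact: mG|exists (`|C| + D); exact: GB].
apply: (ler_cvg_to GI ua); apply: nearW => n; apply: le_trans (Fu n).
by apply: (le_Int (bG n) (bF n)) => x; rewrite /G ge_min lexx.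
Qed.

Lemma derive_Int (a b : R) (G G' : R -> T -> R) (C : R) (t : R) :
  a < t -> t < b -> (forall r, a < r < b -> bm (G r)) ->
  (forall r x, a < r < b -> is_derive r 1 (G^~ x) (G' r x)) ->
  (forall r x, a < r < b -> `|G' r x| <= C) ->
  is_derive t 1 (fun r => Int (G r)) (Int (G' t)).
Proof.
move=> at_ tb bG dG GC.
have It : (`]a, b[%classic : set R) t by rewrite /= in_itv /= at_ tb.
have II r : (`]a, b[%classic : set R) r -> a < r < b by rewrite /= in_itv.
have i1 r : (`]a, b[%classic : set R) r -> mu.-integrable setT (EFin \o G r).
  by move=> /II /bG; exact: bm_integrable.
have i2 r x : (`]a, b[%classic : set R) r -> [set: T] x -> derivable (G^~ x) r 1.
  by move=> /II abr _; exact: (@ex_derive _ _ _ _ _ _ _ (dG r x abr)).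
have C0 : 0 <= C by apply: le_trans (GC t point _) => //; rewrite at_ tb.
have i3 : mu.-integrable setT (EFin \o (fun=> C)) by apply: bm_integrable; exact: bm_cst.
have i4 r x : (`]a, b[%classic : set R) r -> [set: T] x -> `|partial1of2 G r x| <= C.
  move=> /II abr _; rewrite partial1of2E (@derive_val _ _ _ _ _ _ _ (dG r x abr)).
  exact: GC.
split; first exact: (@derivable_under_integral _ _ _ mu G setT measurableT t a b It i1 i2
   (fun=> C) (fun=> C0) i3 i4).
rewrite -derive1E.
rewrite (@differentiation_under_integral _ _ _ mu G setT measurableT t a b It i1 i2
   (fun=> C) (fun=> C0) i3 i4).
apply: eq_Rintegral => x _; rewrite partial1of2E.
by rewrite (@derive_val _ _ _ _ _ _ _ (dG t x _)) ?at_.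
Qed.

Lemma continuous_Int (a b : R) (G : R -> T -> R) (C : R) :
  (forall r, a < r < b -> bm (G r)) ->
  (forall r x, a < r < b -> {for r, continuous (G^~ x)}) ->
  (forall r x, a < r < b -> `|G r x| <= C) ->
  forall t, a < t < b -> {for t, continuous (fun r => Int (G r))}.
Proof.
move=> bG cG GC t atb.
have II r : (`]a, b[%classic : set R) r -> a < r < b by rewrite /= in_itv.
have i1 r : (`]a, b[%classic : set R) r -> mu.-integrable setT (EFin \o G r).
  by move=> /II /bG; exact: bm_integrable.
have i3 : mu.-integrable setT (EFin \o (fun=> C)) by apply: bm_integrable; exact: bm_cst.
have := @continuity_under_integral _ _ _ mu G setT measurableT a b i1 _ (fun=> C) i3 _ t.
apply.
- by apply: aeW => x _ r; rewrite inE => /II; exact: cG.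
- by move=> r /II abr; apply: aeW => x _; exact: GC.
- by rewrite inE /= in_itv.
Qed.

Lemma Int_fubini (F : T -> T -> R) (C : R) :
  measurable_fun setT (fun z : T * T => F z.1 z.2) -> (forall x y, `|F x y| <= C) ->
  [/\ bm (fun x => Int (F x)), bm (fun y => Int (F^~ y)) &
    Int (fun x => Int (F x)) = Int (fun y => Int (F^~ y))].
Proof.
move=> mF FC.
have muF : fin_num_fun mu by apply: lty_fin_num_fun.
have muS : sigma_finite setT mu.
  by apply: fin_num_fun_sigma_finite; [rewrite measure0|exact: muF].
pose H1 := isFinite.Build _ _ _ _ muF.
pose H2 := isSFinite.Build _ _ _ _ (sfinite_measure_sigma_finite muS).
pose H3 := isSigmaFinite.Build _ _ _ _ muS.
pose mu' := HB.pack_for (FiniteMeasure.type T R) (Measure.sort mu) H1 H2 H3.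
(* Adding C makes the integrand nonnegative, so that Tonelli's theorem applies. *)
pose G x y := F x y + C.
have mG : measurable_fun setT (fun z : T * T => G z.1 z.2).
  by apply: measurable_funD => //; exact: measurable_cst.
have G0 x y : 0 <= G x y.
  by have := FC x y; rewrite /G ler_norml => /andP[H _]; rewrite -lerBlDr sub0r.
have GC x y : `|G x y| <= C + C.
  by apply: le_trans (ler_normD _ _) (lerD (FC x y) _); rewrite ger0_norm// (le_trans _ (FC x y)).
have b1 x : bm (G x).
  split; last by exists (C + C).
  exact: (measurableT_comp mG (pair1_measurable x)).
have b2 y : bm (G^~ y).
  split; last by exists (C + C).
  exact: (measurableT_comp mG (pair2_measurable y)).
have E1 x : (Int (G x))%:E = (\int[mu']_(y in setT) (G x y)%:E)%E.
  by rewrite /Rintegral fineK//; exact: (integrable_fin_num measurableT (bm_integrable (b1 x))).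
have E2 y : (Int (G^~ y))%:E = (\int[mu']_(x in setT) (G x y)%:E)%E.
  by rewrite /Rintegral fineK//; exact: (integrable_fin_num measurableT (bm_integrable (b2 y))).
have mGe : measurable_fun setT (fun z : T * T => (G z.1 z.2)%:E) by exact/measurable_EFinP.
have Ge0 (z : T * T) : (0 <= (G z.1 z.2)%:E)%E by rewrite lee_fin.
have F1 := @measurable_fun_fubini_tonelli_F _ _ _ _ _ mu' _ mGe Ge0.
have F2 := @measurable_fun_fubini_tonelli_G _ _ _ _ _ mu' _ mGe Ge0.
have F3 := @fubini_tonelli _ _ _ _ _ mu' mu' _ mGe Ge0.
have bC : bm (fun=> C) := bm_cst C.
have bd (H : T -> R) : bm H -> (forall x, `|H x| <= C + C) -> `|Int H| <= (C + C) * fine (mu setT).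
  by move=> bH HC; rewrite -Int_cst; apply: Int_norm_le => //; exact: bm_cst.
have m1 : bm (fun x => Int (G x)).
  split; last by exists ((C + C) * fine (mu setT)) => x; apply: bd.
  by apply/measurable_EFinP; rewrite (_ : _ \o _ = (fun x => \int[mu']_(y in setT) (G x y)%:E)%E)//;
    apply/funext => x; rewrite /= E1.
have m2 : bm (fun y => Int (G^~ y)).
  split; last by exists ((C + C) * fine (mu setT)) => y; apply: bd.
  by apply/measurable_EFinP; rewrite (_ : _ \o _ = (fun y => \int[mu']_(x in setT) (G x y)%:E)%E)//;
    apply/funext => y; rewrite /= E2.
have bF1 x : bm (F x).
  split; last by exists C.
  exact: (measurableT_comp mF (pair1_measurable x)).
have bF2 y : bm (F^~ y).
  split; last by exists C.
  exact: (measurableT_comp mF (pair2_measurable y)).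
have e1 : (fun x => Int (F x)) = fun x => Int (G x) - Int (fun=> C).
  by apply/funext => x; rewrite -IntB//; apply: eq_Rintegral => y _; rewrite addrK.
have e2 : (fun y => Int (F^~ y)) = fun y => Int (G^~ y) - Int (fun=> C).
  by apply/funext => y; rewrite -IntB//; apply: eq_Rintegral => x _; rewrite addrK.
split; [rewrite e1|rewrite e2|rewrite e1 e2].
- by apply: bmB => //; exact: bm_cst.
- by apply: bmB => //; exact: bm_cst.
- rewrite (IntB m1 (bm_cst _)) (IntB m2 (bm_cst _)); apply: (congr1 (fun z => z - _)).
  rewrite /Rintegral; congr fine.
  transitivity (\int[mu']_x \int[mu']_y (G x y)%:E)%E.
    by apply: eq_integral => x _; exact: E1.
  by rewrite F3; apply: eq_integral => y _; rewrite -E2.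
Qed.

End bounded_measurable.

Notation bm := bounded_measurable.

Section euclidean_divergence.
Context {R : realType} {n : nat}.
Local Notation lam := (lebesgue_rV (R := R) n).

Lemma in_ball_measurable (c : 'rV[R]_n) (r : R) : measurable (in_ball c r : set (borel_rV n)).
Proof.
apply: closed_measurable_rV; apply: compact_closed; last exact: closed_ball_rV_compact.
exact: norm_hausdorff.
Qed.

Lemma in_ball_lebesgue (c : 'rV[R]_n) (r : R) : (lam (in_ball c r) < +oo)%E.
Proof.
have [k Hk] : exists k : nat, `|c| + r <= k%:R.
  by exists (Num.bound `| `|c| + r |); apply: (le_trans (ler_norm _)); exact/ltW/archi_boundP.
apply: le_lt_trans (lebesgue_rV_ball n k).
apply: le_measure; rewrite ?inE; first exact: in_ball_measurable.
  apply: closed_measurable_rV.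
  rewrite (_ : [set v : 'rV[R]_n | `|v| <= k%:R] = (fun v : 'rV[R]_n => `|v|) @^-1` [set x | x <= k%:R])//.
  by apply: closed_comp; [move=> x _; exact: norm_continuous|exact: closed_le].
move=> u /= ur; apply: le_trans Hk; rewrite -[u](subrK c) addrC.
by apply: le_trans (ler_normD _ _) _; rewrite lerD2l.
Qed.

Lemma bump_bound_integrable (c : 'rV[R]_n) (r C : R) (f : borel_rV n -> R) :
  measurable_fun setT f -> (forall u, `|f u| <= C) -> (forall u, ~ in_ball c r u -> f u = 0) ->
  lam.-integrable setT (EFin \o f).
Proof.
move=> mf fC f0.
have mB := in_ball_measurable c r.
have i1 : lam.-integrable (in_ball c r) (EFin \o f).
  apply: measurable_bounded_integrable => //; first exact: in_ball_lebesgue.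
    exact: measurable_funS mf.
  by exists C; split; [exact: num_real|move=> y Cy x _ /=; exact: le_trans (ltW Cy)].
have := (integrable_mkcond (EFin \o f) mB).1 i1.
rewrite (_ : _ \_ _ = EFin \o f)//; apply/funext => u; rewrite patchE.
by case: ifPn => // /negP; rewrite inE => nu; rewrite /= f0.
Qed.

Lemma smooth_bounded_ball (c : 'rV[R]_n) (r : R) U f : in_ball c r `<=` U -> smooth_on U f ->
  exists2 C : R, 0 <= C & forall u, in_ball c r u -> `|f u| <= C.
Proof.
move=> BU sf.
have cK := @closed_ball_rV_compact R n c r.
have cf : {within in_ball c r, continuous f}.
  by apply: continuous_in_subspaceT => u; rewrite inE => /BU Uu; exact: smooth_on_continuous sf Uu.
have /compact_bounded[C [_ HC]] := continuous_compact cf cK.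
exists (`|C| + 1) => // u ur; apply: (HC (`|C| + 1)); last by exists u.
by rewrite ltr_pwDr// ler_norm.
Qed.

Lemma smooth_measurable_rV (f : 'rV[R]_n -> R) : smooth_on setT f ->
  measurable_fun setT (f : borel_rV n -> R).
Proof.
by move=> sf; apply: continuous_on_measurable => [|u _]; [exact: openT|exact: smooth_on_continuous sf I].
Qed.

Lemma partial_out (c : 'rV[R]_n) (r : R) f a u : (forall u, ~ in_ball c r u -> f u = 0) ->
  ~ in_ball c r u -> partial a f u = 0.
Proof.
move=> f0 nu.
have oC : open (~` in_ball c r).
  apply: closed_openC; apply: compact_closed; last exact: closed_ball_rV_compact.
  exact: norm_hausdorff.
by rewrite (partial_ext a oC (g := fun=> 0))// partial_cst.
Qed.

(** The integral of the translates of F along e_a is constant in s; its derivative at s = 0, taken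
    under the integral, is the integral of the partial derivative. *)
Lemma integral_partial0 (c : 'rV[R]_n) (r : R) (F : 'rV[R]_n -> R) (a : 'I_n) :
  smooth_on setT F -> (forall u, ~ in_ball c r u -> F u = 0) ->
  \int[lam]_u partial a F u = 0.
Proof.
move=> sF F0; pose e : 'rV[R]_n := delta_mx 0 a.
have sdF := smooth_on_partial a sF.
have ne : `|e| <= 1.
  apply/rV_norm_le => // b; rewrite mxE /=; case: (b == a); rewrite ?normr1 ?normr0//.
have dF0 u : ~ in_ball c r u -> partial a F u = 0 by exact: partial_out.
have [C C0 FC] := smooth_bounded_ball (@subsetT _ (in_ball c r)) sF.
have [D D0 FD] := smooth_bounded_ball (@subsetT _ (in_ball c r)) sdF.
have FC' u : `|F u| <= C.
  by have [/FC//|/F0 ->] := pselect (in_ball c r u); rewrite normr0.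
have FD' u : `|partial a F u| <= D.
  by have [/FD//|/dF0 ->] := pselect (in_ball c r u); rewrite normr0.
pose G s u := F (u + s *: e).
have mshift s : measurable_fun setT (fun u : borel_rV n => (u + s *: e : borel_rV n)).
  exact: measurable_shift_rV.
have mF := smooth_measurable_rV sF; have mdF := smooth_measurable_rV sdF.
(* Translates by at most 1 stay supported in the ball of radius r + 1, which carries the dominating
   function H. *)
have out s u : `|s| <= 1 -> ~ in_ball c (r + 1) u -> ~ in_ball c r (u + s *: e).
  move=> s1 nu H; apply: nu; rewrite /in_ball /=.
  have -> : u - c = (u + s *: e - c) - s *: e by rewrite addrAC addrK.
  apply: le_trans (ler_normB _ _) (lerD H _); rewrite normrZ.
  by apply: le_trans (ler_pM _ _ s1 ne) _; rewrite ?mulr1.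
have sI (s : R) : (`]-1, 1[%classic : set R) s -> `|s| <= 1.
  by rewrite /= in_itv /= => /andP[/ltW ? /ltW ?]; rewrite ler_norml; apply/andP.
have i1 s : (`]-1, 1[%classic : set R) s -> lam.-integrable setT (EFin \o G s).
  move=> /sI s1; apply: (bump_bound_integrable (c := c) (r := r + 1) (C := C)) => //.
    exact: (measurableT_comp mF (mshift s)).
    by move=> u; exact: FC'.
  by move=> u nu; apply: F0; exact: out.
have dG (s : R) (u : 'rV[R]_n) : is_derive s (1 : R) (G^~ u) (partial a F (u + s *: e)).
  have -> : G^~ u = fun r => F (r *: e + u) by apply/funext => s'; rewrite /G addrC.
  apply: line_is_derive; rewrite [u + _]addrC partialE; apply: derivableP.
  exact: smooth_on_derivable sF I.
have i2 s u : (`]-1, 1[%classic : set R) s -> [set: 'rV[R]_n] u -> derivable (G^~ u) s 1.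
  by move=> _ _; exact: (@ex_derive _ _ _ _ _ _ _ (dG s u)).
pose H (u : borel_rV n) : R := D * \1_(in_ball c (r + 1)) u.
have H0 u : 0 <= H u by rewrite mulr_ge0// indicE ler0n.
have i3 : lam.-integrable setT (EFin \o H).
  apply: (bump_bound_integrable (c := c) (r := r + 1) (C := D)).
  - by apply: measurable_funM => //; apply: measurable_indic; exact: in_ball_measurable.
  - by move=> u; rewrite /H indicE normrM ger0_norm//; case: (_ \in _);
      rewrite ?normr1 ?mulr1// normr0 mulr0.
  - by move=> u nu; rewrite /H indicE memNset// mulr0.
have i4 s u : (`]-1, 1[%classic : set R) s -> [set: 'rV[R]_n] u -> `|partial1of2 G s u| <= H u.
  move=> /sI s1 _; rewrite partial1of2E (@derive_val _ _ _ _ _ _ _ (dG s u)).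
  have [ub|nu] := pselect (in_ball c (r + 1) u); first by rewrite /H indicE mem_set// mulr1.
  by rewrite dF0 ?normr0//; exact: out.
have I0 : (`]-1, 1[%classic : set R) 0 by rewrite /= in_itv /= ltr01 ltrN10.
have := @differentiation_under_integral _ _ _ lam G setT measurableT 0 (-1) 1 I0 i1 i2 H H0 i3 i4.
have -> : (fun s => \int[lam]_(u in setT) G s u) = fun=> \int[lam]_(u in setT) F u.
  apply/funext => s; rewrite /Rintegral; congr fine.
  by apply: (integral_rV_shift (F := EFin \o F)); exact/measurable_EFinP.
rewrite derive1_cst => E; rewrite [RHS]E; apply: eq_Rintegral => u _.
by rewrite partial1of2E (@derive_val _ _ _ _ _ _ _ (dG 0 u)) scale0r addr0.
Qed.

End euclidean_divergence.

Section manifold_integral.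
Context {R : realType} {N : nat} (M : riemannianManifold R N).
Hypothesis M_closed : compact [set: M].
Variable vol : {measure set (borel M) -> \bar R}.
Hypothesis vol_riemannian : riemannian_volume vol.
Implicit Types (i : chart_index M) (f k : M -> R).
Local Notation lam := (lebesgue_rV (R := R) N).

Definition density i (u : 'rV[R]_N) : R := Num.sqrt (\det (metric i u)).

Lemma smooth_density_chart i : smooth_on (chart_cod i) (density i).
Proof.
exact: (smooth_density (cod_open i) (@chart_metric_smooth R N M i)
  (@chart_metricT R N M i) (@chart_metric_gt0 R N M i)).
Qed.

Lemma density_chart_gt0 i u : chart_cod i u -> 0 < density i u.
Proof. exact: (density_gt0 (@chart_metricT R N M i) (@chart_metric_gt0 R N M i)). Qed.

Lemma chart_dom_measurable i : measurable (chart_dom i : set (borel M)).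
Proof. by apply: sub_sigma_algebra; exact: chart_dom_open. Qed.

Lemma chart_cod_measurable i : measurable (chart_cod i : set (borel_rV N)).
Proof. by apply: open_measurable_rV; exact: chart_cod_open. Qed.

Lemma chart_inv_measurable i :
  measurable_fun (chart_cod i : set (borel_rV N)) (chart_inv i : borel_rV N -> borel M).
Proof.
apply: continuous_on_measurable_top; first exact: chart_cod_open.
by move=> u; exact: chart_inv_continuous.
Qed.

Lemma density_measurable i : measurable_fun (chart_cod i : set (borel_rV N)) (density i).
Proof.
apply: continuous_on_measurable; first exact: chart_cod_open.
by move=> u Uu; exact: (smooth_on_continuous (@smooth_density_chart i) Uu).
Qed.

Lemma vol_chartE i (A : set (borel M)) : measurable A ->
  vol (A `&` chart_dom i) =
  (\int[lam]_(u in chart_cod i) (\1_A (chart_inv i u) * density i u)%:E)%E.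
Proof.
move=> mA.
have mV := chart_cod_measurable i.
have mg : measurable_fun (chart_cod i : set (borel_rV N))
    (fun u => (\1_A (chart_inv i u) * density i u)%:E).
  apply/measurable_EFinP; apply: measurable_funM; last exact: density_measurable.
  have m1 : measurable_fun setT (\1_A : borel M -> R) by exact: measurable_indic.
  exact: (measurableT_comp m1 (@chart_inv_measurable i)).
have /(_ i (A `&` chart_dom i)) V := vol_riemannian.
rewrite integral_mkcond V; last 2 first.
- by apply: measurableI => //; exact: chart_dom_measurable.
- by move=> x [].
rewrite -lebesgue_rVE; last 2 first.
- rewrite (_ : (fun u => _) = (fun u => (\1_A (chart_inv i u) * density i u)%:E) \_ (chart_cod i)).
    exact/(measurable_restrictT _ mV).
  apply/funext => u; rewrite patchE; case: ifPn => [|/negP]; rewrite inE => Uu.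
    congr (_ * _)%:E; rewrite !indicE; congr (nat_of_bool _)%:R.
    apply/idP/idP; rewrite !inE.
      by move=> [x [Ax dx] <-]; rewrite chartK.
    move=> Au; exists (chart_inv i u); last exact: chart_invK.
    by split => //; exact: chart_cod_dom.
  rewrite indicE memNset ?mul0r// => -[x [_ dx] xu]; apply: Uu; rewrite -xu.
  exact: chart_dom_cod.
- by move=> u; rewrite lee_fin mulr_ge0// sqrtr_ge0.
apply: eq_integral => u _; rewrite patchE; case: ifPn => [|/negP]; rewrite inE => Uu.
  congr (_ * _)%:E; rewrite !indicE; congr (nat_of_bool _)%:R.
  apply/idP/idP; rewrite !inE.
    by move=> [x [Ax dx] <-]; rewrite chartK.
  move=> Au; exists (chart_inv i u); last exact: chart_invK.
  by split => //; exact: chart_cod_dom.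
rewrite indicE memNset ?mul0r// => -[x [_ dx] xu]; apply: Uu; rewrite -xu.
exact: chart_dom_cod.
Qed.

Lemma chart_integral_ge0 i (f : borel M -> \bar R) : measurable_fun setT f ->
  (forall x, 0 <= f x)%E ->
  (\int[vol]_(x in chart_dom i) f x)%E =
  (\int[lam]_(u in chart_cod i) (f (chart_inv i u) * (density i u)%:E))%E.
Proof.
move=> mf f0; apply: (@transport_integral R _ _ (borel M) (borel_rV N) vol lam (chart_dom i) (chart_cod i)
  (chart_inv i) (density i)) => //.
- exact: chart_dom_measurable.
- exact: chart_cod_measurable.
- exact: chart_inv_measurable.
- exact: density_measurable.
- by move=> u Uu; exact/ltW/density_chart_gt0.
- by move=> A mA; exact: vol_chartE.
Qed.

Lemma chart_integral i (h : borel M -> R) : measurable_fun setT h ->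
  (forall x, ~ chart_dom i x -> h x = 0) ->
  \int[vol]_x h x = \int[lam]_(u in chart_cod i) (h (chart_inv i u) * density i u).
Proof.
move=> mh h0; rewrite /Rintegral; congr fine.
have -> : (\int[vol]_(x in setT) (h x)%:E)%E = (\int[vol]_(x in chart_dom i) (h x)%:E)%E.
  rewrite [RHS]integral_mkcond; apply: eq_integral => x _; rewrite patchE.
  by case: ifPn => // /negP; rewrite inE => nx; rewrite h0.
have mhe : measurable_fun setT (EFin \o h) by exact/measurable_EFinP.
rewrite [LHS]integralE [RHS]integralE; congr (_ - _)%E.
  rewrite (chart_integral_ge0 i (measurable_funepos mhe) (funepos_ge0 _)).
  apply: eq_integral => u; rewrite inE => Uu; have r0 := ltW (density_chart_gt0 Uu).
  rewrite !funeposE /= -!EFin_max -EFinM; congr EFin.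
  by rewrite maxr_pMl// mul0r.
rewrite (chart_integral_ge0 i (measurable_funeneg mhe) (funeneg_ge0 _)).
apply: eq_integral => u; rewrite inE => Uu; have r0 := ltW (density_chart_gt0 Uu).
rewrite !funenegE /= -!EFin_max -EFinM; congr EFin.
by rewrite maxr_pMl// mul0r mulNr.
Qed.

Lemma smooth_function_continuous f : smooth_function f -> continuous f.
Proof.
move=> sf x; pose i := chart_at x.
have dx : chart_dom i x := chart_atP x.
have nx : \forall y \near x, f y = (f \o chart_inv i) (chart i y).
  apply: filterS (open_nbhs_nbhs (conj (@chart_dom_open _ _ _ i) dx)) => y dy.
  by rewrite /= chartK.
apply: (near_eq_continuous (f := (f \o chart_inv i) \o chart i)).
  by apply: filterS nx => y ->.
apply: continuous_comp; first exact: chart_continuous.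
exact: (smooth_on_continuous (sf i) (chart_dom_cod dx)).
Qed.

Lemma smooth_function_measurable f : smooth_function f ->
  measurable_fun setT (f : borel M -> R).
Proof.
move=> sf; apply: continuous_on_measurable; first exact: openT.
by move=> x _; exact: smooth_function_continuous.
Qed.

Lemma continuous_bounded f : continuous f -> exists C : R, forall x, `|f x| <= C.
Proof.
move=> cf.
have cf' : {within [set: M], continuous f} by apply: continuous_subspaceT.
have /compact_bounded[C [_ HC]] := continuous_compact cf' M_closed.
exists (`|C| + 1) => x; apply: (HC (`|C| + 1)); last by exists x.
by rewrite ltr_pwDr// ler_norm.
Qed.

Lemma bm_smooth f : smooth_function f -> bm (f : borel M -> R).
Proof.
move=> sf; split; first exact: smooth_function_measurable.
by apply: continuous_bounded; exact: smooth_function_continuous.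
Qed.

(** Each member of a partition of unity is bounded and supported in a compact cube of a chart, where
    the density is bounded too. *)
Lemma vol_lty : (vol setT < +oo)%E.
Proof.
have [r Hr] := choice (fun x => (exists2P _ _).1 (@bump_radius_exists R N M x setT openT I)).
have {}Hr x : bump_radius x (r x) by have [] := Hr x.
have [n [c [chi [schi chi0 chiO chi1]]]] := partition_of_unity M_closed Hr.
have -> : vol setT = (\int[vol]_x \sum_k (chi k x)%:E)%E.
  rewrite -[LHS]mul1e -integral_cst//; apply: eq_integral => x _.
  by rewrite sumEFin chi1.
rewrite ge0_integral_sum//; last 2 first.
- by move=> k; apply/measurable_EFinP; exact: smooth_function_measurable.
- by move=> k x _; rewrite lee_fin.
apply: lte_sum_pinfty => k _.
set i := chart_at (c k).
have mk : measurable_fun setT (EFin \o (chi k : borel M -> R)).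
  by apply/measurable_EFinP; exact: smooth_function_measurable.
have -> : (\int[vol]_(x in setT) (chi k x)%:E)%E = (\int[vol]_(x in chart_dom i) (chi k x)%:E)%E.
  rewrite [RHS]integral_mkcond; apply: eq_integral => x _; rewrite patchE.
  case: ifPn => // /negP; rewrite inE => nx; rewrite chiO// => -[u ux xE].
  by apply: nx; rewrite -xE; apply: chart_cod_dom; exact: (Hr (c k)).2.
rewrite (chart_integral_ge0 i mk) => [|x]; last by rewrite lee_fin.
set B := in_ball (chart_point (c k)) (2 * r (c k)).
have BU : B `<=` chart_cod i := (Hr (c k)).2.
have [C C0 HC] := smooth_bounded_ball BU (@smooth_density_chart i).
have [D HD] := (bm_smooth (schi k)).2.
have mB : measurable (B : set (borel_rV N)) := in_ball_measurable _ _.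
apply: (@le_lt_trans _ _ (\int[lam]_(u in chart_cod i) ((D * C)%:E * (\1_B u)%:E))%E).
  apply: ge0_le_integral => //.
  - exact: chart_cod_measurable.
  - move=> u Uu; apply: mule_ge0; rewrite lee_fin; first exact: chi0.
    exact/ltW/density_chart_gt0.
  - apply: emeasurable_funM; last by apply/measurable_EFinP; exact: density_measurable.
    exact: (measurableT_comp mk (@chart_inv_measurable i)).
  - by apply/measurable_EFinP; apply: measurable_funM => //; exact: measurable_indic.
  move=> u Uu; rewrite -!EFinM lee_fin indicE.
  have [uB|nB] := pselect (B u).
    rewrite mem_set// mulr1 ler_pM ?(ltW (density_chart_gt0 Uu))//.
      exact: le_trans (ler_norm _) (HD _).
    exact: le_trans (ler_norm _) (HC _ uB).
  rewrite memNset// mulr0 chiO ?mul0r// => -[v vB vE]; apply: nB.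
  by rewrite -(chart_invK Uu) -vE chart_invK//; exact: BU.
rewrite ge0_integralZl//; last 3 first.
- exact: chart_cod_measurable.
- by apply/measurable_EFinP; exact: measurable_indic.
- by rewrite lee_fin mulr_ge0// (le_trans _ (HD point)).
apply: lte_mul_pinfty => //; first by rewrite lee_fin mulr_ge0// (le_trans _ (HD point)).
rewrite integral_indic//; last exact: chart_cod_measurable.
apply: le_lt_trans (in_ball_lebesgue (chart_point (c k)) (2 * r (c k))).
by apply: le_measure; rewrite ?inE//; apply: measurableI => //; exact: chart_cod_measurable.
Qed.

End manifold_integral.

#[local] Opaque grad_coord gamma_coord christoffel laplace_coord ricci_form.

Section chart_divergence.
Context {R : realType} {n : nat}.
Local Notation lam := (lebesgue_rV (R := R) n).

Lemma in_ball_closed (c : 'rV[R]_n) (r : R) : closed (in_ball c r).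
Proof. by apply: compact_closed; [exact: norm_hausdorff|exact: closed_ball_rV_compact]. Qed.

Lemma partial_smooth_out (c : 'rV[R]_n) (r : R) (U : set 'rV[R]_n) f a u :
  open U -> U u -> (forall w, U w -> ~ in_ball c r w -> f w = 0) ->
  ~ in_ball c r u -> partial a f u = 0.
Proof.
move=> oU Uu f0 nu.
have oW : open (U `&` ~` in_ball c r) by apply: openI => //; exact/closed_openC/in_ball_closed.
rewrite (partial_ext a oW (g := fun=> 0)) ?partial_cst//.
by move=> w [Uw nw]; exact: f0.
Qed.

Lemma integral_divergence0 (c : 'rV[R]_n) (r : R) (U : set 'rV[R]_n) (Y : 'I_n -> 'rV[R]_n -> R) :
  open U -> in_ball c r `<=` U -> (forall a, smooth_on U (Y a)) ->
  (forall a u, U u -> ~ in_ball c r u -> Y a u = 0) ->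
  \int[lam]_(u in U) (\sum_a partial a (Y a) u) = 0.
Proof.
move=> oU BU sY Y0.
pose Z a u := if `[< U u >] then Y a u else 0.
have Z0 a u : ~ in_ball c r u -> Z a u = 0.
  by move=> nu; rewrite /Z; case: asboolP => // Uu; exact: Y0.
have oB : open (~` in_ball c r) by exact/closed_openC/in_ball_closed.
have sZ a : smooth_on setT (Z a).
  apply: (@smooth_on_sub _ _ (U `|` ~` in_ball c r)).
    by move=> u _; have [/BU|] := pselect (in_ball c r u); [left|right].
  apply: smooth_onU.
    by apply: (smooth_on_ext oU) (sY a) => u Uu; rewrite /Z asboolT.
  by apply: (smooth_on_ext oB) (smooth_on_cst (0 : R)) => u nu; rewrite Z0.
have E u : U u -> \sum_a partial a (Y a) u = \sum_a partial a (Z a) u.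
  move=> Uu; apply: eq_bigr => a _; apply: (partial_ext a oU) Uu => w Uw.
  by rewrite /Z asboolT.
have PZ a u : ~ in_ball c r u -> partial a (Z a) u = 0 by exact: partial_out (Z0 a).
rewrite Rintegral_mkcond.
have -> : ((fun u => \sum_a partial a (Y a) u) \_ U) = fun u => \sum_a partial a (Z a) u.
  apply/funext => u; rewrite patchE; case: ifPn => [|/negP]; rewrite inE => Uu; first exact: E.
  by rewrite big1// => a _; rewrite PZ// => /BU.
have iZ a : lam.-integrable setT (EFin \o partial a (Z a)).
  have sdZ := smooth_on_partial a (sZ a).
  have [C C0 HC] := smooth_bounded_ball (@subsetT _ (in_ball c r)) sdZ.
  apply: (bump_bound_integrable (c := c) (r := r) (C := C)); last exact: PZ.
    exact: smooth_measurable_rV.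
  by move=> u; have [/HC//|/PZ ->] := pselect (in_ball c r u); rewrite normr0.
suff H (s : seq 'I_n) : \int[lam]_u (\sum_(a <- s) partial a (Z a) u) = 0 /\
    lam.-integrable setT (EFin \o (fun u => \sum_(a <- s) partial a (Z a) u)) by exact: (H _).1.
elim: s => [|a s [IH1 IH2]].
  have E0 : (fun u : borel_rV n => \sum_(a <- [::]) partial a (Z a) u) = fun=> 0.
    by apply/funext => u; rewrite big_nil.
  split; rewrite E0; first by rewrite /Rintegral integral0.
  exact: integrable0.
have Es : (fun u : borel_rV n => \sum_(b <- a :: s) partial b (Z b) u) =
    fun u => partial a (Z a) u + \sum_(b <- s) partial b (Z b) u.
  by apply/funext => u; rewrite big_cons.
split; rewrite Es.
  by rewrite (RintegralD measurableT (iZ a) IH2) IH1 addr0 (integral_partial0 a (sZ a) (Z0 a)).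
have := integrableD measurableT (iZ a) IH2.
by [].
Qed.

End chart_divergence.

Ltac smooth_fun1 :=
  lazymatch goal with
  | |- smooth_function (fun _ => ?c) => apply smooth_function_cst
  | |- smooth_function (fun x => (@?f x + - @?g x)%R) => apply smooth_functionB
  | |- smooth_function (fun x => (@?f x + @?g x)%R) => apply smooth_functionD
  | |- smooth_function (fun x => (@?f x * @?g x)%R) => apply smooth_functionM
  | |- smooth_function (fun x => (- @?f x)%R) => apply smooth_functionN
  | |- smooth_function (fun x => @bigop.body _ _ _ _ (@?F x)) =>
      apply smooth_function_sum; intros ?
  | |- smooth_function (laplacian _) => apply smooth_lap
  | |- smooth_function (fun x => laplacian _ x) => apply smooth_lap
  | |- smooth_function (gam _ _) => apply smooth_gam
  | |- smooth_function (fun x => gam _ _ x) => apply smooth_gam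
  | H : smooth_function ?f |- smooth_function ?f => exact H
  | H : smooth_function ?f |- smooth_function (fun x => ?f x) => exact H
  | H : forall k, smooth_function (?F k) |- smooth_function (?F ?k) => exact (H k)
  | H : forall k, smooth_function (?F k) |- smooth_function (fun x => ?F ?k x) => exact (H k)
  end.

Ltac smooth_fun := repeat smooth_fun1.

Section green.
Context {R : realType} {N : nat} (M : riemannianManifold R N).
Hypothesis M_closed : compact [set: M].
Variable vol : {measure set (borel M) -> \bar R}.
Hypothesis vol_riemannian : riemannian_volume vol.
Implicit Types (i : chart_index M) (f k : M -> R).
Local Notation lam := (lebesgue_rV (R := R) N).
Local Notation Int f := (\int[vol]_(x in setT) f x).

Lemma bm_continuous f : continuous f -> bm (f : borel M -> R).
Proof.
move=> cf; split; last exact: continuous_bounded.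
by apply: continuous_on_measurable; [exact: openT|move=> x _; exact: cf].
Qed.

Lemma lap_sum (I : Type) (s : seq I) (F : I -> M -> R) x : (forall j, smooth_function (F j)) ->
  lap (fun y => \sum_(k <- s) F k y) x = \sum_(k <- s) lap (F k) x.
Proof.
move=> sF; elim: s => [|k s IH].
  rewrite (_ : (fun y => _) = fun=> 0); first by rewrite lap_cst big_nil.
  by apply/funext => y; rewrite big_nil.
rewrite (_ : (fun y => _) = fun y => F k y + \sum_(j <- s) F j y); last first.
  by apply/funext => y; rewrite big_cons.
rewrite lapD ?IH ?big_cons //; last by smooth_fun.
Qed.

Lemma lap_out (A : set M) f x : closed A -> smooth_function f ->
  (forall y, ~ A y -> f y = 0) -> ~ A x -> lap f x = 0.
Proof.
move=> cA sf f0 nx; have [i [u [Uu xE]]] := chart_pointP x.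
have oW : open (chart_cod i `&` chart_inv i @^-1` (~` A)).
  by apply: chart_inv_preimage_open; exact: closed_openC.
have Wu : (chart_cod i `&` chart_inv i @^-1` (~` A)) u by split => //=; rewrite xE.
rewrite -xE (lapE sf Uu) (laplace_ext (metric i) oW Wu (f' := fun=> 0)).
  exact: (laplace_coord_cst (cod_open i) (@chart_metric_smooth R N M i)
    (@chart_metricT R N M i) (@chart_metric_gt0 R N M i) 0 Uu).
by move=> w [Uw nw]; exact: f0.
Qed.

(** The integrand is the divergence of f grad psi: multiplied by the density it is the coordinate
    divergence of Y, which vanishes outside a cube. *)
Lemma green_chart i c r f psi : in_ball c r `<=` chart_cod i ->
  smooth_function f -> smooth_function psi ->
  (forall x, ~ (chart_inv i @` in_ball c r) x -> psi x = 0) ->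
  Int (fun x => f x * lap psi x + gam f psi x) = 0.
Proof.
move=> BU sf sp p0.
pose K := chart_inv i @` in_ball c r.
have cK : closed K by exact: chart_ball_closed.
have sfp := smooth_functionM sf sp.
have out x : ~ K x -> f x * lap psi x + gam f psi x = 0.
  move=> nx; rewrite gam.unlock (lap_out cK sp p0 nx) (p0 _ nx) (lap_out cK sfp) //.
    by rewrite !mulr0 mul0r !subr0 mulr0 addr0.
  by move=> y ny; rewrite p0// mulr0.
rewrite (@chart_integral R N M vol vol_riemannian i); last 2 first.
- by apply: smooth_function_measurable; smooth_fun.
- by move=> x nx; apply: out => -[u uB xE]; apply: nx; rewrite -xE; exact/chart_cod_dom/BU.
pose F := f \o chart_inv i; pose P := psi \o chart_inv i.
pose rho := density i.
pose X a u := rho u * \sum_b invmx (metric i u) a b * partial b P u.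
pose Y a u := F u * X a u.
have oU := cod_open i.
have sh a b : smooth_on (chart_cod i) (fun u => invmx (metric i u) a b).
  exact: (smooth_inv_metric oU (@chart_metric_smooth R N M i)
    (@chart_metricT R N M i) (@chart_metric_gt0 R N M i)).
have sr : smooth_on (chart_cod i) rho := @smooth_density_chart R N M i.
have sP : smooth_on (chart_cod i) P := sp i.
have sF : smooth_on (chart_cod i) F := sf i.
have sX a : smooth_on (chart_cod i) (X a).
  apply: (smooth_onM oU sr); eapply smooth_on_sum; [exact oU|intros b].
  by apply: (smooth_onM oU (sh a b)); exact: smooth_on_partial.
have sY a : smooth_on (chart_cod i) (Y a) by exact: (smooth_onM oU sF (sX a)).
have P0 u : chart_cod i u -> ~ in_ball c r u -> P u = 0.
  move=> Uu nu; apply: p0 => -[v vB vE]; apply: nu.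
  by rewrite -(chart_invK Uu) -vE chart_invK//; exact: BU.
have Y0 a u : chart_cod i u -> ~ in_ball c r u -> Y a u = 0.
  move=> Uu nu; rewrite /Y /X big1 ?mulr0// => b _.
  by rewrite (partial_smooth_out b oU Uu P0 nu) mulr0.
rewrite -[RHS](integral_divergence0 oU BU sY Y0); apply: eq_Rintegral => u; rewrite inE => Uu.
rewrite (lapE sp Uu) (gamE sf sp Uu) gamma_gradl.
have -> : \sum_a partial a (Y a) u =
    F u * (\sum_a partial a (X a) u) + \sum_a partial a F u * X a u.
  rewrite mulr_sumr -big_split; apply: eq_bigr => a _.
  by rewrite (partialM a sF (sX a) Uu) addrC.
have r0 : rho u != 0 by rewrite gt_eqF// density_chart_gt0.
have -> : laplace_coord (metric i) P u = (rho u)^-1 * \sum_a partial a (X a) u by [].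
have -> : \sum_a partial a F u * X a u = rho u * \sum_a partial a F u * grad_coord (metric i) P a u.
  by rewrite mulr_sumr; apply: eq_bigr => a _; rewrite mulrCA.
rewrite -/rho -/F -/P -[f (chart_inv i u)]/(F u).
by move: (\sum_a _) (\sum_a _) => A B; field.
Qed.

(** Only k is cut by the partition of unity; f stays whole, and each piece falls under
    [green_chart]. *)
Lemma green f k : smooth_function f -> smooth_function k ->
  Int (fun x => f x * lap k x) = - Int (gam f k).
Proof.
move=> sf sk.
have [r Hr] := choice (fun x => (exists2P _ _).1 (@bump_radius_exists R N M x setT openT I)).
have {}Hr x : bump_radius x (r x) by have [] := Hr x.
have [n [c [chi [schi chi0 chiO chi1]]]] := partition_of_unity M_closed Hr.
pose psi j x := chi j x * k x.
have sp j : smooth_function (psi j) by exact: (smooth_functionM (schi j) sk).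
have kE : k = fun x => \sum_j psi j x.
  by apply/funext => x; rewrite -mulr_suml chi1 mul1r.
have bL j : bm (fun x : borel M => f x * lap (psi j) x + gam f (psi j) x).
  by apply: bm_smooth M_closed _ _; smooth_fun.
have V := vol_lty M_closed vol_riemannian.
have bf1 : bm (fun x : borel M => f x * lap k x).
  by apply: bm_smooth M_closed _ _; smooth_fun.
have bg : bm (gam f k : borel M -> R).
  by apply: bm_smooth M_closed _ _; smooth_fun.
apply/eqP; rewrite -subr_eq0 opprK -IntD//; apply/eqP.
transitivity (Int (fun x => \sum_j (f x * lap (psi j) x + gam f (psi j) x))).
  apply: eq_Rintegral => x _; rewrite big_split /= -mulr_sumr.
  have E1 : lap k x = \sum_j lap (psi j) x by rewrite {1}kE lap_sum.
  have E2 : lap (fun y => f y * k y) x = \sum_j lap (fun y => f y * psi j y) x.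
    rewrite -lap_sum; last by move=> j; smooth_fun.
    congr (lap _ x); apply/funext => y; rewrite -mulr_sumr; congr (_ * _).
    by rewrite {1}kE.
  rewrite -E1; congr (_ + _).
  rewrite gam.unlock E1 E2 mulr_sumr {1}kE mulr_suml -!sumrB mulr_sumr.
  by [].
rewrite (Int_sum V)// big1// => j _.
by apply: (green_chart (Hr (c j)).2 sf (sp j)) => x nx; rewrite /psi (chiO _ _ nx) mul0r.
Qed.

Lemma lap_symmetric f k : smooth_function f -> smooth_function k ->
  Int (fun x => f x * lap k x) = Int (fun x => k x * lap f x).
Proof.
by move=> sf sk; rewrite !green//; congr (- _); apply: eq_Rintegral => x _; rewrite gamC.
Qed.

Lemma Int_lap f : smooth_function f -> Int (lap f) = 0.
Proof.
move=> sf; have := lap_symmetric (smooth_function_cst (1 : R)) sf.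
under eq_Rintegral do rewrite mul1r.
move=> ->; under eq_Rintegral do rewrite lap_cst mulr0.
exact: Int0.
Qed.

End green.

(** * Functions of time and space *)

Section space_time.
Context {R : realType} {N : nat} (M : riemannianManifold R N).
Implicit Types (i : chart_index M) (u k : R -> M -> R) (I : set R) (w : 'rV[R]_(1 + N)).

Definition cylinder I i : set 'rV[R]_(1 + N) :=
  [set w | I (lsubmx w 0 0) /\ chart_cod i (rsubmx w)].

Definition st_coord u i w : R := u (lsubmx w 0 0) (chart_inv i (rsubmx w)).

(** The set of times is a parameter because the kernel lives on positive times and the time-reversed
    kernel on ]0, c[. *)
Definition smooth_st I u : Prop := forall i, smooth_on (cylinder I i) (st_coord u i).

Definition st_row (t : R) (v : 'rV[R]_N) : 'rV[R]_(1 + N) := row_mx (const_mx t) v.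

Lemma lsubmx_st_row t v : lsubmx (st_row t v) 0 0 = t.
Proof. by rewrite row_mxKl mxE. Qed.

Lemma rsubmx_st_row t v : rsubmx (st_row t v) = v.
Proof. exact: row_mxKr. Qed.

Lemma st_rowK w : st_row (lsubmx w 0 0) (rsubmx w) = w.
Proof.
rewrite -[RHS]hsubmxK; congr (row_mx _ _); apply/rowP => b; rewrite !mxE.
by rewrite [b]ord1.
Qed.

Definition time_index : 'I_(1 + N) := lshift N ord0.

Lemma rsubmx_continuous : continuous (fun w : 'rV[R]_(1 + N) => rsubmx w).
Proof.
move=> w; apply: (@rV_continuous R N _ (fun w : 'rV[R]_(1 + N) => rsubmx w)) => b.
rewrite (_ : (fun s => _) = fun s : 'rV[R]_(1 + N) => s 0 (rshift 1 b)).
  exact: coord_continuous.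
by apply/funext => s; rewrite mxE.
Qed.

Lemma lsubmx_continuous : continuous (fun w : 'rV[R]_(1 + N) => lsubmx w 0 0).
Proof.
rewrite (_ : (fun s => _) = fun s : 'rV[R]_(1 + N) => s 0 time_index).
  by move=> w; exact: coord_continuous.
by apply/funext => s; rewrite mxE.
Qed.

Lemma cylinder_open I i : open I -> open (cylinder I i).
Proof.
move=> oI.
rewrite (_ : cylinder I i = (fun w : 'rV[R]_(1 + N) => lsubmx w 0 0) @^-1` I `&`
   (fun w : 'rV[R]_(1 + N) => rsubmx w) @^-1` chart_cod i) //.
apply: openI; apply: open_comp => //.
- by move=> w _; exact: lsubmx_continuous.
- by move=> w _; exact: rsubmx_continuous.
- exact: chart_cod_open.
Qed.

Arguments cylinder_open {I} i _.

Lemma smooth_st_sub I J u : J `<=` I -> smooth_st I u -> smooth_st J u.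
Proof. by move=> JI su i; apply: (smooth_on_sub _ (su i)) => w [/JI]. Qed.

Lemma smooth_st_cst I (c : R) : smooth_st I (fun _ _ => c).
Proof. by move=> i; exact: smooth_on_cst. Qed.

Lemma smooth_st_coord_r I i b : open I -> smooth_on (cylinder I i) (fun w => rsubmx w 0 b).
Proof.
move=> oI; apply: (@smooth_on_ext _ _ _ (fun w => w 0 (rshift 1 b)) _ (cylinder_open i oI)).
  by move=> w _; rewrite mxE.
exact: smooth_on_coord.
Qed.

Lemma smooth_st_coord_l I i : open I -> smooth_on (cylinder I i) (fun w => lsubmx w 0 0).
Proof.
move=> oI; apply: (@smooth_on_ext _ _ _ (fun w => w 0 time_index) _ (cylinder_open i oI)).
  by move=> w _; rewrite mxE.
exact: smooth_on_coord.
Qed.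

Lemma smooth_st_static I i F : open I -> smooth_on (chart_cod i) F ->
  smooth_on (cylinder I i) (fun w => F (rsubmx w)).
Proof.
move=> oI sF; apply: (smooth_on_comp (cylinder_open i oI) (cod_open i) sF).
  by move=> b; exact: smooth_st_coord_r.
by move=> w [].
Qed.

Lemma smooth_st_fun I (f : M -> R) : open I -> smooth_function f -> smooth_st I (fun _ => f).
Proof. by move=> oI sf i; exact: (smooth_st_static oI (sf i)). Qed.

Lemma smooth_stD I u k : open I -> smooth_st I u -> smooth_st I k ->
  smooth_st I (fun t x => u t x + k t x).
Proof. by move=> oI su sk i; exact: (smooth_onD (cylinder_open i oI) (su i) (sk i)). Qed.

Lemma smooth_stM I u k : open I -> smooth_st I u -> smooth_st I k ->
  smooth_st I (fun t x => u t x * k t x).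
Proof. by move=> oI su sk i; exact: (smooth_onM (cylinder_open i oI) (su i) (sk i)). Qed.

Lemma smooth_stB I u k : open I -> smooth_st I u -> smooth_st I k ->
  smooth_st I (fun t x => u t x - k t x).
Proof. by move=> oI su sk i; exact: (smooth_onB (cylinder_open i oI) (su i) (sk i)). Qed.

Lemma smooth_st_ln I u : open I -> (forall t x, I t -> 0 < u t x) -> smooth_st I u ->
  smooth_st I (fun t x => ln (u t x)).
Proof.
move=> oI u0 su i; apply: (smooth_on_ln (cylinder_open i oI)) (su i).
by move=> w [It _]; exact: u0.
Qed.

Lemma smooth_st_reverse I (c : R) u : open I -> smooth_st I u ->
  smooth_st [set r | I (c - r)] (fun r => u (c - r)).
Proof.
move=> oI su i.
have oJ : open [set r : R | I (c - r)].
  apply: (@open_comp _ _ (fun r : R => c - r) I _ oI) => r _.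
  by apply: continuousB; [exact: cst_continuous|by move=> A].
pose Phi w := st_row (c - lsubmx w 0 0) (rsubmx w).
have E : st_coord (fun r => u (c - r)) i = fun w => st_coord u i (Phi w).
  by apply/funext => w; rewrite /st_coord /Phi lsubmx_st_row rsubmx_st_row.
rewrite E; apply: (smooth_on_comp (cylinder_open i oJ) (cylinder_open i oI) (su i)).
  move=> b; case: (split_ordP b) => [a|a] ->.
    apply: (@smooth_on_ext _ _ _ (fun w => c - lsubmx w 0 0) _ (cylinder_open i oJ)).
      by move=> w _; rewrite /Phi /st_row row_mxEl [RHS]mxE.
    apply: (smooth_onB (cylinder_open i oJ)); first exact: smooth_on_cst.
    exact: smooth_st_coord_l.
  apply: (@smooth_on_ext _ _ _ (fun w => rsubmx w 0 a) _ (cylinder_open i oJ)).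
    by move=> w _; rewrite /Phi /st_row row_mxEr.
  exact: smooth_st_coord_r.
by move=> w [Ic Uw]; rewrite /cylinder /= /Phi lsubmx_st_row rsubmx_st_row.
Qed.

Lemma smooth_st_slice I u t : open I -> I t -> smooth_st I u -> smooth_function (u t).
Proof.
move=> oI It su i.
have E : u t \o chart_inv i = fun v => st_coord u i (st_row t v).
  by apply/funext => v; rewrite /st_coord lsubmx_st_row rsubmx_st_row.
rewrite E; apply: (smooth_on_comp (cod_open i) (cylinder_open i oI) (su i)).
  move=> b; case: (split_ordP b) => [a|a] ->.
    apply: (@smooth_on_ext _ _ _ (fun w : 'rV[R]_N => t) _ (cod_open i)); last exact: smooth_on_cst.
    by move=> w _; rewrite /st_row row_mxEl mxE.
  apply: (@smooth_on_ext _ _ _ (fun w : 'rV[R]_N => w 0 a) _ (cod_open i)); last exact: smooth_on_coord.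
  by move=> w _; rewrite /st_row row_mxEr.
by move=> v Uv; rewrite /cylinder /= lsubmx_st_row rsubmx_st_row.
Qed.

Lemma st_row_time (h t : R) v : h *: delta_mx 0 time_index + st_row t v = st_row (h + t) v.
Proof.
rewrite /st_row; apply/rowP => b; case: (split_ordP b) => [a|a] ->.
  by rewrite row_mxEl [LHS]mxE [X in X + _]mxE row_mxEl !mxE [a]ord1 !eqxx mulr1.
rewrite row_mxEr [LHS]mxE [X in X + _]mxE row_mxEr mxE /=.
by rewrite mulr0 add0r.
Qed.

Lemma st_row_space (h t : R) v a :
  h *: delta_mx 0 (rshift 1 a) + st_row t v = st_row t (h *: delta_mx 0 a + v).
Proof.
rewrite /st_row; apply/rowP => b; case: (split_ordP b) => [d|d] ->.
  rewrite row_mxEl [LHS]mxE [X in X + _]mxE row_mxEl !mxE /=.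
  by rewrite eq_lrshift mulr0 add0r.
by rewrite row_mxEr [LHS]mxE [X in X + _]mxE row_mxEr !mxE /= (inj_eq (@rshift_inj _ _)).
Qed.

Lemma partial_slice (F : 'rV[R]_(1 + N) -> R) t v a :
  partial a (fun v => F (st_row t v)) v = partial (rshift 1 a) F (st_row t v).
Proof.
rewrite !partialE (derive_line (fun v => F (st_row t v))) (derive_line F).
apply: (congr1 (fun k : R -> R => 'D_(1 : R) k (0 : R))); apply/funext => h.
by rewrite st_row_space.
Qed.

Definition dt u (t : R) (x : M) : R := 'D_1 (fun r => u r x) t.

Lemma dt_coord u i w : st_coord (dt u) i w = partial time_index (st_coord u i) w.
Proof.
rewrite -[w in RHS]st_rowK partialE (derive_line (st_coord u i)) /st_coord /dt.
rewrite (derive_line (fun r : R => u r (chart_inv i (rsubmx w)))).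
apply: (congr1 (fun k : R -> R => 'D_(1 : R) k (0 : R))); apply/funext => h.
by rewrite st_row_time lsubmx_st_row rsubmx_st_row [h%:A]mulr1.
Qed.

Lemma smooth_dt I u : open I -> smooth_st I u -> smooth_st I (dt u).
Proof.
move=> oI su i.
apply: (@smooth_on_ext _ _ _ (partial time_index (st_coord u i)) _ (cylinder_open i oI)).
  by move=> w _; rewrite dt_coord.
exact: smooth_on_partial.
Qed.

Lemma cylinderP I i t v : I t -> chart_cod i v -> cylinder I i (st_row t v).
Proof. by move=> It Uv; rewrite /cylinder /= lsubmx_st_row rsubmx_st_row. Qed.

Lemma is_derive_dt I u t x : open I -> smooth_st I u -> I t ->
  is_derive t (1 : R) (fun r => u r x) (dt u t x).
Proof.
move=> oI su It; have [i [v [Uv <-]]] := chart_pointP x.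
have E : (fun r => u r (chart_inv i v)) =
    fun r => st_coord u i (r *: delta_mx 0 time_index + st_row 0 v).
  by apply/funext => r; rewrite st_row_time addr0 /st_coord lsubmx_st_row rsubmx_st_row.
have D : derivable (fun r => u r (chart_inv i v)) t 1.
  rewrite E; apply: (@ex_derive _ _ _ _ _ _ ('D_(delta_mx 0 time_index) (st_coord u i) (st_row t v))).
  apply: (@line_is_derive R _ (st_coord u i) (st_row 0 v) (delta_mx 0 time_index) t).
  rewrite st_row_time addr0; apply: derivableP.
  exact: (smooth_on_derivable (su i) (cylinderP It Uv)).
exact: derivableP.
Qed.

Lemma dtE u t x d : is_derive t (1 : R) (fun r => u r x) d -> dt u t x = d.
Proof. by move=> H; rewrite /dt (@derive_val _ _ _ _ _ _ _ H). Qed.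

(** The Laplacian in the space variables, as an operator on functions of N + 1 variables: its
    commutation with the time derivative is then the symmetry of second derivatives. *)
Definition st_laplace i (F : 'rV[R]_(1 + N) -> R) w : R :=
  (density i (rsubmx w))^-1 * \sum_a partial (rshift 1 a) (fun w => density i (rsubmx w) *
    \sum_b invmx (metric i (rsubmx w)) a b * partial (rshift 1 b) F w) w.

Lemma lap_coord I u i w : open I -> smooth_st I u -> cylinder I i w ->
  st_coord (fun t => lap (u t)) i w = st_laplace i (st_coord u i) w.
Proof.
move=> oI su [It Uw]; rewrite -[w]st_rowK; set t := lsubmx w 0 0; set v := rsubmx w.
rewrite /st_coord lsubmx_st_row rsubmx_st_row.
rewrite (lapE (smooth_st_slice oI It su) Uw) /st_laplace rsubmx_st_row.
#[local] Transparent laplace_coord.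
rewrite /laplace_coord; apply: (congr1 (fun z => (density i v)^-1 * z)).
apply: eq_bigr => a _; rewrite -partial_slice; congr (partial a _ v).
apply/funext => v'; rewrite rsubmx_st_row; apply: (congr1 (fun z => density i v' * z)).
apply: eq_bigr => b _; congr (_ * _); rewrite -partial_slice; congr (partial b _ v').
by apply/funext => v''; rewrite /st_coord lsubmx_st_row rsubmx_st_row.
Qed.

Lemma smooth_st_laplace I i F : open I -> smooth_on (cylinder I i) F ->
  smooth_on (cylinder I i) (st_laplace i F).
Proof.
move=> oI sF; have oC := cylinder_open i oI.
have sr := smooth_st_static oI (@smooth_density_chart R N M i).
have sh a b := smooth_st_static oI (smooth_inv_metric (cod_open i) (@chart_metric_smooth R N M i)
    (@chart_metricT R N M i) (@chart_metric_gt0 R N M i) a b).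
apply: (smooth_onM oC).
  by apply: (smooth_onV oC) sr => w [_ Uw]; rewrite gt_eqF// density_chart_gt0.
eapply smooth_on_sum; [exact oC|intros a]; apply: smooth_on_partial; apply: (smooth_onM oC sr).
eapply smooth_on_sum; [exact oC|intros b]; apply: (smooth_onM oC (sh a b)).
exact: smooth_on_partial.
Qed.

Lemma smooth_st_lap I u : open I -> smooth_st I u -> smooth_st I (fun t => lap (u t)).
Proof.
move=> oI su i.
apply: (@smooth_on_ext _ _ _ (st_laplace i (st_coord u i)) _ (cylinder_open i oI)).
  by move=> w Cw; rewrite (lap_coord oI su Cw).
exact: smooth_st_laplace.
Qed.

Lemma partial_time_static (F : 'rV[R]_N -> R) w :
  partial time_index (fun w => F (rsubmx w)) w = 0.
Proof.
rewrite -[w]st_rowK partialE (derive_line (fun w => F (rsubmx w))).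
rewrite (_ : (fun h => _) = fun=> F (rsubmx w)) ?derive_cst//.
by apply/funext => h; rewrite st_row_time !rsubmx_st_row.
Qed.

Lemma partial_time_static_mul U (F : 'rV[R]_N -> R) G w : smooth_on U (fun w => F (rsubmx w)) ->
  smooth_on U G -> U w ->
  partial time_index (fun w => F (rsubmx w) * G w) w = F (rsubmx w) * partial time_index G w.
Proof.
move=> sF sG Uw; rewrite (partialM time_index sF sG Uw) partial_time_static mul0r add0r.
by rewrite ?addr0.
Qed.

Lemma partial_time_laplace I i F w : open I -> smooth_on (cylinder I i) F -> cylinder I i w ->
  partial time_index (st_laplace i F) w = st_laplace i (partial time_index F) w.
Proof.
move=> oI sF Cw; have oC := cylinder_open i oI.
have sr := smooth_st_static oI (@smooth_density_chart R N M i).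
have sh a b := smooth_st_static oI (smooth_inv_metric (cod_open i) (@chart_metric_smooth R N M i)
    (@chart_metricT R N M i) (@chart_metric_gt0 R N M i) a b).
have srV : smooth_on (cylinder I i) (fun w => (density i (rsubmx w))^-1).
  by apply: (smooth_onV oC) sr => w' [_ Uw]; rewrite gt_eqF// density_chart_gt0.
have sp b : smooth_on (cylinder I i) (partial (rshift 1 b) F) by exact: smooth_on_partial.
have shp a b : smooth_on (cylinder I i)
    (fun w => invmx (metric i (rsubmx w)) a b * partial (rshift 1 b) F w).
  exact: (smooth_onM oC (sh a b) (sp b)).
have sS a : smooth_on (cylinder I i)
    (fun w => \sum_b invmx (metric i (rsubmx w)) a b * partial (rshift 1 b) F w).
  eapply smooth_on_sum; [exact oC|intros b; exact: shp].
have sH a := smooth_onM oC sr (sS a).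
have sPH a := smooth_on_partial (rshift 1 a) (sH a).
have sT : smooth_on (cylinder I i) (fun w => \sum_a partial (rshift 1 a) (fun w => density i (rsubmx w) *
    \sum_b invmx (metric i (rsubmx w)) a b * partial (rshift 1 b) F w) w).
  eapply smooth_on_sum; [exact oC|intros a; exact: sPH].
apply: etrans (partial_time_static_mul (F := fun v => (density i v)^-1) srV sT Cw) _.
apply: (congr1 (fun z => (density i (rsubmx w))^-1 * z)).
apply: etrans (partial_sum _ _ _ oC sPH Cw) _.
apply: eq_bigr => a _.
apply: etrans (smooth_onC _ _ oC (sH a) Cw) _.
apply: (partial_ext _ oC) Cw => w' Cw'.
apply: etrans (partial_time_static_mul sr (sS a) Cw') _.
apply: (congr1 (fun z => density i (rsubmx w') * z)).
apply: etrans (partial_sum _ _ _ oC (shp a) Cw') _.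
apply: eq_bigr => b _.
apply: etrans (partial_time_static_mul (F := fun v => invmx (metric i v) a b) (sh a b) (sp b) Cw') _.
by apply: (congr1 (fun z => _ * z)); exact: (smooth_onC _ _ oC sF Cw').
Qed.

Lemma dt_lap I u t x : open I -> smooth_st I u -> I t ->
  dt (fun r => lap (u r)) t x = lap (dt u t) x.
Proof.
move=> oI su It; have [i [v [Uv xE]]] := chart_pointP x.
have Cw := cylinderP It Uv.
have E k : st_coord k i (st_row t v) = k t x.
  by rewrite /st_coord lsubmx_st_row rsubmx_st_row xE.
rewrite -E dt_coord -[RHS](E (fun t => lap (dt u t))).
rewrite (lap_coord oI (smooth_dt oI su) Cw).
have -> : st_coord (dt u) i = partial time_index (st_coord u i).
  by apply/funext => w; exact: dt_coord.
rewrite -(partial_time_laplace oI (su i) Cw).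
by apply: (partial_ext _ (cylinder_open i oI)) Cw => w Cw; exact: (lap_coord oI su Cw).
Qed.

End space_time.

Arguments cylinder_open {R N M I} i _.

#[local] Transparent grad_coord gamma_coord christoffel laplace_coord ricci_form.

Section monotonicity.
Context {R : realType}.
Implicit Types (f df : R -> R) (a b s t : R).

Lemma derive_mean_value f df a b s t :
  (forall r, a < r < b -> is_derive r (1 : R) f (df r)) -> a < s -> s < t -> t < b ->
  exists2 c, s < c < t & f t - f s = df c * (t - s).
Proof.
move=> Hf as_ st tb.
have D r : r \in `]s, t[ -> is_derive r (1 : R) f (df r).
  by rewrite in_itv /= => /andP[sr rt]; apply: Hf; rewrite (lt_trans as_)// (lt_trans rt).
have [|c + ->] := MVT st D; last by rewrite in_itv /= => cst; exists c.
apply: continuous_in_subspaceT => r; rewrite inE /= in_itv /= => /andP[sr rt].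
apply/differentiable_continuous/derivable1_diffP.
have arb : a < r < b by rewrite (lt_le_trans as_)// (le_lt_trans rt).
exact: (@ex_derive _ _ _ _ _ _ _ (Hf r arb)).
Qed.

Lemma derive_le0_nincr f df a b : (forall r, a < r < b -> is_derive r (1 : R) f (df r)) ->
  (forall r, a < r < b -> df r <= 0) ->
  forall s t, a < s -> s <= t -> t < b -> f t <= f s.
Proof.
move=> Hf df0 s t as_ st tb; move: st; rewrite le_eqVlt => /predU1P[->//|st].
have [c /andP[sc ct] E] := derive_mean_value Hf as_ st tb.
rewrite -subr_le0 E mulr_le0_ge0 ?subr_ge0 ?(ltW st)// df0//.
by rewrite (lt_trans as_)// (lt_trans ct).
Qed.

Lemma derive_0_cst f a b : (forall r, a < r < b -> is_derive r (1 : R) f (0 : R)) ->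
  forall s t, a < s < b -> a < t < b -> f s = f t.
Proof.
move=> Hf; have H s t : a < s -> s <= t -> t < b -> f s = f t.
  move=> as_; rewrite le_eqVlt => /predU1P[->//|st] tb.
  have [c _ /eqP] := derive_mean_value (df := fun=> 0) Hf as_ st tb.
  by rewrite mul0r subr_eq0 => /eqP.
move=> s t /andP[as_ sb] /andP[at_ tb].
by have [st|/ltW ts] := leP s t; [exact: H|apply/esym/H].
Qed.

Lemma derive_lipschitz f df a b C : (forall r, a < r < b -> is_derive r (1 : R) f (df r)) ->
  (forall r, a < r < b -> `|df r| <= C) ->
  forall s t, a < s < b -> a < t < b -> `|f t - f s| <= C * `|t - s|.
Proof.
move=> Hf dfC; have H s t : a < s -> s <= t -> t < b -> `|f t - f s| <= C * `|t - s|.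
  move=> as_; rewrite le_eqVlt => /predU1P[->|st] tb; first by rewrite !subrr normr0 mulr0.
  have [c /andP[sc ct] ->] := derive_mean_value Hf as_ st tb.
  by rewrite normrM ler_wpM2r// dfC// (lt_trans as_)// (lt_trans ct).
move=> s t /andP[as_ sb] /andP[at_ tb].
have [st|/ltW ts] := leP s t; first exact: H.
by rewrite distrC [X in _ * X]distrC; exact: H.
Qed.

End monotonicity.

Section space_time_integral.
Context {R : realType} {N : nat} (M : riemannianManifold R N).
Hypothesis M_closed : compact [set: M].
Implicit Types (i : chart_index M) (u k w : R -> M -> R) (I : set R).

Lemma smooth_st_continuous I u t x : open I -> smooth_st I u -> I t ->
  {for (t, x), continuous (fun z : R * M => u z.1 z.2)}.
Proof.
move=> oI su It; pose i := chart_at x.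
have dx : chart_dom i x := chart_atP x.
pose Phi (z : R * M) := st_row z.1 (chart i z.2).
have nx : \forall z \near (t, x), u z.1 z.2 = (st_coord u i \o Phi) z.
  have : \forall y \near x, chart_dom i y.
    exact: (open_nbhs_nbhs (conj (@chart_dom_open _ _ _ i) dx)).
  move=> dn; near=> z.
  rewrite /= /st_coord /Phi lsubmx_st_row rsubmx_st_row chartK//.
  near: z; apply: (@cvg_snd _ _ (nbhs t) (nbhs x)); exact: dn.
apply: (near_eq_continuous (f := st_coord u i \o Phi)).
  by apply: filterS nx => y ->.
apply: continuous_comp; last first.
  by apply: (smooth_on_continuous (su i)); apply: cylinderP => //; exact: chart_dom_cod.
apply: rV_continuous => b; case: (split_ordP b) => [a|a] ->.
  rewrite (_ : (fun s => _) = fun z : R * M => z.1); first exact: cvg_fst.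
  by apply/funext => z; rewrite /Phi /st_row row_mxEl mxE.
rewrite (_ : (fun s => _) = (fun v : 'rV[R]_N => v 0 a) \o (chart i) \o (fun z : R * M => z.2)).
  apply: continuous_comp; first exact: cvg_snd.
  apply: continuous_comp; first exact: chart_continuous.
  exact: coord_continuous.
by apply/funext => z; rewrite /Phi /st_row row_mxEr.
Unshelve. all: by end_near. Qed.

Lemma smooth_st_bounded I u a b : open I -> smooth_st I u -> (forall r, a <= r <= b -> I r) ->
  exists2 C : R, 0 <= C & forall r x, a <= r <= b -> `|u r x| <= C.
Proof.
move=> oI su HI.
have cK : compact (`[a, b]%classic `*` [set: M]).
  by apply: compact_setX => //; exact: segment_compact.
have cf : {within (`[a, b]%classic `*` [set: M]), continuous (fun z : R * M => u z.1 z.2)}.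
  apply: continuous_in_subspaceT => -[r x]; rewrite inE => -[/= rab _].
  by apply: (smooth_st_continuous (x := x) oI su); apply: HI; rewrite in_itv in rab.
have /compact_bounded[C [_ HC]] := continuous_compact cf cK.
exists (`|C| + 1) => // r x rab; apply: (HC (`|C| + 1)); first by rewrite ltr_pwDr// ler_norm.
by exists (r, x) => //; split => //=; rewrite in_itv.
Qed.

Lemma open_interval_nbhs I t : open I -> I t ->
  exists2 d : R, 0 < d & forall r, t - d <= r <= t + d -> I r.
Proof.
move=> oI It; have /nbhs_ballP[e /= e0 He] : nbhs t I by exact: open_nbhs_nbhs.
exists (e / 2) => [|r]; first by rewrite divr_gt0.
rewrite -ler_distl => rt; apply: He; rewrite -ball_normE /= distrC.
by apply: le_lt_trans rt _; rewrite ltr_pdivrMr// ltr_pMr// ltr1n.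
Qed.

Variable vol : {measure set (borel M) -> \bar R}.
Hypothesis vol_riemannian : riemannian_volume vol.
Local Notation Int f := (\int[vol]_(x in setT) f x).

Lemma bm_st I u t : open I -> smooth_st I u -> I t -> bm (u t : borel M -> R).
Proof. by move=> oI su It; apply: bm_smooth M_closed _ _; exact: smooth_st_slice su. Qed.

Lemma derive_Int_st I u t : open I -> smooth_st I u -> I t ->
  is_derive t (1 : R) (fun r => Int (u r)) (Int (dt u t)).
Proof.
move=> oI su It; have [d d0 Hd] := open_interval_nbhs oI It.
have sdu := smooth_dt oI su.
have [C C0 HC] := smooth_st_bounded oI sdu Hd.
have Hd' r : t - d < r < t + d -> I r by move=> /andP[/ltW ? /ltW ?]; apply: Hd; apply/andP.
apply: (derive_Int (vol_lty M_closed vol_riemannian) (a := t - d) (b := t + d) (C := C)).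
- by rewrite ltrBlDr ltrDl.
- by rewrite ltrDl.
- by move=> r /Hd' Ir; exact: (bm_st oI su).
- by move=> r x /Hd' Ir; exact: (is_derive_dt x oI su).
- by move=> r x /andP[/ltW ? /ltW ?]; apply: HC; apply/andP.
Qed.

(** Since P solves the backward equation and the Laplacian is symmetric, only the heat operator
    applied to w survives. Reproduction, the entropy formula and the Fisher information formula are
    instances. *)
Lemma derive_duality I P w t : open I -> smooth_st I P -> smooth_st I w -> I t ->
  (forall x, dt P t x = - lap (P t) x) ->
  is_derive t (1 : R) (fun r => Int (fun x => P r x * w r x))
    (Int (fun x => P t x * (dt w t x - lap (w t) x))).
Proof.
move=> oI sP sw It PE.
have sPw := smooth_stM oI sP sw.
have sPt := smooth_st_slice oI It sP; have swt := smooth_st_slice oI It sw.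
have sdw := smooth_st_slice oI It (smooth_dt oI sw).
apply: (is_derive_eq (derive_Int_st oI sPw It)).
have E : dt (fun r x => P r x * w r x) t = fun x => P t x * dt w t x - w t x * lap (P t) x.
  apply/funext => x; apply: dtE.
  have d1 := is_derive_dt x oI sP It; have d2 := is_derive_dt x oI sw It.
  by apply: (is_derive_eq (is_deriveM d1 d2)); rewrite PE /GRing.scale /=; ring.
rewrite E; have V := vol_lty M_closed vol_riemannian.
have b1 : bm (fun x : borel M => P t x * dt w t x).
  by apply: bm_smooth M_closed _ _; smooth_fun.
have b2 : bm (fun x : borel M => w t x * lap (P t) x).
  by apply: bm_smooth M_closed _ _; smooth_fun.
have b3 : bm (fun x : borel M => P t x * lap (w t) x).
  by apply: bm_smooth M_closed _ _; smooth_fun.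
rewrite (IntB V b1 b2) (lap_symmetric M_closed vol_riemannian swt sPt) -(IntB V b1 b3).
by apply: eq_Rintegral => x _; rewrite mulrBr.
Qed.

End space_time_integral.

Section dt_rules.
Context {R : realType} {N : nat} (M : riemannianManifold R N).
Implicit Types (u k w : R -> M -> R) (I : set R).

Lemma dt_ext I u k t x : open I -> I t -> (forall r, I r -> u r x = k r x) ->
  dt u t x = dt k t x.
Proof.
move=> oI It E; apply: near_eq_derive.
by apply: filterS (open_nbhs_nbhs (conj oI It)) => r; exact: E.
Qed.

Lemma dtM I u k t x : open I -> smooth_st I u -> smooth_st I k -> I t ->
  dt (fun r y => u r y * k r y) t x = u t x * dt k t x + k t x * dt u t x.
Proof.
move=> oI su sk It; apply: dtE.
by apply: (is_derive_eq (is_deriveM (is_derive_dt x oI su It) (is_derive_dt x oI sk It))).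
Qed.

Lemma dtB I u k t x : open I -> smooth_st I u -> smooth_st I k -> I t ->
  dt (fun r y => u r y - k r y) t x = dt u t x - dt k t x.
Proof.
move=> oI su sk It; apply: dtE.
exact: (is_deriveB (is_derive_dt x oI su It) (is_derive_dt x oI sk It)).
Qed.

Lemma dtZ I (a : R) u t x : open I -> smooth_st I u -> I t ->
  dt (fun r y => a * u r y) t x = a * dt u t x.
Proof.
move=> oI su It; apply: dtE; exact: (is_deriveZ _ (is_derive_dt x oI su It)).
Qed.

Lemma smooth_st_gam I u k : open I -> smooth_st I u -> smooth_st I k ->
  smooth_st I (fun t => gam (u t) (k t)).
Proof.
move=> oI su sk; rewrite gam.unlock; apply: (smooth_stM oI); first exact: smooth_st_cst.
apply: (smooth_stB oI); last first.
  by apply: (smooth_stM oI sk); exact: smooth_st_lap.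
apply: (smooth_stB oI); last by apply: (smooth_stM oI su); exact: smooth_st_lap.
by apply: (smooth_st_lap oI); exact: smooth_stM.
Qed.

Lemma dt_gam I u k t x : open I -> smooth_st I u -> smooth_st I k -> I t ->
  dt (fun r => gam (u r) (k r)) t x = gam (dt u t) (k t) x + gam (u t) (dt k t) x.
Proof.
move=> oI su sk It.
have suk := smooth_stM oI su sk.
have sLuk := smooth_st_lap oI suk.
have sLu := smooth_st_lap oI su; have sLk := smooth_st_lap oI sk.
have suLk := smooth_stM oI su sLk; have skLu := smooth_stM oI sk sLu.
have sut := smooth_st_slice oI It su; have skt := smooth_st_slice oI It sk.
have sdu := smooth_st_slice oI It (smooth_dt oI su).
have sdk := smooth_st_slice oI It (smooth_dt oI sk).
rewrite gam.unlock.
have s1 := smooth_stB oI sLuk suLk; have s2 := smooth_stB oI s1 skLu.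
apply: etrans (dtZ 2^-1 x oI s2 It) _.
rewrite (dtB x oI s1 skLu It) (dtB x oI sLuk suLk It).
rewrite (dtM x oI su sLk It) (dtM x oI sk sLu It).
rewrite (dt_lap x oI suk It) (dt_lap x oI su It) (dt_lap x oI sk It).
have -> : dt (fun r y => u r y * k r y) t = fun y => u t y * dt k t y + k t y * dt u t y.
  by apply/funext => y; exact: (dtM y oI su sk It).
rewrite (lapD x (smooth_functionM sut sdk) (smooth_functionM skt sdu)).
rewrite (_ : (fun y => k t y * dt u t y) = fun y => dt u t y * k t y); last first.
  by apply/funext => y; exact: mulrC.
move: (lap _ x) (lap _ x) (lap _ x) (lap _ x) (lap _ x) (lap _ x) => *; ring.
Qed.

End dt_rules.

Section positive_times.
Context {R : realType}.

Definition positive_times : set R := [set t : R | 0 < t].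

Lemma open_positive : open positive_times.
Proof. exact: open_gt. Qed.

Lemma cvg_at_right_unique (h : R -> R) (l : R) (a b : R) : 0 < b ->
  (forall r, 0 < r < b -> h r = a) -> h r @[r --> 0^'+] --> l -> l = a.
Proof.
move=> b0 ha hl.
have N0 : \forall r \near 0^'+, cst a r = h r.
  near=> r; apply/esym/ha/andP.
  by split; near: r; [exact: nbhs_right_gt|exact: nbhs_right_lt].
have hl' : h r @[r --> 0^'+] --> a by exact: cvg_trans (near_eq_cvg N0) (cvg_cst a).
exact: (cvg_unique (@Rhausdorff R) hl hl').
Unshelve. all: by end_near. Qed.

End positive_times.

#[local] Opaque grad_coord gamma_coord christoffel laplace_coord ricci_form.

Section smooth_ricci.
Context {R : realType} {N : nat}.
Variables (g : 'rV[R]_N -> 'M[R]_N) (U : set 'rV[R]_N).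
Hypothesis oU : open U.
Hypothesis sg : forall a b, smooth_on U (fun u => g u a b).
Hypothesis gT : forall u, U u -> (g u)^T = g u.
Hypothesis gpos : forall u (v : 'rV[R]_N), U u -> v != 0 ->
  0 < (v *m g u *m v^T) 0 0.

Lemma abs_mul_le (x y A B : R) : x ^+ 2 <= A -> y ^+ 2 <= B -> `|x| * `|y| <= A + B.
Proof.
rewrite -[x ^+ 2]real_normK ?num_real// -[y ^+ 2]real_normK ?num_real//.
have := normr_ge0 x; have := normr_ge0 y; move: `|x| `|y| => {}x {}y y0 x0 xA yB.
have := sqr_ge0 (x - y); have := mulr_ge0 x0 y0; rewrite sqrrB -mulr_natr; lra.
Qed.

Lemma smooth_ricci_coord c d : smooth_on U (ricci_coord g c d).
Proof.
have sG a b e := smooth_christoffel oU sg gT gpos a b e.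
rewrite /ricci_coord; eapply smooth_on_sum; [exact oU|intros a].
rewrite /riemann_coord; apply: (smooth_onD oU).
  by apply: (smooth_onB oU); exact: smooth_on_partial.
eapply smooth_on_sum; [exact oU|intros l].
by apply: (smooth_onB oU); exact: (smooth_onM oU).
Qed.

Lemma smooth_ricci_up a b : smooth_on U (ricci_up g a b).
Proof.
have sh a' b' := smooth_inv_metric oU sg gT gpos a' b'.
rewrite /ricci_up; eapply smooth_on_sum; [exact oU|intros c].
eapply smooth_on_sum; [exact oU|intros d].
apply: (smooth_onM oU) (sh _ _); apply: (smooth_onM oU (sh _ _)).
exact: smooth_ricci_coord.
Qed.

Definition ricci_quad (u : 'rV[R]_N) (p : 'I_N -> R) : R :=
  \sum_a \sum_b ricci_up g a b u * p a * p b.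

(** This bounds Ric from below in the Li-Yau estimate, makes Ric + K g nonnegative in
    [ricci_chart_lower], and provides dominating constants. *)
Lemma ricci_quad_le c r : in_ball c r `<=` U ->
  exists2 K : R, 0 <= K & forall u p, in_ball c r u -> `|ricci_quad u p| <= K * cometric g u p p.
Proof.
move=> BU.
have HC a b : exists C : R, 0 <= C /\ forall u, in_ball c r u -> `|ricci_up g a b u| <= C.
  by have [C C0 H] := smooth_bounded_ball BU (smooth_ricci_up a b); exists C.
have HD a : exists C : R, 0 <= C /\ forall u, in_ball c r u -> `|g u a a| <= C.
  by have [C C0 H] := smooth_bounded_ball BU (sg a a); exists C.
pose C a := projT1 (choice (HC a)).
have HC' a b : 0 <= C a b /\ forall u, in_ball c r u -> `|ricci_up g a b u| <= C a b.
  exact: (projT2 (choice (HC a)) b).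
have [D {}HD] := choice HD.
exists (\sum_a \sum_b C a b * (D a + D b)).
  by do 2!(apply: sumr_ge0 => ? _); rewrite mulr_ge0 ?addr_ge0 ?(HC' _ _).1 ?(HD _).1.
move=> u p uB; have Uu := BU _ uB; rewrite /ricci_quad mulr_suml.
apply: le_trans (ler_norm_sum _ _ _) _; apply: ler_sum => a _; rewrite mulr_suml.
apply: le_trans (ler_norm_sum _ _ _) _; apply: ler_sum => b _.
have c0 := cometric_ge0 gT gpos p Uu.
have pa e : p e ^+ 2 <= D e * cometric g u p p.
  apply: le_trans (coord_cometric_le gT gpos p e Uu) _; rewrite ler_wpM2r//.
  exact: le_trans (ler_norm _) ((HD e).2 _ uB).
rewrite -mulrA !normrM -mulrA ler_pM ?mulr_ge0 ?(HC' a b).2//.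
by rewrite mulrDl abs_mul_le.
Qed.

End smooth_ricci.

(** * The Ricci form averaged over charts *)

Section averaged_ricci.
Context {R : realType} {N : nat} (M : riemannianManifold R N).
Hypothesis M_closed : compact [set: M].

Record unity_partition := UnityPartition {
  up_size : nat ;
  up_center : 'I_up_size -> M ;
  up_radius : 'I_up_size -> R ;
  up_fun : 'I_up_size -> M -> R ;
  up_bump : forall k, bump_radius (up_center k) (up_radius k) ;
  up_smooth : forall k, smooth_function (up_fun k) ;
  up_ge0 : forall k x, 0 <= up_fun k x ;
  up_out : forall k x, ~ chart_ball (up_center k) (2 * up_radius k) x -> up_fun k x = 0 ;
  up_sum : forall x, \sum_k up_fun k x = 1 }.

Variable D : unity_partition.
Local Notation chi := (@up_fun D).
Definition up_chart (k : 'I_(up_size D)) : chart_index M := chart_at (up_center k).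
Definition up_ball (k : 'I_(up_size D)) : set 'rV[R]_N :=
  in_ball (chart_point (up_center k)) (2 * up_radius k).

Lemma up_ball_cod k : up_ball k `<=` chart_cod (up_chart k).
Proof. exact: (up_bump k).2. Qed.

Lemma up_inv_out k u : chart_cod (up_chart k) u -> ~ up_ball k u ->
  chi k (chart_inv (up_chart k) u) = 0.
Proof.
move=> Uu nu; apply: up_out => -[v vB vE]; apply: nu.
by rewrite -(chart_invK Uu) -vE chart_invK//; exact: up_ball_cod.
Qed.

Definition covector (i : chart_index M) (f : M -> R) (u : 'rV[R]_N) (a : 'I_N) : R :=
  partial a (f \o chart_inv i) u.

Definition chi_ricci (k : 'I_(up_size D)) (f : M -> R) : M -> R :=
  chart_ext (up_chart k) (fun u => (chi k (chart_inv (up_chart k) u)) *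
    ricci_quad (metric (up_chart k)) u (covector (up_chart k) f u)).

(** Ric(grad f, grad f), assembled from coordinate expressions by a partition of unity. The bounds
    in use hold in every chart and so pass to the average, which spares a discussion of how Ric
    transforms. *)
Definition ricci_avg (f : M -> R) (x : M) : R := \sum_k chi_ricci k f x.

Lemma smooth_chi_ricci k f : smooth_function f -> smooth_function (chi_ricci k f).
Proof.
move=> sf; set i := up_chart k.
pose F u := chi k (chart_inv i u) * ricci_quad (metric i) u (covector i f u).
pose F' u := if `[< chart_cod i u >] then F u else 0.
have -> : chi_ricci k f = chart_ext i F'.
  apply/funext => x; rewrite /chi_ricci /chart_ext; case: asboolP => // dx.
  by rewrite /F' asboolT//; exact: chart_dom_cod.
apply: (chart_ext_smooth (@up_ball_cod k)); last first.
  move=> u nu; rewrite /F'; case: asboolP => // Uu.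
  by rewrite /F up_inv_out ?mul0r.
have oU := cod_open i.
apply: (@smooth_on_ext _ _ _ F _ oU) => [u Uu|]; first by rewrite /F' asboolT.
apply: (smooth_onM oU (@up_smooth D k i)).
eapply smooth_on_sum; [exact oU|intros a]; eapply smooth_on_sum; [exact oU|intros b].
apply: (smooth_onM oU); last exact: (smooth_on_partial b (sf i)).
apply: (smooth_onM oU); last exact: (smooth_on_partial a (sf i)).
exact: (smooth_ricci_up oU (@chart_metric_smooth R N M i)
    (@chart_metricT R N M i) (@chart_metric_gt0 R N M i)).
Qed.

Lemma smooth_ricci_avg f : smooth_function f -> smooth_function (ricci_avg f).
Proof. by move=> sf; apply: smooth_function_sum => k; exact: smooth_chi_ricci. Qed.

Lemma chi_ricciE k f u : chart_cod (up_chart k) u ->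
  chi_ricci k f (chart_inv (up_chart k) u) = chi k (chart_inv (up_chart k) u) *
    ricci_quad (metric (up_chart k)) u (covector (up_chart k) f u).
Proof. by move=> Uu; rewrite /chi_ricci chart_extE. Qed.

Lemma up_cases k x : chi k x = 0 \/ exists2 u, up_ball k u & chart_inv (up_chart k) u = x.
Proof.
have [[u uB uE]|/up_out ->] := pselect (chart_ball (up_center k) (2 * up_radius k) x); last by left.
by right; exists u.
Qed.

Lemma ricci_avg_le f x (lambda : R) : smooth_function f ->
  ricci_avg f x <= 2^-1 * lap (gam f f) x - gam f (lap f) x
    + 2 * lambda * lap f x + N%:R * lambda ^+ 2.
Proof.
move=> sf; set Y := _ + _; rewrite -[Y]mul1r -(up_sum D x) mulr_suml; apply: ler_sum => k _.
have [c0|[u uB ux]] := up_cases k x.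
  rewrite c0 mul0r /chi_ricci /chart_ext; case: asboolP => // dx.
  by rewrite chartK// c0 mul0r.
have Uu := up_ball_cod uB; rewrite -ux (chi_ricciE f Uu) ler_wpM2l ?up_ge0// /Y -ux.
exact: curvature_dimension.
Qed.

Lemma ricci_quad_bound : exists2 K : R, 0 <= K & forall k u p, up_ball k u ->
  `|ricci_quad (metric (up_chart k)) u p| <= K * cometric (metric (up_chart k)) u p p.
Proof.
have H k : exists K : R, 0 <= K /\ forall u p, up_ball k u ->
  `|ricci_quad (metric (up_chart k)) u p| <= K * cometric (metric (up_chart k)) u p p.
  have [K K0 HK] := ricci_quad_le (cod_open (up_chart k)) (@chart_metric_smooth R N M (up_chart k))
    (@chart_metricT R N M (up_chart k)) (@chart_metric_gt0 R N M (up_chart k)) (@up_ball_cod k).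
  by exists K.
have [K HK] := choice H.
exists (\sum_k K k) => [|k u p uB]; first by apply: sumr_ge0 => k _; exact: (HK k).1.
apply: le_trans ((HK k).2 u p uB) _; rewrite ler_wpM2r//.
  apply: (cometric_ge0 (@chart_metricT R N M (up_chart k)) (@chart_metric_gt0 R N M (up_chart k))).
  exact: up_ball_cod.
rewrite [leRHS](bigD1 k)//= lerDl; apply: sumr_ge0 => l _; exact: (HK l).1.
Qed.

Lemma gam_cometric i f u : smooth_function f -> chart_cod i u ->
  gam f f (chart_inv i u) = cometric (metric i) u (covector i f u) (covector i f u).
Proof. by move=> sf Uu; rewrite (gamE sf sf Uu). Qed.

Lemma ricci_avg_norm : exists2 K : R, 0 <= K & forall f x, smooth_function f ->
  `|ricci_avg f x| <= K * gam f f x.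
Proof.
have [K K0 HK] := ricci_quad_bound; exists K => // f x sf.
rewrite -[_ * _]mul1r -(up_sum D x) mulr_suml; apply: le_trans (ler_norm_sum _ _ _) _.
apply: ler_sum => k _; have [c0|[u uB ux]] := up_cases k x.
  rewrite c0 mul0r /chi_ricci /chart_ext; case: asboolP => [dx|_]; last by rewrite normr0.
  by rewrite chartK// c0 mul0r normr0.
have Uu := up_ball_cod uB; rewrite -ux (chi_ricciE f Uu) normrM ger0_norm ?up_ge0//.
by rewrite ler_wpM2l ?up_ge0// (gam_cometric sf Uu) HK.
Qed.

End averaged_ricci.

#[local] Transparent grad_coord gamma_coord christoffel laplace_coord ricci_form.

(** * The differential inequality behind the Li-Yau bound *)

Section liyau_weight.
Context {R : realType}.
Implicit Types (K nu q m s : R).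

(** The integral over 0 <= r <= s of 2 r q + 2 K r^2 q + (nu/2) m (1 + K r)^2, the right side left
    by the weight r^2 in [liyau_integrated]. Here q stands for the time derivative of u, m for u and
    nu for the dimension. *)
Definition liyau_poly K nu q m s : R :=
  s * s * q + 2 * K / 3 * (s * s * s) * q + nu / 2 * m * (s + K * (s * s) + K ^+ 2 / 3 * (s * s * s)).

Lemma is_derive_liyau_poly K nu q m (a r : R) :
  is_derive r (1 : R) (fun r => liyau_poly K nu q m (r - a))
    (2 * (r - a) * q + 2 * K * (r - a) ^+ 2 * q + nu / 2 * m * (1 + K * (r - a)) ^+ 2).
Proof.
have d1 : is_derive r (1 : R) (fun r => r - a) 1.
  by apply: (is_derive_eq (is_deriveB (is_derive_id r 1) (is_derive_cst a r 1))); rewrite subr0.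
have d2 := is_deriveM d1 d1; have d3 := is_deriveM d2 d1.
have e1 := is_deriveM d2 (is_derive_cst q r 1).
have e2 := is_deriveM d3 (is_derive_cst (2 * K / 3 * q) r 1).
have e3 := is_deriveM (is_derive_cst (nu / 2 * m) r 1) (is_deriveD (is_deriveD d1
   (is_deriveM (is_derive_cst K r 1) d2)) (is_deriveM (is_derive_cst (K ^+ 2 / 3) r 1) d3)).
have e := is_deriveD (is_deriveD e1 e2) e3.
have -> : (fun r => liyau_poly K nu q m (r - a)) =
    (fun r => (r - a) * (r - a) * q + (r - a) * (r - a) * (r - a) * (2 * K / 3 * q)
    + nu / 2 * m * ((r - a) + K * ((r - a) * (r - a)) + K ^+ 2 / 3 * ((r - a) * (r - a) * (r - a)))).
  by apply/funext => s; rewrite /liyau_poly; ring.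
apply: (is_derive_eq e); rewrite !fctE /GRing.scale /=; by field.
Qed.

(** The difference W of the two sides vanishes at a and has derivative at most 0: the weight (r -
    a)^2 makes the inequality for j independent of j. *)
Lemma liyau_integrated K nu q m (c : R) (j j' : R -> R) :
  (forall r, 0 < r < c -> is_derive r (1 : R) j (j' r)) ->
  (forall r lambda, 0 < r < c ->
     j' r <= 2 * K * j r + 4 * lambda * (q - j r) + 2 * nu * lambda ^+ 2 * m) ->
  forall a r, 0 < a -> a < r -> r < c ->
  (r - a) ^+ 2 * j r <= liyau_poly K nu q m (r - a).
Proof.
move=> dj jle a r a0 ar rc.
pose W r := (r - a) * (r - a) * j r - liyau_poly K nu q m (r - a).
pose W' r := 2 * (r - a) * j r + (r - a) ^+ 2 * j' r -
  (2 * (r - a) * q + 2 * K * (r - a) ^+ 2 * q + nu / 2 * m * (1 + K * (r - a)) ^+ 2).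
have dW s : 0 < s < c -> is_derive s (1 : R) W (W' s).
  move=> sc.
  have d1 : is_derive s (1 : R) (fun r => r - a) 1.
    by apply: (is_derive_eq (is_deriveB (is_derive_id s 1) (is_derive_cst a s 1))); rewrite subr0.
  have e := is_deriveB (is_deriveM (is_deriveM d1 d1) (dj s sc)) (is_derive_liyau_poly K nu q m a s).
  by apply: (is_derive_eq e); rewrite !fctE /GRing.scale /= /W'; ring.
have [s /andP[as_ sr]] := derive_mean_value dW a0 ar rc.
have -> : W a = 0 by rewrite /W subrr /liyau_poly; ring.
rewrite subr0 => E.
suff : W r <= 0 by rewrite /W subr_le0 expr2.
rewrite E mulr_le0_ge0 ?subr_ge0 ?(ltW ar)//.
have x0 : 0 < s - a by rewrite subr_gt0.
have sc : 0 < s < c by rewrite (lt_trans a0 as_) (lt_trans sr rc).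
(* This lambda cancels every term in j: the weight contributes 2 x y, the Ricci bound 2 K x^2 y, and
   -4 lambda x^2 y removes both. *)
have := jle s ((2 * (s - a))^-1 + K / 2) sc.
move: x0; rewrite /W'; move: (s - a) (j s) (j' s) => x y y' x0 H.
have x2 : 0 <= x ^+ 2 by rewrite exprn_ge0// ltW.
have := ler_wpM2l x2 H.
have -> : x ^+ 2 * (2 * K * y + 4 * ((2 * x)^-1 + K / 2) * (q - y) + 2 * nu * ((2 * x)^-1 + K / 2) ^+ 2 * m) =
   2 * x * q + 2 * K * x ^+ 2 * q + nu / 2 * m * (1 + K * x) ^+ 2 - 2 * x * y.
  by field; rewrite gt_eqF.
lra.
Qed.

Lemma ge0_left_limit (f : R -> R) (c : R) : 0 < c -> {for c, continuous f} ->
  (forall s, 0 < s < c -> 0 <= f s) -> 0 <= f c.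
Proof.
move=> c0 cf f0; rewrite leNgt; apply/negP => fc.
have e0 : 0 < - f c by rewrite oppr_gt0.
have /cvgrPdist_lt/(_ _ e0)/nbhs_ballP[d /= d0 Hd] := cf.
pose s := c - Num.min c d / 2.
have m0 : 0 < Num.min c d by rewrite lt_min c0 d0.
have mc : Num.min c d <= c by rewrite ge_min lexx.
have md : Num.min c d <= d by rewrite ge_min lexx orbT.
have sc : 0 < s < c by rewrite /s; apply/andP; split; lra.
have : ball c d s.
  by rewrite -ball_normE /= /s opprB addrC subrK ger0_norm; lra.
move=> /Hd /=; rewrite ltr_norml => /andP[H1 H2]; have := f0 s sc; lra.
Qed.

Lemma liyau_poly_limit K nu q m (c j : R) : 0 < c ->
  (forall s : R, 0 < s < c -> s ^+ 2 * j <= liyau_poly K nu q m s) -> c ^+ 2 * j <= liyau_poly K nu q m c.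
Proof.
move=> c0 H; have e := is_deriveB (is_derive_liyau_poly K nu q m 0 c)
  (is_deriveM (is_deriveM (is_derive_id c 1) (is_derive_id c 1)) (is_derive_cst j c 1)).
have C : {for c, continuous (fun s => liyau_poly K nu q m (s - 0) - s * s * j)}.
  by apply/differentiable_continuous/derivable1_diffP; exact: (@ex_derive _ _ _ _ _ _ _ e).
rewrite expr2 -subr_ge0 -[c in liyau_poly _ _ _ _ c]subr0.
by apply: (ge0_left_limit c0 C) => r rc; rewrite subr0 subr_ge0 -expr2 H.
Qed.

End liyau_weight.

Section line_calculus.
Context {R : realType} {N : nat} (M : riemannianManifold R N).
Implicit Types (i : chart_index M) (f : R -> M -> R) (I : set R).

Lemma unity_partition_exists (M_closed : compact [set: M]) (W : M -> set 'rV[R]_N) :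
  (forall x, open (W x)) -> (forall x, W x (chart_point x)) ->
  exists D : unity_partition M, forall k, up_ball (D := D) k `<=` W (up_center k) /\
    in_ball (chart_point (up_center k)) (4 * (2 * up_radius k)) `<=` chart_cod (up_chart k).
Proof.
move=> oW Wx.
have [r Hr] := choice (fun x => (exists2P _ _).1 (bump_radius_exists (oW x) (Wx x))).
(* With a quarter of the available radius, the supports of the partition can be enlarged fourfold
   inside the chart, as cutoffs of coordinate functions require. *)
have Hr4 x : bump_radius x (r x / 4).
  have [[r0 rB] _] := Hr x; split; first by rewrite divr_gt0.
  by move=> u uB; apply: rB; apply: le_trans uB _; lra.
have [n [c [chi [h1 h2 h3 h4]]]] := partition_of_unity M_closed Hr4.
exists (UnityPartition (fun k => Hr4 (c k)) h1 h2 h3 h4) => k; have [[r0 rB] rW] := Hr (c k).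
split=> u uB; first by apply: rW; apply: le_trans uB _; rewrite /=; lra.
by apply: rB; apply: le_trans uB _; rewrite /=; lra.
Qed.

Lemma st_line_is_derive I f i (t tau : R) (v d : 'rV[R]_N) (s : R) :
  open I -> smooth_st I f -> I (t + s * tau) -> chart_cod i (v + s *: d) ->
  is_derive s (1 : R) (fun s => f (t + s * tau) (chart_inv i (v + s *: d)))
    (tau * dt f (t + s * tau) (chart_inv i (v + s *: d)) +
     \sum_a d 0 a * covector i (f (t + s * tau)) (v + s *: d) a).
Proof.
move=> oI sf It Uv.
pose c s := st_row (t + s * tau) (v + s *: d).
have cc : cylinder (M := M) I i (c s) by exact: cylinderP.
have D : differentiable (st_coord f i) (c s).
  exact: (smooth_on_differentiable (cylinder_open i oI) (sf i)).
have dl (x y : R) : is_derive s (1 : R) (fun s => x + s * y) y.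
  apply: (is_derive_eq (is_deriveD (is_derive_cst x s 1) (is_deriveM (is_derive_id s 1) (is_derive_cst y s 1)))).
  by rewrite /GRing.scale /= mulr0 !add0r mulr1.
have H := curve_is_derive (v := st_row tau d) D.
rewrite (_ : (fun s => _) = st_coord f i \o c); last first.
  by apply/funext => r; rewrite /= /st_coord lsubmx_st_row rsubmx_st_row.
apply: (is_derive_eq (H _)).
  move=> a; case: (split_ordP a) => b ->; rewrite /c /st_row.
    rewrite row_mxEl mxE.
    by under eq_fun do rewrite row_mxEl mxE; exact: dl.
  rewrite row_mxEr.
  by under eq_fun do rewrite row_mxEr !mxE; exact: dl.
rewrite big_split_ord big_ord1; apply: f_equal2.
  rewrite /st_row row_mxEl mxE -/(st_row _ _) -/time_index -dt_coord.
  by rewrite /st_coord lsubmx_st_row rsubmx_st_row.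
apply: eq_bigr => a _; rewrite {1}/st_row row_mxEr; congr (_ * _).
rewrite /covector -partial_slice; congr partial; apply/funext => w.
by rewrite /st_coord lsubmx_st_row rsubmx_st_row.
Qed.

Lemma metric_bounded i (c : 'rV[R]_N) (r : R) : in_ball c r `<=` chart_cod i ->
  exists2 C : R, 0 <= C & forall u a b, in_ball c r u -> `|metric i u a b| <= C.
Proof.
move=> sB.
have H a : exists C : R, 0 <= C /\ forall u b, in_ball c r u -> `|metric i u a b| <= C.
  have H b : exists C : R, 0 <= C /\ forall u, in_ball c r u -> `|metric i u a b| <= C.
    by have [C C0 HC] := smooth_bounded_ball sB (@chart_metric_smooth R N M i a b); exists C.
  have [C HC] := choice H; exists (\sum_b C b); split; first by apply: sumr_ge0 => b _; exact: (HC b).1.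
  move=> u b uB; apply: le_trans ((HC b).2 u uB) _.
  by rewrite (bigD1 b)//= lerDl sumr_ge0// => e _; exact: (HC e).1.
have [C HC] := choice H; exists (\sum_a C a); first by apply: sumr_ge0 => a _; exact: (HC a).1.
move=> u a b uB; apply: le_trans ((HC a).2 u b uB) _.
by rewrite (bigD1 a)//= lerDl sumr_ge0// => e _; exact: (HC e).1.
Qed.

Lemma metric_form_le i u (d : 'rV[R]_N) (C rho : R) :
  (forall a b, `|metric i u a b| <= C) -> (forall a, `|d 0 a| <= rho) ->
  (d *m metric i u *m d^T) 0 0 <= N%:R * N%:R * (C * (rho * rho)).
Proof.
move=> HC Hd.
have -> : (d *m metric i u *m d^T) 0 0 = \sum_a \sum_b metric i u a b * d 0 a * d 0 b.
  have -> : d = \row_a d 0 a by apply/rowP => a; rewrite mxE.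
  rewrite -bilinear_mx; apply: eq_bigr => a _; apply: eq_bigr => b _.
  by rewrite !mxE.
apply: (@le_trans _ _ (\sum_(a < N) \sum_(b < N) C * (rho * rho))).
  apply: ler_sum => a _; apply: ler_sum => b _; apply: le_trans (ler_norm _) _.
  rewrite !normrM -mulrA; apply: ler_pM; rewrite ?normr_ge0 ?mulr_ge0 ?HC//.
  by apply: ler_pM; rewrite ?normr_ge0 ?Hd.
apply: eq_ler; rewrite !big_const_ord !iter_addr_0 -[LHS]mulr_natr -[X in X * _]mulr_natr.
by rewrite [RHS]mulrC -[LHS]mulrA.
Qed.

End line_calculus.

(** * Joint measurability *)

Section caratheodory.
Context {R : realType} {T : ptopologicalType}.
Hypothesis T2 : second_countable (T := T).
Local Notation B := (g_sigma_algebraType (@open T)).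

(** Caratheodory functions are jointly measurable. With one point [dn m] chosen in each basic open
    set, F z y > a holds exactly when some basic neighbourhood g n of z and some k have F (dn m) y
    >= a + 1/(k+1) for every basic set inside g n. This serves for quantities whose regularity in z
    is known only for each y. *)
Lemma separately_continuous_measurable d (S : measurableType d) (F : T -> S -> R) :
  (forall y, continuous (F^~ y)) -> (forall z, measurable_fun setT (F z)) ->
  measurable_fun setT (fun w : B * S => F w.1 w.2).
Proof.
move=> Fc Fm; have [A cA [Ao Ab]] := T2.
have [g gA] := (pcard_surjP cA).
pose dn m := get (g m).
pose G (b : R) n := [set y : S | forall m, A (g m) -> g m `<=` g n -> g m !=set0 -> b <= F (dn m) y].
have mG b n : measurable (G b n).
  rewrite (_ : G b n = \bigcap_(m in [set m | [/\ A (g m), g m `<=` g n & g m !=set0]])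
     [set y | b <= F (dn m) y]); last first.
    apply/seteqP; split=> y Gy m; first by move=> [h1 h2 h3]; exact: Gy.
    by move=> h1 h2 h3; apply: Gy.
  apply: bigcap_measurableType => m _.
  have := Fm (dn m) measurableT `[b, +oo[%classic (measurable_itv _).
  rewrite setTI (_ : _ @^-1` _ = [set y | b <= F (dn m) y])//.
  by apply/seteqP; split=> y /=; rewrite in_itv /= andbT.
apply: (measurability _ (RGenOInfty.measurableE R)) => //.
move=> /= _ [_ [a ->] <-]; rewrite setTI.
rewrite (_ : _ @^-1` _ = \bigcup_k \bigcup_(n in [set n | A (g n)]) (g n `*` G (a + k.+1%:R^-1) n)).
  apply: bigcupT_measurable => k; apply: bigcup_measurable => n An; apply: measurableX => //.
  by apply: sub_sigma_algebra; exact: Ao.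
apply/seteqP; split=> [[z y] /=|[z y] [k _ [n An [/= gz Gy]]]]; rewrite in_itv /= andbT.
  move=> aF.
  have [k Hk] : exists k, a + k.+1%:R^-1 < F z y.
    have d0 : 0 < F z y - a by rewrite subr_gt0.
    near \oo => k; exists k; rewrite -ltrBrDl.
    by near: k; exact: near_infty_natSinv_lt (PosNum d0).
  have N1 : nbhs z [set z' | a + k.+1%:R^-1 < F z' y].
    by apply: (Fc y z [set r | a + k.+1%:R^-1 < r]); apply: open_nbhs_nbhs; split => //; exact: open_gt.
  have [U [AU Uz] HU] := Ab z _ N1.
  have [n _ gn] := gA U AU.
  exists k => //; exists n; first by rewrite /= gn.
  split => /=; first by rewrite gn.
  move=> m Am mn m0; apply: ltW; apply: HU; rewrite -gn; apply: mn.
  exact: (getPex m0).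
suff : a + k.+1%:R^-1 <= F z y by apply: lt_le_trans; rewrite ltrDl.
rewrite leNgt; apply/negP => Fz.
have N1 : nbhs z (g n `&` [set z' | F z' y < a + k.+1%:R^-1]).
  apply: filterI; first by apply: open_nbhs_nbhs; split => //; exact: Ao.
  by apply: (Fc y z [set r | r < a + k.+1%:R^-1]); apply: open_nbhs_nbhs; split => //; exact: open_lt.
have [U [AU Uz] HU] := Ab z _ N1.
have [m _ gm] := gA U AU.
have m0 : g m !=set0 by exists z; rewrite gm.
have Um : U (dn m) by rewrite -[X in X _]gm; exact: (getPex m0).
have := Gy m; rewrite /= gm => /(_ AU (fun w Uw => (HU w Uw).1) (ex_intro _ z Uz)).
by rewrite leNgt; have [_ /= ->] := HU _ Um.
Unshelve. all: by end_near. Qed.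

Lemma harmonic_dnbhs : (n.+1%:R^-1 : R) @[n --> \oo] --> 0^'.
Proof.
move=> A HA; have H : nbhs (0 : R) [set x | x != 0 -> A x] by exact: HA.
have H2 : \forall n \near \oo, @harmonic R n != 0 -> A (harmonic n) := cvg_harmonic H.
suff : \forall n \near \oo, A (n.+1%:R^-1 : R) by [].
by apply: filterS H2 => n; apply; rewrite /harmonic /= invr_eq0 pnatr_eq0.
Qed.

End caratheodory.

Section growth.
Context {R : realType}.
Implicit Types (f df phi dphi : R -> R).

Lemma nincr_from_right f df (T f0 : R) :
  (forall r : R, 0 < r < T -> is_derive r (1 : R) f (df r)) ->
  (forall r, 0 < r < T -> df r <= 0) -> f r @[r --> 0^'+] --> f0 ->
  forall t, 0 < t < T -> f t <= f0.
Proof.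
move=> dF df0 f0c t /andP[t0 tT].
apply: (ler_cvg_to (cvg_cst (f t)) f0c); near=> r.
have r0 : 0 < r by near: r; exact: nbhs_right_gt.
have rt : r <= t by near: r; apply: nbhs_right_le.
exact: (derive_le0_nincr dF df0 r0 rt tT).
Unshelve. all: by end_near. Qed.

(** The bound on the derivative is integrated from 0, where only one-sided limits are available; phi
    is a primitive of the bound. *)
Lemma growth_bound f df phi dphi (T f0 : R) :
  (forall r : R, 0 < r < T -> is_derive r (1 : R) f (df r)) ->
  (forall r : R, 0 < r < T -> is_derive r (1 : R) phi (dphi r)) ->
  (forall r, 0 < r < T -> `|df r| <= dphi r) ->
  f r @[r --> 0^'+] --> f0 -> phi r @[r --> 0^'+] --> (0 : R) ->
  forall t, 0 < t < T -> `|f t - f0| <= phi t.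
Proof.
move=> dF dP H cf cp t tT.
have H1 := @nincr_from_right (fun r => f r - phi r) (fun r => df r - dphi r) T f0.
have H2 := @nincr_from_right (fun r => - f r - phi r) (fun r => - df r - dphi r) T (- f0).
have c1 : f r - phi r @[r --> 0^'+] --> f0 by rewrite -[f0]subr0; exact: cvgB.
have c2 : - f r - phi r @[r --> 0^'+] --> - f0.
  by rewrite -[- f0]subr0; apply: cvgB => //; exact: cvgN.
have {H1} : f t - phi t <= f0.
  apply: H1 => // r rT; first exact: (is_deriveB (dF r rT) (dP r rT)).
  by have := H r rT; rewrite ler_norml subr_le0 => /andP[].
have {H2} : - f t - phi t <= - f0.
  apply: H2 => // r rT; first exact: (is_deriveB (is_deriveN (dF r rT)) (dP r rT)).
  by have := H r rT; rewrite ler_norml subr_le0 lerNl => /andP[].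
by rewrite ler_norml => ? ?; apply/andP; split; lra.
Qed.

(** In this way expansions of differences with an error proportional to the increment become
    expansions of gradients. *)
Lemma derive_norm_le f (d B e : R) : 0 < e -> is_derive (0 : R) (1 : R) f d ->
  (forall s, `|s| < e -> `|f s - f 0| <= B * `|s|) -> `|d| <= B.
Proof.
move=> e0 df H.
have D : h^-1 *: (f (h *: 1 + 0) - f 0) @[h --> 0^'] --> d.
  rewrite -[d](@derive_val _ _ _ _ _ _ _ df) /derive.
  exact: (@ex_derive _ _ _ _ _ _ _ df).
apply: (ler_cvg_to (cvg_norm D) (cvg_cst B)); near=> h.
have h0 : h != 0 by near: h; exact: nbhs_dnbhs_neq.
have hn : 0 < `|h| by rewrite normr_gt0.
rewrite addr0 [h%:A]mulr1 normrZ normfV ler_pdivrMl// mulrC; apply: H.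
near: h; apply: dnbhs0_lt => //.
Unshelve. all: by end_near. Qed.

Lemma sqrt_cvg0 (C : R) : C * Num.sqrt r @[r --> 0^'+] --> (0 : R).
Proof.
rewrite -[X in _ --> X](mulr0 C); apply: cvgMr; rewrite -[X in _ --> X](@sqrtr0 R).
by apply: cvg_at_right_filter; exact: sqrt_continuous.
Qed.

Lemma monomial_cvg0 (C : R) k : C * r ^+ k.+1 @[r --> 0^'+] --> (0 : R).
Proof.
rewrite -[X in _ --> X](mulr0 C); apply: cvgMr; rewrite -[X in _ --> X](expr0n R k.+1).
by apply: cvg_at_right_filter; exact: exprn_continuous.
Qed.

Lemma is_derive_monomial (C r : R) k :
  is_derive r (1 : R) (fun r => C * r ^+ k.+1) (C * (k.+1%:R * r ^+ k)).
Proof.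
have H : is_derive r (1 : R) (fun r => r ^+ k.+1) (k.+1%:R * r ^+ k).
  elim: k => [|k IH].
    by rewrite (_ : (fun r => r ^+ 1) = id)//; apply: (is_derive_eq (is_derive_id r (1 : R))); rewrite expr0 mulr1.
  rewrite (_ : (fun r => _) = fun r : R => r * r ^+ k.+1); last by apply/funext => s; rewrite exprS.
  apply: (is_derive_eq (is_deriveM (is_derive_id r (1 : R)) IH)).
  rewrite /GRing.scale /= -[k.+2%:R]natr1 exprS; move: (k.+1%:R) (r ^+ k) => x y; ring.
exact: (is_deriveZ C H).
Qed.

End growth.

Section cutoff.
Context {R : realType} {N : nat} (M : riemannianManifold R N).
Variables (i : chart_index M) (c : 'rV[R]_N) (rho : R).
Hypothesis rho0 : 0 < rho.
Hypothesis sB : in_ball c (4 * rho) `<=` chart_cod i.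

(** The bump leaves F unchanged on the cube of radius 2 rho, a neighbourhood of the closed cube of
    radius rho where derivatives are compared, and has its support within radius 4 rho. *)
Definition cutoff (F : 'rV[R]_N -> R) : M -> R :=
  chart_ext i (fun u => bump_rV c (2 * rho) u * F u).

Lemma smooth_cutoff F : smooth_on (chart_cod i) F -> smooth_function (cutoff F).
Proof.
move=> sF; apply: (chart_ext_smooth sB).
  by apply: (smooth_onM (cod_open i)) sF; exact: (smooth_bump_rV _ _ (cod_open i)).
move=> u nu; rewrite bump_rV0 ?mul0r// ?mulr_gt0//.
by rewrite ltNge; apply/negP => H; apply: nu; apply: le_trans H _; lra.
Qed.

Definition cutoff_dom : set 'rV[R]_N := chart_cod i `&` [set u | `|u - c| < 2 * rho].

Lemma cutoff_dom_open : open cutoff_dom.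
Proof.
apply: openI; first exact: cod_open.
rewrite (_ : [set u | _] = ball c (2 * rho)); first by apply: ball_open; rewrite mulr_gt0.
by apply/seteqP; split=> u; rewrite -ball_normE /= distrC.
Qed.

Lemma cutoffE F u : cutoff_dom u -> cutoff F (chart_inv i u) = F u.
Proof.
by move=> [Uu uB]; rewrite /cutoff chart_extE// bump_rV1 ?mul1r ?mulr_gt0// ltW.
Qed.

Lemma cutoff_ball u : in_ball c rho u -> cutoff_dom u.
Proof.
rewrite /in_ball /= => uB; split; first by apply: sB; apply: le_trans uB _; have := rho0; lra.
by apply: le_lt_trans uB _; have := rho0; lra.
Qed.

Lemma covector_cutoff F u a : cutoff_dom u -> covector i (cutoff F) u a = partial a F u.
Proof.
by move=> uD; apply: (partial_ext a cutoff_dom_open _ uD) => w; exact: cutoffE.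
Qed.

Lemma partial2_cutoff F u a b : cutoff_dom u ->
  partial a (partial b (cutoff F \o chart_inv i)) u = partial a (partial b F) u.
Proof.
by move=> uD; apply: (partial_ext a cutoff_dom_open _ uD) => w; exact: covector_cutoff.
Qed.

End cutoff.

(** * Coordinates with vanishing Hessian at a point *)

Section geodesic_coordinates.
Context {R : realType} {n : nat}.
Variables (v : 'rV[R]_n) (G : 'I_n -> 'I_n -> 'I_n -> R).
Hypothesis GC : forall d a b, G d a b = G d b a.

(** Coordinates around v corrected to second order. With G the Christoffel symbols at v their
    Hessians vanish at v, as for geodesic normal coordinates. *)
Definition quad_coord (d : 'I_n) (u : 'rV[R]_n) : R :=
  (u 0 d - v 0 d) + 2^-1 * \sum_a \sum_b G d a b * ((u 0 a - v 0 a) * (u 0 b - v 0 b)).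

Lemma smooth_quad_coord U d : open U -> smooth_on U (quad_coord d).
Proof. by move=> oU; rewrite /quad_coord; smooth. Qed.

Lemma partial_quad_coord d e u : partial e (quad_coord d) u = (e == d)%:R + \sum_b G d e b * (u 0 b - v 0 b).
Proof.
have oT : open [set: 'rV[R]_n] by exact: openT.
have pl a w : partial e (fun w => w 0 a - v 0 a) w = (e == a)%:R.
  rewrite (@partialB _ _ setT)//; [|by smooth|by smooth].
  by rewrite partial_coord partial_cst subr0.
rewrite /quad_coord (@partialD _ _ setT)//; [|by smooth|by smooth].
rewrite pl (@partialM _ _ setT)//; [|by smooth|by smooth].
rewrite partial_cst mul0r add0r; apply: (congr1 (fun x => _ + x)).
rewrite (@partial_sum _ _ setT)//; last by move=> a; smooth.
transitivity (2^-1 * \sum_a (\sum_b G d a b * ((e == a)%:R * (u 0 b - v 0 b)) +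
   \sum_b G d a b * ((u 0 a - v 0 a) * (e == b)%:R))).
  apply: (congr1 (fun x => _ * x)); apply: eq_bigr => a _.
  rewrite (@partial_sum _ _ setT)//; last by move=> b; smooth.
  rewrite -big_split; apply: eq_bigr => b _ /=.
  rewrite (@partialM _ _ setT)//; [|by smooth|by smooth].
  rewrite partial_cst mul0r add0r (@partialM _ _ setT)//; [|by smooth|by smooth].
  by rewrite !pl mulrDr.
rewrite big_split /=.
have -> : \sum_a \sum_b G d a b * ((e == a)%:R * (u 0 b - v 0 b)) = \sum_b G d e b * (u 0 b - v 0 b).
  rewrite exchange_big; apply: eq_bigr => b _ /=.
  rewrite -[RHS](sum_kron (fun a => G d a b * (u 0 b - v 0 b))).
  by apply: eq_bigr => a _; ring.
have -> : \sum_a \sum_b G d a b * ((u 0 a - v 0 a) * (e == b)%:R) = \sum_b G d e b * (u 0 b - v 0 b).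
  apply: eq_bigr => b _ /=; rewrite GC.
  rewrite -[RHS](sum_kron (fun a => G d b a * (u 0 b - v 0 b))).
  by apply: eq_bigr => a _; ring.
by move: (\sum_b _) => S; field.
Qed.

Lemma partial2_quad_coord d e a u : partial a (partial e (quad_coord d)) u = G d a e.
Proof.
have oT : open [set: 'rV[R]_n] by exact: openT.
have -> : partial e (quad_coord d) = fun u => (e == d)%:R + \sum_b G d e b * (u 0 b - v 0 b).
  by apply/funext => w; exact: partial_quad_coord.
rewrite (@partialD _ _ setT)//; [|by smooth|by smooth].
rewrite partial_cst add0r (@partial_sum _ _ setT)//; last by move=> b; smooth.
rewrite [RHS]GC -[RHS](sum_kron (fun b => G d e b)); apply: eq_bigr => b _.
rewrite (@partialM _ _ setT)//; [|by smooth|by smooth].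
rewrite partial_cst mul0r add0r (@partialB _ _ setT)//; [|by smooth|by smooth].
by rewrite partial_coord partial_cst subr0 mulrC.
Qed.

End geodesic_coordinates.

Section uniform_bounds.
Context {R : realType}.

Lemma uniform_bound (I : finType) (P : I -> R -> Prop) :
  (forall j C C', C <= C' -> P j C -> P j C') ->
  (forall j, exists2 C : R, 0 <= C & P j C) -> exists2 C : R, 0 <= C & forall j, P j C.
Proof.
move=> mono H.
have [C HC] := choice (fun j => (exists2P _ _).1 (H j)).
exists (\sum_j C j); first by apply: sumr_ge0 => j _; exact: (HC j).1.
move=> j; apply: mono (HC j).2; rewrite (bigD1 j)//= lerDl sumr_ge0// => k _.
exact: (HC k).1.
Qed.

Lemma sum_norm_le n (F : 'I_n -> R) (C : R) : (forall a, `|F a| <= C) -> `|\sum_a F a| <= n%:R * C.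
Proof.
move=> H; apply: le_trans (ler_norm_sum _ _ _) _.
apply: (@le_trans _ _ (\sum_(a < n) C)); first by apply: ler_sum => a _; exact: H.
by rewrite big_const_ord iter_addr_0 [n%:R * C]mulr_natl.
Qed.

(** With h the inverse of g, both gradient terms contract to the trace of X and the covariance term
    to that of Y against g: this is the trace of the Cramer-Rao inequality in the frame dual to the
    coordinates. *)
Lemma frame_contract n (h g X Y : 'I_n -> 'I_n -> R) (k : R) :
  (forall a b, h a b = h b a) -> (forall a b, g a b = g b a) ->
  (forall (Z : 'I_n -> R) a, \sum_d h a d * (\sum_l g d l * Z l) = Z a) ->
  \sum_a \sum_b h a b * (\sum_d g b d * X d a + \sum_d g a d * X d b
     - k * \sum_d \sum_d' g a d * g b d' * Y d d') =
  2 * \sum_a X a a - k * \sum_d \sum_d' g d d' * Y d d'.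
Proof.
move=> hC gC hg.
have A1 : \sum_a \sum_b h a b * (\sum_d g b d * X d a) = \sum_a X a a.
  by apply: eq_bigr => a _; rewrite (hg (X^~ a)).
have A2 : \sum_a \sum_b h a b * (\sum_d g a d * X d b) = \sum_a X a a.
  rewrite exchange_big -A1; apply: eq_bigr => a _; apply: eq_bigr => b _ /=.
  by rewrite hC.
have A3 : \sum_a \sum_b h a b * (\sum_d \sum_d' g a d * g b d' * Y d d') = \sum_d \sum_d' g d d' * Y d d'.
  transitivity (\sum_a \sum_d g a d * \sum_b h a b * \sum_d' g b d' * Y d d').
    apply: eq_bigr => a _.
    under [RHS]eq_bigr do rewrite mulr_sumr.
    rewrite [RHS]exchange_big; apply: eq_bigr => b _ /=.
    rewrite mulr_sumr; apply: eq_bigr => d _; rewrite !mulr_sumr; apply: eq_bigr => d' _.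
    by ring.
  rewrite exchange_big; apply: eq_bigr => d _ /=; apply: eq_bigr => a _.
  by rewrite (hg (Y d)) gC.
transitivity (\sum_a \sum_b h a b * (\sum_d g b d * X d a) + \sum_a \sum_b h a b * (\sum_d g a d * X d b)
   - k * (\sum_a \sum_b h a b * (\sum_d \sum_d' g a d * g b d' * Y d d'))).
  rewrite mulr_sumr -big_split -sumrB; apply: eq_bigr => a _ /=.
  rewrite mulr_sumr -big_split -sumrB; apply: eq_bigr => b _ /=.
  by ring.
by rewrite A1 A2 A3; ring.
Qed.

End uniform_bounds.

Section xlnx.
Context {R : realType}.
Implicit Types (s e C : R).

Lemma ln_ge_1V s : 0 < s -> 1 - s^-1 <= ln s.
Proof.
move=> s0; have i0 : 0 < s^-1 by rewrite invr_gt0.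
have H : -1 < s^-1 - 1 by lra.
have := le_ln1Dx H; rewrite addrC subrK lnV ?posrE//; lra.
Qed.

Lemma ln_le_B1 s : 0 < s -> ln s <= s - 1.
Proof.
move=> s0; have H : -1 < s - 1 by lra.
by have := le_ln1Dx H; rewrite addrC subrK.
Qed.

Lemma xlnx_bound s C : 0 <= s <= C -> `|s * ln s| <= C ^+ 2 + 1.
Proof.
move=> /andP[s0 sC]; have C2 : 0 <= C ^+ 2 by exact: sqr_ge0.
have [->|sn0] := eqVneq s 0; first by rewrite mul0r normr0; lra.
have sp : 0 < s by rewrite lt_neqAle eq_sym sn0.
have h1 := ler_wpM2l s0 (ln_ge_1V sp); have h2 := ler_wpM2l s0 (ln_le_B1 sp).
have h3 : s * s <= C ^+ 2 by rewrite expr2 ler_pM.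
move: h1; rewrite mulrBr mulr1 mulfV// => h1.
by rewrite ler_norml; apply/andP; split; lra.
Qed.

Lemma xlnx_shift s e : 0 <= s -> 0 < e ->
  e * ln e <= (s + e) * ln (s + e) - s * ln s <= e * ln (s + e) + e.
Proof.
move=> s0 e0; have b0 : 0 < s + e by rewrite ltr_wpDl.
have [->|sn0] := eqVneq s 0.
  by rewrite mul0r add0r subr0 lexx lerDl ltW.
have sp : 0 < s by rewrite lt_neqAle eq_sym sn0.
have l1 : ln e <= ln (s + e) by rewrite ler_ln ?posrE// lerDr.
have l2 : ln s <= ln (s + e) by rewrite ler_ln ?posrE// lerDl ltW.
have l3 : s * ln (s + e) - s * ln s <= e.
  rewrite -mulrBr -ln_div ?posrE//; apply: le_trans (ler_wpM2l s0 (ln_le_B1 (divr_gt0 b0 sp))) _.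
  by apply: eq_ler; field.
have := ler_wpM2l (ltW e0) l1; have := ler_wpM2l s0 l2.
by rewrite mulrDl => h1 h2; apply/andP; split; lra.
Qed.

Lemma sqrt_ge_id e : 0 < e <= 1 -> e <= Num.sqrt e.
Proof.
move=> /andP[e0 e1]; rewrite -{1}(sqr_sqrtr (ltW e0)) expr2 ler_piMr ?sqrtr_ge0//.
by rewrite -sqrtr1 ler_sqrt.
Qed.

(** The modulus of continuity of x ln x at 0 is e |ln e|, bounded through ln e = 2 ln(sqrt e) by a
    multiple of sqrt e. Errors due to the shift are measured in sqrt e from here on, and
    [le_sqrt_error] disposes of them. *)
Lemma xlnx_shift_bound s e C : 0 <= s <= C -> 0 < e <= 1 ->
  `|(s + e) * ln (s + e) - s * ln s| <= (C + 3) * Num.sqrt e.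
Proof.
move=> /andP[s0 sC] e01; have /andP[e0 e1] := e01.
have q0 : 0 < Num.sqrt e by rewrite sqrtr_gt0.
have qE := sqr_sqrtr (ltW e0).
have eq := sqrt_ge_id e01.
have b0 : 0 < s + e by rewrite ltr_wpDl.
have /andP[h1 h2] := xlnx_shift s0 e0.
have h3 := ler_wpM2l (ltW e0) (ln_le_B1 b0).
have h4 : - (2 * Num.sqrt e) <= e * ln e.
  have -> : e * ln e = 2 * (e * ln (Num.sqrt e)).
    by rewrite -{2}qE lnXn// mulr2n; ring.
  have := ler_wpM2l (ltW e0) (ln_ge_1V q0).
  have -> : e * (1 - (Num.sqrt e)^-1) = e - Num.sqrt e.
    by rewrite -{1 3}qE; field; rewrite gt_eqF.
  lra.
have h5 : e * (s + e) <= Num.sqrt e * (C + 1) by apply: ler_pM => //; [exact: ltW|lra|lra].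
have C0 : 0 <= C by apply: le_trans sC.
have h6 : 0 <= C * Num.sqrt e by rewrite mulr_ge0// ltW.
by rewrite ler_norml; apply/andP; split; lra.
Qed.

Lemma le_sqrt_error (a b C : R) : 0 <= C -> (forall e : R, 0 < e <= 1 -> a <= b + C * Num.sqrt e) -> a <= b.
Proof.
move=> C0 H; apply: (ler_cvg_to (cvg_cst a) (_ : b + C * Num.sqrt e @[e --> 0^'+] --> b)).
  by rewrite -[X in _ --> X]addr0; apply: cvgD; [exact: cvg_cst|exact: sqrt_cvg0].
near=> e; apply: H; apply/andP; split; near: e; first exact: nbhs_right_gt.
by apply: nbhs_right_le.
Unshelve. all: by end_near. Qed.

End xlnx.

Section inverse_concavity.
Context {R : realType}.

Lemma convex_gt (a u v th : R) : 0 <= th <= 1 -> a < u -> a < v -> a < (1 - th) * u + th * v.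
Proof.
move=> /andP[h0 h1] au av; have [->|hn] := eqVneq th 0; first by rewrite subr0 mul1r mul0r addr0.
have : th * a < th * v by rewrite ltr_pM2l// lt_neqAle eq_sym hn.
have h1' : 0 <= 1 - th by rewrite subr_ge0.
by have := ler_wpM2l h1' (ltW au); lra.
Qed.

(** In the variable 1/t the function is concave on a half-line and bounded below far out, hence
    nondecreasing. If F t1 < F t2, the chord from 1/t2 through 1/t1, prolonged far enough, would
    fall below the lower bound. *)
Lemma inverse_concave_nincr (F : R -> R) (c : R) :
  (forall t1 t2 th, 0 < t1 < c -> 0 < t2 < c -> 0 <= th <= 1 ->
     (1 - th) * F t1 + th * F t2 <= F (((1 - th) * t1^-1 + th * t2^-1)^-1)) ->
  (forall t0, 0 < t0 < c -> exists A, forall t, 0 < t <= t0 -> - A <= F t) ->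
  forall t1 t2, 0 < t1 -> t1 <= t2 -> t2 < c -> F t2 <= F t1.
Proof.
move=> conc bd t1 t2 t10 t12 t2c; rewrite leNgt; apply/negP => F12.
have t20 : 0 < t2 by exact: lt_le_trans t12.
have t1c : t1 < c by exact: le_lt_trans t2c.
have [A HA] := bd t1 (introT andP (conj t10 t1c)).
have d0 : 0 < F t2 - F t1 by rewrite subr_gt0.
(* The chord loses F t2 - F t1 per step from 1/t2, so n steps bring it below -A. *)
pose n := 2 + `|F t2 + A| / (F t2 - F t1).
have n2 : 2 <= n by rewrite lerDl divr_ge0// ltW.
have n0 : 0 < n by lra.
have v12 : t2^-1 <= t1^-1 by rewrite lef_pV2.
have v20 : 0 < t2^-1 by rewrite invr_gt0.
pose w := t2^-1 + n * (t1^-1 - t2^-1).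
have w1 : t1^-1 <= w.
  rewrite /w -lerBlDl; have : 0 <= t1^-1 - t2^-1 by rewrite subr_ge0.
  by move=> q0; rewrite ler_peMl//; lra.
have w0 : 0 < w by rewrite (lt_le_trans _ w1)// invr_gt0.
pose t := w^-1.
have t0 : 0 < t by rewrite invr_gt0.
have tt1 : t <= t1 by rewrite -[t1]invrK lef_pV2 ?posrE ?invr_gt0.
have th01 : 0 <= n^-1 <= 1 by rewrite invr_ge0 (ltW n0) invf_le1//=; lra.
have tc : 0 < t < c by rewrite t0 (le_lt_trans tt1).
have t2c' : 0 < t2 < c by rewrite t20.
have := conc t2 t n^-1 t2c' tc th01.
have -> : (1 - n^-1) * t2^-1 + n^-1 * t^-1 = t1^-1.
  by rewrite /t invrK /w; move: (t1^-1) (t2^-1) => x y; field; rewrite gt_eqF.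
rewrite invrK => H.
have tt : 0 < t <= t1 by rewrite t0.
have := ler_wpM2l (ltW n0) H.
have -> : n * ((1 - n^-1) * F t2 + n^-1 * F t) = (n - 1) * F t2 + F t.
  by field; rewrite gt_eqF.
have := HA t tt.
have : F t2 + A < n * (F t2 - F t1).
  rewrite /n mulrDl divfK ?gt_eqF//; have := ler_norm (F t2 + A); lra.
lra.
Qed.

End inverse_concavity.

Lemma at_right_interval (R : realType) (P : R -> Prop) : (\forall s \near 0^'+, P s) ->
  exists2 d : R, 0 < d & forall s, 0 < s < d -> P s.
Proof.
move=> /nbhs_ballP[d /= d0 H]; exists d => // s /andP[s0 sd].
by apply: H => //; rewrite -ball_normE /= sub0r normrN gtr0_norm.
Qed.

Section scalar_curvature_cover.
Context {R : realType} {N : nat} (M : riemannianManifold R N).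

Lemma smooth_scalar_coord i : smooth_on (chart_cod i) (scalar_coord (@metric R N M i)).
Proof.
have oU := cod_open i.
have sg := @chart_metric_smooth R N M i; have gT := @chart_metricT R N M i.
have gpos := @chart_metric_gt0 R N M i.
eapply smooth_on_sum; [exact oU|intros a]; eapply smooth_on_sum; [exact oU|intros b].
apply: (smooth_onM oU); first exact: (smooth_inv_metric oU sg gT gpos).
exact: (smooth_ricci_coord oU sg gT gpos).
Qed.

(** The curvature at a point is read in the chart chosen there, where its coordinate expression is
    continuous. A strict bound at each centre thus holds on a whole cube of that chart, and no two
    charts are compared. *)
Lemma scalar_curvature_cover (s : M -> R) : compact [set: M] ->
  (forall x, s x < scalar_curvature x) ->
  exists D : unity_partition M, forall k,
    in_ball (chart_point (up_center k)) (4 * (2 * up_radius k)) `<=` chart_cod (up_chart k) /\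
    forall u, up_ball (D := D) k u -> s (up_center k) <= scalar_coord (metric (up_chart k)) u.
Proof.
move=> M_closed sS.
pose W x := chart_cod (chart_at x) `&` scalar_coord (metric (chart_at x)) @^-1` [set y | s x < y].
have Wo x : open (W x).
  have oU := cod_open (chart_at x).
  rewrite openE => u [Uu su]; apply: filterI; first exact: open_nbhs_nbhs.
  have := smooth_on_continuous (@smooth_scalar_coord (chart_at x)) Uu; apply.
  by apply: open_nbhs_nbhs; split => //; exact: open_gt.
have Wc x : W x (chart_point x).
  by split; [exact: chart_dom_cod (chart_atP x)|exact: sS].
have [D HD] := unity_partition_exists M_closed Wo Wc; exists D => k.
have [h1 h2] := HD k; split => // u uB; have [_ su] := h1 u uB.
exact: ltW.
Qed.

End scalar_curvature_cover.

Section monotonicity.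
Context {R : realType}.

(** A supremum argument: the set where H <= H s cannot stop before t. Descent is asked only for some
    arbitrarily small increments, which is what an argument by Fatou's lemma provides. *)
Lemma nincr_of_descent (a b : R) (H : R -> R) :
  (forall t, a < t < b -> {for t, continuous H}) ->
  (forall t d, a < t < b -> 0 < d -> exists2 h, 0 < h < d & H (t + h) <= H t) ->
  forall s t, a < s -> s <= t -> t < b -> H t <= H s.
Proof.
move=> cH desc s t as_ st tb.
pose S := [set r | s <= r <= t /\ H r <= H s].
have Ss : S s by split; rewrite ?lexx.
have hS : has_sup S by split; [exists s|exists t => r [/andP[]]].
have sm : s <= sup S by exact: (sup_upper_bound hS).
have mt : sup S <= t by apply: ge_sup; [exists s|move=> r [/andP[]]].
have mab : a < sup S < b by rewrite (lt_le_trans as_ sm) (le_lt_trans mt tb).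
have Hm : H (sup S) <= H s.
  rewrite leNgt; apply/negP => Hlt.
  have [d /= d0 Hd] : \forall r \near sup S, H s < H r.
    by have /cvgr_gt := cH _ mab; apply.
  have [r [rst Hr] rd] := sup_adherent d0 hS.
  have rm : r <= sup S by apply: (sup_upper_bound hS); split.
  have : H s < H r.
    by apply: Hd; rewrite /= ger0_norm ?subr_ge0// ltrBlDr addrC -ltrBlDr.
  by rewrite ltNge Hr.
move: mt; rewrite le_eqVlt => /predU1P[<-//|mt].
have d0 : 0 < t - sup S by rewrite subr_gt0.
have [h /andP[h0 hd] Hh] := desc _ _ mab d0.
have : S (sup S + h).
  split; last exact: le_trans Hh Hm.
  by apply/andP; split; lra.
by move=> /(sup_upper_bound hS); rewrite gerDl leNgt h0.
Qed.

Lemma convex_of_derive_ndecr (a b : R) (f df : R -> R) :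
  (forall r, a < r < b -> is_derive r (1 : R) f (df r)) ->
  (forall r s, a < r -> r <= s -> s < b -> df r <= df s) ->
  forall u v th, a < u < b -> a < v < b -> 0 <= th <= 1 ->
    f ((1 - th) * u + th * v) <= (1 - th) * f u + th * f v.
Proof.
move=> D mono.
have main u v th : a < u -> u < v -> v < b -> 0 < th < 1 ->
    f ((1 - th) * u + th * v) <= (1 - th) * f u + th * f v.
  move=> au uv vb /andP[th0 th1]; set w := (1 - th) * u + th * v.
  have tv0 : 0 < th * (v - u) by rewrite mulr_gt0// subr_gt0.
  have tv1 : 0 < (1 - th) * (v - u) by rewrite mulr_gt0// subr_gt0.
  have uw : u < w by rewrite /w; lra.
  have wv : w < v by rewrite /w; lra.
  have [r /andP[ur rw] E1] := derive_mean_value D au uw (lt_trans wv vb).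
  have [r' /andP[wr rv] E2] := derive_mean_value D (lt_trans au uw) wv vb.
  have M : df r <= df r' by apply: mono; [exact: lt_trans ur|exact/ltW/(lt_trans rw)|exact: lt_trans vb].
  have e1 : w - u = th * (v - u) by rewrite /w; ring.
  have e2 : v - w = (1 - th) * (v - u) by rewrite /w; ring.
  rewrite e1 in E1; rewrite e2 in E2.
  have k0 : 0 <= th * (1 - th) * (v - u) by rewrite mulr_ge0 ?mulr_ge0 ?subr_ge0 ?ltW.
  have {}M := ler_wpM2l k0 M.
  have -> : f w = (1 - th) * f u + th * f v + (1 - th) * (f w - f u) - th * (f v - f w) by ring.
  by rewrite E1 E2; lra.
move=> u v th /andP[au ub] /andP[av vb] /andP[th0 th1].
have [->|n0] := eqVneq th 0; first by rewrite subr0 !mul1r !mul0r !addr0.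
have [->|n1] := eqVneq th 1; first by rewrite subrr !mul1r !mul0r !add0r.
have t0 : 0 < th by rewrite lt_neqAle eq_sym n0.
have t1 : th < 1 by rewrite lt_neqAle n1.
have [uv|vu|->] := ltgtP u v.
- by apply: main => //; rewrite t0.
- have i : 0 < 1 - th < 1 by apply/andP; split; lra.
  by have := main v u (1 - th) av vu ub i; rewrite subKr addrC [X in _ <= X]addrC.
- by rewrite -!mulrDl subrK !mul1r.
Qed.

(** Bookkeeping for [mean_entropy_convex]: m, m1, m2 are the e-shifted entropies, m0, n1, n2 the
    unshifted ones, l logarithms, S the tilts sigma t / 2, and q is sqrt e. *)
Lemma convexity_error (th m m0 m1 n1 m2 n2 l l1 l2 S S1 S2 A k e q Cs Ls : R) :
  (1 - th) * (m1 - n1) <= (1 - th) * (Cs * q) -> th * (m2 - n2) <= th * (Cs * q) ->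
  m0 - m <= Cs * q -> e * A * ((1 - th) * l1 + th * l2 - l) <= A * Ls * q ->
  m + (k + e * A) * l - S <= (1 - th) * (m1 + (k + e * A) * l1 - S1) +
     th * (m2 + (k + e * A) * l2 - S2) ->
  m0 + k * l - S <= (1 - th) * (n1 + k * l1 - S1) + th * (n2 + k * l2 - S2) + (Cs + Cs + A * Ls) * q.
Proof. lra. Qed.

End monotonicity.

Record heat_setting (R : realType) (N : nat) (M : riemannianManifold R N)
  (vol : {measure set (borel M) -> \bar R}) (p : R -> M -> M -> R) : Prop := HeatSetting {
  hs_closed : compact [set: M] ;
  hs_vol : riemannian_volume vol ;
  hs_heat : minimal_heat_kernel vol p }.

(** * The heat flow *)

Section heat_flow.
Context {R : realType} {N : nat} (M : riemannianManifold R N).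
Context {vol : {measure set (borel M) -> \bar R}} {p : R -> M -> M -> R}.
Hypothesis hs : heat_setting vol p.
Local Notation Int f := (\int[vol]_(x in setT) f x).
Local Notation pos := (@positive_times R).

Let M_closed := hs_closed hs.
Let vol_r := hs_vol hs.
Let oP := @open_positive R.
Let V := vol_lty M_closed vol_r.

Section heat_kernel.
Implicit Types (u k w : R -> M -> R).

Lemma heat_st y : smooth_st pos (fun t x => p t x y).
Proof. by have [[+ _ _ _] _] := hs_heat hs y. Qed.

Lemma heat_ge0 t x y : 0 < t -> 0 <= p t x y.
Proof. by move=> t0; have [[_ + _ _] _] := hs_heat hs y; exact. Qed.

Lemma heat_slice t y : 0 < t -> smooth_function (fun x => p t x y).
Proof. by move=> t0; exact: (smooth_st_slice open_positive t0 (heat_st y)). Qed.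

Lemma bm_heat t y : 0 < t -> bm (fun x : borel M => p t x y).
Proof. by move=> t0; apply: bm_smooth M_closed _ _; exact: heat_slice. Qed.

Lemma heat_dt y t x : 0 < t -> dt (fun t x => p t x y) t x = lap (fun z => p t z y) x.
Proof.
move=> t0; have [[_ _ /(_ t x t0) + _] _] := hs_heat hs y.
by rewrite derive1E laplacian.unlock.
Qed.

Lemma heat_init f y : smooth_function f ->
  Int (fun x => p t x y * f x) @[t --> 0^'+] --> f y.
Proof.
move=> sf; have [[_ _ _ +] _] := hs_heat hs y; apply=> //.
by apply: (subclosed_compact _ M_closed) => //; exact: closed_closure.
Qed.

(** The mass is constant because a Laplacian integrates to 0, and the initial condition tested on
    the constant 1 fixes its value. *)
Lemma heat_mass t y : 0 < t -> Int (fun x => p t x y) = 1.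
Proof.
move=> t0.
have D r : 0 < r < t + 1 -> is_derive r (1 : R) (fun r => Int (fun x => p r x y)) (0 : R).
  move=> /andP[r0 _]; apply: (is_derive_eq (derive_Int_st M_closed vol_r open_positive (heat_st y) r0)).
  rewrite -[RHS](Int_lap M_closed vol_r (heat_slice y r0)); apply: eq_Rintegral => x _.
  exact: heat_dt.
have C := derive_0_cst D.
apply/esym; apply: (@cvg_at_right_unique R (fun r => Int (fun x => p r x y * 1)) _ _ (t + 1)).
- by rewrite addr_gt0.
- move=> r rt; transitivity (Int (fun x => p r x y)).
    by apply: eq_Rintegral => x _; rewrite mulr1.
  by apply: C => //; rewrite t0 ltrDl ltr01.
- exact: (@heat_init _ y (smooth_function_cst (1 : R))).
Qed.

(** The initial condition concerns fixed test functions; total mass 1 lets them vary at a linear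
    rate. *)
Lemma heat_init_moving f k (C d : R) y : 0 < d -> smooth_function f ->
  (forall h, 0 < h < d -> smooth_function (k h)) ->
  (forall h z, 0 < h < d -> `|k h z - f z| <= C * h) ->
  Int (fun x => p h x y * k h x) @[h --> 0^'+] --> f y.
Proof.
move=> d0 sf sk kf.
suff : ((Int (fun x => p h x y * k h x) - Int (fun x => p h x y * f x)) : R) @[h --> 0^'+] --> (0 : R).
  move=> H; rewrite -[f y]add0r.
  rewrite (_ : (fun h => _) = fun h => (Int (fun x => p h x y * k h x) -
    Int (fun x => p h x y * f x)) + Int (fun x => p h x y * f x)).
    by apply: cvgD H _; exact: heat_init.
  by apply/funext => h; rewrite subrK.
apply/cvgr0Pnorm_le => e e0; near=> h.
have h0 : 0 < h by near: h; exact: nbhs_right_gt.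
have hd : h < d by near: h; exact: nbhs_right_lt.
have h0d : 0 < h < d by rewrite h0 hd.
have b1 : bm (fun x : borel M => p h x y * k h x).
  by apply: bm_smooth M_closed _ _; apply: smooth_functionM; [exact: heat_slice|exact: sk].
have b2 : bm (fun x : borel M => p h x y * f x).
  by apply: bm_smooth M_closed _ _; apply: smooth_functionM; [exact: heat_slice|].
rewrite -(IntB V b1 b2).
apply: (@le_trans _ _ (Int (fun x => C * h * p h x y))).
  apply: (Int_norm_le V); [exact: bmB|exact/bmZ/bm_heat|].
  move=> x; rewrite -mulrBr normrM ger0_norm ?heat_ge0// mulrC.
  by rewrite ler_wpM2r ?heat_ge0// kf.
rewrite (IntZ V _ (bm_heat y h0)) heat_mass// mulr1.
apply: (@le_trans _ _ (`|C| * h)); first by rewrite ler_wpM2r ?ler_norm// ltW.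
have : h <= e / (`|C| + 1).
  by near: h; apply: nbhs_right_le; rewrite divr_gt0// ltr_wpDl.
rewrite ler_pdivlMr ?ltr_wpDl// mulrC; apply: le_trans.
by rewrite ler_wpM2r ?(ltW h0)// lerDl.
Unshelve. all: by end_near. Qed.

Lemma st_lipschitz I u t (d : R) : open I -> smooth_st I u -> 0 < d ->
  (forall r, t - d <= r <= t + d -> I r) ->
  exists2 C, 0 <= C & forall h x, `|h| < d -> `|u (t + h) x - u t x| <= C * `|h|.
Proof.
move=> oI su d0 HI.
have [C C0 HC] := smooth_st_bounded M_closed oI (smooth_dt oI su) HI.
exists C => // h x hd.
have HI' r : t - d < r < t + d -> t - d <= r <= t + d by move=> /andP[/ltW -> /ltW ->].
have := @derive_lipschitz R (u^~ x) (fun r => dt u r x) (t - d) (t + d) C _ _ t (t + h).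
rewrite [t + h]addrC addrK; apply.
- by move=> r /HI'/HI Ir; exact: (is_derive_dt x oI su).
- by move=> r /HI'; exact: HC.
- by rewrite ltrBlDr !ltrDl d0.
- by move: hd; rewrite ltr_norml => /andP[? ?]; apply/andP; split; lra.
Qed.

Lemma heat_left_limit w c x : smooth_st pos w -> 0 < c ->
  Int (fun z => p h z x * w (c - h) z) @[h --> 0^'+] --> w c x.
Proof.
move=> sw c0.
have [d d0 Hd] := open_interval_nbhs open_positive c0.
have [C C0 HC] := st_lipschitz open_positive sw d0 Hd.
apply: (@heat_init_moving _ (fun h => w (c - h)) C d) => //.
- exact: (smooth_st_slice open_positive c0).
- move=> h /andP[h0 hd]; apply: (smooth_st_slice open_positive _ sw); apply: Hd.
  by apply/andP; split; lra.
- move=> h z /andP[h0 hd]; have := HC (- h) z; rewrite normrN (gtr0_norm h0).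
  exact.
Qed.

(** The kernel seen from (c, x) in reversed time: it solves the backward heat equation on ]0, c[ and
    concentrates at x as r tends to c. *)
Definition backward (c : R) (x : M) (r : R) (z : M) : R := p (c - r) z x.

Definition time_interval (c : R) : set R := [set r | 0 < r < c].

Lemma time_interval_open c : open (time_interval c).
Proof.
rewrite (_ : time_interval c = [set r | 0 < r] `&` [set r | r < c]).
  by apply: openI; [exact: open_gt|exact: open_lt].
by apply/seteqP; split=> r; rewrite /time_interval /=; [move=> /andP[]|move=> [? ?]; apply/andP].
Qed.

Lemma time_interval_pos c : time_interval c `<=` pos.
Proof. by move=> r /andP[]. Qed.

Lemma backward_st c x : smooth_st (time_interval c) (backward c x).
Proof.
apply: (@smooth_st_sub _ _ _ [set r | pos (c - r)]); last first.
  exact: (@smooth_st_reverse _ _ _ _ c _ open_positive (heat_st x)).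
by move=> r /andP[_ rc]; rewrite /= /positive_times /= subr_gt0.
Qed.

Lemma backward_dt c x r z : time_interval c r ->
  dt (backward c x) r z = - lap (backward c x r) z.
Proof.
move=> /andP[r0 rc]; apply: dtE.
have cr : 0 < c - r by rewrite subr_gt0.
have d1 := is_derive_dt z open_positive (heat_st x) cr.
have d2 : is_derive r (1 : R) (fun r => c - r) (- 1).
  by apply: (is_derive_eq (is_deriveB (is_derive_cst c r 1) (is_derive_id r 1))); rewrite sub0r.
have D : is_derive r (1 : R) (fun r => p (c - r) z x) (dt (fun t y => p t y x) (c - r) z * - 1).
  exact: (@is_derive1_comp _ (fun t => p t z x) (fun r => c - r) _ _ _ d1 d2).
by apply: (is_derive_eq D); rewrite mulrN1 heat_dt.
Qed.

Lemma derive_backward c x w r : smooth_st (time_interval c) w -> time_interval c r ->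
  is_derive r (1 : R) (fun r => Int (fun z => backward c x r z * w r z))
    (Int (fun z => backward c x r z * (dt w r z - lap (w r) z))).
Proof.
move=> sw Ir.
exact: (derive_duality M_closed vol_r (@time_interval_open c) (@backward_st c x) sw Ir
  (fun z => backward_dt x z Ir)).
Qed.

Definition heat_solution u : Prop :=
  smooth_st pos u /\ forall t x, 0 < t -> dt u t x = lap (u t) x.

(** The integral is constant in r by duality and tends to u c x as r tends to c. Applied to kernels,
    this one identity gives symmetry and the semigroup law. *)
Lemma heat_reproduces u c r x : heat_solution u -> 0 < r < c ->
  Int (fun z => backward c x r z * u r z) = u c x.
Proof.
move=> [su hu] rc; have c0 : 0 < c by have /andP[/lt_trans] := rc; exact.
have su' := smooth_st_sub (@time_interval_pos c) su.
have D s : 0 < s < c -> is_derive s (1 : R)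
    (fun r => Int (fun z => backward c x r z * u r z)) (0 : R).
  move=> sc; apply: (is_derive_eq (derive_backward x su' sc)).
  rewrite -[RHS](@Int0 R _ _ vol); apply: eq_Rintegral => z _.
  by rewrite hu ?subrr ?mulr0//; have /andP[] := sc.
apply/esym; apply: (@cvg_at_right_unique R (fun h => Int (fun z => p h z x * u (c - h) z)) _ _ c) => //.
  move=> h /andP[h0 hc]; rewrite -(derive_0_cst D (s := c - h)) //.
    by apply: eq_Rintegral => z _; rewrite /backward subKr.
  by apply/andP; split; lra.
exact: heat_left_limit.
Qed.

Lemma heat_kernel_solution y : heat_solution (fun t x => p t x y).
Proof. by split; [exact: heat_st|move=> t x; exact: heat_dt]. Qed.

Lemma heat_solution_dt u : heat_solution u -> heat_solution (dt u).
Proof.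
move=> [su hu]; split; first exact: (smooth_dt open_positive).
move=> t x t0; rewrite -(dt_lap x open_positive su t0).
by apply: (dt_ext open_positive t0) => r; exact: hu.
Qed.

Lemma heat_solutionD_cst u (e : R) : heat_solution u -> heat_solution (fun t x => u t x + e).
Proof.
move=> [su hu]; split.
  by apply: (smooth_stD open_positive su); exact: smooth_st_cst.
move=> t x t0; rewrite (lapD x (smooth_st_slice open_positive t0 su) (smooth_function_cst e)).
rewrite lap_cst addr0 -hu//; apply: dtE.
apply: (is_derive_eq (is_deriveD (is_derive_dt x open_positive su t0) (is_derive_cst e t 1))).
by rewrite addr0.
Qed.

(** At the middle time t / 2 both values are the same integral of a product of kernels. *)
Lemma heat_sym t x y : 0 < t -> p t x y = p t y x.
Proof.
move=> t0; have t2 : 0 < t / 2 < t by apply/andP; split; lra.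
rewrite -(heat_reproduces x (heat_kernel_solution y) t2) -(heat_reproduces y (heat_kernel_solution x) t2).
by rewrite /backward (_ : t - t / 2 = t / 2); [apply: eq_Rintegral => z _; rewrite mulrC|lra].
Qed.

Lemma heat_semigroup_law s t x y : 0 < s -> 0 < t ->
  Int (fun z => p s z x * p t z y) = p (s + t) x y.
Proof.
move=> s0 t0; rewrite -(heat_reproduces x (heat_kernel_solution y) (r := t)).
  by rewrite /backward addrK.
by rewrite t0 ltrDr.
Qed.

End heat_kernel.
Local Notation bw := backward.

(** * Entropy, Fisher information and the Li-Yau bound *)

Section liyau.
Variable D : unity_partition M.
Local Notation Q := (ricci_avg D).

Variable u : R -> M -> R.
Hypothesis hu : heat_solution u.
Hypothesis u0 : forall t x, 0 < t -> 0 < u t x.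

Let su : smooth_st pos u := hu.1.

Definition log_st (t : R) (x : M) : R := ln (u t x).
Local Notation f := log_st.
Definition log_gam (t : R) : M -> R := gam (f t) (f t).
Local Notation G := log_gam.
Definition fisher_density (t : R) (x : M) : R := u t x * G t x.

Lemma smooth_st_log : smooth_st pos f.
Proof. by apply: (smooth_st_ln oP) su => t x; exact: u0. Qed.

Lemma smooth_st_log_gam : smooth_st pos G.
Proof. by apply: (smooth_st_gam oP); exact: smooth_st_log. Qed.

Lemma smooth_st_fisher : smooth_st pos fisher_density.
Proof. by apply: (smooth_stM oP su); exact: smooth_st_log_gam. Qed.

Lemma u_slice t : 0 < t -> smooth_function (u t).
Proof. by move=> t0; exact: (smooth_st_slice oP t0 su). Qed.

Lemma log_slice t : 0 < t -> smooth_function (f t).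
Proof. by move=> t0; exact: (smooth_st_slice oP t0 smooth_st_log). Qed.

Lemma gam_log t k x : 0 < t -> smooth_function k -> gam (u t) k x = u t x * gam (f t) k x.
Proof.
move=> t0 sk; rewrite (gam_ln x (u_slice t0) sk (fun y => u0 y t0)).
by rewrite mulrCA mulfV ?mulr1// gt_eqF// u0.
Qed.

Lemma lap_log t x : 0 < t -> u t x * (lap (f t) x + G t x) = lap (u t) x.
Proof.
move=> t0; have un0 : u t x != 0 by rewrite gt_eqF// u0.
have -> : G t x = gam (u t) (u t) x / u t x ^+ 2.
  rewrite /G (gam_ln x (u_slice t0) (log_slice t0) (fun y => u0 y t0)) gamC.
  rewrite (gam_ln x (u_slice t0) (u_slice t0) (fun y => u0 y t0)).
  by field.
rewrite (lap_ln x (u_slice t0) (fun y => u0 y t0)); field; exact: un0.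
Qed.

Lemma dt_log t x : 0 < t -> dt f t x = lap (f t) x + G t x.
Proof.
move=> t0; have un0 : u t x != 0 by rewrite gt_eqF// u0.
apply: (mulfI un0); rewrite lap_log// -hu.2//.
have H : is_derive t (1 : R) (fun r => ln (u r x)) ((u t x)^-1 * dt u t x).
  apply: (@is_derive1_comp _ (@ln R) (fun r => u r x)); last exact: (is_derive_dt x oP su t0).
  exact: is_derive1_ln (u0 x t0).
by rewrite (dtE H) mulrA mulfV ?mul1r.
Qed.

Lemma entropy_evolution t x : 0 < t ->
  dt (fun r y => u r y * f r y) t x - lap (fun y => u t y * f t y) x = - fisher_density t x.
Proof.
move=> t0; rewrite (dtM x oP su smooth_st_log t0) dt_log// hu.2//.
rewrite (lapM x (u_slice t0) (log_slice t0)) (gam_log x t0 (log_slice t0)) /fisher_density -/(G t x).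
by move: (lap _ x) (lap _ x) (G t x) => *; ring.
Qed.

(** The bracket is Gamma_2 of log u, which [ricci_avg_le] bounds from below. *)
Lemma fisher_evolution t x : 0 < t ->
  dt fisher_density t x - lap (fisher_density t) x =
  - 2 * (u t x * (2^-1 * lap (G t) x - gam (f t) (lap (f t)) x)).
Proof.
move=> t0; have sG := smooth_st_slice oP t0 smooth_st_log_gam.
have sf := log_slice t0; have sL := smooth_lap sf.
rewrite (dtM x oP su smooth_st_log_gam t0) hu.2//.
rewrite (lapM x (u_slice t0) sG) (gam_log x t0 sG).
rewrite (dt_gam x oP smooth_st_log smooth_st_log t0).
have -> : dt f t = fun y => lap (f t) y + G t y by apply/funext => y; rewrite dt_log.
rewrite [gam (f t) (fun y => _) x]gamC (gamD x sL sG sf) [gam (lap _) _ _]gamC [gam (G t) _ _]gamC.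
by move: (lap _ x) (lap _ x) (gam _ _ x) (gam _ _ x) => *; field.
Qed.

(** For u = p_t(., y) + e this is the Fisher information j_y. *)
Definition fisher_info (c : R) (x : M) (r : R) : R :=
  Int (fun z => bw c x r z * fisher_density r z).

Lemma derive_entropy (c r : R) x : 0 < r < c ->
  is_derive r (1 : R) (fun r => Int (fun z => bw c x r z * (u r z * f r z)))
    (- fisher_info c x r).
Proof.
move=> rc; have r0 : 0 < r by have /andP[] := rc.
have suf := smooth_stM oP su smooth_st_log.
apply: (is_derive_eq (derive_backward x (smooth_st_sub (@time_interval_pos c) suf) rc)).
have sf := smooth_st_slice oP r0 smooth_st_fisher.
have bP : bm (fun z : borel M => bw c x r z * fisher_density r z).
  apply: bmM; last by apply: bm_smooth M_closed _ _.
  by apply: bm_heat; have /andP[_] := rc; rewrite subr_gt0.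
rewrite /fisher_info -(IntN V bP); apply: eq_Rintegral => z _.
by rewrite entropy_evolution// mulrN.
Qed.

Definition ricci_info (c : R) (x : M) (r : R) : R :=
  Int (fun z => bw c x r z * (u r z * Q (f r) z)).

Definition fisher_info' (c : R) (x : M) (r : R) : R :=
  Int (fun z => bw c x r z * (dt fisher_density r z - lap (fisher_density r) z)).

Lemma derive_fisher (c r : R) x : 0 < r < c ->
  is_derive r (1 : R) (fisher_info c x) (fisher_info' c x r).
Proof.
by move=> rc; exact: (derive_backward x (smooth_st_sub (@time_interval_pos c) smooth_st_fisher) rc).
Qed.

Lemma bm_backward c x r : 0 < r < c -> bm (bw c x r : borel M -> R).
Proof. by move=> /andP[_ rc]; apply: bm_heat; rewrite subr_gt0. Qed.

Lemma backward_ge0 c x r z : 0 < r < c -> 0 <= bw c x r z.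
Proof. by move=> /andP[_ rc]; apply: heat_ge0; rewrite subr_gt0. Qed.

(** Multiplied by u, the term in Lap (log u) of Bochner's inequality becomes Lap u minus the Fisher
    density. Integrated against the backward kernel this is d_t u at (c, x) minus the Fisher
    information, because d_t u is itself a heat solution. *)
Lemma fisher_info'_le c x r (lambda : R) : 0 < r < c ->
  fisher_info' c x r <= - 2 * ricci_info c x r + 4 * lambda * (dt u c x - fisher_info c x r)
    + 2 * N%:R * lambda ^+ 2 * u c x.
Proof.
move=> rc; have r0 : 0 < r by have /andP[] := rc.
have bP := bm_backward x rc.
have sm k : smooth_function k -> bm (k : borel M -> R) by exact: bm_smooth.
have bu := sm _ (u_slice r0); have bF := sm _ (smooth_st_slice oP r0 smooth_st_fisher).
have bL := sm _ (smooth_lap (u_slice r0)).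
have bQ := sm _ (smooth_ricci_avg D (log_slice r0)).
have bdF := sm _ (smooth_st_slice oP r0 (smooth_dt oP smooth_st_fisher)).
have bLF := sm _ (smooth_lap (smooth_st_slice oP r0 smooth_st_fisher)).
rewrite -(heat_reproduces x (heat_solution_dt hu) rc) -(heat_reproduces x hu rc).
rewrite (_ : Int (fun z => bw c x r z * dt u r z) = Int (fun z => bw c x r z * lap (u r) z)); last first.
  by apply: eq_Rintegral => z _; rewrite hu.2.
rewrite /fisher_info /ricci_info -(IntB V (bmM bP bL) (bmM bP bF)).
have b1 := bmM bP (bmM bu bQ); have b2 := bmB (bmM bP bL) (bmM bP bF); have b3 := bmM bP bu.
rewrite -(IntZ V _ b1) -(IntZ V _ b2) -(IntZ V _ b3).
have b4 := bmD (bmZ (- 2) b1) (bmZ (4 * lambda) b2).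
rewrite -(IntD V (bmZ (- 2) b1) (bmZ (4 * lambda) b2)) -(IntD V b4 (bmZ (2 * N%:R * lambda ^+ 2) b3)).
apply: (le_Int V); first exact: (bmM bP (bmB bdF bLF)).
  by apply: bmD b4 _; exact: bmZ.
move=> z; rewrite fisher_evolution// -lap_log// /fisher_density.
have := ricci_avg_le D z lambda (log_slice r0); rewrite -/(G r).
have P0 := backward_ge0 x z rc; have U0 := ltW (u0 z r0).
have PU := mulr_ge0 P0 U0.
move=> /(ler_wpM2l PU).
move: (bw c x r z) (u r z) (lap (G r) z) (gam _ _ z) (lap (f r) z) (G r z) (Q _ z) => *.
lra.
Qed.

Variable K : R.
Hypothesis K0 : 0 <= K.
Hypothesis QK : forall k x, smooth_function k -> `|Q k x| <= K * gam k k x.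

Lemma ricci_info_norm c x r : 0 < r < c -> `|ricci_info c x r| <= K * fisher_info c x r.
Proof.
move=> rc; have r0 : 0 < r by have /andP[] := rc.
have bP := bm_backward x rc.
have sm k : smooth_function k -> bm (k : borel M -> R) by exact: bm_smooth.
have bu := sm _ (u_slice r0); have bF := sm _ (smooth_st_slice oP r0 smooth_st_fisher).
have bQ := sm _ (smooth_ricci_avg D (log_slice r0)).
rewrite /fisher_info -(IntZ V _ (bmM bP bF)); apply: (Int_norm_le V).
- exact: (bmM bP (bmM bu bQ)).
- exact: (bmZ K (bmM bP bF)).
move=> z; have P0 := backward_ge0 x z rc; have U0 := ltW (u0 z r0).
have := QK z (log_slice r0); have PU := mulr_ge0 P0 U0 => /(ler_wpM2l PU).
rewrite !normrM (ger0_norm P0) (ger0_norm U0) /fisher_density -/(G r).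
by move: (bw c x r z) (u r z) (G r z) `|Q _ z| => *; lra.
Qed.

Lemma fisher_info_le c x a r : 0 < a -> a < r -> r < c ->
  (r - a) ^+ 2 * fisher_info c x r <= liyau_poly K N%:R (dt u c x) (u c x) (r - a).
Proof.
apply: (liyau_integrated (fun r rc => @derive_fisher c r x rc)) => {}r lambda rc.
apply: le_trans (fisher_info'_le x lambda rc) _; rewrite !lerD2r.
have := ricci_info_norm x rc; rewrite ler_norml => /andP[H _].
by move: H; move: (ricci_info _ _ _) (fisher_info _ _ _) => A B; lra.
Qed.

(** The integrated estimate is used on a window of length s ending at time c - h. As h tends to 0
    the backward kernel concentrates and the Fisher information becomes the density at (c, x); then
    s tends to c. *)
Lemma liyau c x : 0 < c ->
  c ^+ 2 * fisher_density c x <= liyau_poly K N%:R (dt u c x) (u c x) c.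
Proof.
move=> c0; apply: (liyau_poly_limit c0) => s /andP[s0 sc].
have L := @heat_left_limit _ c x smooth_st_fisher c0.
have L2 : s ^+ 2 * Int (fun z => p h z x * fisher_density (c - h) z) @[h --> 0^'+] -->
    s ^+ 2 * fisher_density c x by apply: cvgMr.
apply: (ler_cvg_to L2 (cvg_cst (liyau_poly K N%:R (dt u c x) (u c x) s))).
near=> h.
have h0 : 0 < h by near: h; exact: nbhs_right_gt.
have hc : h < c - s by near: h; apply: nbhs_right_lt; rewrite subr_gt0.
have [a0 [ar rc]] : 0 < c - h - s /\ (c - h - s < c - h /\ c - h < c) by split; [|split]; lra.
have := @fisher_info_le c x (c - h - s) (c - h) a0 ar rc.
rewrite (_ : c - h - (c - h - s) = s); last by lra.
rewrite /fisher_info /backward; congr (_ * _ <= _).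
by apply: eq_Rintegral => z _; rewrite subKr.
Unshelve. all: by end_near. Qed.

End liyau.
Local Notation finfo := fisher_info.
Local Notation finfo' := fisher_info'.

(** * The Harnack inequality *)

Section harnack.
Implicit Types u : R -> M -> R.

Lemma liyau_bound : exists2 K : R, 0 <= K &
  forall u, heat_solution u -> (forall t x, 0 < t -> 0 < u t x) -> forall c x, 0 < c ->
    c ^+ 2 * fisher_density u c x <= liyau_poly K N%:R (dt u c x) (u c x) c.
Proof.
have [|D _] := @unity_partition_exists R N M M_closed (fun _ => setT) (fun _ => openT) _ => //.
have [K K0 HK] := ricci_avg_norm D; exists K => // u hu u0 c x c0.
exact: (liyau hu u0 (fun k y sk => HK k y sk) x c0).
Qed.

(** For bounded times the coefficients of the Li-Yau bound fit into one constant. Raising the factor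
    in front of the whole bracket to A is legitimate because the bracket dominates a nonnegative
    Fisher density. *)
Lemma liyau_rate (T : R) : 0 < T -> exists A : R, 1 <= A /\
  forall u, heat_solution u -> (forall t x, 0 < t -> 0 < u t x) -> forall c x, 0 < c <= T ->
    fisher_density u c x <= A * (dt u c x + A / c * u c x).
Proof.
move=> T0; have [K K0 HK] := liyau_bound.
have N0 : 0 <= N%:R :> R by [].
(* A dominates both the coefficient [al] of the time derivative and c times that of u, for all c <=
   T. *)
pose A := 1 + 2 * K / 3 * T + N%:R / 2 * (1 + K * T + K ^+ 2 / 3 * T ^+ 2).
have A1 : 1 <= A.
  rewrite /A -addrA lerDl addr_ge0//.
    by rewrite !mulr_ge0// ltW.
  by rewrite mulr_ge0 ?divr_ge0// !addr_ge0// ?mulr_ge0 ?exprn_ge0// ltW.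
exists A; split => // u hu u0 c x /andP[c0 cT].
have H := HK u hu u0 c x c0.
have F0 : 0 <= fisher_density u c x.
  rewrite mulr_ge0 ?(ltW (u0 _ _ c0))// /log_gam.
  by apply: gam_ge0; exact: (smooth_st_slice oP c0 (smooth_st_log hu u0)).
have U0 := u0 c x c0.
move: H F0 U0; rewrite /liyau_poly; move: (fisher_density u c x) (dt u c x) (u c x) => F q m H F0 m0.
pose al := 1 + 2 * K / 3 * c.
pose be := N%:R / 2 * (1 + K * c + K ^+ 2 / 3 * c ^+ 2) / c * m.
have Kc : 0 <= K * c by rewrite mulr_ge0// ltW.
have KT : K * c <= K * T by rewrite ler_wpM2l.
have KT2 : K ^+ 2 / 3 * c ^+ 2 <= K ^+ 2 / 3 * T ^+ 2.
  by rewrite ler_wpM2l ?divr_ge0 ?exprn_ge0// !expr2 ler_pM// ltW.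
have Kc2 : 0 <= K ^+ 2 / 3 * c ^+ 2 by rewrite mulr_ge0 ?divr_ge0 ?exprn_ge0// ltW.
have al1 : 1 <= al by rewrite /al; lra.
have bA : N%:R / 2 * (1 + K * c + K ^+ 2 / 3 * c ^+ 2) <= A.
  apply: (@le_trans _ _ (N%:R / 2 * (1 + K * T + K ^+ 2 / 3 * T ^+ 2))).
    by rewrite ler_wpM2l ?divr_ge0// lerD// lerD2l.
  by rewrite /A; lra.
have alA : al <= A.
  have : 0 <= N%:R / 2 * (1 + K * T + K ^+ 2 / 3 * T ^+ 2).
    by rewrite mulr_ge0 ?divr_ge0//; lra.
  by rewrite /A /al; lra.
have be0 : 0 <= be by rewrite /be mulr_ge0 ?(ltW m0)// divr_ge0 ?(ltW c0)// mulr_ge0 ?divr_ge0//; lra.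
have F1 : F <= al * q + be.
  have cc : 0 < c ^+ 2 by rewrite exprn_gt0.
  rewrite -(ler_pM2l cc); apply: le_trans H _; apply: eq_ler.
  by rewrite /al /be; field; rewrite gt_eqF.
have beA : be <= A / c * m.
  by rewrite /be ler_wpM2r ?(ltW m0)// ler_wpM2r// invr_ge0 ltW.
have H1 : F <= al * (q + A / c * m).
  apply: (le_trans F1); rewrite mulrDr lerD2l; apply: (le_trans beA).
  have X0 : 0 <= A / c * m by apply: le_trans be0 beA.
  by have := ler_wpM2r X0 al1; rewrite mul1r.
apply: (le_trans H1); rewrite ler_wpM2r//.
have al0 : 0 < al by lra.
by have := le_trans F0 H1; rewrite pmulr_rge0.
Qed.

(** The Li-Yau bound is integrated along the space-time segment from (t0, x) to (2 t0, y): the slope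
    of log u along it is at least -B, with B independent of u. *)
Lemma harnack_ball x0 (r t0 : R) : bump_radius x0 r -> 0 < t0 ->
  exists2 C : R, 0 < C & forall u, heat_solution u -> (forall t x, 0 < t -> 0 < u t x) ->
    forall x y, chart_ball x0 r x -> chart_ball x0 r y -> u t0 x <= C * u (2 * t0) y.
Proof.
move=> [r0 sB] t00; set i := chart_at x0; set c0 := chart_point x0.
have T0 : 0 < 3 * t0 by rewrite mulr_gt0.
have [A [A1 HA]] := liyau_rate T0.
have [Cg Cg0 HCg] := metric_bounded sB.
(* Young's parameter for which half the gradient term is (t0 / A) |grad log u|^2, exactly what t0
   times the Li-Yau bound can pay. *)
pose kap := A / (2 * t0).
have A0 : 0 < A by lra.
have kap0 : 0 < kap by rewrite divr_gt0// mulr_gt0.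
pose B := 2 * (t0 * (A / t0)) + 2^-1 * (kap * (N%:R * N%:R * (Cg * ((2 * r) * (2 * r))))).
exists (expR B); first exact: expR_gt0.
move=> u hu u0 x y [v vB <-] [w wB <-].
have sf := smooth_st_log hu u0.
pose d := w - v.
(* A little more than [0, 1], so that both ends are interior for the mean value theorem; the points
   stay in the ball of radius 2r and the times below 3 t0. *)
have inB (s : R) : - 4^-1 < s < 5 / 4 -> in_ball c0 (2 * r) (v + s *: d).
  move=> /andP[s1 s2]; rewrite /in_ball /=.
  have -> : v + s *: d - c0 = (1 - s) *: (v - c0) + s *: (w - c0).
    by apply/rowP => a; rewrite /d !mxE; ring.
  apply: le_trans (ler_normD _ _) _; rewrite !normrZ.
  have n1 : `|1 - s| <= 5 / 4 by rewrite ler_norml; apply/andP; split; lra.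
  have n2 : `|1 - s| + `|s| <= 2.
    have [s0|s0] := leP 0 s; [rewrite (ger0_norm s0)|rewrite (ltr0_norm s0)].
      by have [?|?] := leP 0 (1 - s); [rewrite ger0_norm//|rewrite ltr0_norm//]; lra.
    by rewrite ger0_norm; lra.
  apply: (@le_trans _ _ (`|1 - s| * r + `|s| * r)).
    by apply: lerD; apply: ler_wpM2l; rewrite ?normr_ge0//.
  by rewrite -mulrDl ler_wpM2r// ltW.
have time (s : R) : - 4^-1 < s < 5 / 4 -> 0 < t0 + s * t0 <= 3 * t0.
  move=> /andP[s1 s2].
  have := ltr_pM2r t00 (- 4^-1) s; rewrite s1 => /idP H1.
  have := ltr_pM2r t00 s (5 / 4); rewrite s2 => /idP H2.
  by apply/andP; split; lra.
have dd a : `|d 0 a| <= 2 * r.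
  apply: le_trans (rV_coord_le _ _) _; rewrite (_ : d = (w - c0) - (v - c0)); last first.
    by apply/rowP => b; rewrite /d !mxE; ring.
  apply: le_trans (ler_normB _ _) _; have := vB; have := wB; rewrite /in_ball /= -/c0; lra.
pose f := log_st u.
pose h s := f (t0 + s * t0) (chart_inv i (v + s *: d)).
pose h' s := t0 * dt f (t0 + s * t0) (chart_inv i (v + s *: d)) +
     \sum_a d 0 a * covector i (f (t0 + s * t0)) (v + s *: d) a.
have dh (s : R) : - 4^-1 < s < 5 / 4 -> is_derive s (1 : R) h (h' s).
  move=> sI; apply: (st_line_is_derive oP sf); first by have /andP[] := time s sI.
  by apply: sB; exact: inB.
have h'B (s : R) : - 4^-1 < s < 5 / 4 -> - B <= h' s.
  move=> sI; have /andP[t1 t2] := time s sI.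
  have vs := inB s sI; have Us := sB _ vs.
  set t := t0 + s * t0 in t1 t2 *; set z := v + s *: d in vs Us *.
  have G0 : 0 < u t (chart_inv i z) by exact: u0.
  have dtu : dt u t (chart_inv i z) = u t (chart_inv i z) * dt f t (chart_inv i z).
    by rewrite (dt_log hu u0 _ t1) lap_log// hu.2.
  have := HA u hu u0 t (chart_inv i z); rewrite t1 t2 => /(_ isT).
  rewrite dtu /fisher_density [A / t * _]mulrC -mulrDr mulrCA ler_pM2l//.
  rewrite /log_gam (gam_cometric (smooth_st_slice oP t1 sf) Us).
  have := cometric_young (@chart_metricT R N M i) (@chart_metric_gt0 R N M i) (covector i (f t) z) (- d) Us kap0.
  rewrite mulNmx mulNmx linearN mulmxN /= opprK.
  have := metric_form_le (fun a b => HCg z a b vs) dd.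
  rewrite /h' -/t -/z.
  under eq_bigr do rewrite mxE mulNr.
  rewrite sumrN.
  set S := \sum_a _; set Q := (_ *m _ *m _) 0 0; set X := cometric _ _ _ _; move: (dt f t _) => df.
  move=> H1 H2 H3; have {}H1 := ler_wpM2l (ltW kap0) H1.
  have At : A / t <= 2 * (A / t0).
    have t4 : 3 / 4 * t0 <= t.
      have /andP[s1 _] := sI; have := ltr_pM2r t00 (- 4^-1) s; rewrite s1 => /idP; rewrite /t; lra.
    rewrite -mulrCA ler_pM2l//; rewrite -(invrK 2) -invfM lef_pV2 ?posrE ?mulr_gt0 ?invr_gt0//; lra.
  have K1 : kap^-1 * X = 2 * (t0 / A * X) by rewrite /kap; field; rewrite !gt_eqF.
  have K2 : t0 / A * X <= t0 * (df + A / t).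
    rewrite -mulrA ler_pM2l// ler_pdivrMl//; exact: H3.
  have K3 : t0 * (A / t) <= 2 * (t0 * (A / t0)) by have := ler_wpM2l (ltW t00) At; lra.
  by rewrite /B; move: K2; rewrite mulrDr; lra.
have [s /andP[s0 s1] E] := derive_mean_value dh (ltac:(lra) : - 4^-1 < 0) ltr01 (ltac:(lra) : 1 < 5 / 4).
have sI : - 4^-1 < s < 5 / 4 by apply/andP; split; lra.
have := h'B s sI; move: E; rewrite /h subr0 mulr1 mul0r addr0 scale0r addr0 mul1r scale1r.
have -> : t0 + t0 = 2 * t0 by rewrite mulr_natl mulr2n.
have -> : v + d = w by rewrite /d addrC subrK.
move=> E; rewrite -E lerBrDr => H.
rewrite -[u t0 _]lnK ?posrE ?u0// -[u (2 * t0) _]lnK ?posrE ?u0 ?mulr_gt0// -expRD ler_expR.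
by move: H; rewrite /f /log_st /i; lra.
Qed.

End harnack.

(** * Uniform bounds on the kernel and its time derivative *)

Section heat_bounds.
Implicit Types u : R -> M -> R.

Definition volume : R := fine (vol setT).

Lemma volume_ge0 : 0 <= volume.
Proof. exact/fine_ge0/measure_ge0. Qed.

(** If the integral were 0, so would be the integrals of the bump against the bounded functions
    p_t(., x), whereas they tend to its value 1 at x. *)
Lemma bump_mass_gt0 x r : bump_radius x r -> 0 < Int (chart_bump x r).
Proof.
move=> br; have sb := smooth_chart_bump br.
have bb : bm (chart_bump x r : borel M -> R) by apply: bm_smooth M_closed _ _.
rewrite lt_neqAle (Int_ge0 vol (chart_bump_ge0 x r)) andbT eq_sym; apply/eqP => I0.
have L := @heat_init _ x sb.
have H t : 0 < t < 1 -> Int (fun z => p t z x * chart_bump x r z) = 0.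
  move=> /andP[t0 _].
  have [C HC] := continuous_bounded M_closed (smooth_function_continuous (heat_slice x t0)).
  have bp := bm_heat x t0; have bpb := bmM bp bb.
  apply/eqP; rewrite eq_le; apply/andP; split.
    rewrite -(mulr0 C) -I0 -(IntZ V C bb); apply: (le_Int V bpb (bmZ C bb)) => z.
    by rewrite ler_wpM2r ?chart_bump_ge0// (le_trans (ler_norm _))// HC.
  by apply: Int_ge0 => z; rewrite mulr_ge0 ?chart_bump_ge0// heat_ge0.
have Ex : chart_inv (chart_at x) (chart_point x) = x by rewrite /chart_point chartK//; exact: chart_atP.
have := cvg_at_right_unique ltr01 H L; rewrite -[X in chart_bump x r X]Ex chart_bump1//.
  by move/eqP; rewrite oner_eq0.
by rewrite /in_ball /= subrr normr0 ltW//; have [] := br.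
Qed.

(** The hypotheses give p >= 0 only, so logarithms are taken of p + e, again a heat solution. *)
Definition heat_shift (e : R) (y : M) (t : R) (x : M) : R := p t x y + e.

Lemma heat_shift_solution e y : heat_solution (heat_shift e y).
Proof. exact: (heat_solutionD_cst e (heat_kernel_solution y)). Qed.

Lemma heat_shift_gt0 e y t x : 0 < e -> 0 < t -> 0 < heat_shift e y t x.
Proof. by move=> e0 t0; rewrite ltr_wpDl// heat_ge0. Qed.

Lemma dt_heat_shift e y t x : 0 < t -> dt (heat_shift e y) t x = dt (fun t x => p t x y) t x.
Proof.
move=> t0; rewrite (heat_shift_solution e y).2// (heat_kernel_solution y).2//.
rewrite (lapD x (heat_slice y t0) (smooth_function_cst e)) lap_cst addr0//.
Qed.

Lemma bm_heat_shift e y t : 0 < t -> bm (heat_shift e y t : borel M -> R).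
Proof. by move=> t0; apply: bmD; [exact: bm_heat|exact: bm_cst]. Qed.

Lemma heat_shift_mass e y t : 0 < t -> Int (heat_shift e y t) = 1 + e * volume.
Proof. by move=> t0; rewrite (IntD V (bm_heat y t0) (bm_cst _ e)) heat_mass// Int_cst. Qed.

(** Harnack's inequality, averaged over the later point against a bump, bounds the kernel by its
    total mass at time 2 t0. The shift e = 1 supplies the positivity that Harnack's inequality asks
    for. *)
Lemma heat_bound_ball x0 r t0 : bump_radius x0 r -> 0 < t0 ->
  exists2 C : R, 0 <= C & forall x y, chart_ball x0 r x -> p t0 x y <= C.
Proof.
move=> br t00; have [C C0 HC] := harnack_ball br t00.
have r0 : 0 < r by have [] := br.
have br2 : bump_radius x0 (r / 2).
  split; first by rewrite divr_gt0.
  move=> u uB; apply: br.2; apply: le_trans uB _; lra.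
have sb := smooth_chart_bump br2; have m0 := bump_mass_gt0 br2.
have bb : bm (chart_bump x0 (r / 2) : borel M -> R) by apply: bm_smooth M_closed _ _.
have [B HB] := continuous_bounded M_closed (smooth_function_continuous sb).
have B0 : 0 <= B by apply: le_trans (HB x0).
exists (C * (B * (1 + volume)) / Int (chart_bump x0 (r / 2))).
  by rewrite divr_ge0 ?(ltW m0)// !mulr_ge0 ?(ltW C0)// addr_ge0// volume_ge0.
move=> x y xB; rewrite ler_pdivlMr//.
have t20 : 0 < 2 * t0 by rewrite mulr_gt0.
have bu := bm_heat_shift 1 y t20; have bub := bmM bu bb.
apply: (@le_trans _ _ (heat_shift 1 y t0 x * Int (chart_bump x0 (r / 2)))).
  by rewrite ler_wpM2r ?(ltW m0)// lerDl.
apply: (@le_trans _ _ (C * Int (fun z => heat_shift 1 y (2 * t0) z * chart_bump x0 (r / 2) z))).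
  rewrite -(IntZ V _ bb) -(IntZ V _ bub); apply: (le_Int V (bmZ _ bb) (bmZ C bub)) => z.
  have [zB|zB] := pselect (chart_ball x0 r z).
    rewrite mulrA ler_wpM2r ?chart_bump_ge0//; apply: HC => //.
      exact: heat_shift_solution.
    by move=> t w; exact: heat_shift_gt0.
  rewrite chart_bump0 ?mulr0//.
  by move: zB; rewrite /chart_ball (_ : 2 * (r / 2) = r)//; lra.
rewrite ler_pM2l//.
apply: (@le_trans _ _ (Int (fun z => B * heat_shift 1 y (2 * t0) z))).
  apply: (le_Int V bub (bmZ B bu)) => z; rewrite mulrC ler_wpM2r//; first exact/ltW/heat_shift_gt0.
  exact: le_trans (ler_norm _) (HB z).
by rewrite (IntZ V _ bu) heat_shift_mass// mul1r.
Qed.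

(** Finitely many local bounds cover M; at later times the semigroup law averages the bound at
    t0. *)
Lemma heat_bound t0 : 0 < t0 -> exists2 C : R, 0 <= C & forall t x y, t0 <= t -> p t x y <= C.
Proof.
move=> t00.
have Hr (x : M) : exists r, bump_radius x r.
  by have [r rb _] := bump_radius_exists (x := x) openT I; exists r.
have [r br] := choice Hr.
have [n [c cov]] := chart_ball_cover M_closed br.
have HC k : exists C : R, 0 <= C /\ forall x y, chart_ball (c k) (r (c k)) x -> p t0 x y <= C.
  by have [C C0 HC] := heat_bound_ball (br (c k)) t00; exists C.
have [C hC] := choice HC.
have C0 : 0 <= \sum_k C k by apply: sumr_ge0 => k _; exact: (hC k).1.
have B0 x y : p t0 x y <= \sum_k C k.
  have [k xk] := cov x; apply: le_trans ((hC k).2 x y xk) _.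
  by rewrite (bigD1 k)//= lerDl sumr_ge0// => j _; exact: (hC j).1.
exists (\sum_k C k) => // t x y; rewrite le_eqVlt => /predU1P[<-//|t0t].
have d0 : 0 < t - t0 by rewrite subr_gt0.
rewrite -[t](subrK t0) -(heat_semigroup_law x y d0 t00).
have b1 := bm_heat x d0; have b2 := bm_heat y t00.
rewrite -[X in _ <= X]mulr1 -(heat_mass x d0) -(IntZ V _ b1).
apply: (le_Int V (bmM b1 b2) (bmZ _ b1)) => z.
by rewrite mulrC ler_wpM2r ?heat_ge0.
Qed.

(** The Li-Yau bound with its nonnegative left side dropped, the shift being removed afterwards. *)
Lemma heat_dt_ge T : 0 < T -> exists2 A : R, 0 <= A &
  forall t x y, 0 < t <= T -> - (A / t * p t x y) <= dt (fun t x => p t x y) t x.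
Proof.
move=> T0; have [A [A1 HA]] := liyau_rate T0; have A0 : 0 < A by lra.
exists A; first exact: ltW.
move=> t x y tT; have t0 : 0 < t by have /andP[] := tT.
rewrite lerNl -subr_ge0 opprK; apply/ler_addgt0Pl => e e0.
pose e' := e / (A / t).
have At : 0 < A / t by rewrite divr_gt0.
have e'0 : 0 < e' by rewrite divr_gt0.
have P := fun t x => @heat_shift_gt0 e' y t x e'0.
have H := HA _ (heat_shift_solution e' y) P t x tT.
have F0 : 0 <= fisher_density (heat_shift e' y) t x.
  rewrite mulr_ge0 ?(ltW (P _ _ t0))//.
  by apply: gam_ge0; exact: (smooth_st_slice oP t0 (smooth_st_log (heat_shift_solution e' y) P)).
have := le_trans F0 H; rewrite pmulr_rge0// dt_heat_shift// /heat_shift mulrDr.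
rewrite (_ : A / t * e' = e); last by rewrite /e' mulrC divfK// gt_eqF.
by move: (dt _ t x) => q; lra.
Qed.

Lemma Int_dt_heat t y : 0 < t -> Int (dt (fun t x => p t x y) t) = 0.
Proof.
move=> t0; rewrite -[RHS](Int_lap M_closed (hs_vol hs) (heat_slice y t0)).
by apply: eq_Rintegral => x _; exact: heat_dt.
Qed.

Lemma bm_dt_heat t y : 0 < t -> bm (dt (fun t x => p t x y) t : borel M -> R).
Proof. by move=> t0; exact: (bm_st M_closed oP (smooth_dt oP (heat_st y)) t0). Qed.

(** The time derivative has integral 0 and is at least -(A/t) p, so its L^1 norm is of order A/t.
    Reproduction over half of the time interval, where the kernel is bounded, turns this into a
    uniform bound. *)
Lemma heat_dt_bound t0 T : 0 < t0 -> exists2 C : R, 0 <= C &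
  forall t x y, t0 <= t <= T -> `|dt (fun t x => p t x y) t x| <= C.
Proof.
move=> t00; have [Tt|Tt] := ltP T t0.
  by exists 0 => // t x y /andP[a b]; have := le_lt_trans (le_trans a b) Tt; rewrite ltxx.
have T0 : 0 < T by apply: lt_le_trans Tt.
have [A A0 HA] := heat_dt_ge T0.
have t02 : 0 < t0 / 2 by rewrite divr_gt0.
have [B B0 HB] := heat_bound t02.
exists (B * (2 * (A / (t0 / 2)))).
  by rewrite !mulr_ge0// invr_ge0 ltW.
move=> t x y /andP[t0t tT].
have tt0 : 0 < t by apply: lt_le_trans t0t.
have th : 0 < t / 2 by rewrite divr_gt0.
have tt : 0 < t / 2 < t by apply/andP; split; lra.
have hT : 0 < t / 2 <= T by rewrite th; lra.
rewrite -(heat_reproduces x (heat_solution_dt (heat_kernel_solution y)) tt).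
rewrite /backward (_ : t - t / 2 = t / 2); last by lra.
have bq := bm_dt_heat y th; have bp := bm_heat y th; have bx := bm_heat x th.
set q := dt _ (t / 2) in bq *.
(* If q >= -X and X >= 0 then |q| <= q + 2X. *)
apply: (@le_trans _ _ (Int (fun z => B * (q z + 2 * (A / (t / 2)) * p (t / 2) z y)))).
  have b1 := bmZ B (bmD bq (bmZ (2 * (A / (t / 2))) bp)).
  apply: (Int_norm_le V (bmM bx bq) b1) => z.
  have P0 : 0 <= p (t / 2) z y by exact: heat_ge0.
  have X0 : 0 <= A / (t / 2) * p (t / 2) z y by rewrite mulr_ge0// divr_ge0// ltW.
  rewrite normrM ger0_norm ?heat_ge0//; apply: ler_pM => //.
  - exact: heat_ge0.
  - by apply: HB; lra.
  have := HA _ z y hT; rewrite -/q -[2 * _ * _]mulrA; move: (A / _ * _) X0 (q z) => X X0 qz H.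
  by rewrite ler_norml; apply/andP; split; lra.
rewrite (IntZ V _ (bmD bq (bmZ _ bp))) (IntD V bq (bmZ _ bp)) (IntZ V _ bp) heat_mass//.
rewrite (Int_dt_heat y th) add0r mulr1 ler_wpM2l// ler_wpM2l// ler_wpM2l// lef_pV2 ?posrE//; lra.
Qed.

(** Uniformity in y and e is what domination in the integrals over y requires. *)
Lemma fisher_density_bound t0 T : 0 < t0 -> exists2 C : R, 0 <= C &
  forall t x y e, t0 <= t <= T -> 0 < e <= 1 -> fisher_density (heat_shift e y) t x <= C.
Proof.
move=> t00; have [Tt|Tt] := ltP T t0.
  by exists 0 => // t x y e /andP[a b]; have := le_lt_trans (le_trans a b) Tt; rewrite ltxx.
have T0 : 0 < T by apply: lt_le_trans Tt.
have [A [A1 HA]] := liyau_rate T0; have A0 : 0 < A by lra.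
have [B B0 HB] := heat_bound t00; have [D D0 HD] := heat_dt_bound T t00.
exists (A * (D + A / t0 * (B + 1))).
  by rewrite mulr_ge0 ?(ltW A0)// addr_ge0// mulr_ge0 ?divr_ge0 ?(ltW A0) ?(ltW t00)// addr_ge0.
move=> t x y e tT /andP[e0 e1]; have /andP[t0t tT'] := tT.
have tt0 : 0 < t by apply: lt_le_trans t0t.
have tT2 : 0 < t <= T by rewrite tt0.
apply: le_trans (HA _ (heat_shift_solution e y) (fun t x => @heat_shift_gt0 e y t x e0) t x tT2) _.
rewrite ler_pM2l// dt_heat_shift//; apply: lerD; first exact: le_trans (ler_norm _) (HD t x y tT).
have U0 := ltW (@heat_shift_gt0 e y t x e0 tt0).
apply: ler_pM; rewrite ?divr_ge0 ?(ltW A0) ?(ltW tt0)//.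
  by rewrite ler_pM2l// lef_pV2 ?posrE.
by apply: lerD => //; exact: HB.
Qed.

End heat_bounds.
Local Notation hsh := heat_shift.

(** * Integration over the source point *)

Section heat_fubini.

Lemma bm_heat_r t z : 0 < t -> bm (p t z : borel M -> R).
Proof.
move=> t0; rewrite (_ : p t z = (fun y => p t y z)); first exact: bm_heat.
by apply/funext => y; exact: heat_sym.
Qed.

Lemma heat_mass_r t z : 0 < t -> Int (p t z) = 1.
Proof.
move=> t0; rewrite -(heat_mass z t0); apply: eq_Rintegral => y _; exact: heat_sym.
Qed.

Lemma dt_heat_sym t x y : 0 < t -> dt (fun t x => p t x y) t x = dt (fun t y => p t y x) t y.
Proof.
move=> t0; apply: near_eq_derive.
by apply: filterS (open_nbhs_nbhs (conj oP t0)) => r r0; exact: heat_sym.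
Qed.

Lemma bm_dt_heat_r t x : 0 < t -> bm (fun y : borel M => dt (fun t x => p t x y) t x).
Proof.
move=> t0; have -> : (fun y : M => dt (fun t x => p t x y) t x) = dt (fun t y => p t y x) t.
  by apply/funext => y; rewrite dt_heat_sym.
exact: bm_dt_heat.
Qed.

Lemma Int_dt_heat_r t x : 0 < t -> Int (fun y => dt (fun t x => p t x y) t x) = 0.
Proof.
move=> t0; rewrite -(Int_dt_heat x t0); apply: eq_Rintegral => y _; exact: dt_heat_sym.
Qed.

Lemma heat_jointly_measurable t : 0 < t ->
  measurable_fun setT (fun w : borel M * borel M => p t w.1 w.2).
Proof.
move=> t0; apply: (separately_continuous_measurable (@points_second_countable R N M)).
  by move=> y; exact: smooth_function_continuous (heat_slice y t0).
by move=> z; have [] := bm_heat_r z t0.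
Qed.

(** The derivative in z is a limit of difference quotients, each measurable in y. *)
Lemma covector_measurable i v a t : 0 < t ->
  chart_cod i v -> measurable_fun setT (fun y : borel M => covector i (fun z => p t z y) v a).
Proof.
move=> t0 Uv.
pose F n (y : borel M) : R := (n.+1%:R^-1)^-1 * (p t (chart_inv i (n.+1%:R^-1 *: delta_mx 0 a + v)) y -
   p t (chart_inv i v) y).
apply: (@measurable_fun_cvg _ _ _ _ F) => //.
  move=> n; apply: measurable_funM; first exact: measurable_cst.
  by apply: measurable_funB; [have [] := bm_heat_r (chart_inv i (n.+1%:R^-1 *: delta_mx 0 a + v)) t0
    |have [] := bm_heat_r (chart_inv i v) t0].
move=> y _; rewrite /covector partialE.
have sf : smooth_on (chart_cod i) ((fun z => p t z y) \o chart_inv i) by exact: (heat_slice y t0).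
have Dv := @smooth_on_derivable _ _ _ _ v a sf Uv; rewrite /derive.
have H := cvg_comp _ _ (harmonic_dnbhs (R := R)) Dv.
exact: H.
Qed.

Lemma smooth_heat_log e y t : 0 < e -> 0 < t -> smooth_function (log_st (hsh e y) t).
Proof.
by move=> e0 t0; apply: (log_slice (heat_shift_solution e y)) => // r z; exact: heat_shift_gt0.
Qed.

Lemma smooth_heat_fisher e y : 0 < e -> smooth_st pos (fisher_density (hsh e y)).
Proof.
by move=> e0; apply: (smooth_st_fisher (heat_shift_solution e y)) => r z; exact: heat_shift_gt0.
Qed.

Lemma fisher_chart e y t i v : 0 < e -> 0 < t -> chart_cod i v ->
  fisher_density (hsh e y) t (chart_inv i v) = hsh e y t (chart_inv i v) *
  cometric (metric i) v (covector i (log_st (hsh e y) t) v) (covector i (log_st (hsh e y) t) v).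
Proof.
move=> e0 t0 Uv; rewrite /fisher_density /log_gam gam_cometric//.
exact: smooth_heat_log.
Qed.

(** The product does not depend on e. This makes the Fisher density monotone in e and lets the case
    e = 1 control the gradient of p itself. *)
Lemma fisher_heat e y t x : 0 < e -> 0 < t ->
  hsh e y t x * fisher_density (hsh e y) t x = gam (fun z => p t z y) (fun z => p t z y) x.
Proof.
move=> e0 t0; have hu := heat_shift_solution e y.
have u0 t' x' := @heat_shift_gt0 e y t' x' e0.
have su := u_slice hu t0; have sp := heat_slice y t0.
have sc : smooth_function (fun _ : M => e) by exact: smooth_function_cst.
have sf := log_slice hu u0 t0.
transitivity (gam (hsh e y t) (hsh e y t) x).
  rewrite (gam_log hu u0 x t0 su) gamC (gam_log hu u0 x t0 sf).
  by rewrite /fisher_density /log_gam.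
have E k : smooth_function k -> gam (hsh e y t) k x = gam (fun z => p t z y) k x.
  by move=> sk; rewrite -[RHS]addr0 -(gam_cst e x sk); exact: (gamD x sp sc sk).
by rewrite (E _ su) gamC (E _ sp).
Qed.

Lemma covector_log e y t i v a : 0 < e -> 0 < t -> chart_cod i v ->
  covector i (log_st (hsh e y) t) v a =
  (hsh e y t (chart_inv i v))^-1 * covector i (fun z => p t z y) v a.
Proof.
move=> e0 t0 Uv.
have sf : smooth_on (chart_cod i) ((fun z => p t z y) \o chart_inv i) by exact: (heat_slice y t0).
apply: (@partial_comp1 _ _ _ (fun s => ln (s + e)) _ _ _ _ sf Uv).
have d : is_derive (p t (chart_inv i v) y) (1 : R) (fun s => s + e) (1 : R).
  by apply: (is_derive_eq (is_deriveD (is_derive_id _ _) (is_derive_cst e _ _))); rewrite addr0.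
have l : is_derive (p t (chart_inv i v) y + e) (1 : R) (@ln R) (hsh e y t (chart_inv i v))^-1.
  by apply: is_derive1_ln; exact: heat_shift_gt0.
by apply: (is_derive_eq (@is_derive1_comp _ (@ln R) (fun s => s + e) _ _ _ l d)); rewrite mulr1.
Qed.

Lemma bm_heat_shift_r e t x : 0 < t -> bm (fun y : borel M => hsh e y t x).
Proof. by move=> t0; apply: bmD; [exact: bm_heat_r|exact: bm_cst]. Qed.

Lemma heat_shift_mass_r e t x : 0 < t -> Int (fun y => hsh e y t x) = 1 + e * volume.
Proof.
move=> t0; rewrite (IntD V (bm_heat_r x t0) (bm_cst _ e)) heat_mass_r//.
by rewrite Int_cst.
Qed.

(** Integrated over y the time derivative disappears, by conservation of mass, and only the
    dimensional term remains. *)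
Lemma Int_liyau_poly K e c x r : 0 < r ->
  bm (fun y : borel M => liyau_poly K N%:R (dt (fun t x => p t x y) r x) (hsh e y r x) c) /\
  Int (fun y => liyau_poly K N%:R (dt (fun t x => p t x y) r x) (hsh e y r x) c) =
  (1 + e * volume) * (N%:R / 2 * (c + K * (c * c) + K ^+ 2 / 3 * (c * c * c))).
Proof.
move=> r0; have bq := bm_dt_heat_r x r0; have bh := bm_heat_shift_r e x r0.
pose k1 := c * c + 2 * K / 3 * (c * c * c).
pose k2 := N%:R / 2 * (c + K * (c * c) + K ^+ 2 / 3 * (c * c * c)).
rewrite (_ : (fun y => _) = fun y => k1 * dt (fun t x => p t x y) r x + k2 * hsh e y r x); last first.
  by apply/funext => y; rewrite /liyau_poly /k1 /k2; move: (dt _ _ _) (hsh _ _ _ _) => *; ring.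
split; first exact: bmD (bmZ _ bq) (bmZ _ bh).
by rewrite (IntD V (bmZ _ bq) (bmZ _ bh)) (IntZ V _ bq) (IntZ V _ bh) Int_dt_heat_r// heat_shift_mass_r// mulr0 add0r mulrC.
Qed.

Lemma heat_shift_inv_measurable e t x : 0 < e -> 0 < t ->
  measurable_fun setT (fun y : borel M => (hsh e y t x)^-1).
Proof.
move=> e0 t0; apply: (@continuous_on_measurable R M setT) openT _ => y _.
rewrite (_ : (fun y => _) = fun y : M => (p t y x + e)^-1); last first.
  by apply/funext => z; rewrite /heat_shift heat_sym.
apply: continuousV; first by rewrite gt_eqF// heat_shift_gt0.
apply: continuousD; last exact: cst_continuous.
exact: (smooth_function_continuous (heat_slice x t0)).
Qed.

Lemma covector_log_measurable i v a e t : 0 < e -> 0 < t -> chart_cod i v ->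
  measurable_fun setT (fun y : borel M => covector i (log_st (hsh e y) t) v a).
Proof.
move=> e0 t0 Uv; under eq_fun do rewrite covector_log//.
by apply: measurable_funM; [exact: heat_shift_inv_measurable|exact: covector_measurable].
Qed.

Lemma bilinear_measurable (A : 'I_N -> 'I_N -> R) (P : borel M -> 'I_N -> R) :
  (forall a, measurable_fun setT (P^~ a)) ->
  measurable_fun setT (fun y => \sum_a \sum_b A a b * P y a * P y b).
Proof.
move=> mP; apply: measurable_sum => a; apply: measurable_sum => b.
by apply: measurable_funM => //; apply: measurable_funM => //; exact: measurable_cst.
Qed.

Lemma fisher_measurable e t x : 0 < e -> 0 < t ->
  measurable_fun setT (fun y : borel M => fisher_density (hsh e y) t x).
Proof.
move=> e0 t0; have [i [v [Uv <-]]] := chart_pointP x.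
under eq_fun do rewrite fisher_chart//.
apply: measurable_funM; first by have [] := bm_heat_shift_r e (chart_inv i v) t0.
by apply: bilinear_measurable => a; exact: covector_log_measurable.
Qed.

Lemma fisher_ge0 e y t x : 0 < e -> 0 < t -> 0 <= fisher_density (hsh e y) t x.
Proof.
move=> e0 t0; apply: mulr_ge0; first exact/ltW/heat_shift_gt0.
by apply: gam_ge0; exact: smooth_heat_log.
Qed.

Lemma bm_fisher e t x : 0 < e <= 1 -> 0 < t ->
  bm (fun y : borel M => fisher_density (hsh e y) t x).
Proof.
move=> e01 t0; have /andP[e0 e1] := e01.
split; first exact: fisher_measurable.
have [C C0 HC] := fisher_density_bound t t0; exists C => y.
by rewrite ger0_norm ?fisher_ge0//; apply: HC => //; rewrite lexx.
Qed.

(** The Li-Yau bound integrated over y. It matches the Cramer-Rao lower bound to leading order, so K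
    times the Fisher information can be added to the Ricci term and removed again at the cost of O(t
    + e). *)
Lemma mean_fisher_upper : exists2 C : R, 0 <= C & forall t e z, 0 < t < 2 -> 0 < e <= 1 ->
  2 * t * Int (fun y => fisher_density (hsh e y) t z) <= N%:R + C * (t + e).
Proof.
have [K K0 HK] := liyau_bound.
pose L := K + 2 * (K ^+ 2 / 3).
have L0 : 0 <= L by rewrite addr_ge0// mulr_ge0// divr_ge0// exprn_ge0.
have V0 := volume_ge0.
have N0 : 0 <= N%:R :> R by [].
exists (N%:R * (L + volume * (1 + 2 * L))).
  by rewrite mulr_ge0// addr_ge0// mulr_ge0// addr_ge0// mulr_ge0.
move=> t e z t02 e01; have /andP[t0 t2] := t02; have /andP[e0 e1] := e01.
have bF := bm_fisher z e01 t0; have [bL IL] := Int_liyau_poly K e t z t0.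
have H : t ^+ 2 * Int (fun y => fisher_density (hsh e y) t z) <=
    (1 + e * volume) * (N%:R / 2 * (t + K * (t * t) + K ^+ 2 / 3 * (t * t * t))).
  rewrite -IL -(IntZ V _ bF); apply: (le_Int V (bmZ _ bF) bL) => y.
  rewrite -(dt_heat_shift e y z t0); apply: HK t0; first exact: heat_shift_solution.
  by move=> r w; exact: heat_shift_gt0.
have t20 : 0 <= 2 / t by rewrite divr_ge0// ltW.
have := ler_wpM2l t20 H; rewrite mulrA (_ : 2 / t * t ^+ 2 = 2 * t); last by field; rewrite gt_eqF.
move=> /le_trans; apply.
have -> : 2 / t * ((1 + e * volume) * (N%:R / 2 * (t + K * (t * t) + K ^+ 2 / 3 * (t * t * t)))) =
    N%:R * ((1 + t * (K + K ^+ 2 / 3 * t)) * (1 + e * volume)).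
  by field; rewrite gt_eqF.
have kL : K + K ^+ 2 / 3 * t <= L.
  have : 0 <= K ^+ 2 / 3 by rewrite divr_ge0// exprn_ge0.
  by move=> q; have := ler_wpM2l q (ltW t2); rewrite /L; lra.
have h1 : t * (K + K ^+ 2 / 3 * t) <= t * L by rewrite ler_wpM2l// ltW.
have h2 : t * L <= 2 * L by rewrite ler_wpM2r// ltW.
have ev : 0 <= e * volume by rewrite mulr_ge0// ltW.
have h3 : (1 + t * (K + K ^+ 2 / 3 * t)) * (1 + e * volume) <=
   1 + t * L + e * volume * (1 + 2 * L).
  set X := t * _ in h1 *; have := ler_wpM2r ev (le_trans h1 h2); lra.
have tv : 0 <= t * (volume * (1 + 2 * L)).
  by rewrite mulr_ge0 ?(ltW t0)// mulr_ge0// addr_ge0// mulr_ge0.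
have eL : 0 <= e * L by rewrite mulr_ge0// ltW.
apply: le_trans (ler_wpM2l N0 h3) _; set Y := L + _.
have -> : N%:R + N%:R * Y * (t + e) = N%:R * (1 + Y * (t + e)) :> R by ring.
apply: (ler_wpM2l N0); rewrite /Y; move: volume tv eL => v tv eL; lra.
Qed.

Variable D : unity_partition M.

Definition ricci_density (e : R) (y : M) (t : R) (z : M) : R :=
  hsh e y t z * ricci_avg D (log_st (hsh e y) t) z.

Lemma ricci_density_measurable e t z : 0 < e -> 0 < t ->
  measurable_fun setT (fun y : borel M => ricci_density e y t z).
Proof.
move=> e0 t0; apply: measurable_funM; first by have [] := bm_heat_shift_r e z t0.
apply: measurable_sum => k.
have [c0|[v vB vz]] := up_cases k z.
  have E y : chi_ricci k (log_st (hsh e y) t) z = 0.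
    rewrite /chi_ricci /chart_ext; case: asboolP => // dz.
    by rewrite chartK// c0 mul0r.
  by under eq_fun do rewrite E; exact: measurable_cst.
have Uv := up_ball_cod vB.
rewrite -vz; under eq_fun do rewrite (chi_ricciE _ Uv).
apply: measurable_funM; first exact: measurable_cst.
by apply: bilinear_measurable => a; exact: covector_log_measurable.
Qed.

Lemma continuous_fisher e y t : 0 < e -> 0 < t -> continuous (fisher_density (hsh e y) t).
Proof.
move=> e0 t0; apply: smooth_function_continuous; apply: (smooth_st_slice oP t0).
exact: smooth_heat_fisher.
Qed.

Lemma continuous_ricci_density e y t : 0 < e -> 0 < t -> continuous (ricci_density e y t).
Proof.
move=> e0 t0; apply: smooth_function_continuous; apply: smooth_functionM.
  exact: (u_slice (heat_shift_solution e y) t0).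
by apply: smooth_ricci_avg; exact: smooth_heat_log.
Qed.

Lemma backward_fubini c x r (G : M -> M -> R) (C : R) : 0 < r < c ->
  measurable_fun setT (fun w : borel M * borel M => G w.1 w.2) ->
  (forall z y, `|G z y| <= C) ->
  [/\ bm (fun y : borel M => Int (fun z => bw c x r z * G z y)),
      bm (fun z : borel M => Int (G z)) &
      Int (fun y => Int (fun z => bw c x r z * G z y)) = Int (fun z => bw c x r z * Int (G z))].
Proof.
move=> /andP[r0 rc] mG GC.
have cr : 0 < c - r by rewrite subr_gt0.
have bb : bm (bw c x r : borel M -> R) by exact: bm_heat.
have [mb [B HB]] := bb.
have [b1 _ _] := Int_fubini V mG GC.
have mF : measurable_fun setT (fun w : borel M * borel M => bw c x r w.1 * G w.1 w.2).
  by apply: measurable_funM mG; exact: (measurableT_comp mb measurable_fst).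
have FC z y : `|bw c x r z * G z y| <= B * C.
  by rewrite normrM; apply: ler_pM.
have [_ b2 E] := Int_fubini V mF FC.
split => //; rewrite -E; apply: eq_Rintegral => z _.
apply: IntZ => //; split; last by exists C => y; exact: GC.
exact: (measurableT_comp mG (pair1_measurable z)).
Qed.

End heat_fubini.

(** * Small-time expansions of the heat semigroup *)

Section heat_operator.
Implicit Types (psi h : M -> R).

(** Integration runs over the first argument of p, in which the heat equation and the initial
    condition are given; [heat_opE] exchanges the arguments by symmetry. *)
Definition heat_op (t : R) psi (x : M) : R := Int (fun y => p t y x * psi y).

Lemma heat_opE t psi x : 0 < t -> heat_op t psi x = Int (fun y => p t x y * psi y).
Proof. by move=> t0; apply: eq_Rintegral => y _; rewrite heat_sym. Qed.

Lemma bm_heat_op t h x : 0 < t -> bm (h : borel M -> R) ->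
  bm (fun y : borel M => p t y x * h y).
Proof. by move=> t0 bh; apply: bmM => //; exact: bm_heat. Qed.

Lemma heat_op_norm t h x (B : R) : 0 < t -> bm (h : borel M -> R) ->
  (forall y, `|h y| <= B) -> `|heat_op t h x| <= B.
Proof.
move=> t0 bh hB; rewrite -[B]mulr1 -(heat_mass x t0) -(IntZ V _ (bm_heat x t0)).
apply: (Int_norm_le V (bm_heat_op x t0 bh) (bmZ B (bm_heat x t0))) => y.
by rewrite normrM (ger0_norm (heat_ge0 _ _ t0)) mulrC ler_wpM2r// heat_ge0.
Qed.

Lemma derive_heat_op (t : R) psi x : 0 < t -> smooth_function psi ->
  is_derive t (1 : R) (fun t => heat_op t psi x) (heat_op t (lap psi) x).
Proof.
move=> t0 sp.
have su : smooth_st pos (fun r y => p r y x * psi y).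
  by apply: (smooth_stM oP (heat_st x)); exact: (smooth_st_fun oP).
apply: (is_derive_eq (derive_Int_st M_closed (hs_vol hs) oP su t0)).
rewrite /heat_op (lap_symmetric M_closed (hs_vol hs) (heat_slice x t0) sp).
apply: eq_Rintegral => y _.
rewrite (dtM y oP (heat_st x) (smooth_st_fun oP sp) t0) heat_dt// mulrC.
have -> : dt (fun _ => psi) t y = 0 by apply: dtE; exact: (is_derive_cst (psi y) t 1).
by rewrite mul0r add0r.
Qed.

Lemma smooth_norm psi : smooth_function psi -> exists2 B : R, 0 <= B & forall x, `|psi x| <= B.
Proof.
move=> sp; have [B HB] := continuous_bounded M_closed (smooth_function_continuous sp).
by exists B => //; apply: le_trans (HB point).
Qed.

(** The derivative of P_t psi in t is P_t (Lap psi). Integrating the uniform bound of the latter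
    gives this order, and each further order comes from the preceding one applied to Lap psi. *)
Lemma heat_expansion1 psi : smooth_function psi -> exists2 C : R, 0 <= C &
  forall t x, 0 < t -> `|heat_op t psi x - psi x| <= C * t.
Proof.
move=> sp; have sL := smooth_lap sp; have [B B0 HB] := smooth_norm sL.
have bL : bm (lap psi : borel M -> R) by apply: bm_smooth M_closed _ _.
exists B => // t x t0.
have tT : 0 < t < t + 1 by rewrite t0 ltrDl ltr01.
rewrite -[t in B * t]expr1.
apply: (@growth_bound R (fun r => heat_op r psi x) (fun r => heat_op r (lap psi) x) (fun r => B * r ^+ 1)
    (fun r => B * (1%:R * r ^+ 0)) (t + 1) (psi x) _ _ _ _ _ t tT).
- by move=> r /andP[r0 _]; exact: derive_heat_op.
- by move=> r _; exact: is_derive_monomial.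
- by move=> r /andP[r0 _]; rewrite expr0 !mulr1; exact: heat_op_norm.
- exact: heat_init.
- exact: monomial_cvg0.
Qed.

Lemma heat_expansion2 psi : smooth_function psi -> exists2 C : R, 0 <= C &
  forall t x, 0 < t -> `|heat_op t psi x - psi x - t * lap psi x| <= C * t ^+ 2.
Proof.
move=> sp; have sL := smooth_lap sp; have [B B0 HB] := heat_expansion1 sL.
exists B => // t x t0.
have tT : 0 < t < t + 1 by rewrite t0 ltrDl ltr01.
rewrite -addrA [- _ - _]addrC addrA.
apply: (@growth_bound R (fun r => heat_op r psi x - r * lap psi x)
   (fun r => heat_op r (lap psi) x - lap psi x) (fun r => B * r ^+ 2)
    (fun r => B * (2%:R * r ^+ 1)) (t + 1) (psi x) _ _ _ _ _ t tT).
- move=> r /andP[r0 _].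
  apply: (is_derive_eq (is_deriveB (derive_heat_op x r0 sp)
    (is_deriveM (is_derive_id r (1 : R)) (is_derive_cst (lap psi x) r 1)))).
  by rewrite /GRing.scale /= mulr0 add0r mulr1.
- by move=> r _; exact: is_derive_monomial.
- move=> r /andP[r0 _]; apply: le_trans (HB r x r0) _.
  by rewrite ler_wpM2l// expr1; lra.
- rewrite -[psi x]subr0; apply: cvgB; first exact: heat_init.
  rewrite (_ : (fun r => _) = fun r : R => lap psi x * r ^+ 1); first exact: monomial_cvg0.
  by apply/funext => r; rewrite expr1 mulrC.
- exact: monomial_cvg0.
Qed.

Lemma heat_expansion3 psi : smooth_function psi -> exists2 C : R, 0 <= C &
  forall t x, 0 < t ->
  `|heat_op t psi x - psi x - t * lap psi x - t ^+ 2 / 2 * lap (lap psi) x| <= C * t ^+ 3.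
Proof.
move=> sp; have sL := smooth_lap sp; have [B B0 HB] := heat_expansion2 sL.
exists B => // t x t0.
have tT : 0 < t < t + 1 by rewrite t0 ltrDl ltr01.
rewrite (_ : _ - _ = (heat_op t psi x - (lap psi x * t ^+ 1 + lap (lap psi) x / 2 * t ^+ 2)) - psi x); last first.
  by move: (heat_op _ _ _) (psi x) (lap _ x) (lap _ x) => *; rewrite expr1; lra.
apply: (@growth_bound R (fun r => heat_op r psi x - (lap psi x * r ^+ 1 + lap (lap psi) x / 2 * r ^+ 2))
   (fun r => heat_op r (lap psi) x - (lap psi x * (1%:R * r ^+ 0) + lap (lap psi) x / 2 * (2%:R * r ^+ 1)))
   (fun r => B * r ^+ 3) (fun r => B * (3%:R * r ^+ 2)) (t + 1) (psi x) _ _ _ _ _ t tT).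
- move=> r /andP[r0 _].
  exact: (is_deriveB (derive_heat_op x r0 sp)
    (is_deriveD (is_derive_monomial _ r 0) (is_derive_monomial _ r 1))).
- by move=> r _; exact: is_derive_monomial.
- move=> r /andP[r0 _]; rewrite (_ : _ - _ = heat_op r (lap psi) x - lap psi x - r * lap (lap psi) x); last first.
    by move: (heat_op _ _ _) (lap _ x) (lap _ x) => *; rewrite expr0 expr1; lra.
  apply: le_trans (HB r x r0) _.
  by rewrite ler_wpM2l//; have := exprn_ge0 2 (ltW r0); lra.
- rewrite -[X in _ --> X]subr0; apply: cvgB; first exact: heat_init.
  by rewrite -[X in _ --> X]addr0; apply: cvgD; exact: monomial_cvg0.
- exact: monomial_cvg0.
Qed.

End heat_operator.
Local Notation hop := heat_op.

(** * Small-time expansions of gradients *)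

Section heat_gradient.
Implicit Types (psi h : M -> R).

Variables (i : chart_index M) (c : 'rV[R]_N) (rho : R).
Hypothesis rho0 : 0 < rho.
Hypothesis sB : in_ball c (2 * rho) `<=` chart_cod i.
Local Notation e_ a := (delta_mx 0 a : 'rV[R]_N).

Definition heat_covector t (y : M) (v : 'rV[R]_N) (a : 'I_N) : R :=
  covector i (fun z => p t z y) v a.
Local Notation cov := heat_covector.

Lemma heat_covector_sq (Cg : R) t y v a : 0 < t -> in_ball c (2 * rho) v ->
  (forall a b, `|metric i v a b| <= Cg) ->
  cov t y v a ^+ 2 <= Cg * (hsh 1 y t (chart_inv i v) * fisher_density (hsh 1 y) t (chart_inv i v)).
Proof.
move=> t0 vB HC; have Uv := sB vB.
rewrite (fisher_heat y _ ltr01 t0) (gam_cometric (heat_slice y t0) Uv).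
apply: le_trans (coord_cometric_le (@chart_metricT R N M i) (@chart_metric_gt0 R N M i)
  (covector i (fun z => p t z y) v) a Uv) _.
rewrite ler_wpM2r//.
  exact: (cometric_ge0 (@chart_metricT R N M i) (@chart_metric_gt0 R N M i) _ Uv).
exact: le_trans (ler_norm _) (HC a a).
Qed.

Lemma amgm_norm (q x y : R) : 0 <= x -> 0 <= y -> q ^+ 2 <= x * y -> `|q| <= (x + y) / 2.
Proof.
move=> x0 y0 H; have s0 : 0 <= (x + y) / 2 by rewrite divr_ge0// addr_ge0.
rewrite -(@ler_sqr R) ?nnegrE// real_normK ?num_real//; apply: le_trans H _.
by have := sqr_ge0 (x - y); rewrite !expr2; nra.
Qed.

Lemma segment_in_ball v a (s : R) : in_ball c rho v -> `|s| <= rho -> in_ball c (2 * rho) (s *: e_ a + v).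
Proof.
move=> vB sr; rewrite /in_ball /= -addrA; apply: le_trans (ler_normD _ _) _.
rewrite (_ : 2 * rho = rho + rho); last by rewrite mulr_natl mulr2n.
apply: lerD => //; rewrite normrZ; apply: le_trans sr.
rewrite ler_piMr//; apply/rV_norm_le => // b.
by rewrite mxE eqxx /=; case: (_ == _); rewrite ?normr1 ?normr0.
Qed.

Lemma ball_half v : in_ball c rho v -> in_ball c (2 * rho) v.
Proof. by rewrite /in_ball /= => H; apply: (le_trans H); have := rho0; lra. Qed.

(** By the arithmetic-geometric inequality the L^1 norm of the gradient of p is at most sqrt t times
    the integrated Fisher information, itself of order 1/t, plus the mass over sqrt t. This stands
    in for Gaussian bounds. *)
Lemma heat_gradient_mass : exists2 C : R, 0 <= C & forall t v a, 0 < t < 2 -> in_ball c (2 * rho) v ->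
  Int (fun y => `|cov t y v a|) <= C * (Num.sqrt t)^-1.
Proof.
have [Cg Cg0 HCg] := metric_bounded sB.
have [C C0 HC] := mean_fisher_upper; pose A := N%:R + C * 3.
have V0 := volume_ge0; have A0 : 0 <= A by rewrite addr_ge0// mulr_ge0.
pose m := 1 + 1 * volume.
have m0 : 0 <= m by rewrite /m; lra.
exists (2^-1 * (Cg * (A / 2) + m)).
  by rewrite mulr_ge0// addr_ge0// mulr_ge0// divr_ge0.
move=> t v a /andP[t0 t2] vB; set z := chart_inv i v.
have s0 : 0 < Num.sqrt t by rewrite sqrtr_gt0.
have sE : Num.sqrt t ^+ 2 = t by rewrite sqr_sqrtr// ltW.
have t12 : 0 < (1 : R) <= 1 by rewrite ltr01 lexx.
have bF := bm_fisher z t12 t0; have bU := bm_heat_shift_r 1 z t0.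
have mc : measurable_fun setT (fun y : borel M => cov t y v a).
  exact: (covector_measurable a t0 (sB vB)).
have F0 y : 0 <= fisher_density (hsh 1 y) t z by exact: fisher_ge0.
have U0 y : 0 <= hsh 1 y t z by exact/ltW/heat_shift_gt0.
have Hp y : `|cov t y v a| <= 2^-1 * (Num.sqrt t * Cg) * fisher_density (hsh 1 y) t z + (2^-1 * (Num.sqrt t)^-1) * hsh 1 y t z.
  have := heat_covector_sq y a t0 vB (fun a b => HCg v a b vB); rewrite -/z => Hq.
  have -> : forall F U : R, 2^-1 * (Num.sqrt t * Cg) * F + 2^-1 * (Num.sqrt t)^-1 * U =
    (Num.sqrt t * Cg * F + (Num.sqrt t)^-1 * U) / 2 by move=> F U; ring.
  apply: amgm_norm.
  - by apply: mulr_ge0 (F0 y); rewrite mulr_ge0// ltW.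
  - by apply: mulr_ge0 (U0 y); rewrite invr_ge0 ltW.
  apply: le_trans Hq _; apply: eq_ler; move: (fisher_density _ _ _) (hsh _ _ _ _) => F U.
  by field; rewrite gt_eqF.
have bR := bmD (bmZ (2^-1 * (Num.sqrt t * Cg)) bF) (bmZ (2^-1 * (Num.sqrt t)^-1) bU).
have bc : bm (fun y : borel M => `|cov t y v a|).
  split; first exact: (measurableT_comp (@normr_measurable R setT) mc).
  by have [B HB] := bR.2; exists B => y; rewrite normr_id; apply: le_trans (Hp y) _;
    apply: le_trans (HB y); exact: ler_norm.
apply: le_trans (le_Int V bc bR Hp) _.
rewrite (IntD V (bmZ _ bF) (bmZ _ bU)) (IntZ V _ bF) (IntZ V _ bU) heat_shift_mass_r// -/m.
have IF : Int (fun y => fisher_density (hsh 1 y) t z) <= A / (2 * t).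
  have t02 : 0 < t < 2 by rewrite t0.
  rewrite ler_pdivlMr ?mulr_gt0// mulrC; apply: le_trans (HC t 1 z t02 t12) _.
  by rewrite lerD2l ler_wpM2l//; lra.
have X0 : 0 <= 2^-1 * (Num.sqrt t * Cg) by rewrite !mulr_ge0// ltW.
apply: le_trans (_ : _ <= 2^-1 * (Num.sqrt t * Cg) * (A / (2 * t)) + 2^-1 * (Num.sqrt t)^-1 * m) _.
  by rewrite lerD2r ler_wpM2l.
apply: eq_ler; rewrite -[in 2 * t]sE; move: (m) (A) s0 => mm AA; move: (Num.sqrt t) => s s0.
by field; rewrite gt_eqF.
Qed.

Lemma heat_covector_bound t : 0 < t -> exists2 C : R, 0 <= C &
  forall y v a, in_ball c (2 * rho) v -> `|cov t y v a| <= C.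
Proof.
move=> t0; have [Cg Cg0 HCg] := metric_bounded sB.
have [B B0 HB] := heat_bound t0; have [C C0 HC] := fisher_density_bound t t0.
have P0 : 0 <= Cg * ((B + 1) * C) by rewrite !mulr_ge0// addr_ge0.
exists (1 + Cg * ((B + 1) * C)); first by rewrite addr_ge0.
move=> y v a vB; have H := heat_covector_sq y a t0 vB (fun a b => HCg v a b vB).
have H2 : cov t y v a ^+ 2 <= Cg * ((B + 1) * C).
  apply: le_trans H _; rewrite ler_wpM2l//; apply: ler_pM.
  - exact/ltW/heat_shift_gt0.
  - exact: fisher_ge0.
  - by apply: lerD => //; exact: HB.
  - by apply: HC; rewrite ?lexx ?ltr01.
rewrite -(real_normK (num_real _)) in H2; have := sqr_ge0 (`|cov t y v a| - 1).
by rewrite sqrrB mulr1 expr1n; lra.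
Qed.

Definition heat_grad t h v a : R := Int (fun y => cov t y v a * h y).

Lemma bm_heat_covector t v a : 0 < t -> in_ball c (2 * rho) v ->
  bm (fun y : borel M => cov t y v a).
Proof.
move=> t0 vB; split; first exact: (covector_measurable a t0 (sB vB)).
by have [C _ HC] := heat_covector_bound t0; exists C => y; exact: HC.
Qed.

Lemma line_covector psi v a (s : R) : smooth_function psi -> chart_cod i (s *: e_ a + v) ->
  is_derive s (1 : R) (fun s => psi (chart_inv i (s *: e_ a + v))) (covector i psi (s *: e_ a + v) a).
Proof.
move=> sp Us; apply: (@line_is_derive _ _ (psi \o chart_inv i)).
have sf : smooth_on (chart_cod i) (psi \o chart_inv i) by exact: sp.
have Dv := @smooth_on_derivable _ _ _ _ _ a sf Us.
by apply: DeriveDef => //; rewrite /covector partialE.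
Qed.

Lemma derive_heat_op_space t h v a (s : R) : 0 < t -> bm (h : borel M -> R) ->
  in_ball c rho v -> `|s| < rho ->
  is_derive s (1 : R) (fun s => hop t h (chart_inv i (s *: e_ a + v))) (heat_grad t h (s *: e_ a + v) a).
Proof.
move=> t0 bh vB; rewrite ltr_norml => /andP[s1 s2].
have [mh [B HB]] := bh; have [C C0 HC] := heat_covector_bound t0.
have inB (r : R) : - rho < r < rho -> in_ball c (2 * rho) (r *: e_ a + v).
  by move=> /andP[r1 r2]; apply: segment_in_ball => //; rewrite ler_norml !ltW.
rewrite (_ : (fun s => _) = fun s => Int (fun y => p t (chart_inv i (s *: e_ a + v)) y * h y)); last first.
  by apply/funext => r; exact: heat_opE.
apply: (@derive_Int _ _ _ vol V (- rho) rho (fun s y => p t (chart_inv i (s *: e_ a + v)) y * h y)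
  (fun s y => cov t y (s *: e_ a + v) a * h y) (C * B) s s1 s2).
- by move=> r _; apply: bmM => //; exact: bm_heat_r.
- move=> r y rI.
  have D := line_covector (heat_slice y t0) (sB (inB r rI)).
  apply: (is_derive_eq (is_deriveM D (is_derive_cst (h y) r (1 : R)))).
  by rewrite /GRing.scale /= mulr0 add0r mulrC.
- by move=> r y rI; rewrite normrM; apply: ler_pM => //; exact: HC (inB r rI).
Qed.

Lemma heat_op_lipschitz : exists2 C : R, 0 <= C & forall t h (B : R) v a (s : R),
  0 < t < 2 -> bm (h : borel M -> R) -> (forall y, `|h y| <= B) ->
  in_ball c rho v -> `|s| < rho ->
  `|hop t h (chart_inv i (s *: e_ a + v)) - hop t h (chart_inv i v)| <= C * B * (Num.sqrt t)^-1 * `|s|.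
Proof.
have [C C0 HC] := heat_gradient_mass; exists C => // t h B v a s t02 bh hB vB sr.
have t0 : 0 < t by have /andP[] := t02.
have B0 : 0 <= B by apply: le_trans (hB point).
have s1 : - rho < s < rho by rewrite -ltr_norml.
have z1 : - rho < 0 < rho by rewrite oppr_lt0 rho0.
have D (r : R) : - rho < r < rho -> is_derive r (1 : R) (fun s => hop t h (chart_inv i (s *: e_ a + v)))
    (heat_grad t h (r *: e_ a + v) a).
  by rewrite -ltr_norml; exact: derive_heat_op_space.
have L := @derive_lipschitz R _ _ (- rho) rho (C * B * (Num.sqrt t)^-1) D.
have := L _ 0 s z1 s1; rewrite scale0r add0r subr0; apply => r rI.
have rB : in_ball c (2 * rho) (r *: e_ a + v).
  by apply: segment_in_ball => //; rewrite ltW// ltr_norml.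
have bc := bm_heat_covector a t0 rB.
have ba : bm (fun y : borel M => B * `|cov t y (r *: e_ a + v) a|).
  apply: bmZ; split; first exact: (measurableT_comp (@normr_measurable R setT) bc.1).
  by have [_ [K HK]] := bc; exists K => y; rewrite normr_id.
apply: le_trans (Int_norm_le V (bmM bc bh) ba _) _.
  by move=> y; rewrite normrM mulrC ler_wpM2r.
rewrite (IntZ V); last first.
  split; first exact: (measurableT_comp (@normr_measurable R setT) bc.1).
  by have [_ [K HK]] := bc; exists K => y; rewrite normr_id.
by rewrite [C * B]mulrC -mulrA ler_wpM2l//; exact: HC.
Qed.

Lemma is_derive_sqrt_scale (C r : R) : 0 < r ->
  is_derive r (1 : R) (fun r => C * Num.sqrt r) (C / 2 * (Num.sqrt r)^-1).
Proof. by move=> r0; apply: (is_derive_eq (is_deriveZ C (is_derive_sqrt r0))); rewrite /GRing.scale /= mulrA. Qed.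

(** Differences are expanded rather than gradients, since P_t psi is differentiated in time at fixed
    points. The Lipschitz constant of P_r (Lap psi), of order r^(-1/2), is integrable at 0 and
    yields the factor sqrt t. *)
Lemma heat_difference_expansion psi : smooth_function psi -> exists2 C : R, 0 <= C &
  forall t v a (s : R), 0 < t < 2 -> in_ball c rho v -> `|s| < rho ->
  `|(hop t psi (chart_inv i (s *: e_ a + v)) - hop t psi (chart_inv i v)) -
    (psi (chart_inv i (s *: e_ a + v)) - psi (chart_inv i v))| <= C * `|s| * Num.sqrt t.
Proof.
move=> sp; have [C C0 HC] := heat_op_lipschitz.
have sL := smooth_lap sp; have [B B0 HB] := smooth_norm sL.
have bL : bm (lap psi : borel M -> R) by apply: bm_smooth M_closed _ _.
exists (2 * (C * B)); first by rewrite !mulr_ge0.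
move=> t v a s t02 vB sr.
set z := chart_inv i (_ + v); set z0 := chart_inv i v.
apply: (@growth_bound R (fun r => hop r psi z - hop r psi z0)
  (fun r => hop r (lap psi) z - hop r (lap psi) z0)
  (fun r => 2 * (C * B) * `|s| * Num.sqrt r)
  (fun r => 2 * (C * B) * `|s| / 2 * (Num.sqrt r)^-1) 2 (psi z - psi z0) _ _ _ _ _ t t02).
- by move=> r /andP[r0 _]; exact: (is_deriveB (derive_heat_op z r0 sp) (derive_heat_op z0 r0 sp)).
- by move=> r /andP[r0 _]; exact: is_derive_sqrt_scale.
- move=> r rI; apply: le_trans (HC r _ B v a s rI bL HB vB sr) _.
  by apply: eq_ler; field; have /andP[r0 _] := rI; rewrite gt_eqF// sqrtr_gt0.
- by apply: cvgB; exact: heat_init.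
- exact: sqrt_cvg0.
Qed.

Lemma heat_difference_expansion2 psi : smooth_function psi -> exists2 C : R, 0 <= C &
  forall t v a (s : R), 0 < t < 2 -> in_ball c rho v -> `|s| < rho ->
  `|(hop t psi (chart_inv i (s *: e_ a + v)) - hop t psi (chart_inv i v)) -
    t * (lap psi (chart_inv i (s *: e_ a + v)) - lap psi (chart_inv i v)) -
    (psi (chart_inv i (s *: e_ a + v)) - psi (chart_inv i v))| <= C * `|s| * (t * Num.sqrt t).
Proof.
move=> sp; have sL := smooth_lap sp; have [C C0 HC] := heat_difference_expansion sL.
exists C => // t v a s t02 vB sr.
set z := chart_inv i (_ + v); set z0 := chart_inv i v.
apply: (@growth_bound R (fun r => hop r psi z - hop r psi z0 - r * (lap psi z - lap psi z0))
  (fun r => hop r (lap psi) z - hop r (lap psi) z0 - (lap psi z - lap psi z0))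
  (fun r => C * `|s| * (r * Num.sqrt r))
  (fun r => C * `|s| * (r * (2^-1 * (Num.sqrt r)^-1) + Num.sqrt r)) 2 (psi z - psi z0) _ _ _ _ _ t t02).
- move=> r /andP[r0 _].
  apply: (is_derive_eq (is_deriveB (is_deriveB (derive_heat_op z r0 sp) (derive_heat_op z0 r0 sp))
    (is_deriveM (is_derive_id r (1 : R)) (is_derive_cst (lap psi z - lap psi z0) r (1 : R))))).
  by rewrite /GRing.scale /= mulr0 add0r mulr1.
- move=> r /andP[r0 _].
  apply: (is_derive_eq (is_deriveZ (C * `|s|) (is_deriveM (is_derive_id r (1 : R)) (is_derive_sqrt r0)))).
  by rewrite /GRing.scale /= mulr1.
- move=> r rI; have /andP[r0 _] := rI; apply: le_trans (HC r v a s rI vB sr) _.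
  rewrite ler_wpM2l ?mulr_ge0// lerDr mulr_ge0 ?(ltW r0)// mulr_ge0// invr_ge0 sqrtr_ge0//.
- rewrite -[X in _ --> X]subr0; apply: cvgB; first by apply: cvgB; exact: heat_init.
  rewrite (_ : (fun r => _) = fun r : R => (lap psi z - lap psi z0) * r ^+ 1); first exact: monomial_cvg0.
  by apply/funext => r; rewrite expr1 mulrC.
- rewrite (_ : (fun r => _) = fun r : R => (C * `|s| * r ^+ 1) * (1 * Num.sqrt r)); last first.
    by apply/funext => r; rewrite expr1 mul1r mulrA.
  by rewrite -[X in _ --> X](mulr0 (0 : R)); apply: cvgM; [exact: monomial_cvg0|exact: sqrt_cvg0].
Qed.

Lemma heat_grad_at t psi v a : 0 < t -> smooth_function psi -> in_ball c rho v ->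
  is_derive (0 : R) (1 : R) (fun s => hop t psi (chart_inv i (s *: e_ a + v))) (heat_grad t psi v a) /\
  is_derive (0 : R) (1 : R) (fun s => psi (chart_inv i (s *: e_ a + v))) (covector i psi v a).
Proof.
move=> t0 sp vB.
have bp : bm (psi : borel M -> R) by apply: bm_smooth M_closed _ _.
have z1 : `|0 : R| < rho by rewrite normr0.
split.
  by have := derive_heat_op_space a t0 bp vB z1; rewrite scale0r add0r.
have := @line_covector psi v a 0 sp; rewrite scale0r add0r; apply.
exact/sB/ball_half.
Qed.

Lemma heat_gradient_expansion1 psi : smooth_function psi -> exists2 C : R, 0 <= C &
  forall t v a, 0 < t < 2 -> in_ball c rho v ->
  `|heat_grad t psi v a - covector i psi v a| <= C * Num.sqrt t.
Proof.
move=> sp; have [C C0 HC] := heat_difference_expansion sp; exists C => // t v a t02 vB.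
have t0 : 0 < t by have /andP[] := t02.
have [D1 D2] := heat_grad_at a t0 sp vB.
apply: (derive_norm_le rho0 (is_deriveB D1 D2)) => s sr.
have := HC t v a s t02 vB sr; rewrite !fctE /= scale0r add0r mulrAC.
by apply: le_trans; apply: eq_ler; congr (`|_|);
  move: (hop _ _ _) (hop _ _ _) (psi _) (psi _) => *; ring.
Qed.

Lemma heat_gradient_expansion2 psi : smooth_function psi -> exists2 C : R, 0 <= C &
  forall t v a, 0 < t < 2 -> in_ball c rho v ->
  `|heat_grad t psi v a - t * covector i (lap psi) v a - covector i psi v a| <= C * (t * Num.sqrt t).
Proof.
move=> sp; have sL := smooth_lap sp.
have [C C0 HC] := heat_difference_expansion2 sp; exists C => // t v a t02 vB.
have t0 : 0 < t by have /andP[] := t02.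
have [D1 D2] := heat_grad_at a t0 sp vB; have [_ D3] := heat_grad_at a t0 sL vB.
apply: (derive_norm_le rho0 (is_deriveB (is_deriveB D1 (is_deriveZ t D3)) D2)) => s sr.
have := HC t v a s t02 vB sr; rewrite !fctE /= scale0r add0r mulrAC.
by apply: le_trans; apply: eq_ler; congr (`|_|);
  move: (hop _ _ _) (hop _ _ _) (lap psi _) (lap psi _) (psi _) (psi _) => *; rewrite /GRing.scale /=; ring.
Qed.

End heat_gradient.

(** * Cramer-Rao inequalities *)

Section shifted_covariance.
Implicit Types (f k : M -> R).

(** A covariance centred at the values at z instead of the means, so that it expands through P_t;
    the weight is the shifted density that also enters the score. *)
Definition shift_cov t e f k (z : M) : R :=
  Int (fun y => hsh e y t z * ((f y - f z) * (k y - k z))).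

Lemma bm_centered f z : smooth_function f -> bm (fun y : borel M => f y - f z).
Proof.
by move=> sf; apply: bmB; [apply: bm_smooth M_closed _ _|exact: bm_cst].
Qed.

Lemma bm_shift_cov t e f k z : 0 < t -> smooth_function f -> smooth_function k ->
  bm (fun y : borel M => hsh e y t z * ((f y - f z) * (k y - k z))).
Proof.
move=> t0 sf sk; apply: bmM; first exact: bm_heat_shift_r.
by apply: bmM; exact: bm_centered.
Qed.

Lemma shift_cov_sum t e (F : 'I_N -> M -> R) (w w' : 'I_N -> R) z : 0 < t ->
  (forall c, smooth_function (F c)) ->
  shift_cov t e (fun y => \sum_c w c * F c y) (fun y => \sum_c w' c * F c y) z =
  \sum_c \sum_d w c * w' d * shift_cov t e (F c) (F d) z.
Proof.
move=> t0 sF.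
transitivity (Int (fun y => \sum_c \sum_d w c * w' d * (hsh e y t z * ((F c y - F c z) * (F d y - F d z))))).
  apply: eq_Rintegral => y _; rewrite -!sumrB big_distrlr mulr_sumr; apply: eq_bigr => c _ /=.
  by rewrite mulr_sumr; apply: eq_bigr => d _; ring.
have b c d := bm_shift_cov e z t0 (sF c) (sF d).
rewrite (Int_sum V) => [|c]; last by apply: bm_sum => d; exact: bmZ.
apply: eq_bigr => c _; rewrite (Int_sum V) => [|d]; last exact: bmZ.
by apply: eq_bigr => d _; rewrite (IntZ V _ (b c d)).
Qed.

Lemma shift_covE t e f k z : 0 < t -> smooth_function f -> smooth_function k ->
  shift_cov t e f k z = (hop t (fun y => f y * k y) z - f z * hop t k z - k z * hop t f z + f z * k z)
    + e * Int (fun y => (f y - f z) * (k y - k z)).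
Proof.
move=> t0 sf sk; have bf := bm_centered z sf; have bk := bm_centered z sk.
have bp := bm_heat z t0; have bfk := bmM bf bk.
have b1 : bm (f : borel M -> R) by apply: bm_smooth M_closed _ _.
have b2 : bm (k : borel M -> R) by apply: bm_smooth M_closed _ _.
have c1 := bmM bp (bmM b1 b2); have c2 := bmM bp b1; have c3 := bmM bp b2.
rewrite /heat_op -[X in X + e * _]mulr1 -(heat_mass z t0).
transitivity (Int (fun y => (p t y z * (f y * k y) - f z * (p t y z * k y) - k z * (p t y z * f y) + f z * k z * p t y z)
    + e * ((f y - f z) * (k y - k z)))).
  by apply: eq_Rintegral => y _; rewrite /heat_shift heat_sym //; move: (p _ _ _) => q; ring.
have d1 := bmB c1 (bmZ (f z) c3); have d2 := bmB d1 (bmZ (k z) c2).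
have d3 := bmD d2 (bmZ (f z * k z) bp).
rewrite (IntD V d3 (bmZ e bfk)) (IntZ V e bfk) (IntD V d2 (bmZ _ bp)) (IntB V d1 (bmZ _ c2)) (IntB V c1 (bmZ _ c3)).
by rewrite (IntZ V _ c3) (IntZ V _ c2) (IntZ V _ bp) heat_mass// !mulr1.
Qed.

Lemma centered_bound f k : smooth_function f -> smooth_function k ->
  exists2 C : R, 0 <= C & forall z, `|Int (fun y => (f y - f z) * (k y - k z))| <= C.
Proof.
move=> sf sk; have [A A0 HA] := smooth_norm sf; have [B B0 HB] := smooth_norm sk.
exists ((A + A) * (B + B) * fine (vol setT)).
  by rewrite !mulr_ge0 ?addr_ge0//; exact/fine_ge0/measure_ge0.
move=> z; rewrite -Int_cst; apply: (Int_norm_le V).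
- by apply: bmM; exact: bm_centered.
- exact: bm_cst.
- move=> y; rewrite normrM; apply: ler_pM => //; apply: le_trans (ler_normB _ _) _;
  exact: lerD.
Qed.

(** Lap^2 at z of the product (f - f z) (k - k z), hence the second-order coefficient of the
    covariance. *)
Definition gamma_iterated f k (z : M) : R :=
  lap (lap (fun y => f y * k y)) z - f z * lap (lap k) z - k z * lap (lap f) z.

Lemma shift_cov_expansion2 f k : smooth_function f -> smooth_function k ->
  exists2 C : R, 0 <= C & forall t e z, 0 < t -> 0 <= e ->
  `|shift_cov t e f k z - t * (2 * gam f k z) - t ^+ 2 / 2 * gamma_iterated f k z| <= C * (t ^+ 3 + e).
Proof.
move=> sf sk; have sfk := smooth_functionM sf sk.
have [A A0 HA] := smooth_norm sf; have [B B0 HB] := smooth_norm sk.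
have [C1 C10 H1] := heat_expansion3 sfk.
have [C2 C20 H2] := heat_expansion3 sf.
have [C3 C30 H3] := heat_expansion3 sk.
have [C4 C40 H4] := centered_bound sf sk.
exists (C1 + A * C3 + B * C2 + C4); first by rewrite !addr_ge0 ?mulr_ge0.
move=> t e z t0 e0; rewrite shift_covE// /gamma_iterated.
have := H1 t z t0; have := H2 t z t0; have := H3 t z t0; have := H4 z.
rewrite [lap (fun y => f y * k y) z](lapM z sf sk); have := HA z; have := HB z.
move: (hop _ _ _) (hop _ _ _) (hop _ _ _) (lap (lap (fun y => _)) z) (lap (lap f) z) (lap (lap k) z).
move: (f z) (k z) (lap f z) (lap k z) (gam f k z) (Rintegral _ _ _).
move=> a b la lb g I0 p1 p2 p3 q1 q2 q3 bB aA h4 h3 h2 h1.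
set r1 := _ - _ in h1; set r2 := _ - _ in h2; set r3 := _ - _ in h3.
have -> : p1 - a * p3 - b * p2 + a * b + e * I0 - t * (2 * g) - t ^+ 2 / 2 * (q1 - a * q3 - b * q2) =
    r1 - a * r3 - b * r2 + e * I0.
  by rewrite /r1 /r2 /r3; ring.
apply: le_trans (ler_normD _ _) _; rewrite normrM (ger0_norm e0).
have x1 : `|a * r3| <= A * (C3 * t ^+ 3) by rewrite normrM; exact: ler_pM.
have x2 : `|b * r2| <= B * (C2 * t ^+ 3) by rewrite normrM; exact: ler_pM.
have x3 : e * `|I0| <= e * C4 by exact: ler_wpM2l.
have x4 : `|r1 - a * r3 - b * r2| <= C1 * t ^+ 3 + A * (C3 * t ^+ 3) + B * (C2 * t ^+ 3).
  apply: le_trans (ler_normB _ _) _; apply: lerD => //.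
  by apply: le_trans (ler_normB _ _) _; exact: lerD.
have y1 : 0 <= (C1 + A * C3 + B * C2) * e by rewrite mulr_ge0// !addr_ge0 ?mulr_ge0.
have y2 : 0 <= C4 * t ^+ 3 by rewrite mulr_ge0// exprn_ge0// ltW.
apply: le_trans (lerD x4 x3) _; lra.
Qed.

Lemma shift_cov_expansion1 f k : smooth_function f -> smooth_function k ->
  exists2 C : R, 0 <= C & forall t e z, 0 < t < 2 -> 0 <= e ->
  `|shift_cov t e f k z - t * (2 * gam f k z)| <= C * (t ^+ 2 + e).
Proof.
move=> sf sk; have sfk := smooth_functionM sf sk; have [C C0 HC] := shift_cov_expansion2 sf sk.
have sI : smooth_function (gamma_iterated f k) by rewrite /gamma_iterated; smooth_fun.
have [B B0 HB] := smooth_norm sI; exists (2 * C + B); first by rewrite addr_ge0 ?mulr_ge0.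
move=> t e z /andP[t0 t2] e0; rewrite -[X in `|X|](subrK (t ^+ 2 / 2 * gamma_iterated f k z)).
have tt : 0 <= t ^+ 2 by rewrite exprn_ge0// ltW.
apply: le_trans (ler_normD _ _) _; apply: le_trans (lerD (HC t e z t0 e0) _) (_ : C * (t ^+ 3 + e) + t ^+ 2 / 2 * B <= _).
  by rewrite normrM ger0_norm ?divr_ge0// ler_wpM2l ?divr_ge0.
have c3 : C * t ^+ 3 <= C * (2 * t ^+ 2) by rewrite ler_wpM2l// exprS ler_wpM2r// ltW.
have := mulr_ge0 C0 e0; have := mulr_ge0 B0 e0; have := mulr_ge0 B0 tt; lra.
Qed.

End shifted_covariance.

Section cramer_rao.

Variables (i : chart_index M) (c : 'rV[R]_N) (rho : R).
Hypothesis rho0 : 0 < rho.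
Hypothesis sB : in_ball c (2 * rho) `<=` chart_cod i.
Local Notation cov := (@heat_covector i).
Local Notation hgrad := (@heat_grad i).
Local Notation scov := shift_cov.

(** Centring costs nothing because the gradient of p in z integrates to 0 over y, the derivative of
    P_t 1 = 1. *)
Lemma heat_grad_centered t psi v a : 0 < t -> smooth_function psi -> in_ball c rho v ->
  Int (fun y => cov t y v a * (psi y - psi (chart_inv i v))) = hgrad t psi v a.
Proof.
move=> t0 sp vB; have bc := bm_heat_covector sB a t0 (ball_half rho0 vB).
have bp : bm (psi : borel M -> R) by apply: bm_smooth M_closed _ _.
have C0 : Int (fun y => cov t y v a) = 0.
  have s1 : smooth_function (fun _ : M => (1 : R)) by exact: smooth_function_cst.
  have [D _] := heat_grad_at rho0 sB a t0 s1 vB.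
  have E : (fun s : R => hop t (fun=> 1) (chart_inv i (s *: delta_mx 0 a + v))) = fun=> 1.
    apply/funext => s; rewrite -[RHS](heat_mass (chart_inv i (s *: delta_mx 0 a + v)) t0).
    by apply: eq_Rintegral => y _; rewrite mulr1.
  move: D; rewrite E => D; have := @derive_val _ _ _ _ _ _ _ D.
  rewrite derive_cst /heat_grad => ->; apply: eq_Rintegral => y _; exact/esym/mulr1.
transitivity (Int (fun y => cov t y v a * psi y - psi (chart_inv i v) * cov t y v a)).
  by apply: eq_Rintegral => y _; rewrite mulrBr [cov _ _ _ _ * psi (chart_inv i v)]mulrC.
by rewrite (IntB V (bmM bc bp) (bmZ _ bc)) (IntZ V _ bc) C0 mulr0 subr0.
Qed.

Lemma bm_covector_log t e v a : 0 < t -> 0 < e -> in_ball c (2 * rho) v ->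
  bm (fun y : borel M => covector i (log_st (hsh e y) t) v a).
Proof.
move=> t0 e0 vB; split; first exact: (covector_log_measurable a e0 t0 (sB vB)).
have [C C0 HC] := heat_covector_bound sB t0.
exists (e^-1 * C) => y; rewrite (covector_log y a e0 t0 (sB vB)) normrM.
apply: ler_pM => //; last exact: HC.
have u0 := heat_shift_gt0 y (chart_inv i v) e0 t0.
rewrite normfV ger0_norm ?(ltW u0)// lef_pV2 ?posrE//.
by rewrite /heat_shift lerDr heat_ge0.
Qed.

(** With w = score - (eta y - eta z) / 2t, the integral of 2t u B(w, w) is nonnegative. Since u
    times the score is the gradient of p in z, the cross terms are gradients of P_t eta, and the
    square of the second part is the covariance. *)
Lemma cramer_rao t e v (B : 'I_N -> 'I_N -> R) (eta : 'I_N -> M -> R) :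
  0 < t -> 0 < e -> in_ball c rho v ->
  (forall w : 'I_N -> R, 0 <= \sum_a \sum_b B a b * w a * w b) ->
  (forall a, smooth_function (eta a)) ->
  \sum_a \sum_b B a b * (hgrad t (eta b) v a + hgrad t (eta a) v b
     - (2 * t)^-1 * scov t e (eta a) (eta b) (chart_inv i v)) <=
  2 * t * Int (fun y => hsh e y t (chart_inv i v) *
     \sum_a \sum_b B a b * covector i (log_st (hsh e y) t) v a * covector i (log_st (hsh e y) t) v b).
Proof.
move=> t0 e0 vB B0 se; set z := chart_inv i v.
have vB2 := ball_half rho0 vB; have Uv := sB vB2.
pose X y a := covector i (log_st (hsh e y) t) v a.
have bX a : bm (fun y : borel M => X y a) by exact: bm_covector_log.
have bu := bm_heat_shift_r e z t0.
have bz a := bm_centered z (se a).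
have bc a := bm_heat_covector sB a t0 vB2.
have bs a b := bm_shift_cov e z t0 (se a) (se b).
have bR : bm (fun y : borel M => hsh e y t z * \sum_a \sum_b B a b * X y a * X y b).
  apply: bmM => //; apply: bm_sum => a; apply: bm_sum => b.
  by apply: bmM => //; exact: bmZ.
have bt a b := bmB (bmD (bmM (bc a) (bz b)) (bmM (bc b) (bz a))) (bmZ (2 * t)^-1 (bs a b)).
rewrite -(IntZ V _ bR).
apply: (@le_trans _ _ (Int (fun y => \sum_a \sum_b B a b * (cov t y v a * (eta b y - eta b z) +
   cov t y v b * (eta a y - eta a z) - (2 * t)^-1 * (hsh e y t z * ((eta a y - eta a z) * (eta b y - eta b z))))))).
  apply: eq_ler; rewrite (Int_sum V) => [|a]; last by apply: bm_sum => b; exact: bmZ.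
  apply: eq_bigr => a _; rewrite (Int_sum V) => [|b]; last exact: bmZ.
  apply: eq_bigr => b _; rewrite (IntZ V _ (bt a b)).
  rewrite (IntB V (bmD (bmM (bc a) (bz b)) (bmM (bc b) (bz a))) (bmZ _ (bs a b))).
  rewrite (IntD V (bmM (bc a) (bz b)) (bmM (bc b) (bz a))) (IntZ V _ (bs a b)).
  by rewrite !heat_grad_centered.
apply: (le_Int V).
- by apply: bm_sum => a; apply: bm_sum => b; exact: bmZ.
- exact: bmZ.
move=> y; have U0 := heat_shift_gt0 y z e0 t0.
have XE a : X y a = (hsh e y t z)^-1 * cov t y v a by exact: covector_log.
pose w a := X y a - (2 * t)^-1 * (eta a y - eta a z).
have tU : 0 <= 2 * t * hsh e y t z by rewrite !mulr_ge0// ltW.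
rewrite -subr_ge0; apply: le_trans (mulr_ge0 tU (B0 w)) _; apply: eq_ler.
rewrite mulrA !mulr_sumr -sumrB; apply: eq_bigr => a _; rewrite !mulr_sumr -sumrB; apply: eq_bigr => b _.
rewrite /w !XE; move: (cov t y v a) (cov t y v b) U0 (eta a y) (eta b y) (eta a z) (eta b z).
move: (hsh e y t z) => u ca cb u0 ay bY az bz'.
by field; rewrite !gt_eqF.
Qed.

Lemma heat_grad_sum t (xi : 'I_N -> M -> R) (w : 'I_N -> R) v a : 0 < t ->
  (forall d, smooth_function (xi d)) -> in_ball c rho v ->
  hgrad t (fun y => \sum_d w d * xi d y) v a = \sum_d w d * hgrad t (xi d) v a.
Proof.
move=> t0 sx vB; have bc := bm_heat_covector sB a t0 (ball_half rho0 vB).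
have bx d : bm (xi d : borel M -> R) by apply: bm_smooth M_closed _ _.
transitivity (Int (fun y => \sum_d w d * (cov t y v a * xi d y))).
  by apply: eq_Rintegral => y _; rewrite mulr_sumr; apply: eq_bigr => d _; rewrite mulrCA.
rewrite (Int_sum V) => [|d]; last exact/bmZ/bmM.
by apply: eq_bigr => d _; rewrite (IntZ V _ (bmM bc (bx d))).
Qed.

Lemma smooth_lincomb (xi : 'I_N -> M -> R) (w : 'I_N -> R) : (forall d, smooth_function (xi d)) ->
  smooth_function (fun y => \sum_d w d * xi d y).
Proof.
move=> sx; apply: smooth_function_sum => d; apply: smooth_functionM => //.
exact: smooth_function_cst.
Qed.

End cramer_rao.

(** * Leading order and curvature term of the Cramer-Rao inequality *)

Section cramer_rao_bounds.

Variables (i : chart_index M) (c : 'rV[R]_N) (rho : R).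
Hypothesis rho0 : 0 < rho.
Hypothesis sB : in_ball c (2 * rho) `<=` chart_cod i.
Local Notation cov := (@heat_covector i).
Local Notation hgrad := (@heat_grad i).
Local Notation scov := shift_cov.
Local Notation g := (metric i).
Local Notation h := (fun u => invmx (metric i u)).

Let gT u := @chart_metricT R N M i u.
Let gpos u v := @chart_metric_gt0 R N M i u v.

(** On S the functions xi have the differentials of the coordinates. For a bound uniform in v, S is
    a whole cube and xi are cut-off coordinates; for the curvature term, S is a single point at
    which the Hessians of xi vanish. *)
Variable S : set 'rV[R]_N.
Hypothesis SB : S `<=` in_ball c rho.
Variable xi : 'I_N -> M -> R.
Hypothesis sxi : forall d, smooth_function (xi d).
Hypothesis xi_cov : forall v d a, S v -> covector i (xi d) v a = (a == d)%:R.

Let ball_cod v : S v -> chart_cod i v.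
Proof. by move=> /SB vB; apply: sB; exact: ball_half. Qed.

Lemma gam_xi (f : M -> R) d v : smooth_function f -> S v ->
  gam (xi d) f (chart_inv i v) = \sum_b h v d b * covector i f v b.
Proof.
move=> sf vB; rewrite (gamE (sxi d) sf (ball_cod vB)) /gamma_coord.
rewrite -[RHS](sum_kron (fun a => \sum_b h v a b * covector i f v b)); apply: eq_bigr => a _.
rewrite mulr_sumr; apply: eq_bigr => b _.
have := xi_cov d a vB; rewrite /covector => ->; rewrite eq_sym /=.
by rewrite -/(covector i f v b); move: (h v a b) (covector i f v b) => x y; ring.
Qed.

Lemma gam_xi2 d d' v : S v -> gam (xi d) (xi d') (chart_inv i v) = h v d d'.
Proof.
move=> vB; rewrite (gam_xi d (sxi d') vB) -[RHS](sum_kron (fun b => h v d b)); apply: eq_bigr => b _.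
by rewrite xi_cov// eq_sym mulrC.
Qed.

(** The matrix of [cramer_rao] for eta_a = sum_d g_ad xi_d with g frozen at v, whose gradients at v
    are the coordinate vectors. Each of the three terms tends to g_ab, and so does the
    combination. *)
Definition cr_term t e v a b : R := \sum_d g v b d * hgrad t (xi d) v a + \sum_d g v a d * hgrad t (xi d) v b
  - (2 * t)^-1 * \sum_d \sum_d' g v a d * g v b d' * scov t e (xi d) (xi d') (chart_inv i v).

Lemma cramer_rao_frame t e v (B : 'I_N -> 'I_N -> R) : 0 < t -> 0 < e -> S v ->
  (forall w : 'I_N -> R, 0 <= \sum_a \sum_b B a b * w a * w b) ->
  \sum_a \sum_b B a b * cr_term t e v a b <=
  2 * t * Int (fun y => hsh e y t (chart_inv i v) *
     \sum_a \sum_b B a b * covector i (log_st (hsh e y) t) v a * covector i (log_st (hsh e y) t) v b).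
Proof.
move=> t0 e0 vB B0.
have se a : smooth_function (fun y => \sum_d g v a d * xi d y) by exact: smooth_lincomb.
apply: le_trans (cramer_rao rho0 sB t0 e0 (SB vB) B0 se); apply: eq_ler.
apply: eq_bigr => a _; apply: eq_bigr => b _; apply: (congr1 (fun x => _ * x)).
by rewrite !(heat_grad_sum rho0 sB _ _ t0 sxi (SB vB)) shift_cov_sum.
Qed.

Lemma sqrt_ge_half (t : R) : 0 < t < 2 -> t <= 2 * Num.sqrt t.
Proof.
move=> /andP[t0 t2]; have s0 := sqrtr_ge0 t; have sE : Num.sqrt t ^+ 2 = t by rewrite sqr_sqrtr// ltW.
rewrite -{1}sE expr2 ler_wpM2r// leNgt; apply/negP => H.
have : 2 * 2 < Num.sqrt t * Num.sqrt t by exact: ltr_pM.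
by rewrite -[X in _ < X]expr2 sE; lra.
Qed.

(** Gradients contribute the error sqrt t; the shift in the covariance contributes e / t after
    division by 2t. *)
Lemma cr_term_expansion : exists2 C : R, 0 <= C & forall t e v a b, 0 < t < 2 -> 0 < e ->
  S v -> `|cr_term t e v a b - g v a b| <= C * (Num.sqrt t + e / t).
Proof.
have [Cg Cg0 HCg] := metric_bounded sB.
have [C1 C10 H1] : exists2 C : R, 0 <= C & forall d, forall t v a, 0 < t < 2 -> in_ball c rho v ->
    `|hgrad t (xi d) v a - covector i (xi d) v a| <= C * Num.sqrt t.
  apply: uniform_bound => [d C C' CC' H t v a t02 vB|d]; last exact: heat_gradient_expansion1.
  by apply: le_trans (H t v a t02 vB) _; rewrite ler_wpM2r// sqrtr_ge0.
have [C2 C20 H2] : exists2 C : R, 0 <= C & forall d : 'I_N * 'I_N, forall t e z, 0 < t < 2 -> 0 <= e ->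
    `|scov t e (xi d.1) (xi d.2) z - t * (2 * gam (xi d.1) (xi d.2) z)| <= C * (t ^+ 2 + e).
  apply: uniform_bound => [d C C' CC' H t e z t02 e0|d]; last exact: shift_cov_expansion1.
  by apply: le_trans (H t e z t02 e0) _; rewrite ler_wpM2r// addr_ge0// exprn_ge0//; have /andP[/ltW] := t02.
have Nn : 0 <= N%:R :> R by [].
pose K1 := N%:R * (Cg * C1); pose K2 := N%:R * (N%:R * (Cg * Cg * C2)).
have K10 : 0 <= K1 by rewrite /K1 !mulr_ge0.
have K20 : 0 <= K2 by rewrite /K2 !mulr_ge0.
exists (K1 + K1 + K2); first by rewrite !addr_ge0.
move=> t e v a b t02 e0 vB; have /andP[t0 t2] := t02.
have vB2 := ball_half rho0 (SB vB); have Uv := ball_cod vB.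
have s0 := sqrtr_ge0 t.
have HG x y : `|g v x y| <= Cg by exact: HCg.
have E1 x y : \sum_d g v x d * covector i (xi d) v y = g v x y.
  rewrite -[RHS](sum_kron (fun d => g v x d)); apply: eq_bigr => d _.
  by rewrite xi_cov// mulrC.
have E2 : \sum_d \sum_d' g v a d * g v b d' * (t * (2 * gam (xi d) (xi d') (chart_inv i v))) = 2 * t * g v a b.
  transitivity (2 * t * \sum_d g v a d * (\sum_d' h v d d' * g v d' b)).
    rewrite mulr_sumr; apply: eq_bigr => d _; rewrite !mulr_sumr; apply: eq_bigr => d' _.
    by rewrite gam_xi2// (metricC gT b d' Uv); move: (g v a d) (g v d' b) (h v d d') => x y z; ring.
  apply: (congr1 (fun x => _ * x)); rewrite -[RHS](sum_kron (fun d => g v a d)).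
  by apply: eq_bigr => d _; rewrite (inv_metricE gT gpos d b Uv) mulrC eq_sym.
have -> : cr_term t e v a b - g v a b =
    \sum_d g v b d * (hgrad t (xi d) v a - covector i (xi d) v a) +
    \sum_d g v a d * (hgrad t (xi d) v b - covector i (xi d) v b) -
    (2 * t)^-1 * \sum_d \sum_d' g v a d * g v b d' *
      (scov t e (xi d) (xi d') (chart_inv i v) - t * (2 * gam (xi d) (xi d') (chart_inv i v))).
  have S1 (x y : 'I_N) : \sum_d g v x d * (hgrad t (xi d) v y - covector i (xi d) v y) =
      \sum_d g v x d * hgrad t (xi d) v y - g v x y.
    by rewrite -(E1 x y) -sumrB; apply: eq_bigr => d _; rewrite mulrBr.
  have -> : \sum_d \sum_d' g v a d * g v b d' *
      (scov t e (xi d) (xi d') (chart_inv i v) - t * (2 * gam (xi d) (xi d') (chart_inv i v))) =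
     \sum_d \sum_d' g v a d * g v b d' * scov t e (xi d) (xi d') (chart_inv i v) - 2 * t * g v a b.
    rewrite -E2 -sumrB; apply: eq_bigr => d _; rewrite -sumrB; apply: eq_bigr => d' _.
    by rewrite mulrBr.
  rewrite !S1 /cr_term (metricC gT b a Uv).
  have alg (x y z w q : R) : q != 0 -> x + y - q^-1 * z - w = x - w + (y - w) - q^-1 * (z - q * w).
    by move=> q0; field.
  by apply: alg; rewrite gt_eqF// mulr_gt0.
have n1 (x y : 'I_N) : `|\sum_d g v x d * (hgrad t (xi d) v y - covector i (xi d) v y)| <= K1 * Num.sqrt t.
  rewrite /K1 -mulrA -mulrA; apply: sum_norm_le => d; rewrite normrM; apply: ler_pM => //.
  by apply: H1 => //; exact: SB.
have n2 : `|\sum_d \sum_d' g v a d * g v b d' *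
      (scov t e (xi d) (xi d') (chart_inv i v) - t * (2 * gam (xi d) (xi d') (chart_inv i v)))| <= K2 * (t ^+ 2 + e).
  rewrite /K2 -mulrA; apply: sum_norm_le => d; rewrite -mulrA; apply: sum_norm_le => d'.
  rewrite normrM -mulrA; apply: ler_pM => //; last exact: (H2 (d, d') t e _ t02 (ltW e0)).
  by rewrite normrM; apply: ler_pM.
have k0 : 0 <= (2 * t)^-1 by rewrite invr_ge0 mulr_ge0// ltW.
have n3 := ler_wpM2l k0 n2; rewrite -{1}(ger0_norm k0) -normrM in n3.
apply: le_trans (ler_normB _ _) _.
apply: le_trans (lerD (le_trans (ler_normD _ _) (lerD (n1 b a) (n1 a b))) n3) _.
have -> : (2 * t)^-1 * (K2 * (t ^+ 2 + e)) = K2 * (t / 2) + K2 * (e / t / 2).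
  by field; rewrite gt_eqF.
have et0 : 0 <= e / t by rewrite divr_ge0// ltW.
have x1 : K2 * (t / 2) <= K2 * Num.sqrt t by rewrite ler_wpM2l//; have := sqrt_ge_half t02; lra.
have x2 : K2 * (e / t / 2) <= K2 * (e / t) by rewrite ler_wpM2l//; lra.
have x3 : 0 <= (K1 + K1) * (e / t) by rewrite mulr_ge0// addr_ge0.
lra.
Qed.

Lemma cramer_rao_trace : exists2 C : R, 0 <= C & forall t e v (B : 'I_N -> 'I_N -> R) (beta : R),
  0 < t < 2 -> 0 < e -> S v -> (forall a b, `|B a b| <= beta) ->
  (forall w : 'I_N -> R, 0 <= \sum_a \sum_b B a b * w a * w b) ->
  \sum_a \sum_b B a b * g v a b - C * beta * (Num.sqrt t + e / t) <=
  2 * t * Int (fun y => hsh e y t (chart_inv i v) *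
     \sum_a \sum_b B a b * covector i (log_st (hsh e y) t) v a * covector i (log_st (hsh e y) t) v b).
Proof.
have [C C0 HC] := cr_term_expansion; exists (N%:R * (N%:R * C)); first by rewrite !mulr_ge0.
move=> t e v B beta t02 e0 vB Bb B0; have /andP[t0 t2] := t02.
apply: le_trans (cramer_rao_frame t0 e0 vB B0); rewrite lerBlDl -lerBlDr.
apply: le_trans (ler_norm _) _; rewrite -sumrB.
under eq_bigr do rewrite -sumrB.
rewrite -2!mulrA; apply: sum_norm_le => a; rewrite -mulrA; apply: sum_norm_le => b.
rewrite -mulrBr normrM distrC mulrCA; apply: ler_pM => //.
exact: HC.
Qed.

Variable v : 'rV[R]_N.
Hypothesis vB : S v.
Hypothesis hess0 : forall d a b, hess_low g (xi d \o chart_inv i) a b v = 0.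

Let L a := covector i (lap (xi a)) v a.

Lemma lap_xi d : lap (xi d) (chart_inv i v) = 0.
Proof.
have Uv := ball_cod vB; rewrite (lapE (sxi d) Uv).
have sx : smooth_on (chart_cod i) (xi d \o chart_inv i) by exact: sxi.
rewrite (laplace_hess_low (cod_open i) (@chart_metric_smooth R N M i) gT gpos sx Uv).
by apply: big1 => a _; apply: big1 => b _; rewrite hess0 mulr0.
Qed.

(** In Bochner's formula the products of Hessians vanish at v, which leaves gradients of Laplacians
    and twice the Ricci term, whose trace is the scalar curvature. *)
Lemma lap_gam_xi : \sum_d \sum_d' g v d d' * lap (gam (xi d) (xi d')) (chart_inv i v) =
  2 * \sum_a L a + 2 * scalar_coord g v.
Proof.
have Uv := ball_cod vB; have oU := cod_open i; have sg := @chart_metric_smooth R N M i.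
have sx d : smooth_on (chart_cod i) (xi d \o chart_inv i) by exact: sxi.
have hc0 d a b : hess_coord g (xi d \o chart_inv i) a b v = 0.
  rewrite (hess_coordE oU sg gT gpos a b (sx d) Uv); apply: big1 => e _.
  by rewrite hess0 mulr0.
have E d d' : lap (gam (xi d) (xi d')) (chart_inv i v) =
    gam (xi d') (lap (xi d)) (chart_inv i v) + gam (xi d) (lap (xi d')) (chart_inv i v)
    + ricci_up g d d' v + ricci_up g d' d v.
  rewrite (lapE (smooth_gam (sxi d) (sxi d')) Uv).
  transitivity (laplace_coord g (gamma_coord g (xi d \o chart_inv i) (xi d' \o chart_inv i)) v).
    by apply: (laplace_ext g oU Uv) => w Uw; exact: (gamE (sxi d) (sxi d') Uw).
  rewrite (bochner oU sg gT gpos (sx d) (sx d') Uv).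
  rewrite big1 ?mulr0 ?add0r; last by move=> a _; apply: big1 => b _; rewrite hc0 mul0r.
  rewrite (gamE (sxi d') (smooth_lap (sxi d)) Uv) (gamE (sxi d) (smooth_lap (sxi d')) Uv).
  have gl e e' : gamma_coord g (xi e' \o chart_inv i) (laplace_coord g (xi e \o chart_inv i)) v =
      gamma_coord g (xi e' \o chart_inv i) (lap (xi e) \o chart_inv i) v.
    exact: (gamma_ext g oU Uv (fun w _ => erefl) (fun w Uw => esym (lapE (sxi e) Uw))).
  rewrite !gl.
  have rf e e' : ricci_form g (fun a => grad_coord g (xi e \o chart_inv i) a v)
      (fun a => grad_coord g (xi e' \o chart_inv i) a v) v = ricci_up g e e' v.
    rewrite /grad_coord (ricci_formE gT _ _ Uv).
    rewrite -[RHS](sum_kron (fun a => ricci_up g a e' v)); apply: eq_bigr => a _.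
    rewrite -[in RHS](sum_kron (fun b => ricci_up g a b v)) mulr_sumr; apply: eq_bigr => b _.
    have := xi_cov e a vB; have := xi_cov e' b vB; rewrite /covector => -> ->.
    by rewrite [b == e']eq_sym [a == e]eq_sym; move: (ricci_up _ _ _ _) => q; ring.
  by rewrite !rf.
have GL : \sum_d \sum_d' g v d d' * gam (xi d) (lap (xi d')) (chart_inv i v) = \sum_a L a.
  rewrite exchange_big; apply: eq_bigr => d' _ /=.
  transitivity (\sum_d g v d' d * \sum_b h v d b * covector i (lap (xi d')) v b).
    apply: eq_bigr => d _; rewrite (metricC gT d d' Uv) gam_xi//; exact: smooth_lap.
  exact: (lower_raise gT gpos (fun b => covector i (lap (xi d')) v b) d' Uv).
have S1 := ricci_up_trace gT gpos Uv.
have S2 : \sum_d \sum_d' g v d d' * ricci_up g d d' v = scalar_coord g v.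
  by rewrite -S1; apply: eq_bigr => d _; apply: eq_bigr => d' _; rewrite mulrC.
have GL' : \sum_d \sum_d' g v d d' * gam (xi d') (lap (xi d)) (chart_inv i v) = \sum_a L a.
  rewrite -GL exchange_big; apply: eq_bigr => d _; apply: eq_bigr => d' _.
  by rewrite (metricC gT d d' Uv).
have S2' : \sum_d \sum_d' g v d d' * ricci_up g d' d v = scalar_coord g v.
  rewrite -S2 exchange_big; apply: eq_bigr => d _; apply: eq_bigr => d' _.
  by rewrite (metricC gT d d' Uv).
rewrite (_ : 2 * _ + 2 * _ = \sum_a L a + \sum_a L a + scalar_coord g v + scalar_coord g v); last first.
  by move: (\sum_a _) (scalar_coord _ _) => x y; ring.
rewrite -{1}GL' -GL -{1}S2 -S2' -!big_split; apply: eq_bigr => d _ /=.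
rewrite -!big_split; apply: eq_bigr => d' _ /=; rewrite E.
by rewrite !mulrDr.
Qed.

(** The product rule is applied twice; terms containing Lap xi at v drop out, and [lap_gam_xi]
    evaluates the rest. *)
Lemma gamma_iterated_trace :
  \sum_d \sum_d' g v d d' * gamma_iterated (xi d) (xi d') (chart_inv i v) =
  8 * \sum_a L a + 4 * scalar_coord g v.
Proof.
have Uv := ball_cod vB.
have E d d' : gamma_iterated (xi d) (xi d') (chart_inv i v) =
    2 * gam (xi d) (lap (xi d')) (chart_inv i v) + 2 * gam (xi d') (lap (xi d)) (chart_inv i v)
    + 2 * lap (gam (xi d) (xi d')) (chart_inv i v).
  have s1 := smooth_lap (sxi d); have s2 := smooth_lap (sxi d'); have s3 := smooth_gam (sxi d) (sxi d').
  rewrite /gamma_iterated.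
  have -> : lap (fun y => xi d y * xi d' y) = fun y => (xi d y * lap (xi d') y + xi d' y * lap (xi d) y) + 2 * gam (xi d) (xi d') y.
    by apply/funext => y; rewrite (lapM y (sxi d) (sxi d')).
  have sA := smooth_functionM (sxi d) s2; have sA' := smooth_functionM (sxi d') s1.
  rewrite (lapD _ (smooth_functionD sA sA') (smooth_functionM (smooth_function_cst (2 : R)) s3)).
  rewrite (lapD _ sA sA') (lapM _ (sxi d) s2) (lapM _ (sxi d') s1) !lap_xi.
  rewrite (lapM _ (smooth_function_cst (2 : R)) s3) lap_cst (gam_cst _ _ s3).
  move: (lap (lap _) _) (lap (lap _) _) (gam _ _ _) (gam _ _ _) (lap (gam _ _) _) (gam _ _ _).
  by move=> *; ring.
have GL : \sum_d \sum_d' g v d d' * gam (xi d) (lap (xi d')) (chart_inv i v) = \sum_a L a.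
  rewrite exchange_big; apply: eq_bigr => d' _ /=.
  transitivity (\sum_d g v d' d * \sum_b h v d b * covector i (lap (xi d')) v b).
    apply: eq_bigr => d _; rewrite (metricC gT d d' Uv) gam_xi//; exact: smooth_lap.
  exact: (lower_raise gT gpos (fun b => covector i (lap (xi d')) v b) d' Uv).
have GL' : \sum_d \sum_d' g v d d' * gam (xi d') (lap (xi d)) (chart_inv i v) = \sum_a L a.
  rewrite -GL exchange_big; apply: eq_bigr => d _; apply: eq_bigr => d' _.
  by rewrite (metricC gT d d' Uv).
have LG := lap_gam_xi.
transitivity (2 * (\sum_d \sum_d' g v d d' * gam (xi d) (lap (xi d')) (chart_inv i v)) +
  2 * (\sum_d \sum_d' g v d d' * gam (xi d') (lap (xi d)) (chart_inv i v)) +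
  2 * (\sum_d \sum_d' g v d d' * lap (gam (xi d) (xi d')) (chart_inv i v))).
  rewrite !mulr_sumr -!big_split; apply: eq_bigr => d _ /=.
  rewrite !mulr_sumr -!big_split; apply: eq_bigr => d' _ /=; rewrite E.
  by move: (g v d d') (gam _ _ _) (gam _ _ _) (lap _ _) => *; ring.
by rewrite GL GL' LG; move: (\sum_a _) (scalar_coord _ _) => x y; ring.
Qed.

(** The trace with the inverse metric. To first order in t the gradients give 2 (N + t L), with L
    the sum of the [L a], and the covariance gives N + t (2 L + Scal). The difference is N - t Scal:
    the third derivatives of the coordinates contained in L cancel. *)
Lemma cramer_rao_curvature : exists2 C : R, 0 <= C & forall t e, 0 < t < 2 -> 0 < e ->
  N%:R - t * scalar_coord g v - C * (t * Num.sqrt t + e / t) <=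
  2 * t * Int (fun y => fisher_density (hsh e y) t (chart_inv i v)).
Proof.
have Uv := ball_cod vB; have vB2 := ball_half rho0 (SB vB).
have [Cg Cg0 HCg] := metric_bounded sB.
have [C1 C10 H1] : exists2 C : R, 0 <= C & forall d, forall t w a, 0 < t < 2 -> in_ball c rho w ->
    `|hgrad t (xi d) w a - t * covector i (lap (xi d)) w a - covector i (xi d) w a| <= C * (t * Num.sqrt t).
  apply: uniform_bound => [d C C' CC' H t w a t02 wB|d]; last exact: heat_gradient_expansion2.
  apply: le_trans (H t w a t02 wB) _; rewrite ler_wpM2r// mulr_ge0 ?sqrtr_ge0//.
  by have /andP[/ltW] := t02.
have [C2 C20 H2] : exists2 C : R, 0 <= C & forall d : 'I_N * 'I_N, forall t e z, 0 < t -> 0 <= e ->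
    `|scov t e (xi d.1) (xi d.2) z - t * (2 * gam (xi d.1) (xi d.2) z) -
       t ^+ 2 / 2 * gamma_iterated (xi d.1) (xi d.2) z| <= C * (t ^+ 3 + e).
  apply: uniform_bound => [d C C' CC' H t e z t0 e0|d]; last exact: shift_cov_expansion2.
  by apply: le_trans (H t e z t0 e0) _; rewrite ler_wpM2r// addr_ge0// exprn_ge0// ltW.
pose K1 := N%:R * C1; pose K2 := N%:R * (N%:R * (Cg * C2)).
have K10 : 0 <= K1 by rewrite /K1 !mulr_ge0.
have K20 : 0 <= K2 by rewrite /K2 !mulr_ge0.
exists (K1 + K1 + K2 + K2); first by rewrite !addr_ge0.
move=> t e t02 e0; have /andP[t0 t2] := t02.
have h0 (w : 'I_N -> R) : 0 <= \sum_a \sum_b h v a b * w a * w b.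
  exact: (cometric_ge0 gT gpos w Uv).
have CR := cramer_rao_frame t0 e0 vB h0.
have EI : Int (fun y => hsh e y t (chart_inv i v) * \sum_a \sum_b h v a b *
     covector i (log_st (hsh e y) t) v a * covector i (log_st (hsh e y) t) v b) =
   Int (fun y => fisher_density (hsh e y) t (chart_inv i v)).
  by apply: eq_Rintegral => y _; rewrite fisher_chart.
rewrite EI in CR; apply: le_trans CR.
have T1 : \sum_a \sum_b h v a b * cr_term t e v a b = 2 * \sum_a hgrad t (xi a) v a
    - (2 * t)^-1 * \sum_d \sum_d' g v d d' * scov t e (xi d) (xi d') (chart_inv i v).
  exact: (frame_contract (fun d a => hgrad t (xi d) v a) (fun d d' => scov t e (xi d) (xi d') (chart_inv i v))
    (2 * t)^-1 (fun a b => inv_metricC gT a b Uv) (fun a b => metricC gT a b Uv)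
    (fun X a => raise_lower gT gpos X a Uv)).
rewrite T1.
have F1 : N%:R + t * \sum_a L a - K1 * (t * Num.sqrt t) <= \sum_a hgrad t (xi a) v a.
  rewrite lerBlDr -lerBlDl; apply: le_trans (ler_norm _) _.
  have -> : N%:R + t * \sum_a L a = \sum_a (covector i (xi a) v a + t * L a).
    rewrite big_split -mulr_sumr /=; congr (_ + _).
    under eq_bigr do rewrite (xi_cov _ _ vB) eqxx.
    by rewrite big_const_ord iter_addr_0.
  rewrite -sumrB /K1 -mulrA; apply: sum_norm_le => a; rewrite distrC.
  apply: le_trans (H1 a t v a t02 (SB vB)); apply: eq_ler; congr (`|_|).
  by rewrite /L; move: (hgrad _ _ _ _) (covector _ _ _ _) (covector _ _ _ _) => *; ring.
have F2 : \sum_d \sum_d' g v d d' * scov t e (xi d) (xi d') (chart_inv i v) <=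
    2 * t * N%:R + t ^+ 2 / 2 * (8 * \sum_a L a + 4 * scalar_coord g v) + K2 * (t ^+ 3 + e).
  rewrite -gamma_iterated_trace.
  have -> : 2 * t * N%:R = \sum_d \sum_d' g v d d' * (t * (2 * gam (xi d) (xi d') (chart_inv i v))).
    have -> : 2 * t * N%:R = 2 * t * \sum_(d < N) (d == d)%:R.
      congr (_ * _); under eq_bigr do rewrite eqxx.
      by rewrite big_const_ord iter_addr_0.
    rewrite mulr_sumr; apply: eq_bigr => d _; rewrite -(metric_invE gT gpos d d Uv) mulr_sumr.
    apply: eq_bigr => d' _; rewrite gam_xi2// (inv_metricC gT d d' Uv).
    by move: (g v d d') (h v d' d) => *; ring.
  rewrite -lerBlDl; apply: le_trans (ler_norm _) _.
  rewrite mulr_sumr -big_split -sumrB /K2 -mulrA; apply: sum_norm_le => d /=.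
  rewrite mulr_sumr -big_split -sumrB -mulrA; apply: sum_norm_le => d' /=.
  have -> : forall G Z T Q, G * Z - (G * T + t ^+ 2 / 2 * (G * Q)) = G * (Z - T - t ^+ 2 / 2 * Q).
    by move=> G Z T Q; ring.
  rewrite normrM -[Cg * C2 * _]mulrA; apply: ler_pM => //.
    exact: HCg.
  exact: (H2 (d, d') t e _ t0 (ltW e0)).
have {}F2 := ler_wpM2l (_ : 0 <= (2 * t)^-1) F2.
have k0 : 0 <= (2 * t)^-1 by rewrite invr_ge0 mulr_ge0// ltW.
move: (F2 k0) F1; set Z := \sum_d \sum_d' _; set H := \sum_a hgrad _ _ _ _.
move: (\sum_a L a) (scalar_coord g v) => l sc.
have -> : (2 * t)^-1 * (2 * t * N%:R + t ^+ 2 / 2 * (8 * l + 4 * sc) + K2 * (t ^+ 3 + e)) =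
   N%:R + t * (2 * l + sc) + K2 * (t ^+ 2 / 2) + K2 * (e / t / 2).
  by field; rewrite gt_eqF.
have et0 : 0 <= e / t by rewrite divr_ge0// ltW.
have ts0 : 0 <= t * Num.sqrt t by rewrite mulr_ge0 ?sqrtr_ge0// ltW.
have x1 : K2 * (t ^+ 2 / 2) <= K2 * (t * Num.sqrt t).
  rewrite ler_wpM2l// expr2 -mulrA ler_wpM2l ?(ltW t0)//; have := sqrt_ge_half t02; lra.
have x2 : K2 * (e / t / 2) <= K2 * (e / t) by rewrite ler_wpM2l//; lra.
have x3 : 0 <= (K1 + K1) * (e / t) by rewrite mulr_ge0// addr_ge0.
have x4 : 0 <= K2 * (e / t) by rewrite mulr_ge0.
have x5 : 0 <= K2 * (t * Num.sqrt t) by rewrite mulr_ge0.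
lra.
Qed.

End cramer_rao_bounds.

(** * Entropy and curvature *)

(** [fisher_info_le] with the starting time a sent to 0, so that the weight is r^2. *)
Lemma fisher_info_liyau : exists2 K : R, 0 <= K &
  forall u, heat_solution u -> (forall t x, 0 < t -> 0 < u t x) -> forall c x r, 0 < r < c ->
    r ^+ 2 * finfo u c x r <= liyau_poly K N%:R (dt u c x) (u c x) r.
Proof.
have [|D _] := @unity_partition_exists R N M M_closed (fun _ => setT) (fun _ => openT) _ => //.
have [K K0 HK] := ricci_avg_norm D; exists K => // u hu u0 c x r /andP[r0 rc].
apply: (liyau_poly_limit r0) => s /andP[s0 sr].
have [a0 ar] : 0 < r - s /\ r - s < r by split; lra.
have := fisher_info_le hu u0 (fun k y sk => HK k y sk) x a0 ar rc.
by rewrite (_ : r - (r - s) = s)//; lra.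
Qed.

Definition xlnx (s : R) : R := s * ln s.

Lemma xlnx_measurable : measurable_fun setT xlnx.
Proof. by apply: measurable_funM; [exact: measurable_id|exact: measurable_ln]. Qed.

Definition backward_entropy (e c : R) (x y : M) (r : R) : R :=
  Int (fun z => bw c x r z * xlnx (hsh e y r z)).

(** At e = 0 and c = t + s this is minus the iterated Nash entropy up to terms in t
    ([nash_entropyE]), which makes the latter a function of one variable on each line t + s = c. *)
Definition mean_entropy (e c : R) (x : M) (r : R) : R :=
  Int (fun y => backward_entropy e c x y r).

Lemma xlnx_shift_heat_bound t0 : 0 < t0 -> exists2 C : R, 0 <= C &
  forall t z y e, t0 <= t -> 0 <= e <= 1 -> `|xlnx (hsh e y t z)| <= C.
Proof.
move=> t00; have [B B0 HB] := heat_bound t00.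
exists ((B + 1) ^+ 2 + 1); first by rewrite addr_ge0// sqr_ge0.
move=> t z y e tt /andP[e0 e1]; apply: xlnx_bound; rewrite /heat_shift lerD ?HB// andbT.
by rewrite addr_ge0// heat_ge0//; exact: lt_le_trans tt.
Qed.

Lemma xlnx_heat_measurable e t : 0 < t ->
  measurable_fun setT (fun w : borel M * borel M => xlnx (hsh e w.2 t w.1)).
Proof.
move=> t0; apply: (measurableT_comp xlnx_measurable); apply: measurable_funD.
  exact: heat_jointly_measurable.
exact: measurable_cst.
Qed.

Lemma bm_backward_entropy e c x r : 0 <= e <= 1 -> 0 < r < c ->
  bm (fun y : borel M => backward_entropy e c x y r).
Proof.
move=> e01 rc; have r0 : 0 < r by have /andP[] := rc.
have [C C0 HC] := xlnx_shift_heat_bound r0.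
by have [] := backward_fubini x rc (xlnx_heat_measurable e r0) (fun z y => HC r z y e (lexx _) e01).
Qed.

Lemma mean_entropyE e c x r : 0 <= e <= 1 -> 0 < r < c ->
  mean_entropy e c x r = Int (fun z => bw c x r z * Int (fun y => xlnx (hsh e y r z))) /\
  bm (fun z : borel M => Int (fun y => xlnx (hsh e y r z))).
Proof.
move=> e01 rc; have r0 : 0 < r by have /andP[] := rc.
have [C C0 HC] := xlnx_shift_heat_bound r0.
by have [_ ? ?] := backward_fubini x rc (xlnx_heat_measurable e r0) (fun z y => HC r z y e (lexx _) e01).
Qed.

Lemma hsh0 y t z : hsh 0 y t z = p t z y.
Proof. exact: addr0. Qed.

Lemma nash_entropyE t s x : 0 < t -> 0 < s ->
  nash_entropy vol p N%:R x t s =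
  - mean_entropy 0 (t + s) x t - N%:R / 2 * ln (4 * pi * t) - N%:R / 2.
Proof.
move=> t0 s0; have ts : 0 < t < t + s by rewrite t0 ltrDl.
have e01 : 0 <= (0 : R) <= 1 by rewrite lexx ler01.
have [-> bI] := mean_entropyE x e01 ts.
rewrite /nash_entropy /heat_semigroup /pointed_nash_entropy.
set K := N%:R / 2 * ln (4 * pi * t); set I := fun z : M => Int (fun y => xlnx (hsh 0 y t z)).
have bb : bm (bw (t + s) x t : borel M -> R).
  by rewrite /backward [t + s]addrC addrK; exact: bm_heat.
have mb : Int (bw (t + s) x t) = 1 by rewrite /backward [t + s]addrC addrK; exact: heat_mass.
transitivity (Int (fun z => - (bw (t + s) x t z * I z) - (K + N%:R / 2) * bw (t + s) x t z)).
  apply: eq_Rintegral => z _; rewrite /backward [t + s]addrC addrK (heat_sym _ _ s0).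
  rewrite (_ : Int (fun y => p t z y * ln (p t z y)) = I z); last first.
    by apply: eq_Rintegral => y _; rewrite hsh0.
  by move: (I z) (p s z x) => *; ring.
have b1 := bmM bb bI.
by rewrite (IntB V (bmN b1) (bmZ _ bb)) (IntN V b1) (IntZ V _ bb) mb mulr1 opprD addrA.
Qed.

(** The kernel is bounded for r >= t0, so [xlnx_shift_bound] applies with one constant. *)
Lemma mean_entropy_shift c x t0 : 0 < t0 -> exists2 C : R, 0 <= C &
  forall e r, 0 < e <= 1 -> t0 <= r -> r < c ->
  `|mean_entropy e c x r - mean_entropy 0 c x r| <= C * Num.sqrt e.
Proof.
move=> t00; have [B B0 HB] := heat_bound t00.
exists ((B + 3) * volume); first by rewrite mulr_ge0 ?volume_ge0// addr_ge0.
move=> e r e01 tr rc; have r0 : 0 < r by exact: lt_le_trans tr.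
have rc' : 0 < r < c by rewrite r0.
have e01' : 0 <= e <= 1 by have /andP[/ltW -> ->] := e01.
have z01 : 0 <= (0 : R) <= 1 by rewrite lexx ler01.
have b1 := bm_backward_entropy x e01' rc'; have b2 := bm_backward_entropy x z01 rc'.
rewrite /mean_entropy -(IntB V b1 b2).
rewrite -mulrA [volume * _]mulrC mulrA -(Int_cst vol).
apply: (Int_norm_le V (bmB b1 b2) (bm_cst _ _)) => y.
have s0 : 0 < c - r by rewrite subr_gt0.
have bb : bm (bw c x r : borel M -> R) by exact: bm_heat.
have bx e' : 0 <= e' <= 1 -> bm (fun z : borel M => xlnx (hsh e' y r z)).
  move=> e'01; split; last first.
    by have [D D0 HD] := xlnx_shift_heat_bound r0; exists D => z; apply: HD.
  apply: (measurableT_comp xlnx_measurable); apply: measurable_funD.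
    by have [] := bm_heat y r0.
  exact: measurable_cst.
rewrite /backward_entropy -(IntB V (bmM bb (bx e e01')) (bmM bb (bx 0 z01))).
set K := (B + 3) * _.
rewrite -[X in _ <= X]mulr1 -(heat_mass x s0) -(IntZ V _ bb).
apply: (Int_norm_le V).
- by apply: bmB; apply: bmM => //; exact: bx.
- exact: bmZ.
move=> z; rewrite -mulrBr normrM (ger0_norm (heat_ge0 _ _ s0)) mulrC.
apply: ler_wpM2r; first exact: heat_ge0.
rewrite hsh0; apply: xlnx_shift_bound => //; rewrite HB// andbT; exact: heat_ge0.
Qed.

Lemma derive_backward_entropy e (c r : R) x y : 0 < e -> 0 < r < c ->
  is_derive r (1 : R) (backward_entropy e c x y) (- finfo (hsh e y) c x r).
Proof.
move=> e0 rc; apply: (derive_entropy (heat_shift_solution e y) _ x rc) => t z.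
exact: heat_shift_gt0.
Qed.

Lemma bm_finfo e c x r : 0 < e <= 1 -> 0 < r < c ->
  bm (fun y : borel M => finfo (hsh e y) c x r).
Proof.
move=> e01 rc; have /andP[e0 e1] := e01; have r0 : 0 < r by have /andP[] := rc.
have [C C0 HC] := fisher_density_bound r r0.
have mF : measurable_fun setT (fun w : borel M * borel M => fisher_density (hsh e w.2) r w.1).
  apply: (separately_continuous_measurable (F := fun z (y : borel M) => fisher_density (hsh e y) r z)
    (@points_second_countable R N M)).
    by move=> y; exact: continuous_fisher.
  by move=> z; exact: fisher_measurable.
have FC z y : `|fisher_density (hsh e y) r z| <= C.
  by rewrite ger0_norm ?fisher_ge0//; apply: HC => //; rewrite lexx.
by have [] := backward_fubini x rc mF FC.
Qed.

Lemma fisher_info_bound c x t0 : 0 < t0 -> exists2 C : R, 0 <= C &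
  forall e y r, 0 < e <= 1 -> t0 <= r -> r < c -> 0 <= finfo (hsh e y) c x r <= C.
Proof.
move=> t00; have [C C0 HC] := fisher_density_bound c t00; exists C => // e y r e01 tr rc.
have /andP[e0 e1] := e01; have r0 : 0 < r by exact: lt_le_trans tr.
have s0 : 0 < c - r by rewrite subr_gt0.
have bb : bm (bw c x r : borel M -> R) by exact: bm_heat.
have bF : bm (fisher_density (hsh e y) r : borel M -> R).
  by apply: bm_continuous M_closed _ _; exact: continuous_fisher.
apply/andP; split.
  apply: Int_ge0 => z; apply: mulr_ge0; first exact: heat_ge0.
  exact: fisher_ge0.
rewrite -[C]mulr1 -(heat_mass x s0) -(IntZ V _ bb).
apply: (le_Int V (bmM bb bF) (bmZ C bb)) => z.
rewrite mulrC ler_wpM2r//; first exact: heat_ge0.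
by apply: HC => //; rewrite tr ltW.
Qed.

(** By [fisher_heat] the product of p + e with its Fisher density does not depend on e, so the
    density decreases as e grows. *)
Lemma fisher_info_shift e e' c x y r : 0 < e' -> e' <= e -> 0 < r < c ->
  finfo (hsh e y) c x r <= finfo (hsh e' y) c x r.
Proof.
move=> e'0 e'e rc; have /andP[r0 rc'] := rc; have e0 : 0 < e by exact: lt_le_trans e'e.
have s0 : 0 < c - r by rewrite subr_gt0.
have bb : bm (bw c x r : borel M -> R) by exact: bm_heat.
have bF d : 0 < d -> bm (fisher_density (hsh d y) r : borel M -> R).
  by move=> d0; apply: bm_continuous M_closed _ _; exact: continuous_fisher.
apply: (le_Int V (bmM bb (bF e e0)) (bmM bb (bF e' e'0))) => z.
apply: ler_wpM2l; first exact: heat_ge0.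
have := fisher_heat y z e0 r0; rewrite -(fisher_heat y z e'0 r0) => E.
have u0 := heat_shift_gt0 y z e0 r0.
rewrite -(ler_pM2l u0) E ler_wpM2r ?fisher_ge0//.
by rewrite /heat_shift lerD2l.
Qed.

Lemma backward_entropy_difference e e' c x y t t0 : 0 < e' -> e' <= e -> 0 < t -> t <= t0 -> t0 < c ->
  backward_entropy e c x y t - backward_entropy e c x y t0 <=
  backward_entropy e' c x y t - backward_entropy e' c x y t0.
Proof.
move=> e'0 e'e t0' tt0 t0c; have e0 : 0 < e by exact: lt_le_trans e'e.
have D (r : R) : 0 < r < c -> is_derive r (1 : R) (fun r => backward_entropy e' c x y r - backward_entropy e c x y r)
    (- finfo (hsh e' y) c x r - - finfo (hsh e y) c x r).
  by move=> rc; exact: (is_deriveB (derive_backward_entropy x y e'0 rc) (derive_backward_entropy x y e0 rc)).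
have D0 r : 0 < r < c -> - finfo (hsh e' y) c x r - - finfo (hsh e y) c x r <= 0.
  by move=> rc; rewrite opprK addrC subr_le0 fisher_info_shift.
have := derive_le0_nincr D D0 t0' tt0 t0c; lra.
Qed.

(** As the Fisher information grows when e decreases, so does the drop of entropy over [t, t0]. A
    bound at e = 0, where concavity is assumed, therefore carries over to e > 0, where the drop is
    an integral of Fisher information. *)
Lemma mean_entropy_difference e c x t t0 : 0 < e <= 1 -> 0 < t -> t <= t0 -> t0 < c ->
  mean_entropy e c x t - mean_entropy e c x t0 <= mean_entropy 0 c x t - mean_entropy 0 c x t0.
Proof.
move=> e01 t0' tt0 t0c; have /andP[e0 e1] := e01.
have tc : t < c by exact: le_lt_trans t0c.
have [C C0 HC] := @mean_entropy_shift c x t t0'.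
have C20 : 0 <= C + C by rewrite addr_ge0.
apply: (le_sqrt_error C20) => d d01; have /andP[d0 d1] := d01.
(* The auxiliary shift tends to 0 with d and never exceeds e, as the comparison requires. *)
pose e' := Num.min d e.
have e'0 : 0 < e' by rewrite lt_min d0 e0.
have e'e : e' <= e by rewrite ge_min lexx orbT.
have e'd : e' <= d by rewrite ge_min lexx.
have e'01 : 0 < e' <= 1 by rewrite e'0 (le_trans e'e).
have E'01 : 0 <= e' <= 1 by rewrite (ltW e'0) (le_trans e'e).
have E01 : 0 <= e <= 1 by rewrite ltW.
have i1 : 0 < t < c by rewrite t0'.
have i2 : 0 < t0 < c by rewrite (lt_le_trans t0' tt0).
have H : mean_entropy e c x t - mean_entropy e c x t0 <= mean_entropy e' c x t - mean_entropy e' c x t0.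
  have b1 := bm_backward_entropy x E01 i1; have b2 := bm_backward_entropy x E01 i2.
  have b3 := bm_backward_entropy x E'01 i1; have b4 := bm_backward_entropy x E'01 i2.
  apply: (le_trans (eq_ler (esym (IntB V b1 b2)))); apply: (le_trans _ (eq_ler (IntB V b3 b4))).
  by apply: (le_Int V (bmB b1 b2) (bmB b3 b4)) => y; exact: backward_entropy_difference.
have : Num.sqrt e' <= Num.sqrt d by exact: ler_wsqrtr.
move=> /(ler_wpM2l C0); move: (HC e' t e'01 (lexx _) tc) (HC e' t0 e'01 tt0 t0c) H.
move: (mean_entropy e c x t) (mean_entropy e c x t0) (mean_entropy e' c x t) (mean_entropy e' c x t0).
move: (mean_entropy 0 c x t) (mean_entropy 0 c x t0) => a0 b0 a b a' b'.
rewrite !ler_norml => /andP[h1 h2] /andP[h3 h4]; lra.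
Qed.

Local Notation bent := backward_entropy.
Local Notation ment := mean_entropy.

(** * From concavity to monotonicity of the tilted entropy *)

Section lower_scalar_bound.

Definition mean_fisher (e c : R) (x : M) (r : R) : R := Int (fun y => finfo (hsh e y) c x r).

Lemma derive_mean_entropy e (c t : R) x : 0 < e <= 1 -> 0 < t < c ->
  is_derive t (1 : R) (ment e c x) (- mean_fisher e c x t).
Proof.
move=> e01 /andP[t0 tc]; have /andP[e0 e1] := e01.
have e01' : 0 <= e <= 1 by rewrite ltW.
have t20 : 0 < t / 2 by rewrite divr_gt0.
have t2t : t / 2 < t by lra.
have [C C0 HC] := fisher_info_bound c x t20.
have sub r : t / 2 < r < c -> 0 < r < c by move=> /andP[r1 ->]; rewrite (lt_trans t20).
rewrite /mean_fisher -(IntN V); last by apply: bm_finfo => //; rewrite t0.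
apply: (@derive_Int _ _ _ vol V (t / 2) c (fun r y => bent e c x y r)
  (fun r y => - finfo (hsh e y) c x r) C) => //.
- by move=> r /sub rc; exact: bm_backward_entropy.
- by move=> r y /sub rc; exact: derive_backward_entropy.
move=> r y /andP[tr rc]; rewrite normrN.
by have /andP[h1 h2] := HC e y r e01 (ltW tr) rc; rewrite ger0_norm.
Qed.

Lemma mean_fisher_liyau : exists2 K : R, 0 <= K & forall e c x t, 0 < e <= 1 -> 0 < t < c ->
  t ^+ 2 * mean_fisher e c x t <=
  (1 + e * volume) * (N%:R / 2 * (t + K * (t * t) + K ^+ 2 / 3 * (t * t * t))).
Proof.
have [K K0 HK] := fisher_info_liyau; exists K => // e c x t e01 tc.
have /andP[e0 e1] := e01; have /andP[t0 tc'] := tc; have c0 := lt_trans t0 tc'.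
have [bL <-] := Int_liyau_poly K e t x c0.
have bf := bm_finfo x e01 tc; rewrite -(IntZ V _ bf).
apply: (le_Int V (bmZ _ bf) bL) => y; rewrite -(dt_heat_shift e y x c0); apply: HK tc.
  exact: heat_shift_solution.
by move=> r z; exact: heat_shift_gt0.
Qed.

(** The Li-Yau bound N/2r + O(1) on the mean Fisher information is integrated from t to t0. The
    growth -(N/2) ln t is what the normalisation of the Nash entropy compensates, so the tilted
    entropy stays bounded below as t tends to 0. *)
Lemma mean_entropy_upper c x t0 : 0 < t0 < c -> exists A : R, forall t, 0 < t <= t0 ->
  ment 0 c x t + N%:R / 2 * ln t <= A.
Proof.
move=> /andP[t00 t0c]; have [K K0 HK] := mean_fisher_liyau.
have c0 : 0 < c by exact: lt_trans t0c.
have V0 := volume_ge0; have N0 : 0 <= N%:R / 2 :> R by rewrite divr_ge0.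
have K30 : 0 <= K ^+ 2 / 3 by rewrite divr_ge0 ?exprn_ge0.
(* The part of the Li-Yau bound without 1/r, at its largest for e <= 1 and r <= c. *)
pose B := (1 + volume) * (N%:R / 2 * (K + K ^+ 2 / 3 * c)).
have B0 : 0 <= B by rewrite mulr_ge0 ?addr_ge0// mulr_ge0// addr_ge0// mulr_ge0// ltW.
exists (ment 0 c x t0 + N%:R / 2 * ln t0 + B * t0) => t /andP[tp tt0].
have tc : t < c by exact: le_lt_trans t0c.
have [C C0 HC] := mean_entropy_shift c x tp.
have E0 : 0 <= C + C + N%:R / 2 * volume * (`|ln t| + `|ln t0|).
  by rewrite !addr_ge0// mulr_ge0 ?addr_ge0// mulr_ge0.
apply: (le_sqrt_error E0) => e e01; have /andP[e0 e1] := e01.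
(* The coefficient of 1/r carries the mass of p + e; its excess over N/2 is of order e and is paid
   for by the logarithms in E0. *)
pose n := (1 + e * volume) * (N%:R / 2).
have n0 : 0 <= n by rewrite mulr_ge0// addr_ge0// mulr_ge0// ltW.
have D (r : R) : 0 < r < c -> is_derive r (1 : R) (fun r => - (ment e c x r + n * ln r + B * r ^+ 1))
    (- (- mean_fisher e c x r + n * r^-1 + B * (1%:R * r ^+ 0))).
  move=> rc; have /andP[r0 _] := rc; apply: is_deriveN; apply: is_deriveD; last exact: is_derive_monomial.
  apply: is_deriveD; first exact: derive_mean_entropy.
  exact: (is_deriveZ n (is_derive1_ln r0)).
have D0 r : 0 < r < c -> - (- mean_fisher e c x r + n * r^-1 + B * (1%:R * r ^+ 0)) <= 0.
  move=> rc; have /andP[r0 rc'] := rc; rewrite expr0 !mulr1 oppr_le0 -addrA addrC subr_ge0.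
  rewrite -(ler_pM2l (exprn_gt0 2 r0)); apply: le_trans (HK e c x r e01 rc) _.
  have -> : r ^+ 2 * (n / r + B) = n * r + r ^+ 2 * B by field; rewrite gt_eqF.
  have -> : (1 + e * volume) * (N%:R / 2 * (r + K * (r * r) + K ^+ 2 / 3 * (r * r * r))) =
    n * r + r ^+ 2 * (n * (K + K ^+ 2 / 3 * r)) by rewrite /n; ring.
  rewrite lerD2l ler_wpM2l ?exprn_ge0 ?(ltW r0)// /B mulrA; apply: ler_pM => //.
  - by rewrite addr_ge0// mulr_ge0// ltW.
  - by rewrite /n ler_wpM2r// lerD2l ler_piMl.
  - by rewrite lerD2l ler_wpM2l// ltW.
have := derive_le0_nincr D D0 tp tt0 t0c; rewrite !expr1 lerN2.
have h1 := HC e t e01 (lexx _) tc; have h2 := HC e t0 e01 tt0 t0c.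
have h3 : `|N%:R / 2 * volume * (ln t0 - ln t) * e| <=
    N%:R / 2 * volume * (`|ln t| + `|ln t0|) * Num.sqrt e.
  have q0 : 0 <= N%:R / 2 * volume by rewrite mulr_ge0.
  rewrite normrM (ger0_norm (ltW e0)) normrM (ger0_norm q0); apply: ler_pM.
  - by rewrite mulr_ge0.
  - exact: ltW.
  - by rewrite ler_wpM2l// [X in _ <= X]addrC ler_normB.
  - exact: sqrt_ge_id.
have Bt : 0 <= B * t by rewrite mulr_ge0// ltW.
move: h1 h2 h3 Bt; rewrite /n; clearbody B.
move: (ment e c x t) (ment e c x t0) (ment 0 c x t) (ment 0 c x t0) (volume) (Num.sqrt e).
move=> a b a0 b0 v q; rewrite !ler_norml => /andP[h1 h1'] /andP[h2 h2'] /andP[h3 h3'] Bt H.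
move: (ln t) (ln t0) (`|ln t| + _) h3 h3' H => l l0 z h3 h3' H; lra.
Qed.

Variable sigma : R.
Variable tau : R.
Hypothesis tau0 : 0 < tau.
Hypothesis Hconc : forall (x : M) (t s : R -> R), inverse_time_geodesic t s ->
  (forall th : R, 0 <= th <= 1 -> t th < tau /\ s th < tau) ->
  concave_along (fun t' s' => nash_entropy vol p N%:R x t' s' + sigma / 2 * t') t s.

Definition tilted_entropy c x t : R := nash_entropy vol p N%:R x t (c - t) + sigma / 2 * t.

Lemma tilted_entropy_concave c x t1 t2 th : c <= tau -> 0 < t1 < c -> 0 < t2 < c -> 0 <= th <= 1 ->
  (1 - th) * tilted_entropy c x t1 + th * tilted_entropy c x t2 <=
  tilted_entropy c x (((1 - th) * t1^-1 + th * t2^-1)^-1).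
Proof.
move=> ct /andP[t10 t1c] /andP[t20 t2c] th01.
have c0 : 0 < c by exact: lt_trans t1c.
(* The geodesic on the line t + s = c; it stays in ]0, c[ because 1/t is a convex combination of
   numbers above 1/c. *)
pose t th := ((1 - th) * t1^-1 + th * t2^-1)^-1.
pose s th := c - t th.
have tc z : 0 <= z <= 1 -> 0 < t z < c.
  move=> z01; have ci : 0 < c^-1 by rewrite invr_gt0.
  have H : c^-1 < (1 - z) * t1^-1 + z * t2^-1 by apply: convex_gt; rewrite ?ltf_pV2.
  rewrite /t invr_gt0 (lt_trans ci H)/= -[c in X in _ < X]invrK ltf_pV2 ?posrE//.
  exact: lt_trans H.
have E0 : t 0 = t1 by rewrite /t subr0 mul1r mul0r addr0 invrK.
have E1 : t 1 = t2 by rewrite /t subrr mul0r mul1r add0r invrK.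
have geo : inverse_time_geodesic t s.
  move=> z z01; have /andP[h1 h2] := tc z z01.
  have st z' : t z' + s z' = c by rewrite /s addrC subrK.
  split => //; first by rewrite subr_gt0.
    by rewrite !st.
  by rewrite E0 E1 /t invrK.
have small z : 0 <= z <= 1 -> t z < tau /\ s z < tau.
  by move=> z01; have /andP[h1 h2] := tc z z01; rewrite /s; split; lra.
have CC := Hconc x geo small.
have /andP[th0 th1] := th01.
have m1 : (1 : R^o) \in [set th : R^o | 0 <= th <= 1] by rewrite inE /= ler01 lexx.
have m0 : (0 : R^o) \in [set th : R^o | 0 <= th <= 1] by rewrite inE /= ler01 lexx.
pose F z := nash_entropy vol p N%:R x (t z) (s z) + sigma / 2 * t z.
(* The convex combination weights its first point by th, so the endpoints enter in the order 1,
   0. *)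
have : - F (th * 1 + (1 - th) * 0) <= th * - F 1 + (1 - th) * - F 0 by exact: (CC (Itv01 th0 th1) 1 0 m1 m0).
rewrite mulr1 mulr0 addr0 /F.
rewrite /s E0 E1 -/(tilted_entropy c x t1) -/(tilted_entropy c x t2).
by rewrite -/(tilted_entropy c x (t th)) /t; lra.
Qed.

Lemma tilted_entropyE c x t : 0 < t < c ->
  tilted_entropy c x t = - ment 0 c x t - N%:R / 2 * (ln (4 * pi) + ln t) - N%:R / 2 + sigma / 2 * t.
Proof.
move=> /andP[t0 tc]; have s0 : 0 < c - t by rewrite subr_gt0.
have p40 : 0 < 4 * pi :> R by rewrite mulr_gt0// pi_gt0.
have := nash_entropyE x t0 s0; rewrite (_ : t + (c - t) = c); last by rewrite addrC subrK.
by rewrite /tilted_entropy => ->; rewrite lnM ?posrE.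
Qed.

Lemma tilted_entropy_nincr c x t1 t2 : c <= tau -> 0 < t1 -> t1 <= t2 -> t2 < c ->
  tilted_entropy c x t2 <= tilted_entropy c x t1.
Proof.
move=> ct; apply: inverse_concave_nincr => [u1 u2 th u1c u2c th01|t0 t0c].
  exact: tilted_entropy_concave.
have [A HA] := mean_entropy_upper x t0c; have /andP[t00 t0c'] := t0c.
exists (A + N%:R / 2 * ln (4 * pi) + N%:R / 2 + `|sigma| / 2 * c) => t tt; have /andP[tp tt0] := tt.
have tc : 0 < t < c by rewrite tp (le_lt_trans tt0).
rewrite (tilted_entropyE x tc).
have := HA t tt; have : - (`|sigma| * c) <= sigma * t.
  rewrite lerNl -mulNr; apply: (@le_trans _ _ (`|sigma| * t)).
    by rewrite ler_wpM2r ?(ltW tp)// -normrN ler_norm.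
  by rewrite ler_wpM2l// ltW//; have /andP[] := tc.
move: (ment _ _ _ _) (ln (4 * pi)) (ln t) (`|sigma|) => *; lra.
Qed.

(** The window [c - 2h, c - h] shrinks to the end s = 0 of the line, where the backward kernel
    concentrates at x, but stays off t = c, where that kernel degenerates. *)
Lemma mean_entropy_step c x h : c <= tau -> 0 < h -> 2 * h < c ->
  ment 0 c x (c - 2 * h) - ment 0 c x (c - h) <= h * (N%:R / 2 * (c - 2 * h)^-1 - sigma / 2).
Proof.
move=> ct h0 hc.
have c1 : 0 < c - 2 * h < c by apply/andP; split; lra.
have c2 : 0 < c - h < c by apply/andP; split; lra.
have /andP[c10 _] := c1; have /andP[c20 c2c] := c2.
have c12 : c - 2 * h <= c - h by lra.
have := tilted_entropy_nincr x ct c10 c12 c2c; rewrite (tilted_entropyE x c1) (tilted_entropyE x c2) => H.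
have L : ln (c - h) - ln (c - 2 * h) <= h * (c - 2 * h)^-1.
  rewrite -ln_div ?posrE//; apply: le_trans (ln_le_B1 (divr_gt0 c20 c10)) _.
  by apply: eq_ler; field; rewrite gt_eqF.
have N0 : 0 <= N%:R / 2 :> R by rewrite divr_ge0.
have := ler_wpM2l N0 L; move: H.
move: (ment _ _ _ _) (ment _ _ _ _) (ln (c - h)) (ln (c - 2 * h)) (ln (4 * pi)) ((c - 2 * h)^-1) => *.
lra.
Qed.

End lower_scalar_bound.

(** * The heat bound implies the bound on scalar curvature *)

Section scalar_curvature_lower_bound.

Lemma fisher_info_left e y c x : 0 < e -> 0 < c ->
  finfo (hsh e y) c x (c - s) @[s --> 0^'+] --> fisher_density (hsh e y) c x.
Proof.
move=> e0 c0.
have := @heat_left_limit _ c x (smooth_heat_fisher y e0) c0.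
rewrite (_ : (fun s => Int (fun z => p s z x * fisher_density (hsh e y) (c - s) z)) =
  fun s => finfo (hsh e y) c x (c - s))//.
by apply/funext => s; apply: eq_Rintegral => z _; rewrite /backward subKr.
Qed.

Lemma entropy_slope e c x y h : 0 < e -> 0 < h -> 2 * h < c ->
  exists2 s, h < s < 2 * h &
    h^-1 * (bent e c x y (c - 2 * h) - bent e c x y (c - h)) = finfo (hsh e y) c x (c - s).
Proof.
move=> e0 h0 hc.
have [c1 [c2 c3]] : 0 < c - 2 * h /\ c - 2 * h < c - h /\ c - h < c by split; [|split]; lra.
have [r /andP[r1 r2] E] := derive_mean_value (fun r rc => derive_backward_entropy x y e0 rc) c1 c2 c3.
exists (c - r); first by apply/andP; split; lra.
rewrite subKr -opprB E mulNr opprK (_ : c - h - (c - 2 * h) = h); last by lra.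
by field; rewrite gt_eqF.
Qed.

Variables (sigma tau : R).
Hypothesis tau0 : 0 < tau.
Hypothesis Hconc : forall (x : M) (t s : R -> R), inverse_time_geodesic t s ->
  (forall th : R, 0 <= th <= 1 -> t th < tau /\ s th < tau) ->
  concave_along (fun t' s' => nash_entropy vol p N%:R x t' s' + sigma / 2 * t') t s.

(** Divided by h, the drops of entropy over [c - 2h, c - h] are Fisher informations at intermediate
    times and tend, for each y, to the Fisher density at (c, x). Their integrals are bounded by
    [mean_entropy_step], and Fatou's lemma concludes. *)
Lemma mean_fisher_le e c x : 0 < e <= 1 -> 0 < c -> c <= tau ->
  Int (fun y => fisher_density (hsh e y) c x) <= N%:R / 2 * c^-1 - sigma / 2.
Proof.
move=> e01 c0 ct; have /andP[e0 e1] := e01.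
have e01' : 0 <= e <= 1 by rewrite ltW.
pose h n : R := c / 4 * n.+1%:R^-1.
have hn n : 0 < h n by rewrite mulr_gt0// ?divr_gt0// invr_gt0.
have hc n : 2 * h n <= c / 2.
  have i1 : n.+1%:R^-1 <= 1 :> R by rewrite invf_le1// ler1n.
  have c4 : 0 <= c / 4 by rewrite divr_ge0// ltW.
  rewrite /h; have := ler_wpM2l c4 i1; move: (n.+1%:R^-1) => w; lra.
have hc2 n : 2 * h n < c by have := hc n; lra.
have h_cvg : h n @[n --> \oo] --> (0 : R).
  by rewrite -[X in _ --> X](mulr0 (c / 4)); apply: cvgMr; exact: cvg_harmonic.
have i1 n : 0 < c - 2 * h n < c by have := hn n; have := hc2 n => *; apply/andP; split; lra.
have i2 n : 0 < c - h n < c by have := hn n; have := hc2 n => *; apply/andP; split; lra.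
have i3 n : c - 2 * h n <= c - h n by have := hn n; lra.
pose F n (y : borel M) := (h n)^-1 * (bent e c x y (c - 2 * h n) - bent e c x y (c - h n)).
have b1 n := bm_backward_entropy x e01' (i1 n); have b2 n := bm_backward_entropy x e01' (i2 n).
have bF n : bm (F n) by apply: bmZ; exact: bmB (b1 n) (b2 n).
apply: (@lower_fatou _ _ _ vol V F (fun y => fisher_density (hsh e y) c x) _ 0 (fun n => N%:R / 2 * (c - 2 * h n)^-1 - sigma / 2)) => //.
- exact: bm_fisher.
- move=> n y; rewrite oppr0 /F.
  have [s /andP[s1 s2] ->] := entropy_slope x y e0 (hn n) (hc2 n).
  have cs : 0 < c - s < c by have := hn n; have := hc2 n => *; apply/andP; split; lra.
  have /andP[cs0 csc] := cs.
  by have [C _ /(_ e y (c - s) e01 (lexx _) csc) /andP[]] := @fisher_info_bound c x (c - s) cs0.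
- move=> y; apply/cvgrPdist_lt => d d0.
  have /cvgrPdist_lt/(_ _ d0)/at_right_interval[z z0 Hz] := @fisher_info_left e y c x e0 c0.
  have /cvgrPdist_lt/(_ (z / 2)) := h_cvg; rewrite divr_gt0// => /(_ isT); apply: filterS => n.
  rewrite sub0r normrN gtr0_norm// => hz; rewrite /F.
  have [s /andP[s1 s2] ->] := entropy_slope x y e0 (hn n) (hc2 n).
  by apply: Hz; have := hn n => *; apply/andP; split; lra.
- move=> n; rewrite /F (IntZ V _ (bmB (b1 n) (b2 n))) (IntB V (b1 n) (b2 n)) ler_pdivrMl//.
  have E01 := @mean_entropy_difference e c x (c - 2 * h n) (c - h n) e01.
  apply: le_trans (E01 _ _ _) _.
  + by have /andP[] := i1 n.
  + exact: i3.
  + by have /andP[] := i2 n.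
  exact: (mean_entropy_step Hconc x ct (hn n) (hc2 n)).
- apply: cvgB; last exact: cvg_cst.
  apply: cvgMr; apply: cvgV; first by rewrite gt_eqF.
  rewrite -[X in _ --> X]subr0 -[X in _ - X](mulr0 2).
  by apply: cvgB; [exact: cvg_cst|exact: cvgMr].
Qed.

(** The same integral, multiplied by 2t, is at most N - t sigma and at least N - t Scal - C (t sqrt
    t + e / t). *)
Lemma scalar_curvature_ge (x : M) : sigma <= scalar_curvature x.
Proof.
set i := chart_at x; set v := chart_point x.
have [r [r0 rB] _] := bump_radius_exists (x := x) openT I.
pose rho := r / 2.
have rho0 : 0 < rho by rewrite divr_gt0.
have sB4 : in_ball v (4 * rho) `<=` chart_cod i by move=> u uB; apply: rB; apply: le_trans uB _; rewrite /rho; lra.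
have sB2 : in_ball v (2 * rho) `<=` chart_cod i by move=> u uB; apply: rB; apply: le_trans uB _; rewrite /rho; lra.
have vB : in_ball v rho v by rewrite /in_ball /= subrr normr0 ltW.
have Uv : chart_cod i v by apply: sB2; exact: ball_half.
have vx : chart_inv i v = x by rewrite /v /chart_point chartK//; exact: chart_atP.
have oU := cod_open i; have gT u := @chart_metricT R N M i u.
have gpos u w := @chart_metric_gt0 R N M i u w.
(* With these coefficients the quadratic coordinates have vanishing Hessian at v. *)
pose G d a b := christoffel (metric i) d a b v.
have GC d a b : G d a b = G d b a by exact: (christoffelC oU gT d a b Uv).
pose q := quad_coord v G.
have sq d : smooth_on (chart_cod i) (q d) by exact: smooth_quad_coord.
pose xi d := cutoff i v rho (q d).
have sxi d : smooth_function (xi d) by exact: smooth_cutoff.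
have vD : cutoff_dom i v rho v by exact: cutoff_ball.
have qv d e : partial e (q d) v = (e == d)%:R.
  rewrite partial_quad_coord// big1 ?addr0// => b _; by rewrite subrr mulr0.
have xi_cov w d a : [set v] w -> covector i (xi d) w a = (a == d)%:R.
  by move=> ->; rewrite covector_cutoff.
have SB : [set v] `<=` in_ball v rho by move=> _ ->.
have hess0 d a b : hess_low (metric i) (xi d \o chart_inv i) a b v = 0.
  rewrite /hess_low partial2_cutoff// partial2_quad_coord//.
  have P c : partial c (xi d \o chart_inv i) v = (c == d)%:R by have := xi_cov v d c erefl.
  transitivity (G d b a - \sum_e \sum_c (metric i v e c * G c b a) * grad_coord (metric i) (xi d \o chart_inv i) e v).
    congr (_ - _); apply: eq_bigr => e _; rewrite -mulr_suml; congr (_ * _).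
    by rewrite (lower_christoffel gT gpos e b a Uv).
  rewrite exchange_big /= -[G d b a](sum_kron (fun c => G c b a)) -sumrB big1// => c _.
  transitivity ((d == c)%:R * G c b a - G c b a * \sum_e metric i v c e * grad_coord (metric i) (xi d \o chart_inv i) e v).
    congr (_ - _); rewrite mulr_sumr; apply: eq_bigr => e _.
    by rewrite (metricC gT e c Uv); move: (metric i v _ _) (G c b a) (grad_coord _ _ _ _) => *; ring.
  by rewrite (lower_grad gT gpos _ c Uv) P eq_sym mulrC subrr.
have [C C0 HC] := cramer_rao_curvature rho0 sB2 SB sxi xi_cov (erefl v) hess0.
have sE : scalar_curvature x = scalar_coord (metric i) v by [].
rewrite sE; apply: (le_sqrt_error C0) => d /andP[d0 d1].
(* The upper bound holds for t <= tau; t tends to 0 with d. *)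
pose t := Num.min d tau.
have t0 : 0 < t by rewrite lt_min d0.
have td : t <= d by rewrite ge_min lexx.
have tt : t <= tau by rewrite ge_min lexx orbT.
have t02 : 0 < t < 2 by rewrite t0/=; lra.
apply: (@le_trans _ _ (scalar_coord (metric i) v + C * Num.sqrt t)); last first.
  by rewrite lerD2l ler_wpM2l// ler_wsqrtr.
rewrite -(ler_pM2l t0).
(* The error constant depends on t, so e is sent to 0 with t fixed. *)
have Ct0 : 0 <= C / t by rewrite divr_ge0// ltW.
apply: (le_sqrt_error Ct0) => e e01; have /andP[e0 e1] := e01.
have := HC t e t02 e0; rewrite vx => /le_trans/(_ (ler_wpM2l _ (mean_fisher_le x e01 t0 tt))).
have t20 : 0 <= 2 * t by rewrite mulr_ge0// ltW.
move=> /(_ t20); have -> : 2 * t * (N%:R / 2 * t^-1 - sigma / 2) = N%:R - t * sigma.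
  by field; rewrite gt_eqF.
have : C / t * e <= C / t * Num.sqrt e by rewrite ler_wpM2l// sqrt_ge_id.
have -> : C / t * e = C * (e / t) by rewrite mulrAC mulrA.
move: (scalar_coord _ _) (Num.sqrt t) (Num.sqrt e) (e / t) => *; lra.
Qed.

End scalar_curvature_lower_bound.

(** * Lower bound on the averaged Ricci term *)

Section ricci_lower_bound.

Variables (D : unity_partition M) (s : R).
Hypothesis D_cod : forall k,
  in_ball (chart_point (up_center k)) (4 * (2 * up_radius k)) `<=` chart_cod (up_chart (D := D) k).
Hypothesis D_scal : forall k u, up_ball (D := D) k u -> s <= scalar_coord (metric (up_chart k)) u.

Definition ricci_chart k e t v y : R := hsh e y t (chart_inv (up_chart k) v) *
  ricci_quad (metric (up_chart k)) v (covector (up_chart (D := D) k) (log_st (hsh e y) t) v).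

Lemma bm_ricci_chart k e t v : 0 < e <= 1 -> 0 < t -> up_ball k v ->
  bm (ricci_chart k e t v : borel M -> R).
Proof.
move=> e01 t0 vB; have /andP[e0 e1] := e01; have Uv := up_ball_cod vB.
have [K K0 HK] := ricci_quad_bound D; split.
  apply: measurable_funM; first by have [] := bm_heat_shift_r e (chart_inv (up_chart k) v) t0.
  by apply: bilinear_measurable => a; exact: covector_log_measurable.
have [_ [B HB]] := bm_fisher (chart_inv (up_chart k) v) e01 t0; exists (K * B) => y.
have u0 := heat_shift_gt0 y (chart_inv (up_chart k) v) e0 t0.
rewrite normrM gtr0_norm//; apply: le_trans (ler_wpM2l (ltW u0) (HK k v _ vB)) _.
rewrite mulrCA -fisher_chart// ler_wpM2l//; exact: le_trans (ler_norm _) (HB y).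
Qed.

(** Cramer-Rao is applied to B = Ric + K g with raised indices, which is nonnegative and has trace
    Scal + K N. The additional K times the Fisher information is removed by [mean_fisher_upper], so
    the argument does not depend on the sign of Ric. *)
Lemma ricci_chart_lower k : exists2 C : R, 0 <= C & forall t e v, 0 < t < 2 -> 0 < e <= 1 ->
  up_ball k v -> s - C * (Num.sqrt t + e / t) <= 2 * t * Int (ricci_chart k e t v).
Proof.
set i := up_chart k; pose c := chart_point (up_center k); pose rho := 2 * up_radius k.
have rho0 : 0 < rho by rewrite mulr_gt0//; exact: (up_bump k).1.
have sB : in_ball c (4 * rho) `<=` chart_cod i by exact: D_cod.
have sB2 : in_ball c (2 * rho) `<=` chart_cod i.
  by move=> u uB; apply: sB; apply: le_trans uB _; rewrite ler_wpM2r ?(ltW rho0)// ler_nat.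
have oU := cod_open i.
have sg := @chart_metric_smooth R N M i; have gT := @chart_metricT R N M i.
have gpos := @chart_metric_gt0 R N M i.
pose xi (d : 'I_N) := cutoff i c rho (fun u => u 0 d).
have sxi d : smooth_function (xi d) by apply: (smooth_cutoff rho0 sB); exact: smooth_on_coord.
have xi_cov v d a : up_ball (D := D) k v -> covector i (xi d) v a = (a == d)%:R.
  by move=> vB; rewrite (covector_cutoff rho0 _ _ (cutoff_ball rho0 sB vB)) partial_coord.
have [C1 C10 H1] := cramer_rao_trace rho0 sB2 (fun v vB => vB) sxi xi_cov.
have [C2 C20 H2] := mean_fisher_upper.
have [K K0 HK] := ricci_quad_bound D.
have [Cb Cb0 Hb] : exists2 C : R, 0 <= C & forall ab : 'I_N * 'I_N, forall v, up_ball (D := D) k v ->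
    `|ricci_up (metric i) ab.1 ab.2 v + K * invmx (metric i v) ab.1 ab.2| <= C.
  apply: uniform_bound => [d C C' CC' H v vB|[a b]]; first exact: le_trans (H v vB) CC'.
  apply: (smooth_bounded_ball (@up_ball_cod _ _ _ D k)).
  apply: (smooth_onD oU); first exact: (smooth_ricci_up oU sg gT gpos).
  apply: (smooth_onM oU); first exact: smooth_on_cst.
  exact: (smooth_inv_metric oU sg gT gpos).
exists (C1 * Cb + K * C2 * 4); first by rewrite addr_ge0 ?mulr_ge0.
move=> t e v t02 e01 vB; have /andP[t0 t2] := t02; have /andP[e0 e1] := e01.
have Uv := up_ball_cod vB.
pose B a b := ricci_up (metric i) a b v + K * invmx (metric i v) a b.
have BE w : \sum_a \sum_b B a b * w a * w b = ricci_quad (metric i) v w + K * cometric (metric i) v w w.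
  rewrite /ricci_quad /cometric mulr_sumr -big_split; apply: eq_bigr => a _ /=.
  rewrite mulr_sumr -big_split; apply: eq_bigr => b _ /=; rewrite /B.
  by move: (ricci_up _ _ _ _) (invmx _ _ _) => *; ring.
have B0 w : 0 <= \sum_a \sum_b B a b * w a * w b.
  by rewrite BE -[ricci_quad _ _ _]opprK addrC subr_ge0 (le_trans (ler_norm _))// normrN HK.
have := H1 t e v B Cb t02 e0 vB (fun a b => Hb (a, b) v vB) B0.
have -> : \sum_a \sum_b B a b * metric i v a b = scalar_coord (metric i) v + K * N%:R.
  rewrite -(ricci_up_trace gT gpos Uv).
  have -> : N%:R = \sum_(a < N) (a == a)%:R :> R.
    by under eq_bigr do rewrite eqxx; rewrite big_const_ord iter_addr_0.
  rewrite mulr_sumr -big_split; apply: eq_bigr => a _ /=.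
  rewrite -(metric_invE gT gpos a a Uv) mulr_sumr -big_split; apply: eq_bigr => b _ /=.
  by rewrite /B (inv_metricC gT b a Uv); move: (ricci_up _ _ _ _) (invmx _ _ _) (metric _ _ _ _) => *; ring.
set X := covector i.
have bF := bm_fisher (chart_inv i v) e01 t0.
have bR := bm_ricci_chart e01 t0 vB.
have -> : Int (fun y => hsh e y t (chart_inv i v) *
     \sum_a \sum_b B a b * X (log_st (hsh e y) t) v a * X (log_st (hsh e y) t) v b) =
   Int (ricci_chart k e t v) +
   K * Int (fun y => fisher_density (hsh e y) t (chart_inv i v)).
  rewrite -(IntZ V _ bF) -(IntD V bR (bmZ _ bF)); apply: eq_Rintegral => y _.
  by rewrite BE fisher_chart// mulrDr; congr (_ + _); rewrite mulrCA.
have := ler_wpM2l K0 (H2 t e (chart_inv i v) t02 e01).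
have := D_scal vB; rewrite -/i.
have et : C2 * (t + e) <= C2 * (4 * (Num.sqrt t + e / t)).
  rewrite ler_wpM2l//; have := sqrt_ge_half t02; have et0 : 0 <= e / t by rewrite divr_ge0// ltW.
  have : e <= 2 * (e / t).
    by rewrite mulrA ler_pdivlMr// [2 * e]mulrC ler_wpM2l// ltW.
  have := sqrtr_ge0 t; move: (Num.sqrt t) (e / t) et0 => *; lra.
have := ler_wpM2l K0 et.
move: (Rintegral vol setT _) (Rintegral vol setT _) (scalar_coord _ _) (Num.sqrt t + e / t) => I1 I2 sc er *; lra.
Qed.

Lemma mean_ricci_lower : exists2 C : R, 0 <= C & forall t e z, 0 < t < 2 -> 0 < e <= 1 ->
  s - C * (Num.sqrt t + e / t) <= 2 * t * Int (fun y => ricci_density D e y t z).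
Proof.
have [C C0 HC] : exists2 C : R, 0 <= C & forall k, forall t e v, 0 < t < 2 -> 0 < e <= 1 ->
  up_ball k v -> s - C * (Num.sqrt t + e / t) <= 2 * t * Int (ricci_chart k e t v).
  apply: uniform_bound => [k C C' CC' H t e v t02 e01 vB|]; last exact: ricci_chart_lower.
  apply: le_trans (H t e v t02 e01 vB); rewrite lerD2l lerN2 ler_wpM2r// addr_ge0 ?sqrtr_ge0//.
  by have /andP[/ltW t0 _] := t02; have /andP[/ltW e0 _] := e01; rewrite divr_ge0.
exists C => // t e z t02 e01; have /andP[t0 t2] := t02; have /andP[e0 e1] := e01.
pose T k y := hsh e y t z * chi_ricci (D := D) k (log_st (hsh e y) t) z.
have E k v y : up_ball (D := D) k v -> chart_inv (up_chart k) v = z ->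
    T k y = up_fun k z * ricci_chart k e t v y.
  by move=> vB vz; rewrite /T /ricci_chart -vz (chi_ricciE _ (up_ball_cod vB)) mulrCA.
have E0 k y : up_fun (u := D) k z = 0 -> T k y = 0.
  move=> c0; rewrite /T /chi_ricci /chart_ext; case: asboolP => [dx|_]; last by rewrite mulr0.
  by rewrite chartK// c0 mul0r mulr0.
have bT k : bm (T k : borel M -> R).
  have [c0|[v vB vz]] := up_cases k z.
    by rewrite (_ : T k = fun=> 0); [exact: bm_cst|apply/funext => y; exact: E0].
  by have -> : T k = _ := funext (fun y => E k v y vB vz); exact: bmZ (bm_ricci_chart e01 t0 vB).
have -> : Int (fun y => ricci_density D e y t z) = \sum_k Int (T k).
  rewrite -(Int_sum V _ bT); apply: eq_Rintegral => y _.
  by rewrite /ricci_density /ricci_avg mulr_sumr.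
have HC' k v := HC k t e v t02 e01; move: HC'; set tt := 2 * t => HC'.
rewrite -[X in X <= _]mul1r -(up_sum D z) mulr_suml mulr_sumr; apply: ler_sum => k _.
have [c0|[v vB vz]] := up_cases k z.
  rewrite c0 mul0r (_ : T k = fun=> 0) ?Int0 ?mulr0//; apply/funext => y; exact: E0.
have -> : T k = _ := funext (fun y => E k v y vB vz).
rewrite (IntZ V _ (bm_ricci_chart e01 t0 vB)).
by rewrite mulrCA; apply: (ler_wpM2l (up_ge0 _ _)); exact: HC'.
Qed.

End ricci_lower_bound.

(** * Convexity of the entropy in inverse time *)

Section entropy_convexity.

Lemma derive_finfo e (c r : R) x y : 0 < e -> 0 < r < c ->
  is_derive r (1 : R) (finfo (hsh e y) c x) (finfo' (hsh e y) c x r).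
Proof.
move=> e0 rc; apply: (derive_fisher (heat_shift_solution e y)) rc => s z.
exact: heat_shift_gt0.
Qed.

Lemma continuous_mean_fisher e (c t : R) x : 0 < e <= 1 -> 0 < t < c ->
  {for t, continuous (mean_fisher e c x)}.
Proof.
move=> e01 /andP[t0 tc]; have /andP[e0 e1] := e01.
have t20 : 0 < t / 2 by rewrite divr_gt0.
have t2t : t / 2 < t < c by rewrite tc andbT; lra.
have [C C0 HC] := fisher_info_bound c x t20.
have sub r : t / 2 < r < c -> 0 < r < c by move=> /andP[r1 ->]; rewrite (lt_trans t20).
apply: (@continuous_Int _ _ _ vol V (t / 2) c (fun r y => finfo (hsh e y) c x r) C _ _ _ t t2t).
- by move=> r /sub rc; exact: bm_finfo.
- move=> r y /sub rc; apply/differentiable_continuous/derivable1_diffP.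
  exact: (@ex_derive _ _ _ _ _ _ _ (derive_finfo x y e0 rc)).
move=> r y /andP[tr rc].
by have /andP[h1 h2] := HC e y r e01 (ltW tr) rc; rewrite ger0_norm.
Qed.

Variables (D : unity_partition M) (s C : R).
Hypothesis C0 : 0 <= C.
Hypothesis HR : forall t e z, 0 < t < 2 -> 0 < e <= 1 ->
  s - C * (Num.sqrt t + e / t) <= 2 * t * Int (fun y => ricci_density D e y t z).
Local Notation rinfo := (@ricci_info D).

(** With the multiplier 1/2r, the slope of r^2 j is bounded by terms that no longer contain j. *)
Lemma fisher_slope_le e (c r : R) x y : 0 < e -> 0 < r < c ->
  2 * r * finfo (hsh e y) c x r + r ^+ 2 * finfo' (hsh e y) c x r <=
  2 * r * dt (fun t x => p t x y) c x + N%:R / 2 * hsh e y c x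
    - 2 * r ^+ 2 * rinfo (hsh e y) c x r.
Proof.
move=> e0 rc; have /andP[r0 rc'] := rc; have c0 : 0 < c by exact: lt_trans rc'.
have u0 s' z : 0 < s' -> 0 < hsh e y s' z by exact: heat_shift_gt0.
have := fisher_info'_le D (heat_shift_solution e y) u0 x (2 * r)^-1 rc.
rewrite (dt_heat_shift e y x c0) => /(ler_wpM2l (exprn_ge0 2 (ltW r0))).
move: (finfo _ _ _ _) (finfo' _ _ _ _) (rinfo _ _ _ _) (dt _ _ _) (hsh _ _ _ _) => j j' k q m H.
rewrite -lerBrDl; apply: le_trans H _; apply: eq_ler; field.
by rewrite gt_eqF.
Qed.

(** [HR] averaged over z against the backward kernel, of mass 1. *)
Lemma mean_ricci_info e (c r : R) x : 0 < e <= 1 -> 0 < r < c -> r < 2 ->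
  bm (fun y : borel M => rinfo (hsh e y) c x r) /\
  s - C * (Num.sqrt r + e / r) <= 2 * r * Int (fun y => rinfo (hsh e y) c x r).
Proof.
move=> e01 rc r2; have /andP[e0 e1] := e01; have /andP[r0 rc'] := rc.
have [K K0 HK] := ricci_avg_norm D.
have [B B0 HB] := fisher_density_bound r r0.
have mF : measurable_fun setT (fun w : borel M * borel M => ricci_density D e w.2 r w.1).
  apply: (separately_continuous_measurable (F := fun z (y : borel M) => ricci_density D e y r z)
    (@points_second_countable R N M)).
    by move=> y; exact: continuous_ricci_density.
  by move=> z; exact: ricci_density_measurable.
have FC z y : `|ricci_density D e y r z| <= K * B.
  have U0 := heat_shift_gt0 y z e0 r0.
  rewrite normrM gtr0_norm//; apply: le_trans (ler_wpM2l (ltW U0) (HK _ z (smooth_heat_log y e0 r0))) _.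
  rewrite mulrCA; apply: (ler_wpM2l K0).
  by apply: (HB r z y e) => //; rewrite lexx.
have [b1 b2 E] := backward_fubini x rc mF FC.
split; first exact: b1.
have -> : Int (fun y => rinfo (hsh e y) c x r) =
  Int (fun z => bw c x r z * Int (fun y => ricci_density D e y r z)) by exact: E.
have s0 : 0 < c - r by rewrite subr_gt0.
have bb : bm (bw c x r : borel M -> R) by exact: bm_heat.
have r02 : 0 < r < 2 by rewrite r0.
have HR' z := HR z r02 e01; move: HR'; set tr := 2 * r => HR'.
rewrite -(IntZ V _ (bmM bb b2)) -[X in X <= _]mulr1 -(heat_mass x s0) -(IntZ V _ bb).
apply: (le_Int V (bmZ _ bb) (bmZ _ (bmM bb b2))) => z.
rewrite [X in _ <= X]mulrCA [X in X <= _]mulrC; apply: ler_wpM2l.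
  exact: backward_ge0.
exact: HR'.
Qed.

Variables (sigma tau : R).
Hypothesis tau2 : tau <= 2.
Hypothesis sig : forall t, 0 < t < tau -> sigma + C * Num.sqrt t < s.

(** The derivative in w = 1/t of the shifted and tilted entropy ([is_derive_entropy]). The two terms
    in e compensate the error C e / t of the Ricci bound and the excess mass e [volume] of p + e. *)
Definition entropy_rate e c x t : R :=
  t ^+ 2 * mean_fisher e c x t - (N%:R / 2 + e * (C + N%:R / 2 * volume)) * t + sigma / 2 * t ^+ 2.

(** The slopes of r^2 j_y are bounded from above only, which suits Fatou's lemma for their
    negatives. If descent failed along h_n tending to 0, the integrated slopes would in the limit be
    too large for the Ricci bound. *)
Lemma entropy_rate_descent e c x t d : 0 < e <= 1 -> 0 < t < Num.min c tau -> 0 < d ->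
  exists2 h, 0 < h < d & entropy_rate e c x (t + h) <= entropy_rate e c x t.
Proof.
move=> e01 /andP[t0]; rewrite lt_min => /andP[tc ttau] d0.
have /andP[e0 e1] := e01; have rc : 0 < t < c by rewrite t0.
have t2 : t < 2 by exact: lt_le_trans tau2.
have c0 : 0 < c by exact: lt_trans tc.
apply: contrapT => /forall2NP Hno.
(* Increments below d' are below d and keep t + h under c. *)
pose d' := Num.min d (c - t).
have d'0 : 0 < d' by rewrite lt_min d0 subr_gt0.
have d'd : d' <= d by rewrite ge_min lexx.
have d'c : d' <= c - t by rewrite ge_min lexx orbT.
pose h n : R := d' / 2 * n.+1%:R^-1.
have hn n : 0 < h n by rewrite mulr_gt0// ?divr_gt0// invr_gt0.
have hd n : h n < d'.
  have i1 : n.+1%:R^-1 <= 1 :> R by rewrite invf_le1// ler1n.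
  have k0 : 0 <= d' / 2 by rewrite divr_ge0// ltW.
  rewrite /h; have := ler_wpM2l k0 i1; move: (n.+1%:R^-1) => w; lra.
have h_cvg : h n @[n --> \oo] --> (0 : R).
  by rewrite -[X in _ --> X](mulr0 (d' / 2)); apply: cvgMr; exact: cvg_harmonic.
have hcvg (f : R -> R) (l : R) : is_derive t (1 : R) f l ->
    (h n)^-1 * (f (t + h n) - f t) @[n --> \oo] --> l.
  move=> df; have Df : (fun h => h^-1 *: (f (h *: 1 + t) - f t)) @ 0^' --> 'D_1 f t.
    exact: (@ex_derive _ _ _ _ _ _ _ df).
  rewrite (@derive_val _ _ _ _ _ _ _ df) in Df.
  have := (cvgr_dnbhsP _ _ _).1 Df h; move=> /(_ (conj (fun n => lt0r_neq0 (hn n)) h_cvg)).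
  by under eq_fun do rewrite /GRing.scale /= mulr1 [_ + t]addrC.
pose hy (y : borel M) (r : R) := r ^+ 2 * finfo (hsh e y) c x r.
have dhy y (r : R) : 0 < r < c -> is_derive r (1 : R) (hy y)
    (2 * r * finfo (hsh e y) c x r + r ^+ 2 * finfo' (hsh e y) c x r).
  move=> rc'; have d1 := is_derive_monomial 1 r 1.
  have dd := is_deriveM d1 (derive_finfo x y e0 rc').
  rewrite (_ : hy y = (fun r => 1 * r ^+ 2) * finfo (hsh e y) c x); last first.
    by apply/funext => q; rewrite fctE mul1r.
  apply: (is_derive_eq dd); rewrite /GRing.scale /= expr1 mul1r mul1r.
  by move: (finfo _ _ _ _) (finfo' _ _ _ _) => j j'; ring.
pose q y := dt (fun t x => p t x y) c x.
pose G (y : borel M) r := 2 * r * q y + N%:R / 2 * hsh e y c x - 2 * r ^+ 2 * rinfo (hsh e y) c x r.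
have bq : bm (q : borel M -> R) := bm_dt_heat_r x c0.
have bh := bm_heat_shift_r e x c0.
have [br Hr] := mean_ricci_info x e01 rc t2.
have bqm := bmD (bmZ (2 * t) bq) (bmZ (N%:R / 2) bh).
have bG : bm (fun y => - G y t) by apply: bmN; exact: bmB bqm (bmZ _ br).
have [K K0 HK] := ricci_avg_norm D.
have [Bf Bf0 HBf] := fisher_info_bound c x t0.
have [Bq HBq] := bq.2; have [Bm HBm] := bh.2.
have cc0 : 0 <= c ^+ 2 by rewrite exprn_ge0// ltW.
have GB y r : t <= r -> r < c -> G y r <= 2 * c * Bq + N%:R / 2 * Bm + 2 * c ^+ 2 * (K * Bf).
  move=> tr rc'; have r0 : 0 < r by exact: lt_le_trans tr.
  have rcc : 0 < r < c by rewrite r0.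
  have u0 s' w : 0 < s' -> 0 < hsh e y s' w by exact: heat_shift_gt0.
  have R1 := ricci_info_norm (heat_shift_solution e y) u0 HK x rcc.
  have /andP[f0 f1] := HBf e y r e01 tr rc'.
  have R2 : - rinfo (hsh e y) c x r <= K * Bf.
    apply: le_trans (ler_norm _) _; rewrite normrN; apply: le_trans R1 _; exact: ler_wpM2l.
  have q1 : 2 * r * q y <= 2 * c * Bq.
    apply: le_trans (ler_norm _) _; rewrite normrM gtr0_norm ?mulr_gt0//.
    by apply: ler_pM => //; [exact/ltW/mulr_gt0|rewrite ler_wpM2l// ltW].
  have q2 : N%:R / 2 * hsh e y c x <= N%:R / 2 * Bm.
    by rewrite ler_wpM2l ?divr_ge0//; apply: le_trans (ler_norm _) (HBm y).
  have q3 : 2 * r ^+ 2 * - rinfo (hsh e y) c x r <= 2 * c ^+ 2 * (K * Bf).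
    have r20 : 0 <= 2 * r ^+ 2 by rewrite mulr_ge0// exprn_ge0// ltW.
    apply: le_trans (ler_wpM2l r20 R2) _; apply: ler_wpM2r; first exact: mulr_ge0.
    by apply: ler_wpM2l => //; rewrite !expr2 ler_pM// ltW.
  rewrite /G; move: q1 q2 q3; move: (rinfo _ _ _ _) (q y) (hsh _ _ _ _) => *; lra.
pose P r := sigma / 2 * r ^+ 2 - (N%:R / 2 + e * (C + N%:R / 2 * volume)) * r.
have dP : is_derive t (1 : R) P (sigma * t - (N%:R / 2 + e * (C + N%:R / 2 * volume))).
  have dd := is_deriveB (is_derive_monomial (sigma / 2) t 1)
    (is_derive_monomial (N%:R / 2 + e * (C + N%:R / 2 * volume)) t 0).
  apply: (is_derive_eq dd); rewrite expr1 expr0; move: (N%:R / 2 + _) => A.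
  by field.
have tn n : 0 < t + h n < c.
  by have := hn n; have := hd n => *; apply/andP; split; lra.
have bf r : 0 < r < c -> bm (fun y : borel M => finfo (hsh e y) c x r).
  by move=> rc'; exact: bm_finfo.
have HF : - Int (fun y => G y t) <= sigma * t - (N%:R / 2 + e * (C + N%:R / 2 * volume)).
  rewrite -(IntN V); last exact: bmB bqm (bmZ _ br).
  apply: (@lower_fatou _ _ _ vol V (fun n y => - ((h n)^-1 * (hy y (t + h n) - hy y t)))
    (fun y => - (2 * t * finfo (hsh e y) c x t + t ^+ 2 * finfo' (hsh e y) c x t))
    _ (2 * c * Bq + N%:R / 2 * Bm + 2 * c ^+ 2 * (K * Bf))
    (fun n => (h n)^-1 * (P (t + h n) - P t)) _ _ bG).
  - move=> n; apply: bmN; apply: bmZ; apply: bmB; apply: bmZ; exact: bf.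
  - move=> n y; rewrite lerN2.
    have th : t < t + h n by rewrite ltrDl.
    have /andP[_ tnc] := tn n.
    have [r /andP[r1 r2] ->] := derive_mean_value (dhy y) t0 th tnc.
    rewrite [t + _]addrC addrK mulrCA mulVf ?gt_eqF// mulr1.
    have r0 : 0 < r < c by rewrite (lt_trans t0)//= (lt_trans r2).
    apply: le_trans (fisher_slope_le x y e0 r0) _.
    by apply: GB; [exact: ltW|exact: lt_trans tnc].
  - by move=> y; apply: cvgN; apply: hcvg; exact: dhy.
  - by move=> y; rewrite lerN2; exact: fisher_slope_le.
  - move=> n; have b1 := bmZ ((t + h n) ^+ 2) (bf _ (tn n)); have b2 := bmZ (t ^+ 2) (bf _ rc).
    rewrite (IntN V (bmZ _ (bmB b1 b2))) (IntZ V _ (bmB b1 b2)) (IntB V b1 b2).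
    rewrite (IntZ V _ (bf _ (tn n))) (IntZ V _ (bf _ rc)) -mulrN.
    have i0 : 0 <= (h n)^-1 by rewrite invr_ge0 ltW.
    apply: (ler_wpM2l i0).
    have [/negP|/negP] := Hno (h n); first by rewrite hn (lt_le_trans (hd n) d'd).
    rewrite -ltNge /entropy_rate /P /mean_fisher.
    move: (Rintegral vol setT _) (Rintegral vol setT _) (N%:R / 2 + _) => I1 I2 A; lra.
  - exact: hcvg.
move: HF; rewrite /G (IntB V bqm (bmZ _ br)) (IntD V (bmZ _ bq) (bmZ _ bh)).
rewrite (IntZ V _ bq) (IntZ V _ bh) (IntZ V _ br) (Int_dt_heat_r x c0) (heat_shift_mass_r e x c0).
move: Hr (sig (introT andP (conj t0 ttau))); move: (Rintegral vol setT _) volume => I v.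
move=> /(ler_wpM2l (ltW t0)).
(* The loss C e is matched by the term e C in [entropy_rate]. *)
have -> : t * (s - C * (Num.sqrt t + e / t)) = t * (s - C * Num.sqrt t) - C * e.
  by field; rewrite gt_eqF.
move=> H1 H2; have : 0 < t * (s - C * Num.sqrt t - sigma) by rewrite mulr_gt0//; lra.
lra.
Qed.

Lemma entropy_rate_nincr e c x t1 t2 : 0 < e <= 1 -> 0 < t1 -> t1 <= t2 -> t2 < Num.min c tau ->
  entropy_rate e c x t2 <= entropy_rate e c x t1.
Proof.
move=> e01; apply: nincr_of_descent => [t tb|t d tb d0]; last exact: entropy_rate_descent.
have tc : 0 < t < c by move: tb; rewrite lt_min => /and3P[-> ->].
have cX : {for t, continuous (fun t : R => t)} by exact: cvg_id.
apply: continuousD; [apply: continuousB|].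
- apply: continuousM; last exact: continuous_mean_fisher.
  exact: exprn_continuous.
- by apply: continuousM => //; exact: cst_continuous.
- apply: continuousM; first exact: cst_continuous.
  exact: exprn_continuous.
Qed.

Lemma is_derive_entropy e (c w : R) x : 0 < e <= 1 -> c^-1 < w -> 0 < c ->
  is_derive w (1 : R) (fun w => ment e c x w^-1
      + (N%:R / 2 + e * (C + N%:R / 2 * volume)) * - ln w - sigma / 2 * w^-1)
    (entropy_rate e c x w^-1).
Proof.
move=> e01 cw c0; have w0 : 0 < w by apply: lt_trans cw; rewrite invr_gt0.
have iw : 0 < w^-1 < c.
  by rewrite invr_gt0 w0/= -[X in _ < X]invrK ltf_pV2 ?posrE// invr_gt0.
have w0' : w != 0 by rewrite gt_eqF.
have dV := is_deriveV w0' (is_derive_id w (1 : R)).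
have d1 := is_derive1_comp (derive_mean_entropy x e01 iw) dV.
have d2 := is_deriveZ (N%:R / 2 + e * (C + N%:R / 2 * volume)) (is_deriveN (is_derive1_ln w0)).
have d3 := is_deriveZ (sigma / 2) dV.
apply: (is_derive_eq (is_deriveB (is_deriveD d1 d2) d3)).
rewrite /GRing.scale /= /entropy_rate; move: (mean_fisher _ _ _ _) (N%:R / 2 + _) => J A.
by rewrite exprVn mulr1; ring.
Qed.

(** The shifted entropy is convex in w = 1/t because its derivative, the entropy rate at 1/w, is
    nondecreasing in w. Removing the shift costs a multiple of sqrt e. *)
Lemma mean_entropy_convex c x t1 t2 th t :
  0 < t1 < Num.min c tau -> 0 < t2 < Num.min c tau -> 0 <= th <= 1 ->
  t^-1 = (1 - th) * t1^-1 + th * t2^-1 ->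
  ment 0 c x t + N%:R / 2 * ln t - sigma / 2 * t <=
  (1 - th) * (ment 0 c x t1 + N%:R / 2 * ln t1 - sigma / 2 * t1) +
  th * (ment 0 c x t2 + N%:R / 2 * ln t2 - sigma / 2 * t2).
Proof.
move=> tb1 tb2 th01 tE; have /andP[th0 th1] := th01.
have /andP[t10 t1b] := tb1; have /andP[t20 t2b] := tb2.
set b := Num.min c tau in tb1 tb2 t1b t2b.
have b0 : 0 < b by exact: lt_trans t1b.
have bc : b <= c by rewrite ge_min lexx.
have c0 : 0 < c by exact: lt_le_trans bc.
have i0 : 0 < b^-1 by rewrite invr_gt0.
(* A positive lower bound common to t, t1 and t2, so that one constant serves to remove the shift at
   all three. *)
pose a := Num.min t1 t2.
have a0 : 0 < a by rewrite lt_min t10.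
have at1 : a <= t1 by rewrite ge_min lexx.
have at2 : a <= t2 by rewrite ge_min lexx orbT.
have v1 : b^-1 < t1^-1 by rewrite ltf_pV2.
have v2 : b^-1 < t2^-1 by rewrite ltf_pV2.
have th1' : 0 <= 1 - th by rewrite subr_ge0.
have th1'' : 1 - th <= 1 by rewrite gerBl.
set w := (1 - th) * t1^-1 + th * t2^-1 in tE.
have tw : t = w^-1 by rewrite -tE invrK.
have w1 : w <= a^-1.
  have x1 : t1^-1 <= a^-1 by rewrite lef_pV2.
  have x2 : t2^-1 <= a^-1 by rewrite lef_pV2.
  by have := ler_wpM2l th1' x1; have := ler_wpM2l th0 x2; rewrite /w; lra.
have w2 : b^-1 < w by exact: convex_gt.
have w0 : 0 < w by exact: lt_trans w2.
have t0 : 0 < t by rewrite tw invr_gt0.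
have at_ : a <= t by rewrite tw -[a]invrK lef_pV2 ?posrE ?invr_gt0.
have tb : t < b by rewrite tw -[b]invrK ltf_pV2 ?posrE ?invr_gt0.
have [Cs Cs0 HCs] := mean_entropy_shift c x a0.
have tc : t < c by exact: lt_le_trans bc.
have t1c : t1 < c by exact: lt_le_trans bc.
have t2c : t2 < c by exact: lt_le_trans bc.
pose A := C + N%:R / 2 * volume.
have V0 := volume_ge0.
have A0 : 0 <= A by rewrite addr_ge0// mulr_ge0// divr_ge0.
have B0 : 0 <= Cs + Cs + A * (`|ln t| + `|ln t1| + `|ln t2|) by rewrite !addr_ge0// mulr_ge0// !addr_ge0.
apply: (le_sqrt_error B0) => e e01; have /andP[e0 e1] := e01.
pose f w := ment e c x w^-1 + (N%:R / 2 + e * A) * - ln w - sigma / 2 * w^-1.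
(* The upper end only has to exceed both 1/t1 and 1/t2. *)
have D' r : b^-1 < r < t1^-1 + t2^-1 -> is_derive r (1 : R) f (entropy_rate e c x r^-1).
  move=> /andP[br _]; apply: is_derive_entropy => //.
  by apply: le_lt_trans br; rewrite lef_pV2.
have mono r r' : b^-1 < r -> r <= r' -> r' < t1^-1 + t2^-1 ->
    entropy_rate e c x r^-1 <= entropy_rate e c x r'^-1.
  move=> br rr' _; have r0 : 0 < r by exact: lt_trans br.
  have r'0 : 0 < r' by exact: lt_le_trans rr'.
  apply: entropy_rate_nincr => //; first by rewrite invr_gt0.
    by rewrite lef_pV2.
  by rewrite -/b -[b]invrK ltf_pV2 ?posrE.
have u1 : b^-1 < t1^-1 < t1^-1 + t2^-1 by rewrite v1 ltrDl invr_gt0.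
have u2 : b^-1 < t2^-1 < t1^-1 + t2^-1 by rewrite v2 ltrDr invr_gt0.
have := convex_of_derive_ndecr D' mono u1 u2 th01.
have lw r : 0 < r -> - ln (r^-1) = ln r by move=> r0; rewrite lnV ?posrE// opprK.
rewrite -/w /f -tw -{1}[w]invrK -tw !invrK !lw//.
have h0 := HCs e t e01 at_ tc; have h1 := HCs e t1 e01 at1 t1c; have h2 := HCs e t2 e01 at2 t2c.
have es : e <= Num.sqrt e by exact: sqrt_ge_id.
have eA (l l' : R) : `|l| <= l' -> 0 <= l' -> `|e * A * l| <= A * l' * Num.sqrt e.
  move=> ll l0; rewrite normrM ger0_norm ?mulr_ge0 ?(ltW e0)// [e * A]mulrC -!mulrA.
  apply: ler_wpM2l => //; rewrite [X in _ <= X]mulrC; apply: ler_pM => //; exact: ltW.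
pose l := (1 - th) * ln t1 + th * ln t2 - ln t.
have hl : `|l| <= `|ln t| + `|ln t1| + `|ln t2|.
  apply: le_trans (ler_normB _ _) _; rewrite [X in X <= _]addrC -addrA lerD2l.
  apply: le_trans (ler_normD _ _) _; rewrite !normrM (ger0_norm th0) (ger0_norm th1').
  by apply: lerD; apply: ler_piMl.
have L0 : 0 <= `|ln t| + `|ln t1| + `|ln t2| by rewrite !addr_ge0.
have := eA l _ hl L0; rewrite /l.
have g1 := ler_wpM2l th1' h1; have g2 := ler_wpM2l th0 h2.
move: h0 g1 g2; set Ls := `|ln t| + _ + _.
have bnd (k z y : R) : 0 <= k -> k * `|z| <= k * y -> k * z <= k * y.
  by move=> k0 H; apply: le_trans H; rewrite ler_wpM2l// ler_norm.
move=> h0 /(bnd _ _ _ th1') g1 /(bnd _ _ _ th0) g2 /(le_trans (ler_norm _)) h3.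
move: h0; rewrite distrC => /(le_trans (ler_norm _)) h0.
exact: convexity_error g1 g2 h0 h3.
Qed.

End entropy_convexity.

Lemma convex_function_unit (F : R -> R) :
  (forall l a b : R, 0 <= l <= 1 -> 0 <= a <= 1 -> 0 <= b <= 1 ->
     F (l * a + (1 - l) * b) <= l * F a + (1 - l) * F b) ->
  convex_function (E := R^o) [set th : R^o | 0 <= th <= 1] F.
Proof.
move=> H l a b; rewrite !inE /= => a01 b01.
have l01 : 0 <= l%:inum <= 1 by rewrite ge0 le1.
exact: (H l%:inum a b l01 a01 b01).
Qed.

Lemma heat_scalar_curvature_ge_chart (D : unity_partition M) (s sigma : R) :
  (forall k, in_ball (chart_point (up_center k)) (4 * (2 * up_radius k)) `<=`
     chart_cod (up_chart (D := D) k)) ->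
  (forall k u, up_ball (D := D) k u -> s <= scalar_coord (metric (up_chart k)) u) ->
  sigma < s -> heat_scalar_curvature_ge vol p N%:R sigma.
Proof.
move=> D_cod D_scal ss.
have [C C0 HC] := mean_ricci_lower D_cod D_scal.
have C1 : 0 < C + 1 by rewrite ltr_wpDl.
(* If sqrt t < q then C sqrt t < s - sigma; C + 1 avoids a division by zero. *)
pose q := (s - sigma) / (C + 1).
have q0 : 0 < q by rewrite divr_gt0// subr_gt0.
pose tau := Num.min 2 (q ^+ 2).
have tau0 : 0 < tau by rewrite lt_min ltr0n exprn_gt0.
have tau2 : tau <= 2 by rewrite ge_min lexx.
have sig t : 0 < t < tau -> sigma + C * Num.sqrt t < s.
  move=> /andP[t0]; rewrite lt_min => /andP[_ tq].
  have tq' : Num.sqrt t < q.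
    by rewrite -[q]ger0_norm ?(ltW q0)// -sqrtr_sqr ltr_sqrt// exprn_gt0.
  rewrite addrC -ltrBrDr; apply: (@le_lt_trans _ _ (C * q)); first by rewrite ler_wpM2l// ltW.
  rewrite -[X in _ < X](divfK (lt0r_neq0 C1)) -/q [X in _ < X]mulrC ltr_pM2r//.
  by rewrite ltrDl.
exists tau => // x t s' geo small.
apply: convex_function_unit => l a b l01 a01 b01.
have /andP[l0 l1] := l01; have /andP[a0 a1] := a01; have /andP[b0 b1] := b01.
have l1' : 0 <= 1 - l by rewrite subr_ge0.
set z := l * a + (1 - l) * b.
have z01 : 0 <= z <= 1.
  rewrite /z addr_ge0 ?mulr_ge0//=.
  have := ler_wpM2l l0 a1; have := ler_wpM2l l1' b1; lra.
pose c := t 0 + s' 0.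
have tb r : 0 <= r <= 1 -> 0 < t r < Num.min c tau.
  move=> r01; have [h1 h2 h3 _] := geo r r01; have [h4 _] := small r r01.
  by rewrite lt_min h1 h4 andbT /= /c -h3 ltrDl.
have E r : 0 <= r <= 1 -> - (nash_entropy vol p N%:R x (t r) (s' r) + sigma / 2 * t r) =
    ment 0 c x (t r) + N%:R / 2 * ln (t r) - sigma / 2 * t r + (N%:R / 2 * ln (4 * pi) + N%:R / 2).
  move=> r01; have [h1 h2 h3 _] := geo r r01.
  have p40 : 0 < 4 * pi :> R by rewrite mulr_gt0// pi_gt0.
  rewrite (nash_entropyE x h1 h2) h3 -/c lnM ?posrE//.
  by move: (ment _ _ _ _) (ln _) (ln _) => m l' l''; ring.
have tE : (t z)^-1 = (1 - (1 - l)) * (t a)^-1 + (1 - l) * (t b)^-1.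
  have [_ _ _ ->] := geo z z01; have [_ _ _ ->] := geo a a01; have [_ _ _ ->] := geo b b01.
  by rewrite /z; move: ((t 0)^-1) ((t 1)^-1) => u v; ring.
have l01' : 0 <= 1 - l <= 1 by rewrite l1'/= gerBl.
have := mean_entropy_convex C0 HC tau2 sig x (tb a a01) (tb b b01) l01' tE.
rewrite !E// subKr; move: (ment _ _ _ _ + _ - _) (ment _ _ _ _ + _ - _) (ment _ _ _ _ + _ - _) (_ + N%:R / 2).
by move=> u v w k; lra.
Qed.

(** The finitely many centres depend on s and not on sigma, so they can be fixed before sigma is
    chosen. *)
Lemma heat_scalar_curvature_ge_min (s : M -> R) :
  (forall x, s x < scalar_curvature x) ->
  exists2 n : nat, (0 < n)%N & exists y : 'I_n -> M, forall sigma,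
    (forall k, sigma < s (y k)) -> heat_scalar_curvature_ge vol p N%:R sigma.
Proof.
move=> sS; have [D HD] := scalar_curvature_cover (hs_closed hs) sS.
have n0 : (0 < up_size D)%N.
  rewrite lt0n; apply/eqP => D0; have := up_sum D point.
  rewrite big1 => [/eqP|k _]; first by rewrite eq_sym oner_eq0.
  by exfalso; have := ltn_ord k; move: (nat_of_ord k) => i; rewrite D0.
exists (up_size D) => //; exists (@up_center _ _ _ D) => sigma Hs.
(* The seed is one of the entries, so it does not lower the minimum; the number of centres is
   positive because the partition sums to 1. *)
pose m := \big[Num.min/s (up_center (Ordinal n0))]_k s (@up_center _ _ _ D k).
apply: (@heat_scalar_curvature_ge_chart D m).
- by move=> k; exact: (HD k).1.
- by move=> k u uB; apply: le_trans ((HD k).2 u uB); exact: bigmin_le_cond.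
- by rewrite lt_bigmin.
Qed.

End heat_flow.

Theorem theorem1p4 (R : realType) (N : nat) (N_gt0 : (0 < N)%N)
    (M : riemannianManifold R N) (M_closed : compact [set: M])
    (vol : {measure set (borel M) -> \bar R})
    (vol_riemannian : riemannian_volume vol)
    (p : R -> M -> M -> R) (p_heat : minimal_heat_kernel vol p) :
  (forall sigma : R, heat_scalar_curvature_ge vol p N%:R sigma ->
     forall x : M, sigma <= scalar_curvature x) /\
  exists x0 : M,
    [/\ forall x : M, scalar_curvature x0 <= scalar_curvature x,
        forall sigma : R, sigma < scalar_curvature x0 ->
          heat_scalar_curvature_ge vol p N%:R sigma
      & scalar_curvature x0 =
          sup [set sigma : R | heat_scalar_curvature_ge vol p N%:R sigma]].
Proof.
have hs : heat_setting vol p by [].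
pose S := [set sigma : R | heat_scalar_curvature_ge vol p N%:R sigma].
have SA sigma : S sigma -> forall x : M, sigma <= scalar_curvature x.
  by move=> [tau tau0 H] x; exact: (scalar_curvature_ge hs tau0 H).
split; first exact: SA.
have S0 : S !=set0.
  have [n n0 [y Hy]] := @heat_scalar_curvature_ge_min _ _ M _ _ hs (fun x => scalar_curvature x - 1)
    (fun x => ltac:(by rewrite gtrBl)).
  (* The seed 0 can only lower the minimum, and subtracting 1 makes the inequalities strict. *)
  exists (\big[Num.min/0]_k (scalar_curvature (y k) - 1) - 1).
  apply: Hy => k; apply: (@lt_le_trans _ _ (\big[Num.min/0]_k (scalar_curvature (y k) - 1))).
    by rewrite gtrBl.
  exact: bigmin_le_cond.
have hS : has_sup S by split => //; exists (scalar_curvature (point : M)) => sigma /SA.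
have supS (x : M) : sup S <= scalar_curvature x by apply: ge_sup; [exact: S0|move=> sigma Ssig; exact: (SA sigma Ssig x)].
(* No continuity of [scalar_curvature], whose chart varies with the point, is
   needed: if it did not attain [sup S], it would exceed it everywhere, and then
   [S] would contain something larger. *)
have [x0 E] : exists x0 : M, scalar_curvature x0 = sup S.
  apply: contrapT => /forallNP Hne.
  have lt (x : M) : sup S < (sup S + scalar_curvature x) / 2 < scalar_curvature x.
    have : sup S < scalar_curvature x.
      by rewrite lt_neqAle supS andbT; apply/eqP => E; apply: (Hne x).
    by move: (sup S) (scalar_curvature x) => *; apply/andP; split; lra.
  have [n n0 [y Hy]] := @heat_scalar_curvature_ge_min _ _ M _ _ hs
    (fun x => (sup S + scalar_curvature x) / 2) (fun x => (andP (lt x)).2).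
  (* The seed and all entries exceed sup S, hence so does m. *)
  pose m := \big[Num.min/sup S + 1]_k ((sup S + scalar_curvature (y k)) / 2).
  have ms : sup S < m by apply: lt_bigmin => [|k _]; [rewrite ltrDl|have /andP[] := lt (y k)].
  have : S ((sup S + m) / 2).
    apply: Hy => k; apply: (@lt_le_trans _ _ m); last exact: bigmin_le_cond.
    by move: (sup S) m ms => *; lra.
  move=> /(sup_upper_bound hS); move: (sup S) m ms => *; lra.
exists x0; split => // [x|sigma]; rewrite E// => sigS.
have lt (x : M) : sigma < (sigma + scalar_curvature x) / 2 < scalar_curvature x.
  have := lt_le_trans sigS (supS x); move: (scalar_curvature x) => k h.
  by apply/andP; split; lra.
have [n n0 [y Hy]] := @heat_scalar_curvature_ge_min _ _ M _ _ hs
  (fun x => (sigma + scalar_curvature x) / 2) (fun x => (andP (lt x)).2).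
by apply: Hy => k; have /andP[] := lt (y k).
Qed.
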